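(* Let $K$ and $K_e$ be two compact subsets of $\mathbb C$ such that $R(K)$ has only one nontrivial Gleason part $\Omega$, $K=\operatorname{clos}(\Omega)$, and $\partial K\subset K_e\subset K$. Then there exists a rationally 2-cyclic irreducible subnormal operator $S$ such that $\sigma(S)=K$, $\sigma_e(S)=K_e$, and $\operatorname{ind}(S-\lambda)=-1$ for every $\lambda\in K\setminus K_e$. If, in particular, $\mathbb C\setminus K$ has only one component, then $S$ can be constructed as a 2-cyclic irreducible subnormal operator.
   Context: All Hilbert spaces are separable and complex; operators are bounded and linear. An operator $S$ on $\mathcal H$ is subnormal if there are a Hilbert space $\mathcal K\supset\mathcal H$ and a normal operator $M$ on $\mathcal K$ with $M\mathcal H\subset\mathcal H$ and $S=M|_{\mathcal H}$. $S$ is irreducible if it has no nontrivial reducing subspaces. $\sigma(S)$ and $\sigma_e(S)$ denote the spectrum and essential spectrum, and $\operatorname{ind}(S-\lambda)=\dim\ker(S-\lambda)-\dim\ker(S-\lambda)^*$ is the Fredholm index. For compact $K\subset\mathbb C$, $\mathrm{Rat}(K)$ is the set of rational functions with poles off $K$ and $R(K)$ is the uniform closure of $\mathrm{Rat}(K)$ on $K$. A Gleason part of $R(K)$ is a maximal set $\Omega$ of points such that $\|e_x-e_y\|_{R(K)^*}<2$ for all $x,y\in\Omega$, where $e_x$ is the functional of evaluation at $x$; it is nontrivial if it has more than one point. For $F_1,\dots,F_N\in\mathcal H$ let $R^2(S|F_1,\dots,F_N)=\operatorname{clos}\{\sum_{i=1}^N r_i(S)F_i: r_i\in \mathrm{Rat}(\sigma(S))\}$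 and $P^2(S|F_1,\dots,F_N)=\operatorname{clos}\{\sum_{i=1}^N p_i(S)F_i: p_i \text{ polynomials}\}$. $S$ is rationally $N$-cyclic if $\mathcal H=R^2(S|F_1,\dots,F_N)$ for some $F_1,\dots,F_N\in\mathcal H$ and $\mathcal H\neq R^2(S|G_1,\dots,G_{N-1})$ for all $G_1,\dots,G_{N-1}\in\mathcal H$. $S$ is $N$-cyclic if the same holds with $P^2$ in place of $R^2$. *)

(* Defs.v *)
From HB Require Import structures.
From mathcomp Require Import all_boot all_order all_algebra.
From mathcomp Require Import complex.
From mathcomp Require Import all_classical all_reals all_analysis.

Set Implicit Arguments.
Unset Strict Implicit.
Unset Printing Implicit Defensive.

Import Order.TTheory GRing.Theory Num.Theory.
Import numFieldNormedType.Exports.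

Local Open Scope classical_set_scope.
Local Open Scope complex_scope.
Local Open Scope ring_scope.

(* R[i] with its bundled structure kept visible: the library's norm topology is
   attached to numFieldType structures and is not found on the bare type R[i]. *)
Definition cplx (R : realType) : numClosedFieldType := R[i].

(* The inner product is linear in its first argument and conjugate-linear in
   the second. *)
Record hilbertSpace (R : realType) := HilbertSpace {
  hilbert_sort :> completeNormedModType (cplx R);
  inner : {dot hilbert_sort for Num.conj};
  inner_norm : forall x : hilbert_sort, `|x| ^+ 2 = inner x x;
  hilbert_separable :
    exists2 D : set hilbert_sort, countable D & dense D }.

Arguments inner {R h}.

Section Operators.
Variables (R : realType).
Local Notation C := (cplx R).
Implicit Types H : hilbertSpace R.

Definition bounded_operator H (T : H -> H) : Prop :=
  linear T /\ exists c : R, forall x, `|T x| <= (c%:C : C) * `|x|.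

Definition is_adjoint H (T T' : H -> H) : Prop :=
  forall x y, inner (T x) y = inner x (T' y).

Definition normal_operator H (T : H -> H) : Prop :=
  bounded_operator T /\
  exists T' : H -> H, is_adjoint T T' /\ T \o T' = T' \o T.

(* An inclusion of H in a larger Hilbert space is an isometric linear map J;
   the last clause says that M maps J(H) into itself and restricts to T there. *)
Definition subnormal_operator H (T : H -> H) : Prop :=
  exists (L : hilbertSpace R) (J : H -> L) (M : L -> L),
    [/\ linear J,
        forall x y, inner (J x) (J y) = inner x y,
        normal_operator M
      & forall x, M (J x) = J (T x)].

Definition is_subspace H (V : set H) : Prop :=
  V 0 /\ forall (a : C) x y, V x -> V y -> V (a *: x + y).

Definition ortho_compl H (V : set H) : set H :=
  [set y | forall x, V x -> inner x y = 0].

Definition reducing_subspace H (T : H -> H) (V : set H) : Prop :=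
  [/\ is_subspace V, closed V,
      T @` V `<=` V
    & T @` ortho_compl V `<=` ortho_compl V].

Definition irreducible_operator H (T : H -> H) : Prop :=
  forall V : set H, reducing_subspace T V -> V = [set 0] \/ V = setT.

Definition sub_scalar H (T : H -> H) (l : C) : H -> H := fun x => T x - l *: x.

Definition bounded_inverse H (T T' : H -> H) : Prop :=
  [/\ bounded_operator T', cancel T T' & cancel T' T].

Definition spectrum H (T : H -> H) : set C :=
  [set l | ~ exists T', bounded_inverse (sub_scalar T l) T'].

Definition ker_op H (T : H -> H) : set H := [set x | T x = 0].

(* For a linear subspace V: V has a basis of n vectors. *)
Definition has_dim H (V : set H) (n : nat) : Prop :=
  exists b : 'I_n -> H, (forall i, V (b i)) /\
    forall x, V x -> exists! c : 'rV[C]_n, x = \sum_(i < n) c 0 i *: b i.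

(* T is Fredholm: closed range, dim ker T = m and dim ker T^* = n are finite. *)
Definition fredholm_dims H (T : H -> H) (m n : nat) : Prop :=
  [/\ closed (range T), has_dim (ker_op T) m
    & exists2 T' : H -> H, is_adjoint T T' & has_dim (ker_op T') n].

Definition fredholm H (T : H -> H) : Prop := exists m n, fredholm_dims T m n.

Definition fredholm_index H (T : H -> H) (k : int) : Prop :=
  exists m n, fredholm_dims T m n /\ k = m%:Z - n%:Z.

Definition essential_spectrum H (T : H -> H) : set C :=
  [set l | ~ fredholm (sub_scalar T l)].

Definition poly_op H (T : H -> H) (p : {poly C}) : H -> H :=
  fun x => \sum_(i < size p) p`_i *: iter i T x.

(* A rational function with poles off K is a quotient p / q of polynomials with
   q zero-free on K. *)
Definition zero_free (K : set C) (q : {poly C}) : Prop :=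
  forall z, K z -> q.[z] != 0.

(* A = r(T) = p(T) q(T)^-1 for some r = p / q with poles off the spectrum. *)
Definition rat_op H (T A : H -> H) : Prop :=
  exists (p q : {poly C}) (Q : H -> H),
    [/\ zero_free (spectrum T) q, bounded_inverse (poly_op T q) Q
      & A = poly_op T p \o Q].

Definition R2 H (T : H -> H) (N : nat) (F : 'I_N -> H) : set H :=
  closure [set x | exists A : 'I_N -> (H -> H),
    (forall i, rat_op T (A i)) /\ x = \sum_(i < N) A i (F i)].

Definition P2 H (T : H -> H) (N : nat) (F : 'I_N -> H) : set H :=
  closure [set x | exists p : 'I_N -> {poly C},
    x = \sum_(i < N) poly_op T (p i) (F i)].

(* N is positive in the applications; for N = 0 the two clauses contradict each
   other. *)
Definition rationally_cyclic H (T : H -> H) (N : nat) : Prop :=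
  (exists F : 'I_N -> H, R2 T F = setT) /\
  (forall G : 'I_N.-1 -> H, R2 T G <> setT).

Definition cyclic_operator H (T : H -> H) (N : nat) : Prop :=
  (exists F : 'I_N -> H, P2 T F = setT) /\
  (forall G : 'I_N.-1 -> H, P2 T G <> setT).

End Operators.

Section GleasonParts.
Variables (R : realType).
Local Notation C := (cplx R).

Definition rat_fun (K : set C) : set (C -> C) :=
  [set f | exists p q : {poly C},
    zero_free K q /\ f = (fun z => p.[z] / q.[z])].

(* Elements of R(K) are represented by functions on the whole plane whose
   values off K are irrelevant. *)
Definition RK (K : set C) : set (C -> C) :=
  closure (rat_fun K : set {uniform` K -> C}).

Definition RK_dual_norm (K : set C) (phi : (C -> C) -> C) : \bar R :=
  ereal_sup [set (complex.Re `|phi f|)%:E | f in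
    [set f | RK K f /\ forall z, K z -> `|f z| <= 1]].

Definition evaluation (x : C) : (C -> C) -> C := fun f => f x.

Definition gleason_related (K Om : set C) : Prop :=
  forall x y, Om x -> Om y ->
    (RK_dual_norm K (fun f => (evaluation x f - evaluation y f)%R) < 2%:E)%E.

Definition gleason_part (K Om : set C) : Prop :=
  [/\ Om `<=` K, gleason_related K Om
    & forall Om', Om' `<=` K -> gleason_related K Om' ->
        Om `<=` Om' -> Om' = Om].

Definition nontrivial_set (A : set C) : Prop :=
  exists x y, [/\ A x, A y & x <> y].

Definition only_nontrivial_gleason_part (K Om : set C) : Prop :=
  [/\ gleason_part K Om, nontrivial_set Om
    & forall Om', gleason_part K Om' -> nontrivial_set Om' -> Om' = Om].

Definition boundary (A : set C) : set C := closure A `\` interior A.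

End GleasonParts.

(* Main.v *)
Require Import Defs.
From HB Require Import structures.
From mathcomp Require Import all_boot all_order all_algebra.
From mathcomp Require Import complex.
From mathcomp Require Import all_classical all_reals all_analysis.
From mathcomp Require Import ring lra.

Set Implicit Arguments.
Unset Strict Implicit.
Unset Printing Implicit Defensive.

Import Order.TTheory GRing.Theory Num.Theory.
Import numFieldNormedType.Exports.

Local Open Scope classical_set_scope.
Local Open Scope complex_scope.
Local Open Scope ring_scope.

(* Let [a] be a point of the Gleason part and [b 0, b 1, ...] a dense sequence in it.
   By Harnack's inequality for the part and a Hahn-Banach argument, [a] has a finitely
   additive representing measure [Gam] on [boundary K * nat] whose [i]-th slice is
   [kap i] times a representing measure of [b i]; the operators act on completions of
   spaces of rational functions for such measures, which only involves positive
   functionals on bounded functions.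

   If [K] has interior points, choose points [w j] in it whose limits in the interior
   are the interior points of [Ke], and small [eps j]. The operator is multiplication
   by [z] on the pairs of a rational function [f] and a finite sequence [d], mapped to
   [f + \sum_j d j * eps j / (z - w j)] on the boundary and to [d j] at [w j]. The [j]-th
   unit vector is an approximate eigenvector for [w j], and the limits of the [w j]
   enter the essential spectrum; at the other interior points, evaluation spans the
   cokernel. The unit vectors can be packed into one vector, whence two generators.
   One generator [G] is not enough: rational functions [r k] with [r k * G] tending to
   the constant [1] would tend to zero at the [w j], which Blaschke products preclude
   when the [w j] accumulate in the interior, or tend slowly to a boundary point.

   If [K] has no interior point, the operator is multiplication by [z] on the pairs
   [(f, g)] of rational functions, where [f], [g] and [f + g] are measured by three
   linearly independent functionals representing [a]. A projection commuting with it is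
   given by a constant matrix, which self-adjointness for the three functionals forces to
   be scalar, and evaluation at [a] maps onto a plane, so one generator is not enough. *)

(** * Norms *)

(** Where an index is prescribed it is -1, so one evaluation spans the cokernel there and the need
    for two generators cannot be read off from cokernel dimensions: it has to come from an estimate.
    Without interior, [Ke = K] leaves no index to prescribe, and a two-dimensional cokernel at [a]
    is allowed. The weights [eps j] play two opposite roles. Being nonzero, they tie the unit
    vectors to the constant function, since [S - w j] maps the [j]-th unit vector to [eps j] times
    [1]; irreducibility rests on this relation. Being small, they leave both components of a pair
    controlled by the norm, and they can be chosen after all other constants. If [Ke] has no
    interior points, the [w j] must leave every compact part of the interior. Tending to the
    boundary fast, they would have a convergent Blaschke product, whose nonzero value at the center
    defeats the argument; hence the slow approach. Finite additivity suffices because multiplication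
    by bounded functions and uniform approximation are all that is required. The price is that
    separability has to be obtained by hand, through step functions on a countable family of
    cells. *)

Section RealNorm.
Variable R : realType.
Local Notation C := (cplx R).

(** The norms of the structures take values in the complex numbers. Estimates are carried out with
    this real version, where the order is total and linear arithmetic applies. *)
Definition nrm (V : normedZmodType C) (x : V) : R := complex.Re `|x|.

Lemma normE (V : normedZmodType C) (x : V) : `|x| = (nrm x)%:C :> C.
Proof. by rewrite /nrm RRe_real// ger0_real. Qed.

Lemma nrm_ge0 (V : normedZmodType C) (x : V) : 0 <= nrm x.
Proof. by rewrite -lecR -normE normr_ge0. Qed.

Lemma nrm0 (V : normedZmodType C) : nrm (0 : V) = 0.
Proof. by rewrite /nrm normr0. Qed.

Lemma nrm_eq0 (V : normedZmodType C) (x : V) : (nrm x == 0) = (x == 0).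
Proof. by rewrite -(normr_eq0 x) normE -(inj_eq (@complexI R)). Qed.

Lemma nrm_gt0 (V : normedZmodType C) (x : V) : (0 < nrm x) = (x != 0).
Proof. by rewrite lt_def nrm_ge0 nrm_eq0 andbT. Qed.

Lemma ler_nrmD (V : normedZmodType C) (x y : V) : nrm (x + y) <= nrm x + nrm y.
Proof. by rewrite -lecR rmorphD/= -!normE ler_normD. Qed.

Lemma nrmN (V : normedZmodType C) (x : V) : nrm (- x) = nrm x.
Proof. by rewrite /nrm normrN. Qed.

Lemma ler_nrmB (V : normedZmodType C) (x y : V) : nrm (x - y) <= nrm x + nrm y.
Proof. by rewrite (le_trans (ler_nrmD _ _))// nrmN. Qed.

Lemma nrmBC (V : normedZmodType C) (x y : V) : nrm (x - y) = nrm (y - x).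
Proof. by rewrite -nrmN opprB. Qed.

Lemma ler_nrm_dist (V : normedZmodType C) (x y : V) :
  `|nrm x - nrm y| <= nrm (x - y).
Proof.
rewrite ler_norml lerNl opprB; apply/andP; split.
  by rewrite lerBlDl; have := ler_nrmD x (y - x); rewrite addrC subrK addrC nrmBC addrC.
by rewrite lerBlDl; have := ler_nrmD y (x - y); rewrite addrC subrK.
Qed.

Lemma ler_dist_nrm (V : normedZmodType C) (z x y : V) :
  nrm (x - y) <= nrm (x - z) + nrm (z - y).
Proof. by have := ler_nrmD (x - z) (z - y); rewrite addrA subrK. Qed.

Lemma ler_nrm_sum (V : normedZmodType C) (I : Type) (r : seq I) (P : pred I)
    (F : I -> V) :
  nrm (\sum_(i <- r | P i) F i) <= \sum_(i <- r | P i) nrm (F i).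
Proof.
elim/big_ind2: _ => [|x a y b xa yb|//]; first by rewrite nrm0.
by rewrite (le_trans (ler_nrmD _ _))// lerD.
Qed.

Lemma nrmZ (V : normedModType C) (a : C) (x : V) : nrm (a *: x) = nrm a * nrm x.
Proof.
by apply: (@complexI R); rewrite rmorphM/= -!normE normrZ.
Qed.

Lemma nrmM (a b : C) : nrm (a * b) = nrm a * nrm b.
Proof. by apply: (@complexI R); rewrite rmorphM/= -!normE normrM. Qed.

Lemma nrm1 : nrm (1 : C) = 1.
Proof. by rewrite /nrm normr1. Qed.

Lemma nrmV (a : C) : nrm a^-1 = (nrm a)^-1.
Proof.
have [->|a0] := eqVneq a 0; first by rewrite invr0 nrm0 invr0.
have n0 : nrm a != 0 by rewrite nrm_eq0.
by apply: (mulfI n0); rewrite -nrmM !divff// nrm1.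
Qed.

Lemma nrm_real (r : R) : nrm (r%:C : C) = `|r|.
Proof. by rewrite /nrm normc_def/= expr0n/= addr0 sqrtr_sqr. Qed.

Lemma nrm_sqr (a : C) : nrm a ^+ 2 = complex.Re a ^+ 2 + complex.Im a ^+ 2.
Proof.
by rewrite /nrm normc_def/= sqr_sqrtr// addr_ge0// sqr_ge0.
Qed.

Lemma mul_conj (a : C) : a * a^* = (nrm a ^+ 2)%:C.
Proof. by rewrite -sqr_normc normE rmorphXn. Qed.

Lemma nrm_conj (a : C) : nrm a^* = nrm a.
Proof. by rewrite /nrm normcJ. Qed.

Lemma ler_Re_nrm (a : C) : `|complex.Re a| <= nrm a.
Proof. by rewrite -lecR -normE normc_ge_Re. Qed.

Lemma Re_le_nrm (a : C) : complex.Re a <= nrm a.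
Proof. exact: le_trans (ler_norm _) (ler_Re_nrm _). Qed.

Lemma ler_Im_nrm (a : C) : `|complex.Im a| <= nrm a.
Proof.
rewrite -(@ler_pXn2r _ 2)// ?nnegrE ?nrm_ge0// nrm_sqr.
by rewrite real_normK ?num_real// lerDr sqr_ge0.
Qed.

Lemma nrm_le_ReIm (a : C) : nrm a <= `|complex.Re a| + `|complex.Im a|.
Proof.
rewrite -(@ler_pXn2r _ 2)// ?nnegrE ?nrm_ge0 ?addr_ge0// nrm_sqr sqrrD.
rewrite !real_normK ?num_real// lerD2r lerDl.
by rewrite mulrn_wge0// mulr_ge0.
Qed.

Lemma ReD (a b : C) : complex.Re (a + b) = complex.Re a + complex.Re b.
Proof. by case: a b => [? ?] [? ?]. Qed.
Lemma ImD (a b : C) : complex.Im (a + b) = complex.Im a + complex.Im b.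
Proof. by case: a b => [? ?] [? ?]. Qed.
Lemma ReN (a : C) : complex.Re (- a) = - complex.Re a.
Proof. by case: a => [? ?]. Qed.
Lemma ImN (a : C) : complex.Im (- a) = - complex.Im a.
Proof. by case: a => [? ?]. Qed.
Lemma ReB (a b : C) : complex.Re (a - b) = complex.Re a - complex.Re b.
Proof. by rewrite ReD ReN. Qed.
Lemma ImB (a b : C) : complex.Im (a - b) = complex.Im a - complex.Im b.
Proof. by rewrite ImD ImN. Qed.
Lemma ReM (a b : C) : complex.Re (a * b) =
  complex.Re a * complex.Re b - complex.Im a * complex.Im b.
Proof. by case: a b => [? ?] [? ?]. Qed.
Lemma ImM (a b : C) : complex.Im (a * b) =
  complex.Re a * complex.Im b + complex.Im a * complex.Re b.
Proof. by case: a b => [? ?] [? ?]; rewrite /= addrC. Qed.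
Lemma ReRM (r : R) (a : C) : complex.Re (r%:C * a) = r * complex.Re a.
Proof. by rewrite ReM /= mul0r subr0. Qed.
Lemma ImRM (r : R) (a : C) : complex.Im (r%:C * a) = r * complex.Im a.
Proof. by rewrite ImM /= mul0r addr0. Qed.

Lemma ReJ (a : C) : complex.Re a^* = complex.Re a.
Proof. by case: a. Qed.
Lemma ImJ (a : C) : complex.Im a^* = - complex.Im a.
Proof. by case: a. Qed.
Lemma ReImE (a b : C) : complex.Re a = complex.Re b ->
  complex.Im a = complex.Im b -> a = b.
Proof. by case: a b => [? ?] [? ?] /= -> ->. Qed.
End RealNorm.

Section RealTopology.
Variable R : realType.
Local Notation C := (cplx R).
Variable V : normedModType C.

Lemma nbhs_nrmP (x : V) (A : set V) :
  nbhs x A <-> exists2 e : R, 0 < e & forall y, nrm (x - y) < e -> A y.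
Proof.
split.
  move=> /nbhs_ballP[e /= e0 eA]; exists (complex.Re e).
    by move: e0; rewrite ltcE => /andP[_].
  move=> y xy; apply: eA; rewrite -ball_normE/= normE.
  have -> : e = (complex.Re e)%:C by rewrite RRe_real// gtr0_real.
  by rewrite ltcR.
move=> [e e0 eA]; apply/nbhs_ballP; exists (e%:C : C).
  by rewrite /= ltcR.
by move=> y; rewrite -ball_normE/= normE ltcR => /eA.
Qed.

Lemma closure_nrmP (A : set V) (x : V) :
  closure A x <-> forall e : R, 0 < e -> exists2 y, A y & nrm (x - y) < e.
Proof.
split.
  move=> cA e e0; have /cA [y [Ay xy]] : nbhs x [set y | nrm (x - y) < e].
    by apply/nbhs_nrmP; exists e.
  by exists y.
move=> H B /nbhs_nrmP[e e0 eB]; have [y Ay xy] := H e e0.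
by exists y; split=> //; exact: eB.
Qed.

Lemma closed_nrmP (A : set V) :
  closed A <-> forall x, (forall e : R, 0 < e -> exists2 y, A y & nrm (x - y) < e)
    -> A x.
Proof.
split; first by move=> cA x H; apply: cA; apply/closure_nrmP.
by move=> H x /closure_nrmP; exact: H.
Qed.

Lemma interior_nrmP (A : set V) (x : V) :
  interior A x <-> exists2 e : R, 0 < e & forall y, nrm (x - y) < e -> A y.
Proof. exact: nbhs_nrmP. Qed.

Lemma dense_nrmP (A : set V) :
  dense A <-> forall x (e : R), 0 < e -> exists2 y, A y & nrm (x - y) < e.
Proof.
split.
  move=> dA x e e0.
  have [||y [/= xy Ay]] := dA [set y | nrm (x - y) < e]; last by exists y.
    by exists x => /=; rewrite subrr nrm0.
  rewrite openE => y /= xy; apply/nbhs_nrmP.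
  exists (e - nrm (x - y)); first by rewrite subr_gt0.
  move=> z yz /=; rewrite (le_lt_trans (ler_dist_nrm y x z))//.
  by rewrite addrC -ltrBrDr.
move=> H O [x Ox] oO.
have /nbhs_nrmP[e e0 eO] : nbhs x O by exact: open_nbhs_nbhs.
by have [y Ay xy] := H x e e0; exists y; split=> //; exact: eO.
Qed.

End RealTopology.

(** * Sequences and positive forms *)

Section Sequences.
Variable R : realType.
Local Notation C := (cplx R).

Definition tends (V : normedZmodType C) (u : nat -> V) (l : V) :=
  forall e : R, 0 < e -> exists N, forall n, (N <= n)%N -> nrm (u n - l) < e.

Definition cauchyseq (V : normedZmodType C) (u : nat -> V) :=
  forall e : R, 0 < e -> exists N, forall m n, (N <= m)%N -> (N <= n)%N ->
    nrm (u m - u n) < e.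

Lemma cvgn_eps (u : nat -> R) (l : R) : u @ \oo --> l <->
  forall e : R, 0 < e -> exists N, forall n, (N <= n)%N -> `|u n - l| < e.
Proof.
split.
  move=> /cvgrPdist_lt H e e0; have [N _ HN] := H e e0.
  by exists N => n Nn; rewrite distrC; exact: HN.
move=> H; apply/cvgrPdist_lt => e e0; have [N HN] := H e e0.
by exists N => // n /= Nn; rewrite distrC; exact: HN.
Qed.

Lemma real_cauchy (u : nat -> R) :
  (forall e : R, 0 < e -> exists N, forall m n, (N <= m)%N -> (N <= n)%N ->
    `|u m - u n| < e) ->
  exists l, forall e : R, 0 < e -> exists N, forall n, (N <= n)%N ->
    `|u n - l| < e.
Proof.
move=> H.
have cu : cvgn u.
  apply: R_complete; apply/cauchy_ballP => e e0.
  have [N HN] := H e e0.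
  exists ([set x | (exists2 m, (N <= m)%N & x = u m)],
          [set x | (exists2 m, (N <= m)%N & x = u m)]) => /=.
    by split; exists N => //= n Nn; exists n.
  by move=> [x y] /= [[m Nm ->] [n Nn ->]]; exact: HN.
by exists (limn u); apply/cvgn_eps.
Qed.

Lemma complex_cauchy (u : nat -> C) : cauchyseq u -> exists l, tends u l.
Proof.
move=> H.
have [a Ha] : exists a : R, forall e : R, 0 < e -> exists N, forall n,
    (N <= n)%N -> `|complex.Re (u n) - a| < e.
  apply: real_cauchy => e e0; have [N HN] := H e e0; exists N => m n Nm Nn.
  by rewrite -ReB (le_lt_trans (ler_Re_nrm _))// HN.
have [b Hb] : exists b : R, forall e : R, 0 < e -> exists N, forall n,
    (N <= n)%N -> `|complex.Im (u n) - b| < e.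
  apply: real_cauchy => e e0; have [N HN] := H e e0; exists N => m n Nm Nn.
  by rewrite -ImB (le_lt_trans (ler_Im_nrm _))// HN.
exists (a +i* b) => e e0; have e2 : 0 < e / 2 by rewrite divr_gt0.
have [N1 H1] := Ha _ e2; have [N2 H2] := Hb _ e2.
exists (maxn N1 N2) => n; rewrite geq_max => /andP[n1 n2].
rewrite (le_lt_trans (nrm_le_ReIm _))// (splitr e) ReB ImB/=.
by rewrite ltrD ?H1 ?H2.
Qed.

Lemma tends_uniq (V : normedZmodType C) (u : nat -> V) l l' :
  tends u l -> tends u l' -> l = l'.
Proof.
move=> H H'; apply/eqP; rewrite -subr_eq0 -nrm_eq0; apply/negPn/negP => n0.
have n1 : 0 < nrm (l - l') / 2 by rewrite divr_gt0// lt_def n0 nrm_ge0.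
have [N1 H1] := H _ n1; have [N2 H2] := H' _ n1.
have := ler_dist_nrm (u (maxn N1 N2)) l l'.
apply/negP; rewrite -ltNge (splitr (nrm (l - l'))) ltrD//.
  by rewrite nrmBC H1// leq_maxl.
by rewrite H2// leq_maxr.
Qed.

Lemma tendsD (V : normedZmodType C) (u v : nat -> V) l l' :
  tends u l -> tends v l' -> tends (fun n => u n + v n) (l + l').
Proof.
move=> H H' e e0; have e2 : 0 < e / 2 by rewrite divr_gt0.
have [N1 H1] := H _ e2; have [N2 H2] := H' _ e2.
exists (maxn N1 N2) => n; rewrite geq_max => /andP[n1 n2].
rewrite opprD addrACA (le_lt_trans (ler_nrmD _ _))// (splitr e).
by rewrite ltrD ?H1 ?H2.
Qed.

Lemma tendsMl (u : nat -> C) a l : tends u l -> tends (fun n => a * u n) (a * l).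
Proof.
move=> H e e0; have a1 : 0 < nrm a + 1 by rewrite ltr_wpDl// nrm_ge0.
have [N HN] := H (e / (nrm a + 1)) (divr_gt0 e0 a1).
exists N => n Nn; rewrite -mulrBr nrmM.
have := HN n Nn; rewrite ltr_pdivlMr// => h; apply: le_lt_trans h.
by rewrite mulrC ler_wpM2l ?nrm_ge0// lerDl.
Qed.

Lemma tends_conj (u : nat -> C) l : tends u l -> tends (fun n => (u n)^*) l^*.
Proof.
move=> H e e0; have [N HN] := H e e0; exists N => n Nn.
by rewrite -rmorphB nrm_conj HN.
Qed.

Definition summable (u : nat -> C) :=
  exists M : R, forall N, \sum_(i < N) nrm (u i) <= M.

Lemma nonneg_tail (a : nat -> R) (M : R) : (forall n, 0 <= a n) ->
  (forall N, \sum_(i < N) a i <= M) ->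
  forall e : R, 0 < e -> exists N, forall m n, (N <= m)%N -> (m <= n)%N ->
    \sum_(m <= i < n) a i < e.
Proof.
move=> a0 aM e e0.
have cs : cvgn (fun N => \sum_(i < N) a i).
  apply: nondecreasing_is_cvgn.
    move=> m n mn; rewrite -!(big_mkord xpredT a).
    by rewrite [leRHS](big_cat_nat (n:=m))//= lerDl sumr_ge0.
  by exists M => _ [N _ <-].
have /cvgn_eps H := cs.
have [N HN] := H (e / 2) (divr_gt0 e0 (ltr0Sn _ 1)); exists N => m n Nm mn.
have h1 := HN m Nm; have h2 := HN n (leq_trans Nm mn).
have -> : \sum_(m <= i < n) a i = \sum_(i < n) a i - \sum_(i < m) a i.
  rewrite -!(big_mkord xpredT a) [X in _ = X - _](big_cat_nat (n:=m))//=.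
  by rewrite addrAC subrr add0r.
move: h1 h2; rewrite !ltr_norml => /andP[h1 h2] /andP[h3 h4].
by lra.
Qed.

Lemma summable_cvg (u : nat -> C) : summable u ->
  exists l, tends (fun N => \sum_(i < N) u i) l.
Proof.
move=> [M HM]; apply: complex_cauchy => e e0.
have [N HN] := nonneg_tail (fun n => nrm_ge0 (u n)) HM e0.
exists N.
have H m n : (N <= m)%N -> (m <= n)%N ->
    nrm (\sum_(i < n) u i - \sum_(i < m) u i) < e.
  move=> Nm mn; rewrite -!(big_mkord xpredT u) (big_cat_nat (n:=m) _ _ (m:=0%N))//=.
  rewrite addrAC subrr add0r (le_lt_trans (ler_nrm_sum _ _ _))//.
  exact: HN.
move=> m n Nm Nn; case/orP: (leq_total m n) => mn; last exact: H.
by rewrite nrmBC; exact: H.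
Qed.

(** The value 0 for divergent series is a mere default: the sums taken later are absolutely
    convergent. *)
Definition csum (u : nat -> C) : C :=
  if pselect (exists l, tends (fun N => \sum_(i < N) u i) l) is left h
  then projT1 (cid h) else 0.

Lemma csum_tends (u : nat -> C) : summable u ->
  tends (fun N => \sum_(i < N) u i) (csum u).
Proof.
move=> /summable_cvg h; rewrite /csum; case: pselect => // h'.
exact: (projT2 (cid h')).
Qed.

Lemma csumE (u : nat -> C) l : tends (fun N => \sum_(i < N) u i) l -> csum u = l.
Proof.
move=> h; rewrite /csum; case: pselect => h'; last by exfalso; apply: h'; exists l.
exact: tends_uniq (projT2 (cid h')) h.
Qed.

Lemma summableD (u v : nat -> C) : summable u -> summable v ->
  summable (fun n => u n + v n).
Proof.
move=> [M HM] [M' HM']; exists (M + M') => N.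
apply: le_trans (lerD (HM N) (HM' N)); rewrite -big_split/=.
by apply: ler_sum => i _; exact: ler_nrmD.
Qed.

Lemma summableZ (u : nat -> C) a : summable u -> summable (fun n => a * u n).
Proof.
move=> [M HM]; exists (nrm a * M) => N.
under eq_bigr do rewrite nrmM; rewrite -mulr_sumr.
by rewrite ler_wpM2l ?nrm_ge0.
Qed.

Lemma csumD (u v : nat -> C) : summable u -> summable v ->
  csum (fun n => u n + v n) = csum u + csum v.
Proof.
move=> su sv; apply: csumE => e e0.
have [N HN] := tendsD (csum_tends su) (csum_tends sv) e0.
by exists N => n Nn; rewrite big_split; exact: HN.
Qed.

Lemma csumZ (u : nat -> C) a : summable u -> csum (fun n => a * u n) = a * csum u.
Proof.
move=> su; apply: csumE => e e0.
have [N HN] := tendsMl a (csum_tends su) e0.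
by exists N => n Nn; rewrite -mulr_sumr; exact: HN.
Qed.

Lemma csum_conj (u : nat -> C) : summable u ->
  csum (fun n => (u n)^*) = (csum u)^*.
Proof.
move=> su; apply: csumE => e e0.
have [N HN] := tends_conj (csum_tends su) e0.
by exists N => n Nn; rewrite -rmorph_sum; exact: HN.
Qed.

Lemma csum_real (a : nat -> R) : (forall n, 0 <= a n) ->
  summable (fun n => (a n)%:C) ->
  [/\ complex.Im (csum (fun n => (a n)%:C)) = 0,
      forall N, \sum_(i < N) a i <= complex.Re (csum (fun n => (a n)%:C))
    & forall M, (forall N, \sum_(i < N) a i <= M) ->
        complex.Re (csum (fun n => (a n)%:C)) <= M].
Proof.
move=> a0 sa; set s := csum _; have ts := csum_tends sa.
have E N : \sum_(i < N) (a i)%:C = (\sum_(i < N) a i)%:C :> C by rewrite rmorph_sum.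
have mono m n : (m <= n)%N -> \sum_(i < m) a i <= \sum_(i < n) a i.
  move=> mn; rewrite -!(big_mkord xpredT a).
  by rewrite [leRHS](big_cat_nat (n:=m))//= lerDl sumr_ge0.
split.
- apply/eqP/negPn/negP => n0.
  have [N HN] := ts `|complex.Im s| (eq_ind_r is_true n0 (normr_gt0 _)).
  have := HN N (leqnn _); rewrite E => h.
  have := le_lt_trans (ler_Im_nrm _) h; rewrite ImB /= sub0r normrN.
  by rewrite ltxx.
- move=> N; rewrite leNgt; apply/negP => h.
  have [N' HN] := ts _ (eq_ind_r is_true h (subr_gt0 _ _)).
  have := HN (maxn N N') (leq_maxr _ _); rewrite E => {}h'.
  have := le_lt_trans (Re_le_nrm _) h'; rewrite ReB /=.
  have := mono N (maxn N N') (leq_maxl _ _); by lra.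
- move=> M HM; rewrite leNgt; apply/negP => h.
  have [N' HN] := ts _ (eq_ind_r is_true h (subr_gt0 _ _)).
  have := HN N' (leqnn _); rewrite E nrmBC => h'.
  have := le_lt_trans (Re_le_nrm _) h'; rewrite ReB /=.
  have := HM N'; by lra.
Qed.

End Sequences.

Section PsdForm.
Variable R : realType.
Local Notation C := (cplx R).
Variables (E : lmodType C) (B : E -> E -> C) (D : set E).

(** The domain [D] is explicit because the forms used later are total functions that are
    sesquilinear only on bounded functions or on rational functions. Vectors of norm zero are
    allowed; the completion identifies them with 0. *)
Definition psd_form :=
  [/\ D 0 /\ (forall (a : C) x y, D x -> D y -> D (a *: x + y)),
      forall (a : C) x y z, D x -> D y -> D z -> B (a *: x + y) z = a * B x z + B y z,
      forall x y, D x -> D y -> B y x = (B x y)^*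
    & forall x, D x -> 0 <= complex.Re (B x x)].

Hypothesis HB : psd_form.

Definition qn (x : E) : R := Num.sqrt (complex.Re (B x x)).

Lemma psd_D0 : D 0. Proof. by case: HB => -[]. Qed.
Lemma psd_DZD (a : C) x y : D x -> D y -> D (a *: x + y).
Proof. by case: HB => -[_ h] _ _ _; exact: h. Qed.
Lemma psd_DD x y : D x -> D y -> D (x + y).
Proof. by move=> Dx Dy; have := psd_DZD 1 Dx Dy; rewrite scale1r. Qed.
Lemma psd_DZ (a : C) x : D x -> D (a *: x).
Proof. by move=> Dx; have := psd_DZD a Dx psd_D0; rewrite addr0. Qed.
Lemma psd_DN x : D x -> D (- x).
Proof. by move=> Dx; rewrite -scaleN1r; exact: psd_DZ. Qed.
Lemma psd_DB x y : D x -> D y -> D (x - y).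
Proof. by move=> Dx Dy; apply: psd_DD => //; exact: psd_DN. Qed.
Lemma psd_Dsum (I : Type) (r : seq I) (P : pred I) (F : I -> E) :
  (forall i, P i -> D (F i)) -> D (\sum_(i <- r | P i) F i).
Proof. by move=> H; apply: big_ind => //; [exact: psd_D0|exact: psd_DD]. Qed.

Lemma psd_lin (a : C) x y z : D x -> D y -> D z ->
  B (a *: x + y) z = a * B x z + B y z.
Proof. by case: HB => _ h _ _; exact: h. Qed.
Lemma psd_herm x y : D x -> D y -> B y x = (B x y)^*.
Proof. by case: HB => _ _ h _; exact: h. Qed.
Lemma psd_ge0 x : D x -> 0 <= complex.Re (B x x).
Proof. by case: HB => _ _ _ h; exact: h. Qed.

Lemma psd_Dl x y z : D x -> D y -> D z -> B (x + y) z = B x z + B y z.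
Proof. by move=> Dx Dy Dz; have := psd_lin 1 Dx Dy Dz; rewrite scale1r mul1r. Qed.
Lemma psd_0l z : D z -> B 0 z = 0.
Proof.
move=> Dz; have := psd_Dl psd_D0 psd_D0 Dz; rewrite addr0 => h.
by apply: (addrI (B 0 z)); rewrite -h addr0.
Qed.
Lemma psd_Zl a x z : D x -> D z -> B (a *: x) z = a * B x z.
Proof.
by move=> Dx Dz; have := psd_lin a Dx psd_D0 Dz; rewrite addr0 psd_0l// addr0.
Qed.
Lemma psd_Nl x z : D x -> D z -> B (- x) z = - B x z.
Proof. by move=> Dx Dz; rewrite -scaleN1r psd_Zl// mulN1r. Qed.
Lemma psd_Dr x y z : D x -> D y -> D z -> B x (y + z) = B x y + B x z.
Proof.
move=> Dx Dy Dz; have Dyz := psd_DD Dy Dz.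
by rewrite (psd_herm Dyz Dx) psd_Dl// rmorphD (psd_herm Dy Dx) (psd_herm Dz Dx).
Qed.
Lemma psd_Zr a x y : D x -> D y -> B x (a *: y) = a^* * B x y.
Proof.
move=> Dx Dy; rewrite (psd_herm (psd_DZ a Dy) Dx) psd_Zl// rmorphM.
by rewrite (psd_herm Dy Dx).
Qed.
Lemma psd_Nr x y : D x -> D y -> B x (- y) = - B x y.
Proof. by move=> Dx Dy; rewrite -scaleN1r psd_Zr// rmorphN1 mulN1r. Qed.
Lemma psd_0r x : D x -> B x 0 = 0.
Proof. by move=> Dx; rewrite (psd_herm psd_D0 Dx) psd_0l// rmorph0. Qed.
Lemma psd_suml (I : Type) (r : seq I) (P : pred I) (F : I -> E) z : D z ->
  (forall i, P i -> D (F i)) ->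
  B (\sum_(i <- r | P i) F i) z = \sum_(i <- r | P i) B (F i) z.
Proof.
move=> Dz DF; suff : D (\sum_(i <- r | P i) F i) /\
  B (\sum_(i <- r | P i) F i) z = \sum_(i <- r | P i) B (F i) z by case.
elim/big_rec2: _ => [|i y x Pi [Dx <-]]; first by rewrite psd_0l//; split => //; exact: psd_D0.
by split; [apply: psd_DD => //; exact: DF|rewrite psd_Dl//; exact: DF].
Qed.
Lemma psd_sumr (I : Type) (r : seq I) (P : pred I) (F : I -> E) z : D z ->
  (forall i, P i -> D (F i)) ->
  B z (\sum_(i <- r | P i) F i) = \sum_(i <- r | P i) B z (F i).
Proof.
move=> Dz DF; rewrite (psd_herm (psd_Dsum _ DF) Dz) psd_suml// rmorph_sum.
by apply: eq_bigr => i Pi; rewrite (psd_herm (DF i Pi) Dz).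
Qed.

Lemma psd_Bl x y z : D x -> D y -> D z -> B (x - y) z = B x z - B y z.
Proof. by move=> Dx Dy Dz; rewrite psd_Dl ?psd_Nl//; exact: psd_DN. Qed.

Lemma psd_Im x : D x -> complex.Im (B x x) = 0.
Proof.
move=> Dx; have := congr1 (@complex.Im R) (psd_herm Dx Dx); rewrite ImJ.
by lra.
Qed.
Lemma psd_real x : D x -> B x x = (complex.Re (B x x))%:C.
Proof. by move=> Dx; apply: ReImE => //=; exact: psd_Im. Qed.

Lemma qn_ge0 x : 0 <= qn x. Proof. exact: sqrtr_ge0. Qed.
Lemma qn_sqr x : D x -> qn x ^+ 2 = complex.Re (B x x).
Proof. by move=> Dx; rewrite sqr_sqrtr// psd_ge0. Qed.
Lemma qn_sqrC x : D x -> (qn x ^+ 2)%:C = B x x.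
Proof. by move=> Dx; rewrite qn_sqr// -psd_real. Qed.

Lemma psd_sqrD x y : D x -> D y ->
  complex.Re (B (x + y) (x + y)) =
  complex.Re (B x x) + complex.Re (B y y) + 2 * complex.Re (B x y).
Proof.
move=> Dx Dy; have Dxy := psd_DD Dx Dy.
rewrite psd_Dl// !psd_Dr// (psd_herm Dx Dy) !ReD ReJ; by lra.
Qed.

Lemma psd_CS x y : D x -> D y -> nrm (B x y) <= qn x * qn y.
Proof.
move=> Dx Dy.
(* Positivity of the form at [x - t * B x y * y]. *)
have key (t : R) : 0 <= complex.Re (B x x) - 2 * t * nrm (B x y) ^+ 2
    + t ^+ 2 * nrm (B x y) ^+ 2 * complex.Re (B y y).
  have Dz := psd_DZ (- t%:C * B x y) Dy.
  have := psd_ge0 (psd_DD Dx Dz); rewrite psd_sqrD//.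
  rewrite psd_Zl// !psd_Zr// psd_real// mulrA mul_conj.
  have -> : (- t%:C * B x y)^* * B x y = (- t * nrm (B x y) ^+ 2)%:C :> C.
    by apply: ReImE; rewrite /= ?nrm_sqr ?ReM ?ImM ?ReJ ?ImJ ?ReM ?ImM ?ReN ?ImN/=; ring.
  rewrite nrmM exprMn nrmN nrm_real real_normK ?num_real// (psd_real Dy).
  rewrite !ReRM /=; by lra.
rewrite -(@ler_pXn2r _ 2)// ?nnegrE ?nrm_ge0 ?mulr_ge0 ?qn_ge0//.
rewrite exprMn !qn_sqr//.
(* If [y] has norm zero, [key] is affine in [t] and fails for large [t] unless [B x y] vanishes.
   Otherwise the optimal [t] is the inverse of [B y y]. *)
have := psd_ge0 Dy; rewrite le_eqVlt => /orP[/eqP y0|y0].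
  rewrite -y0 mulr0.
  set n := nrm (B x y) ^+ 2.
  rewrite leNgt; apply/negP => n0.
  have := key ((complex.Re (B x x) + 1) / n); rewrite -y0 mulr0 addr0 -/n.
  rewrite -mulrA divfK ?gt_eqF//.
  have := psd_ge0 Dx; by lra.
have := key (complex.Re (B y y))^-1; set b := complex.Re (B y y) in y0 *.
set n := nrm (B x y) ^+ 2.
have -> : complex.Re (B x x) - 2 * b^-1 * n + b^-1 ^+ 2 * n * b =
  complex.Re (B x x) - n / b by field; rewrite gt_eqF.
by rewrite subr_ge0 ler_pdivrMr.
Qed.

Lemma qnD x y : D x -> D y -> qn (x + y) <= qn x + qn y.
Proof.
move=> Dx Dy; rewrite -(@ler_pXn2r _ 2)// ?nnegrE ?addr_ge0 ?qn_ge0//.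
rewrite qn_sqr ?psd_sqrD//; last exact: psd_DD.
have := le_trans (Re_le_nrm _) (psd_CS Dx Dy).
by rewrite sqrrD !qn_sqr// mulr_natl; lra.
Qed.

Lemma qnZ a x : D x -> qn (a *: x) = nrm a * qn x.
Proof.
move=> Dx; rewrite /qn psd_Zl//; last exact: psd_DZ.
rewrite psd_Zr// mulrA mul_conj psd_real// -rmorphM/=.
by rewrite sqrtrM ?sqr_ge0// sqrtr_sqr ger0_norm ?nrm_ge0.
Qed.

Lemma qnN x : D x -> qn (- x) = qn x.
Proof. by move=> Dx; rewrite -scaleN1r qnZ// nrmN nrm1 mul1r. Qed.

Lemma qnB x y : D x -> D y -> qn (x - y) <= qn x + qn y.
Proof. by move=> Dx Dy; rewrite -(qnN Dy) qnD//; exact: psd_DN. Qed.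

Lemma qn0 : qn 0 = 0.
Proof. by rewrite /qn psd_0l ?sqrtr0//; exact: psd_D0. Qed.

End PsdForm.

(** * Square-summable sequences *)

Section Ell2.
Variable R : realType.
Local Notation C := (cplx R).
Variable I : set nat.

(** The support [I] makes one construction serve all dimensions: Gram-Schmidt leaves the indices of
    dependent vectors empty. *)
Definition is_l2 (f : nat -> C^o) : Prop :=
  (forall n, ~ I n -> f n = 0) /\ summable (fun n => f n * (f n)^*).

Definition l2 : {pred nat -> C^o} := fun f => `[< is_l2 f >].

Lemma mul_conj_le (a b : C) : nrm (a * b^*) <= nrm (a * a^*) + nrm (b * b^*).
Proof.
rewrite !nrmM !nrm_conj -!expr2.
have := sqr_ge0 (nrm a - nrm b); have := sqr_ge0 (nrm a); have := sqr_ge0 (nrm b).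
by rewrite sqrrB !expr2; lra.
Qed.

Lemma conj_mulJ (a b : C) : (a * b^*)^* = b * a^*.
Proof. by apply: ReImE; rewrite ?(ReJ, ImJ, ReM, ImM); ring. Qed.

Lemma l2_summable f g : is_l2 f -> is_l2 g -> summable (fun n => f n * (g n)^*).
Proof.
move=> [_ [M HM]] [_ [M' HM']]; exists (M + M') => N.
apply: le_trans (lerD (HM N) (HM' N)); rewrite -big_split/=.
by apply: ler_sum => i _; exact: mul_conj_le.
Qed.

Lemma l2_closed : submod_closed l2.
Proof.
split.
  apply/asboolP; split => // ; exists 0 => N; rewrite big1// => i _.
  by rewrite mul0r nrm0.
move=> a f g /asboolP lf /asboolP lg; apply/asboolP; split.
  move=> n In; have [f0 _] := lf; have [g0 _] := lg.
  transitivity ((a : C) * f n + g n : C) => //.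
  by rewrite (f0 _ In) (g0 _ In) mulr0 addr0.
have E n : (a *: f + g) n * ((a *: f + g) n)^* =
    (a * a^*) * (f n * (f n)^*) + g n * (g n)^* +
    (a * (f n * (g n)^*) + a^* * (g n * (f n)^*)).
  have -> : (a *: f + g) n = (a : C) * (f n : C) + (g n : C) :> C by [].
  by move: (f n : C) (g n : C) => x y; rewrite rmorphD rmorphM; ring.
under eq_fun do rewrite E.
exact: (summableD (summableD (summableZ _ (proj2 lf)) (proj2 lg))
  (summableD (summableZ _ (l2_summable lf lg)) (summableZ _ (l2_summable lg lf)))).
Qed.

HB.instance Definition _ := GRing.isSubmodClosed.Build C (nat -> C^o) l2 l2_closed.

Record ell2 := Ell2 { ell2_val :> nat -> C^o; ell2P : ell2_val \in l2 }.

HB.instance Definition _ := [isSub for ell2_val].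
HB.instance Definition _ := [Choice of ell2 by <:].
HB.instance Definition _ := [SubChoice_isSubLmodule of ell2 by <:].

Lemma ell2_is (x : ell2) : is_l2 x. Proof. exact/asboolP/ell2P. Qed.

Lemma ell2_ext (x y : ell2) : (forall n, x n = y n) -> x = y.
Proof. by move=> h; apply: val_inj; apply/funext. Qed.

Lemma ell2_ZD (a : C) (x y : ell2) n : (a *: x + y) n = a * x n + y n.
Proof. by []. Qed.

Definition l2inner (x y : ell2) : C := csum (fun n => x n * (y n)^*).

Lemma l2inner_psd : psd_form l2inner setT.
Proof.
split => //.
- move=> a x y z _ _ _; rewrite /l2inner.
  under eq_fun do rewrite ell2_ZD mulrDl -mulrA.
  rewrite csumD ?csumZ//; last 2 first.
  - by apply: summableZ; apply: l2_summable; exact: ell2_is.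
  - by apply: l2_summable; exact: ell2_is.
  by apply: l2_summable; exact: ell2_is.
- move=> x y _ _; rewrite /l2inner -csum_conj; last first.
    by apply: l2_summable; exact: ell2_is.
  by congr csum; apply/funext => n; rewrite conj_mulJ.
- move=> x _; rewrite /l2inner; under eq_fun do rewrite mul_conj.
  have [||_ h _] := @csum_real R (fun n => nrm (x n) ^+ 2).
  - by move=> n; rewrite exprn_ge0 ?nrm_ge0.
  - have [_] := ell2_is x; under eq_fun do rewrite mul_conj; by [].
  by apply: le_trans (h 0%N); rewrite big_ord0.
Qed.

Lemma l2_csum (x : ell2) :
  [/\ forall N, \sum_(i < N) nrm (x i) ^+ 2 <= qn l2inner x ^+ 2
    & forall M, (forall N, \sum_(i < N) nrm (x i) ^+ 2 <= M) ->
        qn l2inner x ^+ 2 <= M].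
Proof.
rewrite (qn_sqr l2inner_psd)//.
have [||h0 h1 h2] := @csum_real R (fun n => nrm (x n) ^+ 2).
- by move=> n; rewrite exprn_ge0 ?nrm_ge0.
- have [_] := ell2_is x; under eq_fun do rewrite mul_conj; by [].
by rewrite /l2inner; under eq_fun do rewrite mul_conj; split.
Qed.

Lemma l2_coord (x : ell2) n : nrm (x n) <= qn l2inner x.
Proof.
rewrite -(@ler_pXn2r _ 2)// ?nnegrE ?nrm_ge0 ?qn_ge0//.
have [h _] := l2_csum x; apply: le_trans (h n.+1).
by rewrite big_ord_recr/= lerDr sumr_ge0// => i _; rewrite exprn_ge0 ?nrm_ge0.
Qed.

Definition l2norm (x : ell2) : C := (qn l2inner x)%:C.

Lemma l2normD x y : l2norm (x + y) <= l2norm x + l2norm y.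
Proof. by rewrite /l2norm -rmorphD/= lecR (qnD l2inner_psd). Qed.
Lemma l2normZ (a : C) x : l2norm (a *: x) = `|a| * l2norm x.
Proof. by rewrite /l2norm (qnZ l2inner_psd)// rmorphM/= -normE. Qed.
Lemma l2norm_eq0 x : l2norm x = 0 -> x = 0.
Proof.
move=> /(@complexI R) x0; apply: ell2_ext => n.
by have := l2_coord x n; rewrite x0 => h; apply/eqP; rewrite -nrm_eq0 eq_le h nrm_ge0.
Qed.

HB.instance Definition _ := Lmodule_isNormed.Build C ell2 l2normD l2normZ l2norm_eq0.

Lemma nrm_ell2 (x : ell2) : nrm x = qn l2inner x. Proof. by []. Qed.

(** Completeness is stated for Cauchy filters. Centers of balls of radius [1 / (n + 1)] that belong
    to the filter form a Cauchy sequence, and its limit is the limit of the filter. *)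
Lemma cauchy_complete (V : normedModType C) :
  (forall u : nat -> V, cauchyseq u -> exists l, tends u l) ->
  forall F : set_system V, ProperFilter F -> cauchy F -> cvg F.
Proof.
move=> H F PF /cauchyP cF.
have rp n : 0 < (n.+1%:R^-1 : C) by rewrite invr_gt0 ltr0Sn.
have /choice[u Hu] : forall n, exists x, F (ball x (n.+1%:R^-1 : C)).
  by move=> n; exact: cF.
have rE n : (n.+1%:R^-1 : C) = (n.+1%:R^-1)%:C by rewrite fmorphV rmorph_nat.
have bE n x : ball (u n) (n.+1%:R^-1 : C) x = (nrm (u n - x) < n.+1%:R^-1) :> Prop.
  by rewrite -ball_normE /= normE rE ltcR.
have uu m n : nrm (u m - u n) < m.+1%:R^-1 + n.+1%:R^-1.
  have /filter_ex[x []] : F (ball (u m) (m.+1%:R^-1 : C) `&` ball (u n) (n.+1%:R^-1 : C)).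
    by apply: filterI; exact: Hu.
  rewrite !bE => h1 h2.
  by rewrite (le_lt_trans (ler_dist_nrm x _ _))// ltrD// nrmBC.
have small (e : R) : 0 < e -> exists N, forall n, (N <= n)%N -> n.+1%:R^-1 < e.
  move=> e0; have [N HN] : exists N, e^-1 < N.+1%:R.
    by exists (Num.truncn e^-1); rewrite truncnS_gt.
  exists N => n Nn; rewrite -[ltRHS]invrK ltf_pV2 ?posrE ?invr_gt0//.
  by rewrite (lt_le_trans HN)// ler_nat.
have [l Hl] : exists l, tends u l.
  apply: H => e e0; have [N HN] := small (e / 2) (divr_gt0 e0 (ltr0Sn _ 1)).
  exists N => m n Nm Nn; rewrite (lt_trans (uu _ _))// (splitr e).
  by rewrite ltrD ?HN.
apply/cvg_ex; exists l; apply/cvg_ballP => e e0.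
have eE : e = (complex.Re e)%:C by rewrite RRe_real// gtr0_real.
have e0' : 0 < complex.Re e by move: e0; rewrite {1}eE ltcR.
have e2 : 0 < complex.Re e / 2 by rewrite divr_gt0.
have [N1 H1] := Hl _ e2; have [N2 H2] := small _ e2.
have := Hu (maxn N1 N2); apply: filterS => x; rewrite bE => h.
rewrite -ball_normE /= normE eE ltcR (le_lt_trans (ler_dist_nrm (u (maxn N1 N2)) _ _))//.
rewrite (splitr (complex.Re e)) ltrD//; first by rewrite nrmBC H1// leq_maxl.
by rewrite (lt_trans h)// H2// leq_maxr.
Qed.

Lemma cvg_sum_ord (a : nat -> nat -> R) (l : nat -> R) K :
  (forall i : 'I_K, (fun m => a m i) @ \oo --> l i) ->
  (fun m => \sum_(i < K) a m i) @ \oo --> \sum_(i < K) l i.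
Proof.
elim: K => [|K IH] H.
  by rewrite big_ord0; under eq_fun do rewrite big_ord0; exact: cvg_cst.
rewrite big_ord_recr; under eq_fun do rewrite big_ord_recr.
by apply: cvgD; [apply: IH => i; exact: (H (widen_ord (leqnSn K) i))|exact: (H ord_max)].
Qed.

Lemma ell2_complete_seq (u : nat -> ell2) : cauchyseq u -> exists l, tends u l.
Proof.
move=> cu.
have /choice[f Hf] : forall k, exists l : C, tends (fun n => u n k : C) l.
  move=> k; apply: complex_cauchy => e e0; have [N HN] := cu e e0.
  exists N => m n Nm Nn; apply: le_lt_trans (HN m n Nm Nn).
  by rewrite nrm_ell2; have := l2_coord (u m - u n) k.
(* Finite partial sums of [|u m - u n|^2] pass to the limit in [m]; no interchange with an infinite
   sum is involved. *)
have part (e : R) N : (forall m n, (N <= m)%N -> (N <= n)%N ->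
    nrm (u m - u n) < e) -> forall n K, (N <= n)%N ->
    \sum_(i < K) nrm (f i - u n i : C) ^+ 2 <= e ^+ 2.
  move=> HN n K Nn.
  have e0 : 0 < e by rewrite (le_lt_trans (nrm_ge0 _) (HN N N _ _)).
  have T : (fun m => \sum_(i < K) nrm (u m i - u n i : C) ^+ 2) @ \oo -->
      \sum_(i < K) nrm (f i - u n i : C) ^+ 2.
    apply: (cvg_sum_ord (a := fun m i => nrm (u m i - u n i : C) ^+ 2)
      (l := fun i => nrm (f i - u n i : C) ^+ 2)) => i; rewrite expr2; under eq_fun do rewrite expr2.
    suff h : (fun m => nrm (u m i - u n i : C)) @ \oo --> nrm (f i - u n i : C).
      exact: cvgM.
    apply/cvgn_eps => d d0; have [M HM] := Hf i d d0; exists M => m Mm.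
    rewrite (le_lt_trans (ler_nrm_dist _ _))// opprB addrA subrK.
    exact: HM.
  rewrite -(cvg_lim (@Rhausdorff R) T); apply: limr_le.
    by apply/cvg_ex; exists (\sum_(i < K) nrm (f i - u n i : C) ^+ 2).
  exists N => // m /= Nm; have [h _] := l2_csum (u m - u n).
  apply: le_trans (h K) _; rewrite -nrm_ell2 ler_pXn2r ?nnegrE ?nrm_ge0 ?ltW//.
  exact: HN.
have lf : is_l2 (f : nat -> C^o).
  split.
    move=> k Ik; apply: (tends_uniq (Hf k)) => e e0; exists 0%N => n _.
    by have [h _] := ell2_is (u n); rewrite (h _ Ik) subrr nrm0.
  have [N HN] := cu 1 ltr01.
  exists (2 * (1 + nrm (u N) ^+ 2)) => K.
  have [h _] := l2_csum (u N); have := part 1 N HN N K (leqnn _).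
  move: (h K); rewrite -nrm_ell2 expr1n => {}h h'.
  apply: le_trans (ler_wpM2l (ler0n _ 2) (lerD h' h)).
  rewrite -big_split mulr_sumr/=; apply: ler_sum => i _.
  rewrite nrmM nrm_conj -expr2.
  have h2 : nrm (f i) <= nrm (f i - u N i : C) + nrm (u N i : C).
    by have := ler_nrmD (f i - u N i : C) (u N i); rewrite subrK.
  apply: le_trans (_ : (nrm (f i - u N i : C) + nrm (u N i : C)) ^+ 2 <= _).
    by rewrite ler_pXn2r ?nnegrE ?addr_ge0 ?nrm_ge0.
  have := sqr_ge0 (nrm (f i - u N i : C) - nrm (u N i : C)).
  by rewrite sqrrB sqrrD; lra.
exists (Ell2 (asboolT lf)) => e e0; have [N HN] := cu (e / 2) (divr_gt0 e0 (ltr0Sn _ 1)).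
exists N => n Nn; rewrite nrmBC nrm_ell2.
apply: (@le_lt_trans _ _ (e / 2)); last by rewrite ltr_pdivrMr// ltr_pMr// ltr1n.
rewrite -(@ler_pXn2r _ 2)// ?nnegrE ?qn_ge0 ?divr_ge0 ?(ltW e0)//.
have [_ h] := l2_csum (Ell2 (asboolT lf) - u n); apply: h => K.
exact: (part _ N).
Qed.

HB.instance Definition _ := Uniform_isComplete.Build ell2
  (cauchy_complete ell2_complete_seq).

Lemma l2inner_linear (u : ell2) : linear_for *%R (l2inner ^~ u).
Proof. by move=> a x y; rewrite (psd_lin l2inner_psd). Qed.
Lemma l2inner_linearr (u : ell2) : linear_for (Num.conj \; *%R) (l2inner u).
Proof.
move=> a x y; rewrite (psd_Dr l2inner_psd)// (psd_Zr l2inner_psd)//.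
Qed.

HB.instance Definition _ := bilinear_isBilinear.Build C ell2 ell2 C
  *%R (Num.conj \; *%R) l2inner (l2inner_linear, l2inner_linearr).

Lemma l2inner_herm (x y : ell2) : l2inner x y = (-1) ^+ false * (l2inner y x)^*.
Proof. by rewrite expr0 mul1r (psd_herm l2inner_psd). Qed.

HB.instance Definition _ := isHermitianSesquilinear.Build C ell2 false
  Num.conj l2inner l2inner_herm.

Lemma qn_l2_gt0 (x : ell2) : x != 0 -> 0 < l2inner x x.
Proof.
move=> x0; rewrite (psd_real l2inner_psd)// ltcR -(qn_sqr l2inner_psd)//.
by rewrite exprn_gt0// -nrm_ell2 nrm_gt0.
Qed.

HB.instance Definition _ := isDotProduct.Build C ell2 l2inner qn_l2_gt0.

Lemma l2_inner_norm (x : ell2) : `|x| ^+ 2 = l2inner x x.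
Proof.
by rewrite normE -rmorphXn/= nrm_ell2 (qn_sqrC l2inner_psd).
Qed.

Lemma l2_tail (x : ell2) (e : R) : 0 < e -> exists N, forall K,
  \sum_(N <= i < K) nrm (x i) ^+ 2 < e.
Proof.
move=> e0; have [h _] := l2_csum x.
have [N HN] := nonneg_tail (fun n => exprn_ge0 2 (nrm_ge0 (x n))) h e0.
exists N => K; have [NK|KN] := leqP N K; first exact: HN.
by rewrite big_geq// ltnW.
Qed.

Lemma is_l2_finite (f : nat -> C^o) N : (forall n, ~ I n -> f n = 0) ->
  (forall n, (N <= n)%N -> f n = 0) -> is_l2 f.
Proof.
move=> fI fN; split=> //; exists (\sum_(i < N) nrm (f i * (f i)^*)) => K.
have [NK|KN] := leqP N K.
  rewrite -!(big_mkord xpredT (fun i => nrm (f i * (f i)^*))).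
  rewrite (big_cat_nat (n:=N))//= [X in _ + X]big_nat_cond.
  by rewrite [X in _ + X]big1 ?addr0// => i /andP[/andP[Ni _] _]; rewrite fN// mul0r nrm0.
rewrite -!(big_mkord xpredT (fun i => nrm (f i * (f i)^*))).
by rewrite [leRHS](big_cat_nat (n:=K)) ?(ltnW KN)//= lerDl sumr_ge0// => i _; exact: nrm_ge0.
Qed.

Lemma rat_approx (r e : R) : 0 < e -> exists q : rat, `|r - ratr q| < e.
Proof.
move=> e0; have [q] := @rat_in_itvoo R (r - e) (r + e) (ltac:(lra)).
by rewrite in_itv/= => /andP[h1 h2]; exists q; rewrite ltr_norml; apply/andP; split; lra.
Qed.

Definition cratr (q : rat * rat) : C := (ratr q.1 : R) +i* (ratr q.2 : R).

Lemma crat_approx (z : C) (e : R) : 0 < e -> exists q, nrm (z - cratr q) < e.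
Proof.
move=> e0; have e2 : 0 < e / 2 by rewrite divr_gt0.
have [p Hp] := rat_approx (complex.Re z) e2.
have [q Hq] := rat_approx (complex.Im z) e2.
exists (p, q); rewrite (le_lt_trans (nrm_le_ReIm _))// ReB ImB/= (splitr e).
by rewrite ltrD.
Qed.

Definition l2rat (s : seq (rat * rat)) : nat -> C^o :=
  fun n => if pselect (I n) then if (n < size s)%N then cratr (nth (0, 0) s n) else 0
           else 0.

Lemma l2ratP s : is_l2 (l2rat s).
Proof.
apply: (@is_l2_finite _ (size s)) => n; rewrite /l2rat; first by case: pselect.
by move=> sn; rewrite ltnNge sn; case: pselect.
Qed.

Definition ell2_rat s : ell2 := Ell2 (asboolT (l2ratP s)).

Lemma ell2_separable : exists2 D : set ell2, countable D & dense D.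
Proof.
exists (range ell2_rat); first exact: card_le_trans (card_image_le _ _) (countableP _).
apply/dense_nrmP => x e e0.
have [N HN] := l2_tail x (divr_gt0 (exprn_gt0 2 e0) (ltr0Sn _ 3)).
(* The first [N] coordinates contribute at most [N * d^2 <= e^2 / 4] and the tail less than
   [e^2 / 4]. *)
pose d := e / (2 * N.+1%:R).
have d0 : 0 < d by rewrite divr_gt0// mulr_gt0// ltr0Sn.
have /choice[q Hq] : forall n, exists q, nrm (x n - cratr q : C) < d.
  by move=> n; exact: crat_approx.
exists (ell2_rat (mkseq q N)); first by exists (mkseq q N).
rewrite -(@ltr_pXn2r _ 2)// ?nnegrE ?nrm_ge0 ?(ltW e0)//.
apply: (@le_lt_trans _ _ (e ^+ 2 / 2)); last first.
  by rewrite ltr_pdivrMr// ltr_pMr ?exprn_gt0// ltr1n.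
have xE i : (x - ell2_rat (mkseq q N)) i = x i - l2rat (mkseq q N) i by [].
have [h _] := ell2_is x.
have [_ H] := l2_csum (x - ell2_rat (mkseq q N)); apply: H => K.
apply: (@le_trans _ _ (\sum_(i < N) d ^+ 2 + \sum_(N <= i < maxn N K) nrm (x i) ^+ 2)).
  apply: (@le_trans _ _ (\sum_(i < maxn N K) nrm ((x - ell2_rat (mkseq q N)) i) ^+ 2)).
    pose F i := nrm ((x - ell2_rat (mkseq q N)) i) ^+ 2.
    rewrite -!(big_mkord xpredT F) [leRHS](big_cat_nat (n:=K)) ?leq_maxr//= lerDl.
    by apply: sumr_ge0 => i _; rewrite exprn_ge0 ?nrm_ge0.
  pose F i := nrm ((x - ell2_rat (mkseq q N)) i) ^+ 2.
  rewrite -(big_mkord xpredT F) (big_cat_nat (n:=N)) ?leq_maxl//= lerD//.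
    rewrite big_mkord; apply: ler_sum => i _.
    rewrite /F ler_pXn2r ?nnegrE ?nrm_ge0 ?(ltW d0)// xE /l2rat.
    case: pselect => [Ii|nI]; last by rewrite (h _ nI) subrr nrm0 ltW.
    by rewrite size_mkseq ltn_ord nth_mkseq// ltW.
  apply: ler_sum_nat => i /andP[Ni _]; rewrite /F xE /l2rat size_mkseq ltnNge Ni/=.
  by rewrite if_same subr0.
have -> : e ^+ 2 / 2 = e ^+ 2 / 4 + e ^+ 2 / 4 by field.
rewrite lerD ?(ltW (HN _))// sumr_const card_ord -[_ *+ N]mulr_natr.
have -> : e ^+ 2 / 4 = d ^+ 2 * N.+1%:R ^+ 2.
  have : N.+1%:R != 0 :> R by rewrite pnatr_eq0.
  by rewrite /d; move: (N.+1%:R : R) => t t0; field.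
rewrite ler_wpM2l ?sqr_ge0// -natrX ler_nat.
by rewrite -mulnn (leq_trans (leqnSn _))// leq_pmulr.
Qed.

Definition ell2_hilbert : hilbertSpace R :=
  @HilbertSpace R ell2 l2inner l2_inner_norm ell2_separable.

End Ell2.

(** * Hilbert spaces *)

Section Hilbert.
Variable R : realType.
Local Notation C := (cplx R).
Variable H : hilbertSpace R.
Implicit Types x y z : H.

Lemma innerDl x y z : inner (x + y) z = inner x z + inner y z.
Proof. exact: linearDl. Qed.
Lemma innerZl (a : C) x z : inner (a *: x) z = a * inner x z.
Proof. exact: linearZl_LR. Qed.

Lemma innerC x y : inner y x = (inner x y)^*.
Proof.
have := @hermitian_subproof _ _ _ _ (@inner R H) y x.
by rewrite expr0 mul1r.
Qed.

Lemma inner_nrm x : inner x x = (nrm x ^+ 2)%:C.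
Proof. by rewrite -inner_norm normE rmorphXn. Qed.

Lemma inner_psd : psd_form (@inner R H) setT.
Proof.
split => //.
- by move=> a x y z _ _ _; rewrite innerDl innerZl.
- by move=> x y _ _; rewrite -innerC.
- by move=> x _; rewrite inner_nrm/= sqr_ge0.
Qed.

Lemma qn_inner x : qn (@inner R H) x = nrm x.
Proof. by rewrite /qn inner_nrm/= sqrtr_sqr ger0_norm ?nrm_ge0. Qed.

Lemma innerDr x y z : inner x (y + z) = inner x y + inner x z.
Proof. exact: (psd_Dr inner_psd). Qed.
Lemma innerZr (a : C) x y : inner x (a *: y) = a^* * inner x y.
Proof. exact: (psd_Zr inner_psd). Qed.
Lemma innerNl x y : inner (- x) y = - inner x y.
Proof. exact: (psd_Nl inner_psd). Qed.
Lemma innerNr x y : inner x (- y) = - inner x y.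
Proof. exact: (psd_Nr inner_psd). Qed.
Lemma innerBl x y z : inner (x - y) z = inner x z - inner y z.
Proof. by rewrite innerDl innerNl. Qed.
Lemma innerBr x y z : inner x (y - z) = inner x y - inner x z.
Proof. by rewrite innerDr innerNr. Qed.
Lemma inner0l x : inner 0 x = 0.
Proof. exact: (psd_0l inner_psd). Qed.
Lemma inner0r x : inner x 0 = 0.
Proof. exact: (psd_0r inner_psd). Qed.

Lemma inner_CS x y : nrm (inner x y) <= nrm x * nrm y.
Proof. by rewrite -!qn_inner; exact: (psd_CS inner_psd). Qed.

Lemma inner_eq0 x : inner x x = 0 -> x = 0.
Proof.
rewrite inner_nrm => /(@complexI R) /eqP; rewrite sqrf_eq0 nrm_eq0.
by move=> /eqP.
Qed.

Lemma nrm_sqrD x y :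
  nrm (x + y) ^+ 2 = nrm x ^+ 2 + nrm y ^+ 2 + 2 * complex.Re (inner x y).
Proof.
by have := psd_sqrD inner_psd (x := x) (y := y) I I; rewrite !inner_nrm.
Qed.

Lemma nrm_sqrB x y :
  nrm (x - y) ^+ 2 = nrm x ^+ 2 + nrm y ^+ 2 - 2 * complex.Re (inner x y).
Proof. by rewrite nrm_sqrD innerNr ReN nrmN mulrN. Qed.

Lemma hilbert_complete (u : nat -> H) : cauchyseq u -> exists l, tends u l.
Proof.
move=> cu.
have cF : cauchy (u @ \oo).
  apply/cauchyP => e e0.
  have eE : e = (complex.Re e)%:C by rewrite RRe_real// gtr0_real.
  have e0' : 0 < complex.Re e by move: e0; rewrite {1}eE ltcR.
  have [N HN] := cu _ e0'.
  exists (u N); exists N => // n /= Nn; rewrite -ball_normE /= normE eE ltcR.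
  exact: HN.
have [l Hl] : exists l : H, u @ \oo --> l by exists (lim (u @ \oo)); exact: cauchy_cvg cF.
exists l => e e0; have : nbhs l [set y | nrm (l - y) < e].
  by apply/nbhs_nrmP; exists e.
move=> /Hl [N _ HN]; exists N => n Nn; rewrite nrmBC.
exact: (HN n Nn).
Qed.

Lemma tends_closed (V : set H) (u : nat -> H) l :
  closed V -> (forall n, V (u n)) -> tends u l -> V l.
Proof.
move=> /closed_nrmP cV Vu ul; apply: cV => e e0; have [N HN] := ul e e0.
by exists (u N) => //; rewrite nrmBC HN.
Qed.

Lemma inv_small (e : R) : 0 < e -> exists N : nat, forall n, (N <= n)%N ->
  n.+1%:R^-1 < e.
Proof.
move=> e0; exists (Num.truncn e^-1) => n Nn.
rewrite -[ltRHS]invrK ltf_pV2 ?posrE ?invr_gt0//.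
by rewrite (lt_le_trans (truncnS_gt _))// ler_nat.
Qed.

(** For [t = s * inner u w] the squared norm changes by [|inner u w|^2 * (s^2 |w|^2 - 2 s)], which
    is negative for small positive [s] unless the inner product is zero. *)
Lemma orthogonal_min (u w : H) :
  (forall t : C, nrm u <= nrm (u - t *: w)) -> inner u w = 0.
Proof.
move=> h; apply/eqP; rewrite -nrm_eq0; apply/negPn/negP => n0.
set n := nrm (inner u w) in n0.
have ngt0 : 0 < n by rewrite lt_def n0 nrm_ge0.
have key (s : R) : 0 <= - 2 * s * n ^+ 2 + s ^+ 2 * n ^+ 2 * nrm w ^+ 2.
  have := h (s%:C * inner u w).
  rewrite -(@ler_pXn2r _ 2)// ?nnegrE ?nrm_ge0// nrm_sqrB innerZr.
  have -> : (s%:C * inner u w)^* * inner u w = (s * n ^+ 2)%:C.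
    by apply: ReImE; rewrite /n ?nrm_sqr ?(ReJ, ImJ, ReM, ImM)/=; ring.
  rewrite nrmZ nrmM nrm_real !exprMn real_normK ?num_real//= -/n.
  by lra.
have w1 : 0 < 1 + nrm w ^+ 2 by rewrite ltr_pwDl// sqr_ge0.
have := key (1 + nrm w ^+ 2)^-1.
(* This choice gives [s * |w|^2 <= 1] and makes sense for [w = 0] as well. *)
set s := (1 + nrm w ^+ 2)^-1.
have s0 : 0 < s by rewrite invr_gt0.
have sw : s * nrm w ^+ 2 <= 1.
  by rewrite /s mulrC ler_pdivrMr// mul1r lerDr.
have -> : - 2 * s * n ^+ 2 + s ^+ 2 * n ^+ 2 * nrm w ^+ 2 =
  s * n ^+ 2 * (s * nrm w ^+ 2 - 2) by ring.
rewrite leNgt pmulr_rlt0 ?mulr_gt0 ?exprn_gt0//.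
by lra.
Qed.

Lemma projection (V : set H) x : is_subspace V -> closed V ->
  exists2 v, V v & forall w, V w -> inner (x - v) w = 0.
Proof.
move=> [V0 VL] cV.
pose S := [set r | exists2 w, V w & r = nrm (x - w) ^+ 2].
have Sinf : has_inf S.
  split; first by exists (nrm (x - 0) ^+ 2); exists 0.
  by exists 0 => _ [w _ ->]; rewrite sqr_ge0.
pose d := inf S.
have dle w : V w -> d <= nrm (x - w) ^+ 2.
  by move=> Vw; apply: ge_inf; [case: Sinf|exists w].
have /choice[v Hv] : forall n : nat, exists v, V v /\ nrm (x - v) ^+ 2 < d + n.+1%:R^-1.
  move=> n; have n0 : 0 < n.+1%:R^-1 :> R by rewrite invr_gt0 ltr0Sn.
  by have [_ [w Vw ->] hw] := inf_adherent n0 Sinf; exists w.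
have VB : forall a b, V a -> V b -> V (a - b).
  by move=> a b Va Vb; have := VL (-1) b a Vb Va; rewrite scaleN1r addrC.
(* Parallelogram law: the midpoint of [v m] and [v n] is in [V], hence not closer to [x] than the
   infimum [d] permits. *)
have vv m n : nrm (v m - v n) ^+ 2 <= 2 * (m.+1%:R^-1 + n.+1%:R^-1).
  have [Vm Hm] := Hv m; have [Vn Hn] := Hv n.
  have Vh : V ((2^-1 : C) *: (v m + v n)).
    have := VL 1 (v m) (v n) Vm Vn; rewrite scale1r => Vmn.
    by have := VL 2^-1 _ 0 Vmn V0; rewrite addr0.
  have hd := dle _ Vh.
  pose a := x - v m; pose b := x - v n.
  have e1 : nrm (v m - v n) ^+ 2 = nrm a ^+ 2 + nrm b ^+ 2 - 2 * complex.Re (inner a b).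
    rewrite -nrm_sqrB nrmBC; congr (nrm _ ^+ 2).
    by rewrite /a /b opprB [RHS]addrC addrA subrK.
  have e2 : 4 * nrm (x - (2^-1 : C) *: (v m + v n)) ^+ 2 =
      nrm a ^+ 2 + nrm b ^+ 2 + 2 * complex.Re (inner a b).
    rewrite -nrm_sqrD.
    have -> : a + b = (2 : C) *: (x - (2^-1 : C) *: (v m + v n)).
      rewrite scalerBr scalerA divff ?pnatr_eq0// scale1r scaler_nat mulr2n.
      by rewrite /a /b opprD addrACA.
    rewrite nrmZ exprMn; congr (_ * _).
    have -> : (2 : C) = (2%:R : R)%:C by rewrite rmorph_nat.
    by rewrite nrm_real ger0_norm// -natrX.
  rewrite e1 -/a -/b in Hm Hn *; move: hd Hm Hn e2.
  rewrite -/a -/b.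
  move: (m.+1%:R^-1 : R) (n.+1%:R^-1 : R) => p q.
  by lra.
have [l Hl] : exists l, tends v l.
  apply: hilbert_complete => e e0.
  have [N HN] := inv_small (divr_gt0 (exprn_gt0 2 e0) (ltr0Sn _ 3)).
  exists N => m n Nm Nn.
  rewrite -(@ltr_pXn2r _ 2)// ?nnegrE ?nrm_ge0 ?(ltW e0)//.
  rewrite (le_lt_trans (vv m n))//; have := HN m Nm; have := HN n Nn.
  move: (m.+1%:R^-1 : R) (n.+1%:R^-1 : R) => p q.
  by lra.
have Vl : V l by apply: tends_closed Hl => // n; case: (Hv n).
exists l => // w Vw; apply: orthogonal_min => t.
have hd : nrm (x - l) ^+ 2 <= d.
  rewrite leNgt; apply/negP => hlt.
  have T : forall e : R, 0 < e -> nrm (x - l) ^+ 2 <= d + e.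
    move=> e e0.
    pose B := 2 * nrm (x - l) + 1.
    have B0 : 0 < B by rewrite /B ltr_wpDl// mulr_ge0 ?nrm_ge0.
    pose r := Num.min 1 (e / 2 / B).
    have r0 : 0 < r by rewrite lt_min ltr01/= !divr_gt0.
    have [N1 H1] := Hl r r0.
    have [N2 H2] := inv_small (divr_gt0 e0 (ltr0Sn _ 1)).
    have [_ H3] := Hv (maxn N1 N2).
    have {}H1 := H1 _ (leq_maxl N1 N2); have {}H2 := H2 _ (leq_maxr N1 N2).
    set n := maxn N1 N2 in H1 H2 H3.
    have {}H3 : nrm (x - v n) ^+ 2 < d + e / 2 by rewrite (lt_trans H3)// ltrD2l.
    have h1 := ler_dist_nrm (v n) x l.
    have r1 : r <= 1 by rewrite ge_min lexx.
    have r2 : r * B <= e / 2 by rewrite -ler_pdivlMr// ge_min lexx orbT.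
    have p0 := nrm_ge0 (x - v n); have p1 := nrm_ge0 (x - l).
    have a1 : nrm (x - l) <= nrm (x - v n) + r by rewrite (le_trans h1)// lerD2l ltW.
    have a2 : (nrm (x - l) - r) ^+ 2 <= nrm (x - v n) ^+ 2 \/ nrm (x - l) < r.
      have [h|h] := ltP (nrm (x - l)) r; [by right|left].
      by rewrite ler_pXn2r ?nnegrE// ?subr_ge0// lerBlDr.
    have [a3|a3] := a2.
      have : nrm (x - l) ^+ 2 <= (nrm (x - l) - r) ^+ 2 + r * B.
        rewrite /B sqrrB; have := sqr_ge0 r; nra.
      by lra.
    have : nrm (x - l) ^+ 2 <= r * B by rewrite /B; nra.
    have : 0 <= d.
      by apply: lb_le_inf; [case: Sinf|move=> _ [? _ ->]; exact: sqr_ge0].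
    by lra.
  have := T ((nrm (x - l) ^+ 2 - d) / 2) (ltac:(lra)); lra.
rewrite -(@ler_pXn2r _ 2)// ?nnegrE ?nrm_ge0// (le_trans hd)//.
rewrite -addrA -opprD; apply: dle.
by have := VL t w l Vw Vl; rewrite addrC.
Qed.

Lemma ortho_dense (V : set H) : is_subspace V -> closed V ->
  (forall y, (forall x, V x -> inner x y = 0) -> y = 0) -> V = setT.
Proof.
move=> sV cV h; apply/seteqP; split => // x _.
have [v Vv Hv] := projection x sV cV.
suff /eqP : x - v = 0 by rewrite subr_eq0 => /eqP ->.
by apply: h => w Vw; rewrite innerC Hv// rmorph0.
Qed.

Lemma riesz (phi : H -> C) (c : R) :
  (forall (a : C) x y, phi (a *: x + y) = a * phi x + phi y) ->
  (forall x, nrm (phi x) <= c * nrm x) ->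
  exists k, forall x, phi x = inner x k.
Proof.
move=> lphi bphi.
have phi0 : phi 0 = 0.
  by apply/eqP; rewrite -nrm_eq0 eq_le nrm_ge0 andbT (le_trans (bphi 0))// nrm0 mulr0.
have phiZ a x : phi (a *: x) = a * phi x by rewrite -[a *: x]addr0 lphi phi0 addr0.
have phiB x y : phi (x - y) = phi x - phi y.
  by rewrite addrC -scaleN1r lphi mulN1r addrC.
pose V := [set x | phi x = 0].
have sV : is_subspace V by split => // a x y Vx Vy; rewrite /V/= lphi Vx Vy mulr0 addr0.
have cV : closed V.
  apply/closed_nrmP => x Hx; apply/eqP; rewrite -nrm_eq0 eq_le nrm_ge0 andbT.
  apply/ler_addgt0Pr => e e0; rewrite add0r.
  have c1 : 0 < `|c| + 1 by rewrite ltr_wpDl.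
  have [y Vy xy] := Hx (e / (`|c| + 1)) (divr_gt0 e0 c1).
  have -> : phi x = phi (x - y) by rewrite phiB Vy subr0.
  rewrite (le_trans (bphi _))//.
  rewrite (le_trans (ler_wpM2r (nrm_ge0 _) (ler_norm c)))//.
  rewrite (le_trans (_ : _ <= (`|c| + 1) * nrm (x - y)))//.
    by rewrite ler_wpM2r ?nrm_ge0// lerDl.
  by rewrite mulrC -ler_pdivlMr// ltW.
have [hV|] := pselect (forall x, phi x = 0).
  by exists 0 => x; rewrite hV inner0r.
move=> /existsNP[x0 x0n].
have [v Vv Hv] := projection x0 sV cV.
set u := x0 - v in Hv.
have pu : phi u = phi x0 by rewrite phiB Vv subr0.
have u0 : nrm u != 0.
  by apply/eqP => /eqP; rewrite nrm_eq0 => /eqP uu; apply: x0n; rewrite -pu uu.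
exists (((phi u)^* / (nrm u ^+ 2)%:C) *: u) => x.
have : phi (x - (phi x / phi u) *: u) = 0.
  by rewrite phiB phiZ divfK ?subrr// pu; apply/eqP.
move=> /Hv; rewrite innerC => /eqP; rewrite conjC_eq0 innerBl innerZl subr_eq0.
move=> /eqP xu; rewrite innerZr xu inner_nrm.
have un : (nrm u ^+ 2)%:C != 0 :> C.
  by rewrite (inj_eq (@complexI R) _ 0) sqrf_eq0.
have pu0 : phi u != 0 by rewrite pu; apply/eqP.
have -> : ((phi u)^* / (nrm u ^+ 2)%:C)^* = phi u / (nrm u ^+ 2)%:C.
  by rewrite -fmorphV; apply: ReImE; rewrite ?(ReJ, ImJ, ReM, ImM)/=; ring.
by move: un; move: ((nrm u ^+ 2)%:C : C) => t t0; field; rewrite pu0 t0.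
Qed.

Lemma bounded_opP (T : H -> H) : bounded_operator T <->
  (forall (a : C) x y, T (a *: x + y) = a *: T x + T y) /\
  exists2 c : R, 0 <= c & forall x, nrm (T x) <= c * nrm x.
Proof.
split=> [[lT [c hc]]|[lT [c c0 hc]]].
  split; first exact: lT.
  exists `|c| => // x.
  have := hc x; rewrite !normE -rmorphM/= lecR => h; apply: le_trans h _.
  by rewrite ler_wpM2r ?nrm_ge0// ler_norm.
split; first exact: lT.
by exists c => x; rewrite !normE -rmorphM/= lecR.
Qed.

Lemma adjoint_exists (T : H -> H) : bounded_operator T -> exists T', is_adjoint T T'.
Proof.
move=> /bounded_opP[lT [c c0 hc]].
have /choice[T' HT'] : forall y, exists k, forall x, inner (T x) y = inner x k.
  move=> y; apply: (@riesz (fun x => inner (T x) y) (c * nrm y)).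
    by move=> a x x'; rewrite lT innerDl innerZl.
  move=> x; rewrite (le_trans (inner_CS _ _))// mulrAC.
  by rewrite ler_wpM2r ?nrm_ge0.
by exists T' => x y.
Qed.

End Hilbert.

Section DenseExtension.
Variable R : realType.
Local Notation C := (cplx R).
Variables (E : lmodType C) (D : set E) (H : hilbertSpace R) (tau : E -> H).

(** Algebraic vectors [E] with a linear map onto a dense subspace of [H], not assumed injective.
    Operators, functionals and inequalities on [H] are all read off from this dense part. *)
Definition model :=
  [/\ D 0, forall (a : C) x y, D x -> D y -> D (a *: x + y),
      forall (a : C) x y, D x -> D y -> tau (a *: x + y) = a *: tau x + tau y
    & forall h (e : R), 0 < e -> exists2 x, D x & nrm (h - tau x) < e].

Hypothesis mD : model.

Lemma dense_extension (V : normedModType C) (f : E -> V) (c : R) :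
  (forall u : nat -> V, cauchyseq u -> exists l, tends u l) ->
  0 <= c ->
  (forall (a : C) x y, D x -> D y -> f (a *: x + y) = a *: f x + f y) ->
  (forall x, D x -> nrm (f x) <= c * nrm (tau x)) ->
  exists F : H -> V,
    [/\ forall (a : C) x y, F (a *: x + y) = a *: F x + F y,
        forall x, nrm (F x) <= c * nrm x
      & forall x, D x -> F (tau x) = f x].
Proof.
move=> cV c0 lf bf; have [D0 DL tL dense] := mD.
have tB x y : D x -> D y -> tau (x - y) = tau x - tau y.
  by move=> Dx Dy; rewrite addrC -scaleN1r tL// scaleN1r addrC.
have fB x y : D x -> D y -> f (x - y) = f x - f y.
  by move=> Dx Dy; rewrite addrC -scaleN1r lf// scaleN1r addrC.
have DB x y : D x -> D y -> D (x - y).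
  by move=> Dx Dy; rewrite addrC -scaleN1r; exact: DL.
have c1 : 0 < c + 1 by rewrite ltr_wpDl.
(* The value at [h] is characterized by all Lipschitz bounds against the dense part at once. This
   property survives limits and makes linearity independent of the approximating sequences. *)
pose P h l := forall x, D x -> nrm (l - f x) <= c * nrm (h - tau x).
have ex h : exists l, P h l.
  have /choice[s Hs] : forall n : nat, exists x, D x /\ nrm (h - tau x) < n.+1%:R^-1.
    move=> n; have n0 : 0 < n.+1%:R^-1 :> R by rewrite invr_gt0 ltr0Sn.
    by have [x Dx hx] := dense h _ n0; exists x.
  have [l Hl] : exists l, tends (f \o s) l.
    apply: cV => e e0.
    have e1 : 0 < e / (c + 1) / 2 by rewrite !divr_gt0.
    have [N HN] := inv_small e1; exists N => m n Nm Nn /=.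
    have [Dm Hm] := Hs m; have [Dn Hn] := Hs n.
    rewrite -fB// (le_lt_trans (bf _ (DB _ _ Dm Dn)))// tB//.
    have h1 := ler_dist_nrm h (tau (s m)) (tau (s n)).
    have h2 : nrm (tau (s m) - tau (s n)) < e / (c + 1).
      rewrite (le_lt_trans h1)// (splitr (e / (c + 1))) ltrD//.
        by rewrite nrmBC (lt_trans Hm)// HN.
      by rewrite (lt_trans Hn)// HN.
    rewrite (le_lt_trans (ler_wpM2l c0 (ltW h2)))//.
    by rewrite mulrA ltr_pdivrMr// mulrC ltr_pM2l// ltrDl.
  exists l => x Dx; apply/ler_addgt0Pr => e e0.
  have e1 : 0 < e / (c + 1) / 2 by rewrite !divr_gt0.
  have [N1 H1] := inv_small e1; have [N2 H2] := Hl _ (divr_gt0 e0 (ltr0Sn _ 1)).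
  have {}H1 := H1 _ (leq_maxl N1 N2); have {}H2 := H2 _ (leq_maxr N1 N2).
  set n := maxn N1 N2 in H1 H2; have [Dn Hn] := Hs n.
  have h1 := ler_dist_nrm (f (s n)) l (f x).
  have h2 : nrm (f (s n) - f x) <= c * nrm (tau (s n) - tau x).
    by rewrite -fB// -tB// bf//; exact: DB.
  have h3 := ler_dist_nrm h (tau (s n)) (tau x).
  have h4 : nrm (tau (s n) - h) < e / (c + 1) / 2 by rewrite nrmBC (lt_trans Hn).
  have h5 : c * (e / (c + 1) / 2) <= e / 2.
    rewrite mulrA ler_wpM2r// mulrA ler_pdivrMr// mulrC ler_pM2l//; lra.
  have h6 : c * nrm (tau (s n) - tau x) <= c * (e / (c + 1) / 2 + nrm (h - tau x)).
    by rewrite ler_wpM2l// (le_trans h3)// lerD2r ltW.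
  rewrite /= nrmBC in H2; rewrite mulrDr in h6.
  by lra.
have /choice[F HF] := ex.
have small h (e : R) : 0 < e -> exists2 x, D x & nrm (h - tau x) <= e /\ nrm (F h - f x) <= e.
  move=> e0; have [x Dx hx] := dense h _ (divr_gt0 e0 c1).
  exists x => //; split.
    by rewrite (le_trans (ltW hx))// ler_pdivrMr// mulrC ler_peMl ?(ltW e0)// lerDr.
  rewrite (le_trans (HF h x Dx))// (le_trans (ler_wpM2l c0 (ltW hx)))//.
  rewrite mulrA ler_pdivrMr// mulrC ler_pM2l//; lra.
have Ft x : D x -> F (tau x) = f x.
  move=> Dx; apply/eqP; rewrite -subr_eq0 -nrm_eq0 eq_le nrm_ge0 andbT.
  by rewrite (le_trans (HF _ x Dx))// subrr nrm0 mulr0.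
exists F; split => //.
  move=> a x y; apply/eqP; rewrite -subr_eq0 -nrm_eq0 eq_le nrm_ge0 andbT.
  apply/ler_addgt0Pr => e e0; rewrite add0r.
  pose K := (c + 1) * (nrm a + 1) + nrm a + 1.
  have K0 : 0 < K.
    by have := nrm_ge0 a; rewrite /K; nra.
  have d0 := divr_gt0 e0 K0; set d := e / K in d0.
  have [x' Dx [hx1 hx2]] := small x d d0; have [y' Dy [hy1 hy2]] := small y d d0.
  have h1 := HF (a *: x + y) _ (DL a _ _ Dx Dy).
  rewrite lf// tL// in h1.
  have e1 : a *: x + y - (a *: tau x' + tau y') = a *: (x - tau x') + (y - tau y').
    by rewrite scalerBr opprD addrACA.
  have h2 : nrm (a *: x + y - (a *: tau x' + tau y')) <= (nrm a + 1) * d.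
    rewrite e1 (le_trans (ler_nrmD _ _))// nrmZ mulrDl mul1r lerD//.
    by rewrite ler_wpM2l ?nrm_ge0.
  have e2 : a *: f x' + f y' - (a *: F x + F y) = a *: (f x' - F x) + (f y' - F y).
    by rewrite scalerBr opprD addrACA.
  have h3 : nrm (a *: f x' + f y' - (a *: F x + F y)) <= (nrm a + 1) * d.
    rewrite e2 (le_trans (ler_nrmD _ _))// nrmZ mulrDl mul1r lerD//.
      by rewrite ler_wpM2l ?nrm_ge0// nrmBC.
    by rewrite nrmBC.
  have h4 := ler_dist_nrm (a *: f x' + f y') (F (a *: x + y)) (a *: F x + F y).
  rewrite (le_trans h4)// (le_trans (lerD (le_trans h1 (ler_wpM2l c0 h2)) h3))//.
  have -> : e = K * d by rewrite /d mulrC divfK// gt_eqF.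
  by rewrite mulrA -mulrDl ler_wpM2r ?(ltW d0)// /K; have := nrm_ge0 a; nra.
move=> x; apply/ler_addgt0Pr => e e0.
have e2 : 0 < e / (c + 1) by rewrite divr_gt0.
have [x' Dx [hx1 hx2]] := small x _ e2.
have h1 := ler_nrmD (F x - f x') (f x'); rewrite subrK in h1.
have h2 := ler_nrmD (tau x' - x) x; rewrite subrK nrmBC in h2.
have h3 := bf x' Dx.
have h4 : c * nrm (tau x') <= c * (e / (c + 1) + nrm x).
  by rewrite ler_wpM2l// (le_trans h2)// lerD2r.
have h5 : (c + 1) * (e / (c + 1)) = e by rewrite mulrC divfK// gt_eqF.
by rewrite mulrDr in h4; lra.
Qed.

Lemma dense_riesz (phi : E -> C) (c : R) : 0 <= c ->
  (forall (a : C) x y, D x -> D y -> phi (a *: x + y) = a * phi x + phi y) ->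
  (forall x, D x -> nrm (phi x) <= c * nrm (tau x)) ->
  exists k, forall x, D x -> phi x = inner (tau x) k.
Proof.
move=> c0 lphi bphi.
have [F [lF bF HF]] := @dense_extension C phi c (@complex_cauchy R) c0 lphi bphi.
have [k Hk] := riesz lF bF.
by exists k => x Dx; rewrite -Hk HF.
Qed.

Lemma dense_operator (Z : E -> E) (c : R) : 0 <= c ->
  (forall (a : C) x y, D x -> D y -> tau (Z (a *: x + y)) = a *: tau (Z x) + tau (Z y)) ->
  (forall x, D x -> nrm (tau (Z x)) <= c * nrm (tau x)) ->
  exists2 T : H -> H, bounded_operator T & forall x, D x -> T (tau x) = tau (Z x).
Proof.
move=> c0 lZ bZ.
have [F [lF bF HF]] := @dense_extension H (tau \o Z) c (@hilbert_complete R H) c0 lZ bZ.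
by exists F => //; apply/bounded_opP; split => //; exists c.
Qed.

End DenseExtension.

(** * Completion of a positive form *)

Section GramSchmidt.
Variable R : realType.
Local Notation C := (cplx R).
Variables (E : lmodType C) (B : E -> E -> C) (D : set E).
Hypothesis psdB : psd_form B D.
Variable xs : nat -> E.
Hypothesis Dxs : forall n, D (xs n).

Definition gs_proj (s : seq E) (x : E) : E := \sum_(y <- s) B x y *: y.

(* Since [0^-1 = 0], vectors of norm zero are sent to [0]. *)
Definition gs_normalize (x : E) : E := ((qn B x)^-1)%:C *: x.

Fixpoint gs_list (n : nat) : seq E :=
  if n is m.+1 then
    rcons (gs_list m) (gs_normalize (xs m - gs_proj (gs_list m) (xs m)))
  else [::].

Definition gs_res n : E := xs n - gs_proj (gs_list n) (xs n).
Definition gs n : E := gs_normalize (gs_res n).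

Lemma gs_listE n : gs_list n = mkseq gs n.
Proof.
elim: n => //= n IH; rewrite -/(gs_res n) -/(gs n) IH.
by rewrite /mkseq -[n.+1]addn1 iotaD map_cat /= cats1.
Qed.

Lemma gs_projE n x : gs_proj (gs_list n) x = \sum_(i < n) B x (gs i) *: gs i.
Proof. by rewrite /gs_proj gs_listE big_map -val_enum_ord big_map big_enum. Qed.

Lemma D_gs n : D (gs n).
Proof.
elim/ltn_ind: n => n IH; apply: (psd_DZ psdB); apply: (psd_DB psdB) => //.
rewrite gs_projE; apply: (psd_Dsum psdB) => i _; apply: (psd_DZ psdB).
exact: IH.
Qed.

Lemma D_gs_res n : D (gs_res n).
Proof.
apply: (psd_DB psdB) => //; rewrite gs_projE.
apply: (psd_Dsum psdB) => i _; apply: (psd_DZ psdB); exact: D_gs.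
Qed.

Definition gs_index : set nat := [set n | qn B (gs_res n) != 0].

Lemma gs_out n : ~ gs_index n -> gs n = 0.
Proof.
rewrite /gs_index /gs /gs_normalize => /negP/negPn/eqP ->.
by rewrite invr0 scale0r.
Qed.

Lemma gs_unit n : gs_index n -> B (gs n) (gs n) = 1.
Proof.
move=> In; have Dn := D_gs_res n.
rewrite -(qn_sqrC psdB (D_gs n)) (qnZ psdB)// nrm_real.
by rewrite ger0_norm ?invr_ge0 ?qn_ge0// mulVf// expr1n.
Qed.

Lemma gs_idem x n : D x -> B x (gs n) * B (gs n) (gs n) = B x (gs n).
Proof.
move=> Dx; have [In|nI] := pselect (gs_index n); first by rewrite gs_unit// mulr1.
by rewrite (gs_out nI) (psd_0r psdB)// mul0r.
Qed.

Lemma gs_orth m n : m != n -> B (gs m) (gs n) = 0.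
Proof.
wlog mn : m n / (n < m)%N => [H|] neq.
  move: neq; rewrite neq_ltn => /orP[h|h]; last by apply: H; rewrite ?neq_ltn ?h ?orbT.
  rewrite (psd_herm psdB (D_gs n) (D_gs m)) H ?rmorph0//.
  by rewrite neq_ltn h orbT.
elim/ltn_ind: m n mn {neq} => m IH n mn.
rewrite /gs (psd_Zl psdB) //; [|exact: D_gs_res|exact: D_gs].
suff -> : B (gs_res m) (gs n) = 0 by rewrite mulr0.
have Dsum : D (\sum_(i < m) B (xs m) (gs i) *: gs i).
  by apply: (psd_Dsum psdB) => i _; apply: (psd_DZ psdB); exact: D_gs.
rewrite /gs_res gs_projE (psd_Bl psdB (Dxs m) Dsum (D_gs n)).
rewrite (psd_suml psdB); [|exact: D_gs|by move=> i _; apply: (psd_DZ psdB); exact: D_gs].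
rewrite (bigD1 (Ordinal mn))//= big1.
  rewrite addr0 (psd_Zl psdB) ?gs_idem ?subrr//; exact: D_gs.
move=> i; rewrite -val_eqE /= => ni; rewrite (psd_Zl psdB); [|exact: D_gs|exact: D_gs].
suff -> : B (gs i) (gs n) = 0 by rewrite mulr0.
move: ni; rewrite neq_ltn => /orP[h|h]; last exact: IH.
by rewrite (psd_herm psdB (D_gs n) (D_gs i)) IH ?rmorph0.
Qed.

Definition gs_rem N x : E := x - \sum_(i < N) B x (gs i) *: gs i.

Lemma D_gs_sum N (a : nat -> C) : D (\sum_(i < N) a i *: gs i).
Proof. by apply: (psd_Dsum psdB) => i _; apply: (psd_DZ psdB); exact: D_gs. Qed.

Lemma D_gs_rem N x : D x -> D (gs_rem N x).
Proof. by move=> Dx; apply: (psd_DB psdB) => //; exact: (D_gs_sum N (fun i => B x (gs i))). Qed.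

Lemma gs_rem_gs N x n : D x -> (n < N)%N -> B (gs_rem N x) (gs n) = 0.
Proof.
move=> Dx nN; have Ds := D_gs_sum N (fun i => B x (gs i)).
rewrite /gs_rem (psd_Bl psdB Dx Ds (D_gs n)).
rewrite (psd_suml psdB); [|exact: D_gs|by move=> i _; apply: (psd_DZ psdB); exact: D_gs].
rewrite (bigD1 (Ordinal nN))//= big1.
  rewrite addr0 (psd_Zl psdB) ?gs_idem ?subrr//; exact: D_gs.
move=> i; rewrite -val_eqE /= => ni; rewrite (psd_Zl psdB); [|exact: D_gs|exact: D_gs].
by rewrite gs_orth// mulr0.
Qed.

Lemma gs_rem_inner N x y : D x -> D y ->
  B (gs_rem N x) (gs_rem N y) =
  B x y - \sum_(i < N) B x (gs i) * (B y (gs i))^*.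
Proof.
move=> Dx Dy; have Dr := D_gs_rem N Dx.
have Dsy := D_gs_sum N (fun i => B y (gs i)).
have Dsx := D_gs_sum N (fun i => B x (gs i)).
rewrite [X in B _ X = _]/gs_rem (psd_Dr psdB)//; last exact: (psd_DN psdB).
rewrite (psd_Nr psdB)// (psd_sumr psdB)//; last first.
  by move=> i _; apply: (psd_DZ psdB); exact: D_gs.
rewrite [X in _ - X]big1 ?subr0; last first.
  move=> i _; rewrite (psd_Zr psdB)//; last exact: D_gs.
  by rewrite gs_rem_gs ?mulr0.
rewrite /gs_rem (psd_Dl psdB)//; last exact: (psd_DN psdB).
rewrite (psd_Nl psdB)// (psd_suml psdB)//; last first.
  by move=> i _; apply: (psd_DZ psdB); exact: D_gs.
congr (_ - _); apply: eq_bigr => i _.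
by rewrite (psd_Zl psdB) ?(psd_herm psdB Dy (D_gs i))//; exact: D_gs.
Qed.

Lemma gs_rem_sqr N x : D x ->
  qn B (gs_rem N x) ^+ 2 = qn B x ^+ 2 - \sum_(i < N) nrm (B x (gs i)) ^+ 2.
Proof.
move=> Dx; rewrite !(qn_sqr psdB)//; last exact: D_gs_rem.
rewrite gs_rem_inner// ReB; congr (_ - _).
under eq_bigr do rewrite mul_conj.
by rewrite -rmorph_sum.
Qed.

Lemma gs_rem_le N M x : D x -> (N <= M)%N -> qn B (gs_rem M x) <= qn B (gs_rem N x).
Proof.
move=> Dx NM; rewrite -(@ler_pXn2r _ 2)// ?nnegrE ?qn_ge0// !gs_rem_sqr//.
rewrite lerD2l lerN2 -!(big_mkord xpredT (fun i => nrm (B x (gs i)) ^+ 2)).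
by rewrite [leRHS](big_cat_nat (n:=N))//= lerDl sumr_ge0// => i _; rewrite sqr_ge0.
Qed.

Lemma gs_rem_le1 N x : D x -> qn B (gs_rem N x) <= qn B x.
Proof.
move=> Dx; have := gs_rem_le Dx (leq0n N).
by rewrite [gs_rem 0 x]/gs_rem big_ord0 subr0.
Qed.

Lemma gs_rem_xs n : qn B (gs_rem n.+1 (xs n)) = 0.
Proof.
have e : gs_rem n.+1 (xs n) = gs_res n - B (xs n) (gs n) *: gs n.
  by rewrite /gs_rem /gs_res gs_projE big_ord_recr/= opprD addrA.
have Dr := D_gs_res n; have Dg := D_gs n.
have Ex : B (xs n) (gs n) = B (gs_res n) (gs n).
  rewrite /gs_res gs_projE (psd_Dl psdB)//; last first.
    by apply: (psd_DN psdB); exact: (D_gs_sum n (fun i => B (xs n) (gs i))).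
  rewrite (psd_Nl psdB)//; last exact: (D_gs_sum n (fun i => B (xs n) (gs i))).
  rewrite (psd_suml psdB)//; last by move=> i _; apply: (psd_DZ psdB); exact: D_gs.
  rewrite big1 ?subr0// => i _; rewrite (psd_Zl psdB)//; last exact: D_gs.
  by rewrite gs_orth ?mulr0// neq_ltn ltn_ord.
rewrite e Ex; have [In|nI] := pselect (gs_index n); last first.
  by rewrite (gs_out nI) scaler0 subr0; move: nI => /negP/negPn/eqP.
have q0 : qn B (gs_res n) != 0 by [].
have g : gs_res n = (qn B (gs_res n))%:C *: gs n.
  rewrite /gs /gs_normalize scalerA -rmorphM/= divff// scale1r//.
by rewrite {1}g {2}g (psd_Zl psdB)// gs_unit// mulr1 subrr (qn0 psdB).
Qed.

Hypothesis dense_xs : forall x (e : R), D x -> 0 < e -> exists n, qn B (x - xs n) < e.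

Lemma gs_rem_small x (e : R) : D x -> 0 < e -> exists N, forall n, (N <= n)%N ->
  qn B (gs_rem n x) < e.
Proof.
move=> Dx e0; have [n Hn] := dense_xs Dx e0; exists n.+1 => N nN.
apply: le_lt_trans Hn; apply: le_trans (gs_rem_le Dx nN) _.
have Dxn := psd_DB psdB Dx (Dxs n).
have -> : gs_rem n.+1 x = gs_rem n.+1 (x - xs n) + gs_rem n.+1 (xs n).
  rewrite /gs_rem addrACA subrK -opprD -big_split/=; congr (_ - _).
  apply: eq_bigr => i _; rewrite -scalerDl; congr (_ *: _).
  by rewrite -(psd_Dl psdB)// ?subrK//; exact: D_gs.
apply: le_trans (qnD psdB _ _) _; [exact: D_gs_rem|exact: D_gs_rem|].
by rewrite gs_rem_xs addr0 gs_rem_le1.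
Qed.

Definition gs_seq (x : E) : nat -> C^o := fun n => B x (gs n).

Lemma gs_seq_l2 x : D x -> is_l2 gs_index (gs_seq x).
Proof.
move=> Dx; split.
  by move=> n In; rewrite /gs_seq (gs_out In) (psd_0r psdB).
exists (qn B x ^+ 2) => N; rewrite -subr_ge0.
have -> : \sum_(i < N) nrm (gs_seq x i * (gs_seq x i)^*) =
  \sum_(i < N) nrm (B x (gs i)) ^+ 2.
  by apply: eq_bigr => i _; rewrite nrmM nrm_conj -expr2.
by rewrite -gs_rem_sqr// sqr_ge0.
Qed.

Definition gs_map (x : E) : ell2_hilbert R gs_index :=
  if pselect (D x) is left Dx then Ell2 (asboolT (gs_seq_l2 Dx)) else 0.

Lemma gs_mapE x n : D x -> gs_map x n = B x (gs n).
Proof. by move=> Dx; rewrite /gs_map; case: pselect. Qed.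

(** The completion is realized as the space of square-summable sequences over the Gram-Schmidt
    indices, by Fourier coefficients. Finite combinations of the [gs i] give density; Parseval's
    identity, from the remainders tending to zero, gives the isometry. *)
Lemma completion_gs : model D gs_map /\
  forall x y, D x -> D y -> inner (gs_map x) (gs_map y) = B x y.
Proof.
split; [split|].
- exact: psd_D0 psdB.
- by move=> a x y Dx Dy; exact: (psd_DZD psdB).
- move=> a x y Dx Dy; apply: ell2_ext => n; rewrite ell2_ZD !gs_mapE//.
    by rewrite (psd_lin psdB)//; exact: D_gs.
  exact: (psd_DZD psdB).
- move=> h e e0.
  have [N HN] := l2_tail h (divr_gt0 (exprn_gt0 2 e0) (ltr0Sn _ 1)).
  pose x := \sum_(i < N) (h i : C) *: gs i.
  have Dx : D x by exact: (D_gs_sum N (fun i => h i)).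
  exists x => //.
  rewrite -(@ltr_pXn2r _ 2)// ?nnegrE ?nrm_ge0 ?(ltW e0)//.
  apply: (@le_lt_trans _ _ (e ^+ 2 / 2)); last first.
    by rewrite ltr_pdivrMr// ltr_pMr ?exprn_gt0// ltr1n.
  have xE n : (h - gs_map x) n = h n - B x (gs n) by rewrite -gs_mapE.
  have Bx n : (n < N)%N -> B x (gs n) = h n.
    move=> nN; rewrite /x (psd_suml psdB); [|exact: D_gs|by move=> i _; apply: (psd_DZ psdB); exact: D_gs].
    rewrite (bigD1 (Ordinal nN))//= big1 ?addr0.
      rewrite (psd_Zl psdB)//; [|exact: D_gs|exact: D_gs].
      have [In|nI] := pselect (gs_index n); first by rewrite gs_unit// mulr1.
      by have [h0 _] := ell2_is h; rewrite (h0 _ nI) mul0r.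
    move=> i; rewrite -val_eqE /= => ni; rewrite (psd_Zl psdB); [|exact: D_gs|exact: D_gs].
    by rewrite gs_orth// mulr0.
  have Bx' n : (N <= n)%N -> B x (gs n) = 0.
    move=> nN; rewrite /x (psd_suml psdB); [|exact: D_gs|by move=> i _; apply: (psd_DZ psdB); exact: D_gs].
    rewrite big1// => i _; rewrite (psd_Zl psdB); [|exact: D_gs|exact: D_gs].
    by rewrite gs_orth ?mulr0// neq_ltn (leq_trans (ltn_ord i)).
  have [_ H] := l2_csum (h - gs_map x); apply: H => K.
  apply: le_trans (ltW (HN (maxn N K))).
  pose F i := nrm ((h - gs_map x) i) ^+ 2.
  apply: (@le_trans _ _ (\sum_(i < maxn N K) F i)).
    rewrite -!(big_mkord xpredT F) [leRHS](big_cat_nat (n:=K)) ?leq_maxr//= lerDl.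
    by apply: sumr_ge0 => i _; rewrite /F sqr_ge0.
  rewrite -(big_mkord xpredT F) (big_cat_nat (n:=N)) ?leq_maxl//= big_nat_cond big1.
    rewrite add0r; apply: ler_sum_nat => i /andP[Ni _].
    by rewrite /F xE Bx' ?subr0.
  by move=> i /andP[/andP[_ iN] _]; rewrite /F xE Bx// subrr nrm0 expr0n.
move=> x y Dx Dy; apply: csumE => e e0.
have y1 : 0 < qn B y + 1 by rewrite ltr_wpDl// qn_ge0.
have [N HN] := gs_rem_small Dx (divr_gt0 e0 y1); exists N => n Nn.
have -> : \sum_(i < n) gs_map x i * (gs_map y i)^* =
    \sum_(i < n) B x (gs i) * (B y (gs i))^* :> C.
  by apply: eq_bigr => i _; rewrite !gs_mapE.
rewrite nrmBC -gs_rem_inner//.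
have DRx := D_gs_rem n Dx; have DRy := D_gs_rem n Dy.
rewrite (le_lt_trans (psd_CS psdB DRx DRy))//.
have h := HN n Nn; have h' := gs_rem_le1 n Dy.
rewrite (le_lt_trans (ler_wpM2l (qn_ge0 _ _) (le_trans h' (_ : _ <= qn B y + 1))))//.
  by rewrite lerDl.
by rewrite -ltr_pdivlMr.
Qed.

End GramSchmidt.

Lemma completion (R : realType) (E : lmodType (cplx R)) (B : E -> E -> cplx R)
    (D : set E) :
  psd_form B D ->
  (exists xs : nat -> E, (forall n, D (xs n)) /\
    forall x (e : R), D x -> 0 < e -> exists n, qn B (x - xs n) < e) ->
  exists (H : hilbertSpace R) (tau : E -> H), model D tau /\
    forall x y, D x -> D y -> inner (tau x) (tau y) = B x y.
Proof.
move=> psdB [xs [Dxs Hxs]].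
by exists (ell2_hilbert R (gs_index B xs)), (gs_map psdB Dxs); exact: completion_gs.
Qed.

(** * Compact sets and rational functions *)

Section Compact.
Variable R : realType.
Local Notation C := (cplx R).
Implicit Types K : set C.

Lemma compact_seq K (u : nat -> C) : compact K -> (forall n, K (u n)) ->
  exists2 x, K x & forall (e : R) N, 0 < e -> exists2 n, (N <= n)%N & nrm (x - u n) < e.
Proof.
move=> cK Ku; have [|x [Kx cx]] := cK (u @ \oo) _; first by exists 0%N => // n _; exact: Ku.
exists x => // e N e0.
have NA : (u @ \oo) [set z | exists2 n, (N <= n)%N & u n = z].
  by exists N => // n /= Nn; exists n.
have NB : nbhs (x : C) [set y | nrm (x - y) < e].
  by apply/(@nbhs_nrmP R C); exists e.
by have [_ [[n /= Nn <-] xn]] := cx _ _ NA NB; exists n.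
Qed.

Lemma compact_bounded K : compact K -> exists M : R, forall z, K z -> nrm z <= M.
Proof.
move=> cK; apply: contrapT => h.
have /choice[u Hu] : forall n : nat, exists z, K z /\ n%:R < nrm z.
  move=> n; apply: contrapT => h'; apply: h; exists n%:R => z Kz.
  by rewrite leNgt; apply/negP => zn; apply: h'; exists z.
have [x Kx Hx] := compact_seq cK (fun n => proj1 (Hu n)).
have [n Nn xn] := Hx 1 (Num.truncn (nrm x + 1)).+1 ltr01.
have := ler_nrmD (u n - x) x; rewrite subrK; apply/negP; rewrite -ltNge.
apply: lt_trans (proj2 (Hu n)).
apply: lt_le_trans (_ : (Num.truncn (nrm x + 1)).+1%:R <= _); last by rewrite ler_nat.
apply: le_lt_trans (truncnS_gt _).
by rewrite addrC lerD2l nrmBC ltW.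
Qed.

Lemma compact_closed_nrm K : compact K -> closed K.
Proof.
move=> cK; apply/(@closed_nrmP R C) => x Hx.
have /choice[u Hu] : forall n : nat, exists y, K y /\ nrm (x - y) < n.+1%:R^-1.
  move=> n; have n0 : 0 < n.+1%:R^-1 :> R by rewrite invr_gt0 ltr0Sn.
  by have [y Ky xy] := Hx _ n0; exists y.
have [y Ky Hy] := compact_seq cK (fun n => proj1 (Hu n)).
suff /eqP : x - y = 0 by rewrite subr_eq0 => /eqP ->.
apply/eqP; rewrite -nrm_eq0 eq_le nrm_ge0 andbT; apply/ler_addgt0Pr => e e0.
rewrite add0r; have e2 : 0 < e / 2 by rewrite divr_gt0.
have [n Nn yn] := Hy _ (Num.truncn (e / 2)^-1) e2.
have [_ xn] := Hu n.
rewrite (le_trans (ler_dist_nrm (u n) _ _))// (splitr e) lerD//; last by rewrite nrmBC ltW.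
rewrite (le_trans (ltW xn))// -[leRHS]invrK lef_pV2 ?posrE ?invr_gt0//.
by rewrite (le_trans (ltW (truncnS_gt _)))// ler_nat.
Qed.

Lemma closed_sub_compact K K' : compact K -> closed K' -> K' `<=` K -> compact K'.
Proof. by move=> cK cK' sub; exact: (subclosed_compact cK' cK sub). Qed.

Lemma compact_min K (u : C -> R) : compact K -> K !=set0 ->
  (forall x (e : R), K x -> 0 < e -> exists2 d : R, 0 < d &
     forall y, K y -> nrm (x - y) < d -> `|u x - u y| < e) ->
  exists2 x, K x & forall y, K y -> u x <= u y.
Proof.
move=> cK [z0 Kz0] cu; apply: contrapT => h.
have bnd : has_lbound (u @` K).
  apply: contrapT => nb.
  have /choice[v Hv] : forall n : nat, exists z, K z /\ u z < - n%:R.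
    move=> n; apply: contrapT => h'; apply: nb; exists (- n%:R) => _ [z Kz <-].
    by rewrite leNgt; apply/negP => zn; apply: h'; exists z.
  have [x Kx Hx] := compact_seq cK (fun n => proj1 (Hv n)).
  have [d d0 Hd] := cu x 1 Kx ltr01.
  have [n Nn xn] := Hx d (Num.truncn (1 - u x)).+1 d0.
  have := Hd _ (proj1 (Hv n)) xn; have := proj2 (Hv n).
  have : 1 - u x < n%:R.
    by rewrite (lt_le_trans (truncnS_gt _))// ler_nat.
  rewrite ltr_norml => h1 h2 /andP[_ h3]; lra.
have Sinf : has_inf (u @` K) by split=> //; exists (u z0); exists z0.
set m := inf (u @` K).
have /choice[v Hv] : forall n : nat, exists z, K z /\ u z < m + n.+1%:R^-1.
  move=> n; have n0 : 0 < n.+1%:R^-1 :> R by rewrite invr_gt0 ltr0Sn.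
  by have [_ [z Kz <-] hz] := inf_adherent n0 Sinf; exists z.
have [x Kx Hx] := compact_seq cK (fun n => proj1 (Hv n)).
apply: h; exists x => // y Ky.
apply: le_trans (_ : m <= _); last by apply: ge_inf => //; exists y.
apply/ler_addgt0Pr => e e0; have e2 : 0 < e / 2 by rewrite divr_gt0.
have [d d0 Hd] := cu x _ Kx e2.
have [n Nn xn] := Hx d (Num.truncn (e / 2)^-1) d0.
have := Hd _ (proj1 (Hv n)) xn; have := proj2 (Hv n).
have : n.+1%:R^-1 <= e / 2.
  rewrite -[leRHS]invrK lef_pV2 ?posrE ?invr_gt0//.
  by rewrite (le_trans (ltW (truncnS_gt _)))// ler_nat.
move: (n.+1%:R^-1 : R) => p.
by rewrite ltr_norml => h1 h2 /andP[_ h3]; lra.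
Qed.

Lemma boundaryE K : closed K -> boundary K = K `\` interior K.
Proof. by move=> cK; rewrite /boundary -(closure_id K).1. Qed.

Lemma boundary_sub K : closed K -> boundary K `<=` K.
Proof. by move=> cK; rewrite boundaryE// => x []. Qed.

Lemma boundary_or_interior K z : closed K -> K z -> boundary K z \/ interior K z.
Proof.
move=> cK Kz; rewrite boundaryE//.
by have [h|h] := pselect (interior K z); [right|left].
Qed.

Lemma closed_boundary K : closed K -> closed (boundary K).
Proof.
move=> cK; rewrite boundaryE// setDE; apply: closedI => //.
by apply: open_closedC; exact: open_interior.
Qed.

Lemma compact_boundary K : compact K -> compact (boundary K).
Proof.
move=> cK; have clK := compact_closed_nrm cK.
by apply: closed_sub_compact cK (closed_boundary clK) (boundary_sub clK).
Qed.

Lemma interior_ball (K : set C) z : interior K z -> exists2 e : R, 0 < e &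
  forall y, nrm (y - z) < e -> interior K y.
Proof.
move=> /interior_nrmP[e e0 he]; exists e => // y yz; apply/interior_nrmP.
exists (e - nrm (y - z)); first by rewrite subr_gt0.
by move=> x yx; apply: he; have := ler_dist_nrm y z x; rewrite (nrmBC z y); lra.
Qed.

Lemma interior_dist (K : set C) z : closed K -> interior K z -> exists2 d : R, 0 < d &
  forall x, boundary K x -> d <= nrm (x - z).
Proof.
move=> clK /interior_ball[e e0 he]; exists e => // x.
by rewrite (boundaryE clK) => -[_ nx]; rewrite leNgt; apply/negP => /he.
Qed.

End Compact.

Section Rational.
Variable R : realType.
Local Notation C := (cplx R).
Variable K : set C.

(* Only the values on [K] of a rational function matter. *)
Definition ratK (f : C -> C) := exists p q : {poly C},
  zero_free K q /\ forall z, K z -> f z = p.[z] / q.[z].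

Lemma zero_free1 : zero_free K (1 : {poly C}).
Proof. by move=> z _; rewrite hornerC oner_eq0. Qed.

Lemma zero_freeM (p q : {poly C}) : zero_free K p -> zero_free K q -> zero_free K (p * q).
Proof. by move=> hp hq z Kz; rewrite hornerM mulf_neq0 ?hp ?hq. Qed.

Lemma ratK_eq f g : (forall z, K z -> f z = g z) -> ratK f -> ratK g.
Proof. by move=> fg [p [q [q0 Hf]]]; exists p, q; split=> // z Kz; rewrite -fg// Hf. Qed.

Lemma ratK_poly (p : {poly C}) : ratK (horner p).
Proof.
exists p, 1; split; first exact: zero_free1.
by move=> z _; rewrite hornerC divr1.
Qed.

Lemma ratK_cst (c : C) : ratK (fun _ => c).
Proof. by apply: ratK_eq (ratK_poly c%:P) => z _; rewrite hornerC. Qed.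

Lemma ratK_id : ratK id.
Proof. by apply: ratK_eq (ratK_poly 'X) => z _; rewrite hornerX. Qed.

Lemma ratKD f g : ratK f -> ratK g -> ratK (fun z => f z + g z).
Proof.
move=> [p [q [q0 Hf]]] [p' [q' [q'0 Hg]]].
exists (p * q' + p' * q), (q * q'); split; first exact: zero_freeM.
move=> z Kz; rewrite Hf// Hg// hornerD !hornerM.
by field; rewrite q0 ?q'0.
Qed.

Lemma ratKM f g : ratK f -> ratK g -> ratK (fun z => f z * g z).
Proof.
move=> [p [q [q0 Hf]]] [p' [q' [q'0 Hg]]].
exists (p * p'), (q * q'); split; first exact: zero_freeM.
move=> z Kz; rewrite Hf// Hg// !hornerM.
by field; rewrite q0 ?q'0.
Qed.

Lemma ratKZ (c : C) f : ratK f -> ratK (fun z => c * f z).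
Proof. by move=> rf; apply: (ratKM (ratK_cst c)). Qed.

Lemma ratKN f : ratK f -> ratK (fun z => - f z).
Proof. by move=> rf; apply: ratK_eq (ratKZ (-1) rf) => z _; rewrite mulN1r. Qed.

Lemma ratKB f g : ratK f -> ratK g -> ratK (fun z => f z - g z).
Proof. by move=> rf rg; apply: ratKD => //; exact: ratKN. Qed.

Lemma ratKV f : ratK f -> (forall z, K z -> f z != 0) -> ratK (fun z => (f z)^-1).
Proof.
move=> [p [q [q0 Hf]]] f0.
have p0 : zero_free K p.
  by move=> z Kz; apply: contraNneq (f0 z Kz) => pz; rewrite Hf// pz mul0r.
exists q, p; split=> // z Kz; rewrite Hf// invf_div//.
Qed.

Lemma ratK_div f g : ratK f -> ratK g -> (forall z, K z -> g z != 0) ->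
  ratK (fun z => f z / g z).
Proof. by move=> rf rg g0; apply: ratKM => //; exact: ratKV. Qed.

Lemma ratK_sum (I : Type) (r : seq I) (F : I -> C -> C) :
  (forall i, ratK (F i)) -> ratK (fun z => \sum_(i <- r) F i z).
Proof.
move=> H; elim: r => [|i r IH].
  by apply: ratK_eq (ratK_cst 0) => z _; rewrite big_nil.
by apply: ratK_eq (ratKD (H i) IH) => z _; rewrite big_cons.
Qed.

Lemma ratK_resolvent (l : C) : ~ K l -> ratK (fun z => (z - l)^-1).
Proof.
move=> nKl; apply: (ratKV (f := fun z => z - l)).
  exact: (ratKB ratK_id (ratK_cst l)).
by move=> z Kz; apply/eqP => /eqP; rewrite subr_eq0 => /eqP zl; apply: nKl; rewrite -zl.
Qed.

(** If [f = p / q], then [p - f l * q] vanishes at [l]. Hence a functional killing all multiples of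
    [z - l] is a multiple of the evaluation at [l], which is how cokernels are computed and
    representing functionals are moved. *)
Lemma ratK_quotient f (l : C) : ratK f -> K l ->
  exists2 g, ratK g & forall z, K z -> f z = f l + (z - l) * g z.
Proof.
move=> [p [q [q0 Hf]]] Kl.
have : root (p - (f l)%:P * q) l.
  by rewrite /root hornerD hornerN hornerM hornerC Hf// divfK ?q0// subrr.
move=> /factor_theorem[s Hs].
exists (fun z => s.[z] / q.[z]); first by exists s, q.
move=> z Kz; have := congr1 (fun P : {poly C} => P.[z]) Hs.
rewrite /= hornerD hornerN !hornerM hornerC hornerXsubC => h.
rewrite [LHS]Hf//; have qz := q0 z Kz.
by rewrite mulrA (mulrC (z - l)) -h; field.
Qed.

Lemma poly_bounded (p : {poly C}) (M : R) : exists2 L : R, 0 <= L &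
  forall z, nrm z <= M -> nrm p.[z] <= L.
Proof.
elim/poly_ind: p => [|p c [L L0 HL]].
  by exists 0 => // z _; rewrite horner0 nrm0.
exists (L * `|M| + nrm c); first by rewrite addr_ge0 ?mulr_ge0 ?nrm_ge0.
move=> z zM; rewrite hornerMXaddC (le_trans (ler_nrmD _ _))// lerD2r nrmM.
by rewrite ler_pM ?nrm_ge0 ?HL// (le_trans zM)// ler_norm.
Qed.

Lemma poly_lipschitz (p : {poly C}) (M : R) : exists2 L : R, 0 <= L &
  forall x y, nrm x <= M -> nrm y <= M -> nrm (p.[x] - p.[y]) <= L * nrm (x - y).
Proof.
elim/poly_ind: p => [|p c [L L0 HL]].
  by exists 0 => // x y _ _; rewrite !horner0 subrr nrm0 mul0r.
have [B B0 HB] := poly_bounded p M.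
exists (L * `|M| + B); first by rewrite addr_ge0 ?mulr_ge0.
move=> x y xM yM; rewrite !hornerMXaddC.
have -> : p.[x] * x + c - (p.[y] * y + c) = (p.[x] - p.[y]) * x + p.[y] * (x - y).
  by ring.
rewrite (le_trans (ler_nrmD _ _))// !nrmM mulrDl lerD//; last first.
  by rewrite ler_wpM2r ?nrm_ge0// HB.
by rewrite mulrAC ler_pM ?mulr_ge0 ?nrm_ge0 ?HL// (le_trans xM)// ler_norm.
Qed.

Hypothesis cK : compact K.

Lemma zero_free_lower (q : {poly C}) : zero_free K q ->
  exists2 m : R, 0 < m & forall z, K z -> m <= nrm q.[z].
Proof.
move=> q0; have [K0|nK0] := pselect (K !=set0); last first.
  by exists 1 => // z Kz; exfalso; apply: nK0; exists z.
have [M HM] := compact_bounded cK.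
have [L L0 HL] := poly_lipschitz q M.
have L1 : 0 < L + 1 by rewrite ltr_wpDl.
have [x Kx Hx] : exists2 x, K x & forall y, K y -> nrm q.[x] <= nrm q.[y].
  apply: compact_min => // x e Kx e0; exists (e / (L + 1)); first exact: divr_gt0.
  move=> y Ky xy; rewrite (le_lt_trans (ler_nrm_dist _ _))//.
  rewrite (le_lt_trans (HL _ _ (HM _ Kx) (HM _ Ky)))//.
  rewrite (le_lt_trans (ler_wpM2r (nrm_ge0 _) (_ : L <= L + 1)))// ?lerDl//.
  by rewrite mulrC -ltr_pdivlMr.
by exists (nrm q.[x]) => //; rewrite nrm_gt0 q0.
Qed.

Lemma ratK_bounded f : ratK f -> exists2 L : R, 0 <= L & forall z, K z -> nrm (f z) <= L.
Proof.
move=> [p [q [q0 Hf]]]; have [M HM] := compact_bounded cK.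
have [L L0 HL] := poly_bounded p M; have [m m0 Hm] := zero_free_lower q0.
exists (L / m); first by rewrite divr_ge0 ?(ltW m0).
move=> z Kz; rewrite Hf// nrmM nrmV ler_pM ?nrm_ge0 ?invr_ge0 ?nrm_ge0 ?HL ?HM//.
by rewrite lef_pV2 ?posrE ?Hm// (lt_le_trans m0)// Hm.
Qed.

Lemma ratK_lipschitz f : ratK f -> exists2 L : R, 0 <= L & forall x y, K x -> K y ->
  nrm (f x - f y) <= L * nrm (x - y).
Proof.
move=> [p [q [q0 Hf]]]; have [M HM] := compact_bounded cK.
have [B B0 HB] := poly_bounded p M; have [m m0 Hm] := zero_free_lower q0.
have [L L0 HL] := poly_lipschitz p M; have [L' L'0 HL'] := poly_lipschitz q M.
have [B' B'0 HB'] := poly_bounded q M.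
exists ((L * B' + B * L') / m ^+ 2).
  by rewrite divr_ge0 ?addr_ge0 ?mulr_ge0 ?exprn_ge0 ?(ltW m0).
move=> x y Kx Ky; rewrite !Hf//.
have -> : p.[x] / q.[x] - p.[y] / q.[y] =
   ((p.[x] - p.[y]) * q.[x] - p.[x] * (q.[x] - q.[y])) / (q.[x] * q.[y]).
  by field; rewrite !q0.
rewrite nrmM nrmV nrmM mulrAC ler_pM ?nrm_ge0 ?invr_ge0 ?mulr_ge0 ?nrm_ge0//.
  rewrite (le_trans (ler_nrmB _ _))// !nrmM mulrDl lerD//.
    by rewrite mulrAC ler_pM ?nrm_ge0 ?HL ?HB' ?HM.
  by rewrite -mulrA ler_pM ?nrm_ge0 ?HL' ?HB ?HM.
rewrite expr2 lef_pV2 ?posrE ?mulr_gt0//.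
- by rewrite ler_pM ?Hm ?(ltW m0).
- by rewrite (lt_le_trans m0) ?Hm.
- by rewrite (lt_le_trans m0) ?Hm.
Qed.

End Rational.

Lemma ratK_sub (R : realType) (K K' : set (cplx R)) f : K' `<=` K -> ratK K f -> ratK K' f.
Proof.
by move=> sub [p [q [q0 Hf]]]; exists p, q; split=> [z /sub/q0|z /sub/Hf].
Qed.

(** * Maximum principle and Harnack inequality *)

Section MaximumPrinciple.
Variable R : realType.
Local Notation C := (cplx R).
Variable K : set C.
Hypothesis cK : compact K.

Lemma interior_shift z (e : R) : (forall y : C, nrm (z - y) < e -> K y) -> 0 < e ->
  forall w : C, nrm w < e -> K (z + w).
Proof. by move=> h e0 w we; apply: h; rewrite opprD addrA subrr sub0r nrmN. Qed.

(** A point of [K] with maximal real part cannot be interior. *)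
Lemma boundary_nonempty : K !=set0 -> boundary K !=set0.
Proof.
move=> K0; have clK := compact_closed_nrm cK.
have [x Kx Hx] : exists2 x, K x & forall y, K y -> - complex.Re x <= - complex.Re y.
  apply: (compact_min (u := fun z => - complex.Re z)) => // x e Kx e0.
  exists e => // y Ky xy; rewrite -opprD normrN -ReN -ReD.
  exact: le_lt_trans (ler_Re_nrm _) xy.
exists x; have [//|/(@interior_nrmP R C)[e e0 eK]] := boundary_or_interior clK Kx.
have e2 : 0 < e / 2 by rewrite divr_gt0.
have := Hx (x + (e / 2)%:C) (interior_shift eK e0 _); rewrite ReD /=.
rewrite nrm_real ger0_norm ?(ltW e2)// => /(_ ltac:(lra)).
by lra.
Qed.

Lemma ratK_continuous f x (e : R) : ratK K f -> K x -> 0 < e ->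
  exists2 d : R, 0 < d & forall y, K y -> nrm (x - y) < d -> nrm (f x - f y) < e.
Proof.
move=> rf Kx e0; have [L L0 HL] := ratK_lipschitz cK rf.
have L1 : 0 < L + 1 by rewrite ltr_wpDl.
exists (e / (L + 1)); first exact: divr_gt0.
move=> y Ky xy; rewrite (le_lt_trans (HL _ _ Kx Ky))//.
rewrite (le_lt_trans (ler_wpM2r (nrm_ge0 _) (_ : L <= L + 1)))// ?lerDl//.
by rewrite mulrC -ltr_pdivlMr.
Qed.

(* At an interior minimum [x] of [Re f], [f - f x] behaves like
   [gamma (z - x) ^ m] and takes negative real values in the direction of an
   [m]-th root of [- 1 / gamma]. *)
Lemma Re_min_boundary f : ratK K f ->
  (forall z, boundary K z -> 0 <= complex.Re (f z)) ->
  forall z, K z -> 0 <= complex.Re (f z).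
Proof.
move=> rf fb z Kz; have clK := compact_closed_nrm cK.
have [x Kx Hx] : exists2 x, K x & forall y, K y -> complex.Re (f x) <= complex.Re (f y).
  apply: (compact_min (u := fun z => complex.Re (f z))) => //; first by exists z.
  move=> x e Kx e0; have [d d0 Hd] := ratK_continuous rf Kx e0.
  exists d => // y Ky xy; rewrite -ReB.
  exact: le_lt_trans (ler_Re_nrm _) (Hd _ Ky xy).
apply: le_trans (Hx z Kz).
have [/fb//|/(@interior_nrmP R C)[e e0 eK]] := boundary_or_interior clK Kx.
have [p [q [q0 Hf]]] := rf.
pose P : {poly C} := p - (f x)%:P * q.
have fP y : K y -> f y - f x = P.[y] / q.[y].
  move=> Ky; rewrite Hf// /P hornerD hornerN hornerM hornerC.
  by rewrite mulrBl mulfK ?q0.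
have [P0|P0] := eqVneq P 0.
  have [y By] : boundary K !=set0 by apply: boundary_nonempty; exists z.
  have := fP y (boundary_sub clK By); rewrite P0 horner0 mul0r => /eqP.
  by rewrite subr_eq0 => /eqP <-; exact: fb.
have [m [G]] := multiplicity_XsubC P x; rewrite P0 /= => Gx PE.
have m0 : (0 < m)%N.
  rewrite lt0n; apply/negP => /eqP mz.
  have : root P x.
    rewrite /root /P hornerD hornerN hornerM hornerC Hf//.
    by rewrite divfK ?q0// subrr.
  by rewrite PE mz expr0 mulr1 (negPf Gx).
pose gam := G.[x] / q.[x].
have gam0 : gam != 0 by rewrite mulf_neq0 ?invr_neq0 ?q0.
pose w : C := m.-root (- gam^-1).
have wm : w ^+ m = - gam^-1 by rewrite rootCK.
pose h y := w ^+ m * (G.[y] / q.[y]).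
have rh : ratK K h by apply: ratKZ; exists G, q.
have hx : h x = -1 by rewrite /h wm -/gam mulNr mulVf.
have half0 : 0 < 2^-1 :> R by rewrite invr_gt0.
have [d d0 Hd] := ratK_continuous rh Kx half0.
have w1 : 0 < nrm w + 1 by rewrite ltr_wpDl ?nrm_ge0.
pose s := Num.min (e / (nrm w + 1)) (d / (nrm w + 1)).
have s0 : 0 < s by rewrite lt_min !divr_gt0.
have swlt t : s <= t / (nrm w + 1) -> nrm (s%:C * w) < t.
  rewrite ler_pdivlMr// => h1; apply: lt_le_trans h1.
  by rewrite nrmM nrm_real gtr0_norm// ltr_pM2l// ltrDl.
pose y := x + s%:C * w.
have Ky : K y by apply: (interior_shift eK e0); apply: swlt; rewrite ge_min lexx.
have xy : nrm (x - y) < d.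
  rewrite /y opprD addrA subrr sub0r nrmN; apply: swlt.
  by rewrite ge_min lexx orbT.
have := Hd y Ky xy; rewrite hx => hy.
have hy' : complex.Re (h y) < 0.
  have := le_lt_trans (ler_Re_nrm _) hy; rewrite ReB /=.
  by rewrite ltr_norml => /andP[h1 h2]; move: h1 h2; lra.
have : f y - f x = (s ^+ m)%:C * h y.
  have yx : y - x = s%:C * w by rewrite /y addrAC subrr add0r.
  by rewrite (fP y Ky) PE hornerM horner_exp hornerXsubC yx /h exprMn -rmorphXn/=; ring.
move=> /(congr1 (@complex.Re R)); rewrite ReB ReRM => hh.
have := Hx y Ky; have := pmulr_rlt0 (complex.Re (h y)) (exprn_gt0 m s0).
by rewrite hy' -hh subr_lt0 => h1 h2; move: h1; rewrite ltNge h2.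
Qed.

(** Minimum principle for the real part of [M - al * f], where the unimodular constant [al] rotates
    [f z] to its modulus. *)
Lemma max_modulus f (M : R) : ratK K f ->
  (forall z, boundary K z -> nrm (f z) <= M) -> forall z, K z -> nrm (f z) <= M.
Proof.
move=> rf fb z Kz.
have [y By] : boundary K !=set0 by apply: boundary_nonempty; exists z.
have M0 : 0 <= M := le_trans (nrm_ge0 _) (fb y By).
have [->|fz0] := eqVneq (f z) 0; first by rewrite nrm0.
pose al := (f z)^* / (nrm (f z))%:C.
have nf0 : nrm (f z) != 0 by rewrite nrm_eq0.
have nal : nrm al = 1.
  by rewrite /al nrmM nrm_conj nrmV nrm_real ger0_norm ?nrm_ge0// divff.
have := @Re_min_boundary (fun z => M%:C - al * f z)
  (ratKB (ratK_cst _ _) (ratKZ al rf)) _ z Kz.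
have -> : al * f z = (nrm (f z))%:C.
  rewrite /al mulrAC [(f z)^* * _]mulrC mul_conj expr2 rmorphM/= mulfK//.
  by rewrite (inj_eq (@complexI R) _ 0).
rewrite ReB /= subr_ge0; apply => x Bx; rewrite ReB /= subr_ge0.
by rewrite (le_trans (Re_le_nrm _))// nrmM nal mul1r fb.
Qed.

End MaximumPrinciple.

Section Discs.
Variable R : realType.
Local Notation C := (cplx R).

Definition cdisc (c : C) (r : R) : set C := [set z | nrm (z - c) <= r].

Lemma cdisc_closed c r : closed (cdisc c r).
Proof.
apply/(@closed_nrmP R C) => x Hx; rewrite /cdisc/=; apply/ler_addgt0Pr => e e0.
have [y cy xy] := Hx e e0.
by rewrite (le_trans (ler_dist_nrm y _ _))// addrC lerD// ltW.
Qed.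

Lemma cdisc_boundary c r z : boundary (cdisc c r) z -> nrm (z - c) = r.
Proof.
rewrite boundaryE; last exact: cdisc_closed.
move=> [/= zr ni]; apply/eqP; rewrite eq_le zr leNgt; apply/negP => lt; apply: ni.
apply/(@interior_nrmP R C); exists (r - nrm (z - c)); first by rewrite subr_gt0.
move=> y; rewrite nrmBC => zy.
by rewrite /cdisc/= (le_trans (ler_dist_nrm z _ _))// -lerBrDr ltW.
Qed.

Lemma disc_max_modulus (K : set C) c (r M : R) f : compact K -> cdisc c r `<=` K ->
  ratK K f -> (forall z, nrm (z - c) = r -> nrm (f z) <= M) ->
  forall z, nrm (z - c) <= r -> nrm (f z) <= M.
Proof.
move=> cK sub rf fM z zr.
have cD := closed_sub_compact cK (@cdisc_closed c r) sub.
apply: (max_modulus cD (ratK_sub sub rf)) => // y By.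
exact/fM/cdisc_boundary.
Qed.

End Discs.

Section Harnack.
Variable R : realType.
Local Notation C := (cplx R).
Variables (K Om : set C).

(** A Moebius map of the right half-plane to the disc turns a function with positive real part into
    a competitor for the norm of the difference of the two evaluations. If the values of [f] at [a]
    and [b] were very disproportionate, that norm would be close to 2. *)
Lemma gleason_harnack a b : Om `<=` K -> gleason_related K Om -> Om a -> Om b ->
  exists2 c : R, 0 < c & forall f, ratK K f ->
    (forall z, K z -> 0 <= complex.Re (f z)) ->
    c * complex.Re (f b) <= complex.Re (f a).
Proof.
move=> OmK gl Oa Ob; have Ka := OmK _ Oa; have Kb := OmK _ Ob.
have [r r2 Hr] : exists2 r : R, r < 2 & forall h, RK K h ->
    (forall z, K z -> `|h z| <= 1) -> complex.Re (h b - h a) <= r.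
  have := gl b a Ob Oa; set N := RK_dual_norm _ _ => N2.
  have up h : RK K h -> (forall z, K z -> `|h z| <= 1) ->
      ((complex.Re (h b - h a))%:E <= N)%E.
    move=> RKh hle; apply: (@le_trans _ _ (nrm (h b - h a))%:E).
      by rewrite lee_fin Re_le_nrm.
    by apply: ereal_sup_ubound; exists h => //; split.
  case E : N => [r| |]; first last.
  - by exists 0 => // h RKh hle; have := up h RKh hle; rewrite E leeNy_eq.
  - by move: N2; rewrite E.
  exists r; first by move: N2; rewrite E lte_fin.
  by move=> h RKh hle; have := up h RKh hle; rewrite E lee_fin.
(* Below, [l] is the square root of the ratio of the two real parts and satisfies [2 - 4 * l <= r],
   that is [del <= l]. *)
pose del := (2 - r) / 4.
have del0 : 0 < del by rewrite divr_gt0// subr_gt0.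
have strict f : ratK K f -> (forall z, K z -> 0 < complex.Re (f z)) ->
    del ^+ 2 * complex.Re (f b) <= complex.Re (f a).
  move=> rf f0; pose u := complex.Re (f b); have u0 : 0 < u := f0 b Kb.
  pose s := complex.Re (f a) / u.
  have s0 : 0 < s by rewrite divr_gt0// f0.
  pose l := Num.sqrt s; have l0 : 0 < l by rewrite sqrtr_gt0.
  have ls : l ^+ 2 = s by rewrite sqr_sqrtr// ltW.
  (* Normalized so that [g a = s] is real and [g b] has real part 1. The map with zero at [l], the
     square root of [s], then separates them: the real part of [h] is [(l - 1) / (l + 1)] at [a] and
     at least [(1 - l) / (1 + l)] at [b]. *)
  pose g z := (u^-1)%:C * (f z - (0 +i* complex.Im (f a))).
  have rg : ratK K g by apply: ratKZ; apply: ratKB => //; exact: ratK_cst.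
  have Reg z : complex.Re (g z) = complex.Re (f z) / u.
    by rewrite /g ReRM ReB /= subr0 mulrC.
  have g0 z : K z -> 0 < complex.Re (g z) by move=> Kz; rewrite Reg divr_gt0 ?f0.
  have gl0 z : K z -> g z + l%:C != 0.
    move=> Kz; apply/eqP => /(congr1 (@complex.Re R)); rewrite ReD /=.
    by have := g0 z Kz; lra.
  have rh : ratK K (fun z => (g z - l%:C) / (g z + l%:C)).
    apply: (ratK_div (f := fun z => g z - l%:C) (g := fun z => g z + l%:C)) => //.
      by apply: ratKB => //; exact: ratK_cst.
    by apply: ratKD => //; exact: ratK_cst.
  have [P [Q [Q0 HPQ]]] := rh.
  pose h z := P.[z] / Q.[z].
  have hE z : K z -> h z = (g z - l%:C) / (g z + l%:C) by move=> Kz; rewrite HPQ.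
  have RKh : RK K h.
    by apply: subset_closure; exists P, Q.
  have hle z : K z -> `|h z| <= 1.
    move=> Kz; rewrite normE -[1]/(1%:C) lecR hE// nrmM nrmV ler_pdivrMr ?nrm_gt0 ?gl0//.
    rewrite mul1r -(@ler_pXn2r _ 2)// ?nnegrE ?nrm_ge0// !nrm_sqr.
    rewrite ReB ReD ImB ImD /= subr0 addr0 lerD2r.
    have p := mulr_gt0 (g0 z Kz) l0.
    by rewrite sqrrB sqrrD; move: p; set x := complex.Re (g z); lra.
  have ga : g a = s%:C.
    apply: ReImE; first by rewrite Reg.
    by rewrite /g ImRM ImB /= subrr mulr0.
  have Regb : complex.Re (g b) = 1 by rewrite Reg divff// gt_eqF.
  have l1 : 0 < 1 + l by rewrite addr_gt0.
  have ha : complex.Re (h a) = (l - 1) / (l + 1).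
    rewrite hE// ga -rmorphB -rmorphD -fmorphV -rmorphM/= -ls.
    have l2 : l ^+ 2 + l != 0 by rewrite gt_eqF// addr_gt0// exprn_gt0.
    have l3 : l + 1 != 0 by rewrite addrC gt_eqF.
    by apply/eqP; rewrite eqr_div//; apply/eqP; ring.
  have hb : 1 - 2 * l / (1 + l) <= complex.Re (h b).
    rewrite hE//; have -> : (g b - l%:C) / (g b + l%:C) = 1 - (2 * l)%:C * (g b + l%:C)^-1.
      have := gl0 b Kb; rewrite rmorphM rmorph_nat/=; move: (l%:C : C) => L gL.
      by field.
    rewrite ReB ReRM /= lerD2l lerN2 -mulrA -mulrA ler_pM2l// ler_pM2l//.
    rewrite (le_trans (Re_le_nrm _))// nrmV lef_pV2 ?posrE ?nrm_gt0 ?gl0//.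
    by rewrite (le_trans _ (Re_le_nrm _))// ReD /= Regb.
  have := Hr h RKh hle; rewrite ReB ha => hr.
  have lr : 2 - 4 * l <= r.
    apply: le_trans hr; apply: le_trans (lerB hb (lexx _)).
    have -> : 1 - 2 * l / (1 + l) - (l - 1) / (l + 1) = (2 - 2 * l) / (1 + l).
      have l3 : l + 1 != 0 by rewrite addrC gt_eqF.
      by rewrite [1 + l]addrC; field.
    by rewrite ler_pdivlMr//; have := sqr_ge0 l; nra.
  have dl : del <= l by rewrite /del; lra.
  have : del ^+ 2 <= s by rewrite -ls ler_pXn2r ?nnegrE ?(ltW del0) ?(ltW l0).
  by rewrite /s ler_pdivlMr.
exists (Num.min 1 (del ^+ 2)); first by rewrite lt_min ltr01 exprn_gt0.
(* Adding a positive constant to [f] reduces nonnegative real parts to the strict case. *)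
move=> f rf f0; apply/ler_addgt0Pr => e e0.
have rfe : ratK K (fun z => f z + e%:C) by apply: ratKD => //; exact: ratK_cst.
have fe0 z : K z -> 0 < complex.Re (f z + e%:C).
  by move=> Kz; rewrite ReD /= ltr_wpDl ?f0.
have := strict _ rfe fe0; rewrite !ReD /=; set m := Num.min _ _.
have m1 : m <= del ^+ 2 by rewrite ge_min lexx orbT.
have fb0 := f0 b Kb => h1.
have h2 : m * (complex.Re (f b) + e) <= del ^+ 2 * (complex.Re (f b) + e).
  by rewrite ler_wpM2r// addr_ge0// ltW.
have m0 : 0 < m by rewrite lt_min ltr01 exprn_gt0.
apply: le_trans (le_trans h2 h1).
by rewrite ler_pM2l// lerDl ltW.
Qed.

End Harnack.

(** * Representing functionals *)

Section PositiveExtension.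
Variable R : realType.
Variable T : Type.
Implicit Types (u v : T -> R) (G : set ((T -> R) * R)).

Definition bfun u := exists M : R, forall t, `|u t| <= M.

Lemma bfunD u v : bfun u -> bfun v -> bfun (fun t => u t + v t).
Proof.
move=> [M HM] [M' HM']; exists (M + M') => t.
by rewrite (le_trans (ler_normD _ _))// lerD.
Qed.

Lemma bfunM u v : bfun u -> bfun v -> bfun (fun t => u t * v t).
Proof.
move=> [M HM] [M' HM']; exists (M * M') => t.
by rewrite normrM ler_pM.
Qed.

Lemma bfun_cst (c : R) : bfun (fun _ => c).
Proof. by exists `|c|. Qed.

Lemma bfunZ (c : R) u : bfun u -> bfun (fun t => c * u t).
Proof. by move=> bu; apply: bfunM => //; exact: bfun_cst. Qed.

(* The graph of a partially defined positive linear functional. *)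
Definition pos_graph G :=
  [/\ forall (a : R) u v r s, G (u, r) -> G (v, s) ->
        G ((fun t => a * u t + v t), a * r + s),
      forall u r, G (u, r) -> (forall t, 0 <= u t) -> 0 <= r
    & forall u r, G (u, r) -> bfun u].

Lemma pos_graph_fun G u r s : pos_graph G -> G (u, r) -> G (u, s) -> r = s.
Proof.
move=> [GL Gpos _] Gr Gs.
have h a b : G (u, a) -> G (u, b) -> b <= a.
  move=> Ga Gb; have := GL (-1) u u b a Gb Ga.
  rewrite mulN1r addrC => /Gpos h; rewrite -subr_ge0; apply: h => t.
  by rewrite mulN1r addrC subrr.
by apply/eqP; rewrite eq_le !h.
Qed.

(** One step of the Hahn-Banach extension for positive functionals. The new value is the supremum
    [al] of the values at functions below [v]; constants in the domain bound it, and positivity on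
    [u + a * v] follows by dividing by [a] according to its sign. *)
Lemma pos_graph_step G v : pos_graph G -> (exists r, G (fun=> 1, r)) ->
  bfun v -> exists2 G', pos_graph G' & G `<=` G' /\ exists r, G' (v, r).
Proof.
move=> [GL Gpos Gb] [r1 G1] [M HM].
have G0 : G (fun=> 0, 0).
  by have := GL (-1) _ _ _ _ G1 G1; rewrite mulN1r addNr mulN1r addNr.
have GZ a u r : G (u, r) -> G ((fun t => a * u t), a * r).
  move=> Gu; have := GL a _ _ _ _ Gu G0; rewrite addr0.
  by congr (G (_, _)); apply/funext => t; rewrite addr0.
have mono u r u' r' : G (u, r) -> G (u', r') -> (forall t, u t <= u' t) -> r <= r'.
  move=> Gu Gu' le; have := GL (-1) _ _ _ _ Gu Gu'.
  rewrite mulN1r addrC => /Gpos h; rewrite -subr_ge0; apply: h => t.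
  by rewrite mulN1r addrC subr_ge0.
pose S := [set r | exists2 u, G (u, r) & forall t, u t <= v t].
have Sub : has_sup S.
  split.
    exists (- M * r1); exists (fun t => - M * 1) => [|t]; first exact: GZ.
    by rewrite mulr1 lerNl (le_trans (ler_norm _))// normrN.
  exists (M * r1) => r [u Gu uv].
  apply: (mono _ _ _ _ Gu (GZ M _ _ G1)) => t.
  by rewrite mulr1 (le_trans (uv t))// (le_trans (ler_norm _)).
pose al := sup S.
have al_ub u r : G (u, r) -> (forall t, u t <= v t) -> r <= al.
  by move=> Gu uv; apply: sup_upper_bound => //; exists u.
have al_lb u r : G (u, r) -> (forall t, v t <= u t) -> al <= r.
  move=> Gu uv; apply: ge_sup; first by case: Sub.
  by move=> r' [u' Gu' uv']; apply: (mono _ _ _ _ Gu' Gu) => t; exact: le_trans (uv' t) (uv t).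
pose G' := [set p : (T -> R) * R | exists u r a, [/\ G (u, r),
   p.1 = (fun t => u t + a * v t) & p.2 = r + a * al]].
exists G'; last first.
  split.
    move=> [u r] Gu; exists u, r, 0; split => //=; rewrite ?mul0r ?addr0//.
    by apply/funext => t; rewrite mul0r addr0.
  exists al; exists (fun=> 0), 0, 1; split => //=; rewrite ?mul1r ?add0r//.
  by apply/funext => t; rewrite mul1r add0r.
split.
- move=> a u u' r s [w [q [b [Gw /= -> ->]]]] [w' [q' [b' [Gw' /= -> ->]]]].
  exists (fun t => a * w t + w' t), (a * q + q'), (a * b + b'); split => /=.
  + exact: GL.
  + by apply/funext => t; ring.
  + by ring.
- move=> _ _ [w [q [b [Gw /= -> ->]]]] wpos.
  have [b0|b0|b0] := ltrgt0P b.
  + have bb : b * b^-1 = 1 by rewrite divff// gt_eqF.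
    have h : - b^-1 * q <= al.
      apply: (al_ub (fun t => - b^-1 * w t)); first exact: GZ.
      move=> t; rewrite -(ler_pM2l b0) mulrA mulrN bb mulN1r.
      by have := wpos t; lra.
    have : b * (- b^-1 * q) <= b * al by rewrite ler_pM2l.
    by rewrite mulrA mulrN bb mulN1r; lra.
  + have b0' : 0 < - b by rewrite oppr_gt0.
    have := al_lb (fun t => (- b)^-1 * w t) _ (GZ (- b)^-1 _ _ Gw) _.
    rewrite ler_pdivlMl// => h.
    have : - b * al <= q.
      apply: h => t; rewrite ler_pdivlMl//.
      by have := wpos t; lra.
    by lra.
  + rewrite b0 mul0r addr0; apply: Gpos Gw _ => t.
    by have := wpos t; rewrite b0 mul0r addr0.
- move=> _ _ [w [q [b [Gw /= -> _]]]]; apply: bfunD; first exact: Gb Gw.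
  by apply: bfunZ; exists M.
Qed.

Lemma positive_extension G0 : pos_graph G0 -> (exists r, G0 (fun=> 1, r)) ->
  exists Gam : (T -> R) -> R,
    [/\ forall (a : R) u v, bfun u -> bfun v ->
          Gam (fun t => a * u t + v t) = a * Gam u + Gam v,
        forall u, bfun u -> (forall t, 0 <= u t) -> 0 <= Gam u
      & forall u r, G0 (u, r) -> Gam u = r].
Proof.
move=> pG0 G01.
(* Zorn's lemma is applied to the parts added to [G0], so that the empty chain, whose union is
   empty, still stands for [G0]. *)
have [F FP Ftot|A [PA Amax]] := @Zorn_bigcup _ (fun G => pos_graph (G0 `|` G)).
  have pick u r v s : (G0 `|` \bigcup_(X in F) X) (u, r) ->
      (G0 `|` \bigcup_(X in F) X) (v, s) ->
      exists2 X, X `<=` \bigcup_(X in F) X & pos_graph (G0 `|` X) /\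
        (G0 `|` X) (u, r) /\ (G0 `|` X) (v, s).
    move=> [Gu|[X FX Xu]] [Gv|[Y FY Yv]].
    - exists set0 => //; rewrite setU0; split => //.
    - exists Y; first exact: bigcup_sup.
      by split; [exact: FP|split; [left|right]].
    - exists X; first exact: bigcup_sup.
      by split; [exact: FP|split; [right|left]].
    - have [XY|YX] := Ftot _ _ FX FY.
        exists Y; first exact: bigcup_sup.
        by split; [exact: FP|split; right => //; exact: XY].
      exists X; first exact: bigcup_sup.
      by split; [exact: FP|split; right => //; exact: YX].
  split.
  - move=> a u v r s hu hv; have [X sX [[XL _ _] [Xu Xv]]] := pick _ _ _ _ hu hv.
    by have [h|/sX h] := XL a _ _ _ _ Xu Xv; [left|right].
  - move=> u r hu; have [X sX [[_ Xp _] [Xu _]]] := pick _ _ _ _ hu hu.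
    exact: Xp.
  - move=> u r hu; have [X sX [[_ _ Xb] [Xu _]]] := pick _ _ _ _ hu hu.
    exact: Xb Xu.
set G := G0 `|` A in PA; have [GL Gpos Gb] := PA.
have G1 : exists r, G (fun=> 1, r) by have [r h] := G01; exists r; left.
have total u : bfun u -> exists r, G (u, r).
  move=> bu; apply: contrapT => nu.
  have [G' pG' [GG' [r G'u]]] := pos_graph_step PA G1 bu.
  apply: (Amax G').
    split; first by apply: subset_trans GG' => p; right.
    by move=> sub; apply: nu; exists r; right; exact: sub.
  by rewrite (_ : G0 `|` G' = G') //; apply/setUidPr; apply: subset_trans GG' => p; left.
pose Gam u := if pselect (exists r, G (u, r)) is left h then projT1 (cid h) else 0.
have GamP u r : G (u, r) -> Gam u = r.
  move=> Gu; rewrite /Gam; case: pselect => [h|]; last by case; exists r.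
  exact: pos_graph_fun PA (projT2 (cid h)) Gu.
exists Gam; split.
- move=> a u v /total[r Gu] /total[s Gv].
  by rewrite (GamP _ _ Gu) (GamP _ _ Gv); apply: GamP; exact: GL.
- by move=> u /total[r Gu] u0; rewrite (GamP _ _ Gu); exact: Gpos Gu u0.
- by move=> u r h; apply: GamP; left.
Qed.

End PositiveExtension.

Section Core.
Variable R : realType.
Local Notation C := (cplx R).
Variable K : set C.
Hypothesis cK : compact K.

Definition bd_type := {x : C | boundary K x}.
Definition bd_val (x : bd_type) : C := sval x.

Variables (a : C) (b : nat -> C) (kap : nat -> R).
Hypotheses (Kb : forall i, K (b i)) (kap0 : forall i, 0 < kap i).
(** The evaluation at [a] dominates the weighted sum of the evaluations at all [b i]: this leaves
    room for all slices at once within one representing functional for [a]. *)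
Hypothesis dom : forall f n, ratK K f -> (forall z, K z -> 0 <= complex.Re (f z)) ->
  \sum_(i < n) kap i * complex.Re (f (b i)) <= complex.Re (f a).

Lemma bd_bounded f : ratK K f -> exists M : R, forall x : bd_type, nrm (f (bd_val x)) <= M.
Proof.
move=> rf; have [L _ HL] := ratK_bounded cK rf; exists L => -[x Bx] /=.
exact: HL (boundary_sub (compact_closed_nrm cK) Bx).
Qed.

Definition core_graph : set ((bd_type * nat -> R) * R) :=
  [set p | exists (f : C -> C) (g : nat -> C -> C) N,
    [/\ ratK K f, forall i, ratK K (g i), forall i z, (N <= i)%N -> g i z = 0,
      p.1 = (fun t => complex.Re (f (bd_val t.1)) + complex.Re (g t.2 (bd_val t.1)))
    & p.2 = complex.Re (f a) + \sum_(i < N) kap i * complex.Re (g i (b i))]].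

Lemma core_graph_pos : pos_graph core_graph.
Proof.
split.
- move=> c u v r s [f [g [N [rf rg gN /= -> ->]]]] [f' [g' [N' [rf' rg' gN' /= -> ->]]]].
  exists (fun z => c%:C * f z + f' z), (fun i z => c%:C * g i z + g' i z), (maxn N N').
  split => /=.
  + by apply: ratKD => //; exact: ratKZ.
  + by move=> i; apply: ratKD => //; exact: ratKZ.
  + by move=> i z; rewrite geq_max => /andP[h h']; rewrite gN// gN'// mulr0 addr0.
  + by apply/funext => t; rewrite !ReD !ReRM; ring.
  + have ext (h : nat -> C -> C) n m : (forall i z, (n <= i)%N -> h i z = 0) -> (n <= m)%N ->
        \sum_(i < n) kap i * complex.Re (h i (b i)) = \sum_(i < m) kap i * complex.Re (h i (b i)).
      move=> hn nm; rewrite -!(big_mkord xpredT (fun i => kap i * complex.Re (h i (b i)))).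
      rewrite [RHS](big_cat_nat (n:=n))//= [X in _ + X]big_nat_cond [X in _ + X]big1 ?addr0//.
      by move=> i /andP[/andP[ni _] _]; rewrite hn// mulr0.
    rewrite (ext g N (maxn N N'))// ?leq_maxl// (ext g' N' (maxn N N'))// ?leq_maxr//.
    rewrite ReD ReRM mulrDr mulr_sumr addrACA -big_split/=; congr (_ + _).
    by apply: eq_bigr => i _; rewrite ReD ReRM; ring.
- move=> u r [f [g [N [rf rg gN /= -> ->]]]] upos.
  (* On the slice [N] only [f] is left, and on the slice [i] the function is [f + g i]; the minimum
     principle applies to each. The value is then a sum of two nonnegative terms: [f a] minus the
     weighted values [f (b i)], and the weighted values of [f + g i] at [b i]. *)
  have fpos z : K z -> 0 <= complex.Re (f z).
    apply: (Re_min_boundary cK rf) => x Bx.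
    by have := upos (exist _ x Bx, N); rewrite /= gN// addr0.
  have fgpos i z : K z -> 0 <= complex.Re (f z + g i z).
    apply: (Re_min_boundary cK (ratKD rf (rg i))) => x Bx.
    by have := upos (exist _ x Bx, i); rewrite ReD.
  have := dom N rf fpos; rewrite -subr_ge0 => h1.
  have h2 : 0 <= \sum_(i < N) kap i * complex.Re (f (b i) + g i (b i)).
    by apply: sumr_ge0 => i _; rewrite mulr_ge0 ?(ltW (kap0 i)) ?fgpos.
  have := addr_ge0 h1 h2.
  under [X in _ - _ + X]eq_bigr do rewrite ReD mulrDr.
  by rewrite big_split/= addrA subrK.
- move=> u r [f [g [N [rf rg gN /= -> _]]]].
  have [M HM] := bd_bounded rf.
  have /choice[B HB] : forall i, exists B : R, forall x : bd_type, nrm (g i (bd_val x)) <= B.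
    by move=> i; exact: bd_bounded.
  apply: bfunD.
    by exists M => t; rewrite (le_trans (ler_Re_nrm _)).
  exists (\sum_(i < N) `|B i|) => -[x i] /=; have [Ni|iN] := leqP N i.
    by rewrite gN// normr0 sumr_ge0.
  rewrite (le_trans (ler_Re_nrm _))// (le_trans (HB i x))//.
  by rewrite (bigD1 (Ordinal iN))//= (le_trans (ler_norm _))// lerDl sumr_ge0.
Qed.

(* A representing functional for [a] on the boundary of [K], cut into slices
   whose [i]-th one is a multiple of a representing functional for [b i]. *)
Lemma core_functional : exists Gam : (bd_type * nat -> R) -> R,
  [/\ forall (c : R) u v, bfun u -> bfun v ->
        Gam (fun t => c * u t + v t) = c * Gam u + Gam v,
      forall u, bfun u -> (forall t, 0 <= u t) -> 0 <= Gam u,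
      forall f, ratK K f -> Gam (fun t => complex.Re (f (bd_val t.1))) = complex.Re (f a)
    & forall i f, ratK K f ->
        Gam (fun t => (t.2 == i)%:R * complex.Re (f (bd_val t.1))) =
        kap i * complex.Re (f (b i))].
Proof.
have [|Gam [GL Gp GE]] := positive_extension core_graph_pos.
  exists (complex.Re (1 : C)); exists (fun=> 1), (fun _ _ => 0), 0%N; split => //=.
  - exact: ratK_cst.
  - by move=> i; exact: ratK_cst.
  - by apply/funext => t; rewrite addr0.
  - by rewrite big_ord0 addr0.
exists Gam; split => //.
- move=> f rf; apply: GE; exists f, (fun _ _ => 0), 0%N; split => //=.
  + by move=> i; exact: ratK_cst.
  + by apply/funext => t; rewrite addr0.
  + by rewrite big_ord0 addr0.
- move=> i f rf; apply: GE; exists (fun=> 0), (fun j z => (j == i)%:R * f z), i.+1.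
  split => //=.
  + exact: ratK_cst.
  + by move=> j; exact: ratKZ.
  + by move=> j z ij; rewrite gtn_eqF// mul0r.
  + apply/funext => t; rewrite add0r.
    by case: eqP => _; rewrite ?mul1r ?mul0r.
  + rewrite add0r big_ord_recr/= eqxx mul1r big1 ?add0r// => j _.
    by rewrite (ltn_eqF (ltn_ord j)) mul0r mulr0.
Qed.

End Core.

(** * Spaces of functions with a positive functional *)

Section LinearMaps.
Variables (R : realType) (V W : lmodType (cplx R)) (T : V -> W).
Hypothesis lT : forall (a : cplx R) x y, T (a *: x + y) = a *: T x + T y.

Lemma lin_add x y : T (x + y) = T x + T y.
Proof. by have := lT 1 x y; rewrite !scale1r. Qed.

Lemma lin_sub x y : T (x - y) = T x - T y.
Proof. by have := lT (-1) y x; rewrite !scaleN1r addrC => ->; rewrite addrC. Qed.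

Lemma lin_0 : T 0 = 0.
Proof. by have := lin_sub 0 0; rewrite !subrr. Qed.

Lemma lin_scale (a : cplx R) x : T (a *: x) = a *: T x.
Proof. by have := lT a x 0; rewrite !addr0 lin_0 addr0. Qed.

Lemma lin_sum (I : Type) (r : seq I) (P : pred I) (F : I -> V) :
  T (\sum_(i <- r | P i) F i) = \sum_(i <- r | P i) T (F i).
Proof. by apply: (big_morph T lin_add lin_0). Qed.

End LinearMaps.

Lemma subrACA (V : zmodType) (p q r s : V) : p - q - (r - s) = (p - r) - (q - s).
Proof. by rewrite !opprB addrACA [RHS]addrACA [- q - r]addrC. Qed.

Section DenseIdentities.
Variable R : realType.
Local Notation C := (cplx R).
Variables (E : lmodType C) (D : set E) (H : hilbertSpace R) (tau : E -> H).
Hypothesis mD : model D tau.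

Lemma dense_eq0 (V : normedZmodType C) (f : H -> V) (c : R) :
  (forall x y, nrm (f x - f y) <= c * nrm (x - y)) ->
  (forall x, D x -> f (tau x) = 0) -> forall h, f h = 0.
Proof.
move=> fc f0 h; apply/eqP; rewrite -nrm_eq0 eq_le nrm_ge0 andbT.
apply/ler_addgt0Pr => e e0; rewrite add0r.
have c0 : 0 < `|c| + 1 by rewrite ltr_wpDl.
have [_ _ _ /(_ h _ (divr_gt0 e0 c0))[x Dx hx]] := mD.
have := fc h (tau x); rewrite f0// subr0 => /le_trans; apply.
rewrite (@le_trans _ _ ((`|c| + 1) * nrm (h - tau x)))//.
  by rewrite ler_wpM2r ?nrm_ge0// (le_trans (ler_norm _))// lerDl.
by rewrite mulrC -ler_pdivlMr// ltW.
Qed.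

Lemma dense_inner_eq (f g : H -> C) (c : R) :
  (forall x y, nrm (f x - f y) <= c * nrm (x - y)) ->
  (forall x y, nrm (g x - g y) <= c * nrm (x - y)) ->
  (forall x, D x -> f (tau x) = g (tau x)) -> forall h, f h = g h.
Proof.
move=> fc gc fg h; apply/eqP; rewrite -subr_eq0; apply/eqP.
apply: (@dense_eq0 _ (fun x => f x - g x) (c + c)) => [x y|x Dx].
  have -> : f x - g x - (f y - g y) = (f x - f y) - (g x - g y) by ring.
  by rewrite (le_trans (ler_nrmB _ _))// mulrDl lerD.
by rewrite fg// subrr.
Qed.

Lemma dense_ortho k : (forall x, D x -> inner (tau x) k = 0) -> k = 0.
Proof.
move=> h; apply: inner_eq0; apply: (@dense_eq0 _ (fun x => inner x k) (nrm k)) => //.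
by move=> x y; rewrite -innerBl mulrC inner_CS.
Qed.

End DenseIdentities.

Section PositiveFunctional.
Variable R : realType.
Local Notation C := (cplx R).
Variable T : Type.
Variable Gam : (T -> R) -> R.
Hypothesis GamL : forall (a : R) u v, bfun u -> bfun v ->
  Gam (fun t => a * u t + v t) = a * Gam u + Gam v.
Hypothesis Gam_ge0 : forall u, bfun u -> (forall t, 0 <= u t) -> 0 <= Gam u.
Implicit Types (F G : T -> C^o).

Definition cbf F := exists M : R, forall t, nrm (F t) <= M.

Definition GamC F : C := Gam (fun t => complex.Re (F t)) +i* Gam (fun t => complex.Im (F t)).

Lemma cbf_Re F : cbf F -> bfun (fun t => complex.Re (F t)).
Proof. by move=> [M HM]; exists M => t; rewrite (le_trans (ler_Re_nrm _)). Qed.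

Lemma cbf_Im F : cbf F -> bfun (fun t => complex.Im (F t)).
Proof. by move=> [M HM]; exists M => t; rewrite (le_trans (ler_Im_nrm _)). Qed.

Lemma cbfM F G : cbf F -> cbf G -> cbf (fun t => F t * G t).
Proof.
by move=> [M HM] [N HN]; exists (M * N) => t; rewrite nrmM ler_pM ?nrm_ge0.
Qed.

Lemma cbfD F G : cbf F -> cbf G -> cbf (fun t => F t + G t).
Proof.
by move=> [M HM] [N HN]; exists (M + N) => t; rewrite (le_trans (ler_nrmD _ _))// lerD.
Qed.

Lemma cbf_cst (c : C) : cbf (fun _ => c).
Proof. by exists (nrm c). Qed.

Lemma cbf_conj F : cbf F -> cbf (fun t => (F t)^*).
Proof. by move=> [M HM]; exists M => t; rewrite nrm_conj. Qed.

Lemma Gam0 : Gam (fun=> 0) = 0.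
Proof.
have := @GamL (-1) _ _ (bfun_cst T 0) (bfun_cst T 0).
by under [X in Gam X]eq_fun do rewrite mulr0 addr0; rewrite mulN1r addNr.
Qed.

Lemma GamD u v : bfun u -> bfun v -> Gam (fun t => u t + v t) = Gam u + Gam v.
Proof.
move=> bu bv; have := @GamL 1 _ _ bu bv.
by under [X in Gam X]eq_fun do rewrite mul1r; rewrite mul1r.
Qed.

Lemma GamZ a u : bfun u -> Gam (fun t => a * u t) = a * Gam u.
Proof.
move=> bu; have := @GamL a _ _ bu (bfun_cst T 0).
by under [X in Gam X]eq_fun do rewrite addr0; rewrite Gam0 addr0.
Qed.

Lemma GamN u : bfun u -> Gam (fun t => - u t) = - Gam u.
Proof.
move=> bu; rewrite -mulN1r -GamZ//.
by congr Gam; apply/funext => t; rewrite mulN1r.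
Qed.

Lemma Gam_mono u v : bfun u -> bfun v -> (forall t, u t <= v t) -> Gam u <= Gam v.
Proof.
move=> bu bv uv; have bN : bfun (fun t => - u t).
  by case: bu => M HM; exists M => t; rewrite normrN.
rewrite -subr_ge0 -GamN// -GamD//; apply: Gam_ge0; first exact: bfunD.
by move=> t; rewrite subr_ge0.
Qed.

Lemma Gam3 a b u v w : bfun u -> bfun v -> bfun w ->
  Gam (fun t => a * u t + (b * v t + w t)) = a * Gam u + (b * Gam v + Gam w).
Proof.
move=> bu bv bw; rewrite GamL//; last by apply: bfunD => //; exact: bfunZ.
by rewrite GamL.
Qed.

Lemma GamCL (a : C) F G : cbf F -> cbf G ->
  GamC (fun t => a * F t + G t) = a * GamC F + GamC G.
Proof.
move=> bF bG.
have bRF := cbf_Re bF; have bIF := cbf_Im bF.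
have bRG := cbf_Re bG; have bIG := cbf_Im bG.
apply: ReImE; rewrite /GamC.
  rewrite ReD ReM/= (_ : (fun t => complex.Re (a * F t + G t)) =
    fun t => complex.Re a * complex.Re (F t) + (- complex.Im a * complex.Im (F t) + complex.Re (G t))).
    by rewrite Gam3//; ring.
  by apply/funext => t; rewrite ReD ReM; ring.
rewrite ImD ImM/= (_ : (fun t => complex.Im (a * F t + G t)) =
  fun t => complex.Re a * complex.Im (F t) + (complex.Im a * complex.Re (F t) + complex.Im (G t))).
  by rewrite Gam3//; ring.
by apply/funext => t; rewrite ImD ImM; ring.
Qed.

Lemma GamC_conj F : cbf F -> GamC (fun t => (F t)^*) = (GamC F)^*.
Proof.
move=> bF; apply: ReImE; rewrite ?ReJ ?ImJ /GamC/=.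
  by congr Gam; apply/funext => t; rewrite ReJ.
by rewrite -GamN; [congr Gam; apply/funext => t; rewrite ImJ|exact: cbf_Im].
Qed.

Lemma GamC_real u : bfun u -> GamC (fun t => (u t)%:C) = (Gam u)%:C.
Proof. by move=> bu; rewrite /GamC/= Gam0. Qed.

Definition gform F G : C := GamC (fun t => F t * (G t)^*).

Lemma gform_psd : psd_form gform [set F : T -> C^o | cbf F].
Proof.
split => /=.
- split=> [|a x y bx by']; first exact: cbf_cst.
  by apply: cbfD => //; apply: cbfM => //; exact: cbf_cst.
- move=> a x y z bx by' bz; rewrite /gform -GamCL.
  + by congr GamC; apply/funext => t; rewrite mulrDl mulrA.
  + by apply: cbfM => //; exact: cbf_conj.
  + by apply: cbfM => //; exact: cbf_conj.
- move=> x y bx by'; rewrite /gform -GamC_conj; last by apply: cbfM => //; exact: cbf_conj.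
  by congr GamC; apply/funext => t; rewrite conj_mulJ.
- move=> x bx; rewrite /gform/=; apply: Gam_ge0.
    by apply: cbf_Re; apply: cbfM => //; exact: cbf_conj.
  by move=> t; rewrite mul_conj/= sqr_ge0.
Qed.

Lemma bfun_nrm F : cbf F -> bfun (fun t => nrm (F t) ^+ 2).
Proof.
move=> [M HM]; exists (M ^+ 2) => t; rewrite ger0_norm ?sqr_ge0//.
by rewrite ler_pXn2r ?nnegrE ?nrm_ge0// (le_trans (nrm_ge0 _) (HM t)).
Qed.

Lemma gform_sqr F : cbf F -> gform F F = (Gam (fun t => nrm (F t) ^+ 2))%:C.
Proof.
move=> bF; rewrite -GamC_real; last exact: bfun_nrm.
by congr GamC; apply/funext => t; rewrite mul_conj.
Qed.

Lemma qn_gform F : cbf F -> qn gform F ^+ 2 = Gam (fun t => nrm (F t) ^+ 2).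
Proof. by move=> bF; rewrite (qn_sqr gform_psd)// gform_sqr. Qed.

Lemma qn_gform_le F G : cbf F -> cbf G -> (forall t, nrm (F t) <= nrm (G t)) ->
  qn gform F <= qn gform G.
Proof.
move=> bF bG FG; rewrite -(@ler_pXn2r _ 2)// ?nnegrE ?qn_ge0//.
rewrite !qn_gform//; apply: Gam_mono; try exact: bfun_nrm.
by move=> t; rewrite ler_pXn2r ?nnegrE ?nrm_ge0.
Qed.

Lemma Gam1_ge0 : 0 <= Gam (fun=> 1).
Proof. by apply: Gam_ge0 => //; exact: bfun_cst. Qed.

Lemma qn_gform_bound F (M : R) : 0 <= M -> (forall t, nrm (F t) <= M) ->
  qn gform F <= M * Num.sqrt (Gam (fun=> 1)).
Proof.
move=> M0 FM; have bF : cbf F by exists M.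
have bM : cbf (fun=> M%:C) by exact: cbf_cst.
have h : qn gform (fun=> M%:C) = M * Num.sqrt (Gam (fun=> 1)).
  apply/eqP; rewrite -(@eqrXn2 _ 2)// ?qn_ge0 ?mulr_ge0 ?sqrtr_ge0//.
  rewrite qn_gform// exprMn (sqr_sqrtr Gam1_ge0).
  rewrite -(GamZ _ (bfun_cst T 1)).
  by apply/eqP; congr Gam; apply/funext => t; rewrite nrm_real ger0_norm// mulr1.
by rewrite -h; apply: qn_gform_le => // t; rewrite nrm_real ger0_norm.
Qed.

End PositiveFunctional.

(** A subset of a separable seminormed space is separable: in each ball of radius [1 / (k + 1)]
    around [ys n] a point of the subset is chosen whenever there is one. *)
Lemma separable_sub (R : realType) (E E' : lmodType (cplx R)) (B : E -> E -> cplx R)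
    (D : set E) (D' : set E') (t : E' -> E) (ys : nat -> E) : psd_form B D ->
  D' 0 -> (forall x, D' x -> D (t x)) -> (forall n, D (ys n)) ->
  (forall x (e : R), D' x -> 0 < e -> exists n, qn B (t x - ys n) < e) ->
  exists xs : nat -> E', (forall n, D' (xs n)) /\
    forall x (e : R), D' x -> 0 < e -> exists n, qn B (t x - t (xs n)) < e.
Proof.
move=> pB D0 tD Dy dy.
have /choice[f Hf] : forall p : nat * nat, exists x, D' x /\
    ((exists2 x', D' x' & qn B (t x' - ys p.1) < p.2.+1%:R^-1) ->
     qn B (t x - ys p.1) < p.2.+1%:R^-1).
  move=> p; case: (pselect (exists2 x', D' x' & qn B (t x' - ys p.1) < p.2.+1%:R^-1)).
    by move=> [x Dx hx]; exists x.
  by move=> h; exists 0.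
exists (fun n => if unpickle n is Some p then f p else 0); split.
  by move=> n; case: unpickle => [p|//]; case: (Hf p).
move=> x e Dx e0; have [k hk] := inv_small (divr_gt0 e0 (ltr0Sn _ 1)).
have k0 : 0 < k.+1%:R^-1 :> R by rewrite invr_gt0.
have [n hn] := dy _ _ Dx k0.
have [Df /(_ (ex_intro2 _ _ x Dx hn)) hf] := Hf (n, k).
exists (pickle (n, k)); rewrite pickleK.
have -> : t x - t (f (n, k)) = (t x - ys n) - (t (f (n, k)) - ys n).
  by rewrite opprB addrA subrK.
have Dt y m : D' y -> D (t y - ys m) by move=> Dy'; apply: (psd_DB pB) => //; exact: tD.
apply: le_lt_trans (qnB pB (Dt _ _ Dx) (Dt _ _ Df)) _.
have := hk k (leqnn _); move: hn hf => /=; move: (k.+1%:R^-1 : R) => p; lra.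
Qed.

Section StepFunctions.
Variable R : realType.
Local Notation C := (cplx R).
Variables (T : Type) (zeta : T -> C) (kappa : T -> nat) (Z : R).
Hypothesis Zb : forall t, nrm (zeta t) <= Z.

(** Bounded functions on finitely many levels of [kappa], Lipschitz in [zeta] on each level. The
    class is stable under multiplication by [zeta] and its conjugate, and it is within uniform reach
    of a countable family of step functions; continuity of the functional along sequences is thus
    never called for. *)
Definition lip_class (F : T -> C^o) := [/\ cbf F,
  exists N, forall t, (N <= kappa t)%N -> F t = 0
  & exists2 L : R, 0 <= L & forall s t, kappa s = kappa t ->
      nrm (F s - F t) <= L * nrm (zeta s - zeta t)].

Definition cell (m : nat) (t : T) : nat * nat * nat :=
  (kappa t, Num.truncn ((complex.Re (zeta t) + Z) * m.+1%:R),
            Num.truncn ((complex.Im (zeta t) + Z) * m.+1%:R)).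

(** A step function on the grid of mesh [1 / (p.1 + 1)], its values listed by the codes of the
    cells, with 0 beyond the end of the list. *)
Definition stepf (p : nat * seq (rat * rat)) : T -> C^o :=
  fun t => cratr R (nth (0, 0) p.2 (pickle (cell p.1 t))).

Lemma cbf_stepf p : cbf (stepf p).
Proof.
exists (\sum_(q <- (0, 0) :: p.2) nrm (cratr R q)) => t; rewrite /stepf.
set n := pickle _; have [ns|sn] := ltnP n (size p.2).
  have qin : nth (0, 0) p.2 n \in (0, 0) :: p.2 by rewrite inE mem_nth// orbT.
  by rewrite (big_rem _ qin)/= lerDl sumr_ge0// => i _; exact: nrm_ge0.
by rewrite nth_default// big_cons lerDl sumr_ge0// => i _; exact: nrm_ge0.
Qed.

Lemma truncn_close (x y r : R) : 0 < r -> 0 <= x -> 0 <= y ->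
  Num.truncn (x * r) = Num.truncn (y * r) -> `|x - y| <= r^-1.
Proof.
move=> r0 x0 y0 xy.
have /andP[h1 h2] := Num.Theory.truncn_itv (mulr_ge0 x0 (ltW r0)).
have /andP[h3 h4] := Num.Theory.truncn_itv (mulr_ge0 y0 (ltW r0)).
rewrite -(ler_pM2r r0) mulVf ?gt_eqF// -{1}(gtr0_norm r0) -normrM mulrBl.
move: h1 h2 h3 h4; rewrite xy -natr1; move: ((Num.truncn (y * r))%:R : R) => n.
by move=> h1 h2 h3 h4; rewrite ler_norml; apply/andP; split; lra.
Qed.

Lemma stepf_dense F (e : R) : lip_class F -> 0 < e ->
  exists p, forall t, nrm (F t - stepf p t) <= e.
Proof.
move=> [bF [N FN] [L L0 FL]] e0.
have Z0 t : 0 <= complex.Re (zeta t) + Z /\ 0 <= complex.Im (zeta t) + Z.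
  have := Zb t; have := ler_Re_nrm (zeta t); have := ler_Im_nrm (zeta t).
  by rewrite !ler_norml => /andP[h1 _] /andP[h2 _] h3; split; lra.
have e2 := divr_gt0 e0 (ltr0Sn _ 1).
have L2 : 0 < 2 * L + 1 by lra.
(* Two points in one cell are at distance at most [2 / (m + 1)], so [F] oscillates by at most
   [e / 2] on it. *)
have [m hm] := inv_small (divr_gt0 e2 L2).
have osc s t : cell m s = cell m t -> nrm (F s - F t) <= e / 2.
  move=> [ks r1 r2]; rewrite (le_trans (FL _ _ ks))//.
  have [a1 a2] := Z0 s; have [b1 b2] := Z0 t.
  have := truncn_close (ltr0Sn _ m) a1 b1 r1; have := truncn_close (ltr0Sn _ m) a2 b2 r2.
  have := nrm_le_ReIm (zeta s - zeta t); rewrite ReB ImB.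
  rewrite (_ : _ + Z - (_ + Z) = complex.Im (zeta s) - complex.Im (zeta t)); last by ring.
  rewrite (_ : _ + Z - (_ + Z) = complex.Re (zeta s) - complex.Re (zeta t)); last by ring.
  have := hm m (leqnn _); rewrite ltr_pdivlMr//.
  move: (m.+1%:R^-1 : R) (nrm (zeta s - zeta t)) => p n h1 h2 h3 h4.
  have h5 : n <= 2 * p by lra.
  have := ler_wpM2l L0 h5; have := nrm_ge0 (zeta s - zeta t); nra.
have /choice[q Hq] : forall c, exists q, forall t, cell m t = c -> nrm (F t - cratr R q) <= e.
  move=> c; have [[t0 ht0]|none] := pselect (exists t, cell m t = c); last first.
    by exists (0, 0) => t ht; case: none; exists t.
  have [q hq] := crat_approx (F t0) e2; exists q => t ht.
  rewrite (le_trans (ler_dist_nrm (F t0) _ _))//.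
  have := osc t t0; rewrite ht ht0 => /(_ erefl); lra.
pose B := (Num.truncn ((Z + Z) * m.+1%:R)).+1.
pose cells := [seq (x, z) | x <- [seq (x, y) | x <- iota 0 N, y <- iota 0 B], z <- iota 0 B].
pose P := (\max_(c <- cells) pickle c).+1.
exists (m, mkseq (fun n => if unpickle n is Some c then q c else (0, 0)) P) => t.
rewrite /stepf/=; have [lt|ge] := ltnP (pickle (cell m t)) P.
  by rewrite nth_mkseq// pickleK; exact: Hq.
rewrite nth_default ?size_mkseq//.
have [kt|tk] := leqP N (kappa t).
  rewrite FN// sub0r nrmN (_ : cratr R (0, 0) = 0) ?nrm0 ?(ltW e0)//.
  by apply: ReImE; rewrite /= rmorph0.
have tr (x : R) : 0 <= x + Z -> x <= Z -> (Num.truncn ((x + Z) * m.+1%:R) < B)%N.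
  move=> x0 xZ; rewrite ltnS; apply: Num.Theory.le_truncn.
  by rewrite ler_wpM2r// lerD2r.
have cin : cell m t \in cells.
  have [z1 z2] := Z0 t.
  have z3 : complex.Re (zeta t) <= Z.
    by rewrite (le_trans (ler_norm _))// (le_trans (ler_Re_nrm _)).
  have z4 : complex.Im (zeta t) <= Z.
    by rewrite (le_trans (ler_norm _))// (le_trans (ler_Im_nrm _)).
  apply: (allpairs_f (fun x z => (x, z))); last by rewrite mem_iota add0n; exact: tr.
  apply: (allpairs_f (fun x z => (x, z))); first by rewrite mem_iota.
  by rewrite mem_iota add0n; exact: tr.
move: ge; rewrite leqNgt /P ltnS => /negP[].
by rewrite (big_rem _ cin)/= leq_maxl.
Qed.

End StepFunctions.

Section Gns.
Variable R : realType.
Local Notation C := (cplx R).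
Variables (T : Type) (Gam : (T -> R) -> R).
Hypothesis GamL : forall (a : R) u v, bfun u -> bfun v ->
  Gam (fun t => a * u t + v t) = a * Gam u + Gam v.
Hypothesis Gam_ge0 : forall u, bfun u -> (forall t, 0 <= u t) -> 0 <= Gam u.
Variables (zeta : T -> C) (kappa : T -> nat) (Z : R).
Hypothesis Zb : forall t, nrm (zeta t) <= Z.

Let D := [set F : T -> C^o | lip_class zeta kappa F].

Lemma lip_class0 : lip_class zeta kappa (fun=> 0).
Proof.
split; first exact: cbf_cst.
  by exists 0%N.
by exists 0 => // s t _; rewrite subrr nrm0 mul0r.
Qed.

Lemma lip_classL (a : C) F G : lip_class zeta kappa F -> lip_class zeta kappa G ->
  lip_class zeta kappa (fun t => a * F t + G t).
Proof.
move=> [bF [N FN] [L L0 FL]] [bG [N' GN] [L' L'0 GL]]; split.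
- by apply: cbfD => //; apply: cbfM => //; exact: cbf_cst.
- exists (maxn N N') => t; rewrite geq_max => /andP[h h'].
  by rewrite FN// GN// mulr0 addr0.
- exists (nrm a * L + L'); first by rewrite addr_ge0// mulr_ge0 ?nrm_ge0.
  move=> s t st; rewrite (_ : _ + _ - _ = a * (F s - F t) + (G s - G t)); last by ring.
  rewrite (le_trans (ler_nrmD _ _))// mulrDl lerD//; last exact: GL.
  by rewrite nrmM -mulrA ler_wpM2l ?nrm_ge0//; exact: FL.
Qed.

Lemma lip_classM (G : T -> C^o) (L' : R) F : 0 <= L' -> cbf G ->
  (forall s t, nrm (G s - G t) <= L' * nrm (zeta s - zeta t)) ->
  lip_class zeta kappa F -> lip_class zeta kappa (fun t => G t * F t).
Proof.
move=> L'0 bG GL [bF [N FN] [L L0 FL]]; split; first exact: cbfM.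
  by exists N => t h; rewrite FN// mulr0.
have [M HM] := bF; have [M' HM'] := bG.
exists (`|M'| * L + L' * `|M|); first by rewrite addr_ge0// mulr_ge0.
move=> s t st.
rewrite (_ : _ * _ - _ = G s * (F s - F t) + (G s - G t) * F t); last by ring.
rewrite (le_trans (ler_nrmD _ _))// [leRHS]mulrDl lerD// nrmM.
  rewrite -mulrA ler_pM ?nrm_ge0//; last exact: FL.
  by rewrite (le_trans (HM' _))// ler_norm.
rewrite mulrAC ler_pM ?nrm_ge0//.
by rewrite (le_trans (HM _))// ler_norm.
Qed.

Let pB := gform_psd GamL Gam_ge0.

Lemma lip_psd : psd_form (gform Gam) D.
Proof.
case: pB => [[_ _] h2 h3 h4]; split.
- by split; [exact: lip_class0|move=> a x y; exact: lip_classL].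
- by move=> a x y z [bx _ _] [by' _ _] [bz _ _]; exact: h2.
- by move=> x y [bx _ _] [by' _ _]; exact: h3.
- by move=> x [bx _ _]; exact: h4.
Qed.

Lemma lip_separable (E' : lmodType C) (D' : set E') (t : E' -> T -> C^o) :
  D' 0 -> (forall x, D' x -> D (t x)) ->
  exists xs : nat -> E', (forall n, D' (xs n)) /\
    forall x (e : R), D' x -> 0 < e -> exists n, qn (gform Gam) (t x - t (xs n)) < e.
Proof.
move=> D0 tD.
pose ys n := if unpickle n is Some p then stepf zeta kappa Z p else fun=> 0.
have bys n : cbf (ys n).
  by rewrite /ys; case: unpickle => [p|]; [exact: cbf_stepf|exact: cbf_cst].
apply: (@separable_sub _ _ _ _ [set F : T -> C^o | cbf F] _ _ ys) => //.
- by move=> x /tD[].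
- move=> x e /tD Dx e0.
  have s0 : 0 < Num.sqrt (Gam (fun=> 1)) + 1 by rewrite ltr_wpDl ?sqrtr_ge0.
  have [p hp] := stepf_dense Zb Dx (divr_gt0 e0 s0).
  exists (pickle p); rewrite /ys pickleK.
  apply: le_lt_trans (qn_gform_bound GamL Gam_ge0 (ltW (divr_gt0 e0 s0)) hp) _.
  by rewrite mulrAC ltr_pdivrMr// ltr_pM2l// ltrDl.
Qed.

(** The extension space [L] is the completion of the whole Lipschitz class, where multiplication by
    [zeta] and by its conjugate are bounded, adjoint to each other and commute. The functions [t x]
    span an invariant subspace, whose completion [H] embeds isometrically through [J]. *)
Lemma gns_model (E' : lmodType C) (D' : set E') (t : E' -> T -> C^o) (Z' : E' -> E') :
  D' 0 -> (forall (a : C) x y, D' x -> D' y -> D' (a *: x + y)) ->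
  (forall (a : C) x y, D' x -> D' y -> t (a *: x + y) = a *: t x + t y) ->
  (forall x, D' x -> lip_class zeta kappa (t x)) ->
  (forall x, D' x -> D' (Z' x)) ->
  (forall (a : C) x y, D' x -> D' y -> Z' (a *: x + y) = a *: Z' x + Z' y) ->
  (forall x s, D' x -> t (Z' x) s = zeta s * t x s) ->
  exists (H : hilbertSpace R) (tau : E' -> H) (S : H -> H),
    [/\ model D' tau,
        forall x y, D' x -> D' y -> inner (tau x) (tau y) = gform Gam (t x) (t y),
        bounded_operator S,
        subnormal_operator S
      & forall x, D' x -> S (tau x) = tau (Z' x)].
Proof.
move=> D0 DL tL tD ZD ZL tZ.
have [L [tL' [mL iL]]] : exists (L : hilbertSpace R) (tauL : (T -> C^o) -> L), model D tauL /\
    forall x y, D x -> D y -> inner (tauL x) (tauL y) = gform Gam x y.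
  apply: completion; first exact: lip_psd.
  by apply: (@lip_separable _ _ id) => //; exact: lip_class0.
have psd' : psd_form (fun x y => gform Gam (t x) (t y)) D'.
  case: lip_psd => [_ h2 h3 h4]; split => //.
  - by move=> a x y z Dx Dy Dz; rewrite tL//; apply: h2; exact: tD.
  - by move=> x y Dx Dy; apply: h3; exact: tD.
  - by move=> x Dx; apply: h4; exact: tD.
have tB x y : D' x -> D' y -> t (x - y) = t x - t y.
  move=> Dx Dy; have -> : x - y = (-1) *: y + x by rewrite scaleN1r addrC.
  by rewrite tL// scaleN1r addrC.
have [H [tau [mH iH]]] : exists (H : hilbertSpace R) (tau : E' -> H), model D' tau /\
    forall x y, D' x -> D' y -> inner (tau x) (tau y) = gform Gam (t x) (t y).
  apply: completion => //; have [xs [Dxs dxs]] := lip_separable D0 tD.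
  exists xs; split => // x e Dx e0; have [n hn] := dxs _ _ Dx e0; exists n.
  by move: hn; rewrite -tB.
have nL x : D x -> nrm (tL' x) = qn (gform Gam) x.
  by move=> Dx; rewrite -qn_inner /qn iL.
have nH x : D' x -> nrm (tau x) = qn (gform Gam) (t x).
  by move=> Dx; rewrite -qn_inner /qn iH.
have Z0 : 0 <= `|Z| by [].
have Zb' s : nrm (zeta s) <= `|Z| by rewrite (le_trans (Zb s))// ler_norm.
have bz : cbf zeta by exists Z.
have Dz x : D x -> D (fun s => zeta s * x s).
  by apply: (@lip_classM _ 1) => // s s'; rewrite mul1r.
have Dz' x : D x -> D (fun s => (zeta s)^* * x s).
  apply: (@lip_classM _ 1) => //; first exact: cbf_conj.
  by move=> s s'; rewrite mul1r -rmorphB nrm_conj.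
have qz (g : T -> C) x : (forall s, nrm (g s) <= `|Z|) -> cbf x -> cbf (fun s => g s * x s) ->
    qn (gform Gam) (fun s => g s * x s) <= `|Z| * qn (gform Gam) x.
  move=> gZ bx bgx; have -> : `|Z| = nrm (`|Z|%:C : C) by rewrite nrm_real normr_id.
  rewrite -(qnZ pB)//; apply: (qn_gform_le GamL Gam_ge0) => //.
    by apply: cbfM => //; exact: cbf_cst.
  by move=> s; rewrite nrmM [leRHS]nrmM ler_wpM2r ?nrm_ge0// nrm_real normr_id.
have mul_op (g : T -> C) : (forall s, nrm (g s) <= `|Z|) ->
    (forall x, D x -> D (fun s => g s * x s)) ->
    exists2 M : L -> L, bounded_operator M &
      forall x, D x -> M (tL' x) = tL' (fun s => g s * x s).
  move=> gZ Dg; apply: (dense_operator mL (Z := fun x s => g s * x s) Z0).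
    move=> a x y Dx Dy; case: mL => _ _ mLl _; rewrite -mLl; [|exact: Dg|exact: Dg].
    congr tL'; apply/funext => s /=.
    have hs (b c d e : C) : b * (c * d + e) = c * (b * d) + b * e by ring.
    exact: hs.
  move=> x Dx; rewrite !nL//; last exact: Dg.
  by apply: qz => //; [case: Dx|case: (Dg _ Dx)].
have [M bM HM] := mul_op _ Zb' Dz.
have Zbc s : nrm (zeta s)^* <= `|Z| by rewrite nrm_conj.
have [M' bM' HM'] := mul_op _ Zbc Dz'.
have [lM [cM cM0 HcM]] := (bounded_opP M).1 bM.
have [lM' [cM' cM'0 HcM']] := (bounded_opP M').1 bM'.
have adj : is_adjoint M M'.
  have adj1 x y : D y -> inner (M x) (tL' y) = inner x (M' (tL' y)).
    move=> Dy; move: x; apply: (dense_inner_eq mL (c := cM * nrm (tL' y) + nrm (M' (tL' y)))).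
    - move=> u v; rewrite -innerBl -(lin_sub lM) mulrDl.
      rewrite (le_trans (inner_CS _ _))// mulrAC ler_wpDr ?mulr_ge0 ?nrm_ge0//.
      by rewrite ler_wpM2r ?nrm_ge0.
    - move=> u v; rewrite -innerBl mulrDl.
      rewrite (le_trans (inner_CS _ _))// mulrC ler_wpDl ?mulr_ge0 ?nrm_ge0//.
    - move=> x Dx; rewrite HM// HM'// !iL//; [|exact: Dz'|exact: Dz].
      rewrite /gform; congr GamC; apply/funext => s.
      have hs (z u v : C) : z * u * v^* = u * (z^* * v)^*.
        by rewrite [z^* * v]mulrC conj_mulJ mulrA [u * z]mulrC.
      exact: hs.
  move=> x; apply: (dense_inner_eq mL (c := cM' * nrm x + nrm (M x))).
  - move=> u v; rewrite -innerBr mulrDl.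
    rewrite (le_trans (inner_CS _ _))// ler_wpDl ?mulr_ge0 ?nrm_ge0//.
  - move=> u v; rewrite -innerBr -(lin_sub lM') mulrDl.
    rewrite (le_trans (inner_CS _ _))// mulrC mulrAC ler_wpDr ?mulr_ge0 ?nrm_ge0//.
    by rewrite ler_wpM2r ?nrm_ge0.
  - by move=> y Dy; exact: adj1.
have comm : M \o M' = M' \o M.
  apply/funext => x; apply/eqP; rewrite -subr_eq0; apply/eqP; move: x.
  apply: (dense_eq0 mL (c := cM * cM' + cM' * cM)) => [u v|x Dx] /=.
    have -> : M (M' u) - M' (M u) - (M (M' v) - M' (M v)) = M (M' (u - v)) - M' (M (u - v)).
      by rewrite (lin_sub lM') (lin_sub lM) (lin_sub lM) (lin_sub lM') subrACA.
    rewrite (le_trans (ler_nrmB _ _))// mulrDl lerD// -mulrA.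
      by rewrite (le_trans (HcM _))// ler_wpM2l.
    by rewrite (le_trans (HcM' _))// ler_wpM2l.
  rewrite (HM' _ Dx) (HM _ Dx) (HM _ (Dz' _ Dx)) (HM' _ (Dz _ Dx)).
  apply/eqP; rewrite subr_eq0; apply/eqP; congr tL'; apply/funext => s.
  have hs (b c d : C) : b * (c * d) = c * (b * d) by ring.
  exact: hs.
have [S bS HS] : exists2 S : H -> H, bounded_operator S &
    forall x, D' x -> S (tau x) = tau (Z' x).
  apply: (dense_operator mH Z0) => [a x y Dx Dy|x Dx].
    by rewrite ZL//; case: mH => _ _ mHl _; rewrite mHl//; exact: ZD.
  rewrite !nH//; last exact: ZD.
  have -> : t (Z' x) = fun s => zeta s * t x s by apply/funext => s; exact: tZ.
  by apply: qz => //; [case: (tD _ Dx)|case: (Dz _ (tD _ Dx))].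
have [lS [cS cS0 HcS]] := (bounded_opP S).1 bS.
have [J [lJ bJ HJ]] : exists J : H -> L,
    [/\ forall (a : C) x y, J (a *: x + y) = a *: J x + J y,
        forall x, nrm (J x) <= 1 * nrm x
      & forall x, D' x -> J (tau x) = tL' (t x)].
  apply: (dense_extension mH (@hilbert_complete _ L)) => // [a x y Dx Dy|x Dx].
    by rewrite tL//; case: mL => _ _ mLl _; rewrite mLl//; exact: tD.
  by rewrite mul1r nL ?nH//; exact: tD.
have JB u v : nrm (J u - J v) <= nrm (u - v) by rewrite -(lin_sub lJ) -[leRHS]mul1r.
exists H, tau, S; split => //; exists L, J, M; split => //.
- have iJ1 x y : D' y -> inner (J x) (J (tau y)) = inner x (tau y).
    move=> Dy; move: x; apply: (dense_inner_eq mH (c := nrm (J (tau y)) + nrm (tau y))).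
    + move=> u v; rewrite -innerBl mulrDl (le_trans (inner_CS _ _))//.
      by rewrite mulrC ler_wpDr ?mulr_ge0 ?nrm_ge0// ler_wpM2l ?nrm_ge0.
    + move=> u v; rewrite -innerBl mulrDl (le_trans (inner_CS _ _))//.
      by rewrite mulrC ler_wpDl ?mulr_ge0 ?nrm_ge0.
    + by move=> x Dx; rewrite !HJ// iL ?iH//; exact: tD.
  move=> x; apply: (dense_inner_eq mH (c := nrm (J x) + nrm x)).
  + move=> u v; rewrite -innerBr mulrDl (le_trans (inner_CS _ _))//.
    by rewrite ler_wpDr ?mulr_ge0 ?nrm_ge0// ler_wpM2l ?nrm_ge0.
  + move=> u v; rewrite -innerBr mulrDl (le_trans (inner_CS _ _))//.
    by rewrite ler_wpDl ?mulr_ge0 ?nrm_ge0.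
  + by move=> y Dy; exact: iJ1.
- by split => //; exists M'.
- move=> x; apply/eqP; rewrite -subr_eq0; apply/eqP; move: x.
  apply: (dense_eq0 mH (c := cM + cS)) => [u v|x Dx].
    rewrite (_ : _ - _ = M (J u - J v) - J (S u - S v)); last first.
      by rewrite (lin_sub lM) (lin_sub lJ) subrACA.
    rewrite (le_trans (ler_nrmB _ _))// mulrDl lerD//.
      by rewrite (le_trans (HcM _))// ler_wpM2l.
    by rewrite (le_trans (bJ _))// mul1r -(lin_sub lS).
  rewrite (HJ _ Dx) (HM _ (tD _ Dx)) (HS _ Dx) (HJ _ (ZD _ Dx)).
  by rewrite (_ : t (Z' x) = fun s => zeta s * t x s) ?subrr//; apply/funext => s; exact: tZ.
Qed.

End Gns.

(** What all constructions use of the Gleason part. [core_harnack] is Harnack's inequality in the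
    direction opposite to the one that produced [kap]; together with [core_two] it serves the
    compact sets without interior. *)
Record core_data (R : realType) (K : set (cplx R)) (a : cplx R) (b : nat -> cplx R)
    (kap : nat -> R) (Gam : (bd_type K * nat -> R) -> R) : Prop := CoreData {
  core_compact : compact K;
  core_Ka : K a;
  core_Kb : forall i, K (b i);
  core_kap0 : forall i, 0 < kap i;
  core_dense : forall z (e : R), K z -> 0 < e -> exists i, nrm (z - b i) < e;
  core_GamL : forall (c : R) u v, bfun u -> bfun v ->
        Gam (fun t => c * u t + v t) = c * Gam u + Gam v;
  core_Gam_ge0 : forall u, bfun u -> (forall t, 0 <= u t) -> 0 <= Gam u;
  core_Gam_a : forall f, ratK K f ->
    Gam (fun t => complex.Re (f (bd_val t.1))) = complex.Re (f a);
  core_Gam_b : forall i f, ratK K f ->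
    Gam (fun t => (t.2 == i)%:R * complex.Re (f (bd_val t.1))) =
    kap i * complex.Re (f (b i));
  core_harnack : forall i, exists2 c : R, 0 < c & forall f, ratK K f ->
    (forall z, K z -> 0 <= complex.Re (f z)) ->
    c * complex.Re (f a) <= complex.Re (f (b i));
  core_two : exists i, b i != a }.

Lemma core_exists (R : realType) (K Om : set (cplx R)) : compact K ->
  only_nontrivial_gleason_part K Om -> K = closure Om ->
  exists a b kap (Gam : (bd_type K * nat -> R) -> R), core_data a b kap Gam.
Proof.
move=> cK [[OK gO _] [x0 [y0 [Ox Oy xy]]] _] Kcl.
have /choice[pk Hpk] : forall p : (rat * rat) * nat, exists z, Om z /\
    ((exists2 z', Om z' & nrm (z' - cratr R p.1) < p.2.+1%:R^-1) ->
     nrm (z - cratr R p.1) < p.2.+1%:R^-1).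
  move=> p; case: (pselect (exists2 z', Om z' & nrm (z' - cratr R p.1) < p.2.+1%:R^-1)).
    by move=> [z Oz hz]; exists z.
  by move=> h; exists x0.
pose b n := if unpickle n is Some p then pk p else x0.
have Ob n : Om (b n) by rewrite /b; case: unpickle => [p|//]; case: (Hpk p).
have db z (e : R) : K z -> 0 < e -> exists i, nrm (z - b i) < e.
  rewrite Kcl => /closure_nrmP cz e0.
  have e3 : 0 < e / 3 by rewrite divr_gt0.
  have [z' Oz' zz'] := cz _ e3.
  have [k hk] := inv_small e3.
  have k0 : 0 < k.+1%:R^-1 :> R by rewrite invr_gt0.
  have [q hq] := crat_approx z' k0.
  exists (pickle (q, k)); rewrite /b pickleK.
  have [_ Hh] := Hpk (q, k).
  have {Hh}/= h := Hh (ex_intro2 (fun z0 => Om z0) (fun z0 => nrm (z0 - cratr R q) < k.+1%:R^-1) z' Oz' hq).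
  have := ler_dist_nrm z' z (pk (q, k)).
  have := ler_dist_nrm (cratr R q) z' (pk (q, k)).
  rewrite (nrmBC (cratr R q)); have := hk k (leqnn _).
  move: hq h zz'; move: (k.+1%:R^-1 : R) => p; lra.
have /choice[c Hc] : forall i, exists c : R, 0 < c /\ forall f, ratK K f ->
    (forall z, K z -> 0 <= complex.Re (f z)) ->
    c * complex.Re (f (b i)) <= complex.Re (f x0).
  by move=> i; have [c c0 hc] := gleason_harnack OK gO Ox (Ob i); exists c.
(* Harnack's inequality for [b i] holds with [c i]; the geometric factors make all weighted
   evaluations sum to at most the evaluation at [x0]. *)
pose kap i := 2^-1 ^+ i.+1 * c i.
have kap0 i : 0 < kap i by rewrite mulr_gt0 ?exprn_gt0//; case: (Hc i).
have geo n : \sum_(i < n) (2^-1 : R) ^+ i.+1 = 1 - 2^-1 ^+ n.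
  elim: n => [|n IH]; first by rewrite big_ord0 expr0 subrr.
  by rewrite big_ord_recr/= IH exprS; lra.
have dom f n : ratK K f -> (forall z, K z -> 0 <= complex.Re (f z)) ->
    \sum_(i < n) kap i * complex.Re (f (b i)) <= complex.Re (f x0).
  move=> rf fp; have fa : 0 <= complex.Re (f x0) by apply: fp; exact: OK.
  apply: (@le_trans _ _ ((\sum_(i < n) 2^-1 ^+ i.+1) * complex.Re (f x0))).
    rewrite mulr_suml; apply: ler_sum => i _; rewrite /kap -mulrA ler_wpM2l ?exprn_ge0//.
    by have [_] := Hc i; exact.
  by rewrite geo ler_piMl// lerBlDr lerDl exprn_ge0.
have [Gam [GL Gp Ga Gb]] := core_functional cK (fun i => OK _ (Ob i)) kap0 dom.
exists x0, b, kap, Gam; split => //.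
- exact: OK.
- by move=> i; exact: OK.
- by move=> i; exact: gleason_harnack OK gO (Ob i) Ox.
- have : 0 < nrm (y0 - x0).
    by rewrite nrm_gt0 subr_eq0; apply/eqP => h; apply: xy.
  move=> /(db _ _ (OK _ Oy))[i hi]; exists i; apply: contraTneq hi => ->.
  by rewrite ltxx.
Qed.

Section CoreBounds.
Variable R : realType.
Local Notation C := (cplx R).
Variables (K : set C) (a : C) (b : nat -> C) (kap : nat -> R).
Variable Gam : (bd_type K * nat -> R) -> R.
Hypothesis cd : core_data a b kap Gam.
Let W : Type := (bd_type K * nat)%type.
Let cK := core_compact cd.
Let GL := core_GamL cd.
Let Gp := core_Gam_ge0 cd.
Let pB := gform_psd GL Gp.

Definition bpull (f : C -> C) : W -> C^o := fun t => f (bd_val t.1).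

Definition slice (i : nat) (F : W -> C^o) : W -> C^o := fun t => if t.2 == i then F t else 0.

Lemma bd_in (x : bd_type K) : K (bd_val x).
Proof. by case: x => x Bx; exact: (boundary_sub (compact_closed_nrm cK) Bx). Qed.

Lemma cbf_bpull f : ratK K f -> cbf (bpull f).
Proof. by move=> rf; have [M HM] := bd_bounded cK rf; exists M => -[x i]; exact: HM. Qed.

Lemma cbf_slice i F : cbf F -> cbf (slice i F).
Proof.
move=> [M HM]; exists M => t; rewrite /slice; case: eqP => // _.
by rewrite nrm0 (le_trans (nrm_ge0 _) (HM t)).
Qed.

Lemma GamC_a f : ratK K f -> GamC Gam (bpull f) = f a.
Proof.
move=> rf; apply: ReImE => /=; first exact: (core_Gam_a cd).
have := core_Gam_a cd (ratKZ (0 -i* 1) rf).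
rewrite ReM/= mul0r sub0r mulN1r opprK => <-.
by congr Gam; apply/funext => t; rewrite ReM/= mul0r sub0r mulN1r opprK.
Qed.

Lemma GamC_b i f : ratK K f -> GamC Gam (slice i (bpull f)) = (kap i)%:C * f (b i).
Proof.
move=> rf; apply: ReImE; rewrite ?ReRM ?ImRM /=.
  rewrite -(core_Gam_b cd)//; congr Gam; apply/funext => t; rewrite /slice.
  by case: eqP => _; rewrite ?mul1r ?mul0r.
have := core_Gam_b cd i (ratKZ (0 -i* 1) rf).
rewrite ReM/= mul0r sub0r mulN1r opprK => <-.
congr Gam; apply/funext => t; rewrite /slice ReM/= mul0r sub0r mulN1r opprK.
by case: eqP => _; rewrite ?mul1r ?mul0r.
Qed.

Lemma qn_slice_le i F : cbf F -> qn (gform Gam) (slice i F) <= qn (gform Gam) F.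
Proof.
move=> bF; apply: (qn_gform_le GL Gp) => //; first exact: cbf_slice.
by move=> t; rewrite /slice; case: eqP => // _; rewrite nrm0 nrm_ge0.
Qed.

Lemma qn_slice1 i : qn (gform Gam) (slice i (fun=> 1)) = Num.sqrt (kap i).
Proof.
rewrite /qn; congr Num.sqrt; rewrite /gform.
have := GamC_b i (ratK_cst K 1); rewrite mulr1 => h.
transitivity (complex.Re (GamC Gam (slice i (bpull (fun=> 1))))); last by rewrite h.
congr (complex.Re (GamC Gam _)); apply/funext => t; rewrite /slice; case: eqP => _; last exact: mul0r.
by have := mul_conj (1 : C); rewrite nrm1 expr1n.
Qed.

Lemma slice_CS i F : cbf F ->
  nrm (GamC Gam (slice i F)) <= qn (gform Gam) (slice i F) * Num.sqrt (kap i).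
Proof.
move=> bF; rewrite -qn_slice1.
rewrite (_ : GamC Gam (slice i F) = gform Gam (slice i F) (slice i (fun=> 1))).
  by apply: (psd_CS pB); apply: cbf_slice => //; exact: cbf_cst.
congr GamC; apply/funext => t; rewrite /slice; case: eqP => _; last by rewrite mul0r.
have h1 (z : C) : z = z * (1 : C)^* by rewrite rmorph1 mulr1.
exact: h1.
Qed.

Lemma slice_Re_ge i F (m : R) : cbf F -> (forall t, t.2 = i -> m <= complex.Re (F t)) ->
  m * kap i <= complex.Re (GamC Gam (slice i F)).
Proof.
move=> bF mF /=; have h1 := core_Gam_b cd i (ratK_cst K 1).
rewrite mulr1 in h1; rewrite -h1 -(GamZ GL); last first.
  by exists 1 => t; case: eqP => _; rewrite ?mul1r ?mul0r ?normr1 ?normr0.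
apply: (Gam_mono GL Gp).
- apply: bfunZ; exists 1 => t; case: eqP => _; rewrite ?mul1r ?mul0r ?normr1 ?normr0//.
- exact: cbf_Re (cbf_slice i bF).
- move=> t; rewrite /slice; case: eqP => [ti|_]; rewrite ?mul1r ?mul0r ?mulr0// mulr1.
  exact: mF.
Qed.

Lemma slice_value i f : ratK K f ->
  nrm (f (b i)) <= qn (gform Gam) (slice i (bpull f)) / Num.sqrt (kap i).
Proof.
move=> rf; have k0 := core_kap0 cd i.
have s0 : 0 < Num.sqrt (kap i) by rewrite sqrtr_gt0.
rewrite ler_pdivlMr// -(ler_pM2r s0) -mulrA -expr2 (sqr_sqrtr (ltW k0)) mulrC.
have := slice_CS i (cbf_bpull rf); by rewrite GamC_b// nrmM nrm_real (ger0_norm (ltW k0)).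
Qed.

(** The weight [(x - c) / (x - lam)] turns the slice representing [c = b i] into a complex
    functional that is a multiple of the evaluation at [lam]. Bounded evaluations thus spread from
    the dense sequence to whole discs, with a uniform constant. *)
Lemma ev_bound i (d t : R) f lam : ratK K f -> 0 < d -> 0 <= t -> t < 1 ->
  (forall x, boundary K x -> d <= nrm (x - b i)) -> K lam -> nrm (lam - b i) <= t * d ->
  nrm (f lam) <= 2 / ((1 - t) * Num.sqrt (kap i)) * qn (gform Gam) (bpull f).
Proof.
move=> rf d0 t0 t1 dist Kl ltd; have k0 := core_kap0 cd i.
have s0 : 0 < Num.sqrt (kap i) by rewrite sqrtr_gt0.
set c := b i in dist ltd *.
have t1' : 0 < 1 - t by rewrite subr_gt0.
have [g rg Hg] := ratK_quotient rf Kl.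
have xl x : boundary K x -> (1 - t) * nrm (x - c) <= nrm (x - lam).
  move=> Bx; have := ler_dist_nrm lam x c; have := dist _ Bx; nra.
have xl0 x : boundary K x -> 0 < nrm (x - lam).
  by move=> Bx; apply: lt_le_trans (xl _ Bx); rewrite mulr_gt0// (lt_le_trans d0)// dist.
pose q (x : C) : C := (x - c) / (x - lam).
have qle x : boundary K x -> nrm (q x) <= (1 - t)^-1.
  move=> Bx; rewrite nrmM nrmV ler_pdivrMr ?xl0// -(ler_pM2l t1') mulrA divff ?gt_eqF//.
  by rewrite mul1r xl.
have bq : cbf (bpull q) by exists (1 - t)^-1 => -[[x Bx] j]; exact: qle.
have bqf : cbf (bpull (fun x => q x * f x)) by exact: cbfM bq (cbf_bpull rf).
(* The real part of [q x] is at least one half exactly when [|q x - 1| <= |q x|], that is when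
   [|lam - c| <= |x - c|]. *)
have Req x : boundary K x -> 2^-1 <= complex.Re (q x).
  move=> Bx; have x0 : x - lam != 0 by rewrite -nrm_gt0 xl0.
  have e1 : x - c = q x * (x - lam) by rewrite /q divfK.
  have e2 : lam - c = (q x - 1) * (x - lam) by rewrite mulrBl -e1 mul1r; ring.
  have le : nrm (lam - c) <= nrm (x - c) by have := dist _ Bx; nra.
  move: le; rewrite e1 e2 (nrmM _ (x - lam)) (nrmM (q x)) ler_pM2r ?xl0//; move: (q x) => qx.
  rewrite -(@ler_pXn2r _ 2)// ?nnegrE ?nrm_ge0// !nrm_sqr ReB ImB/= oppr0 addr0.
  by move: (complex.Re qx) (complex.Im qx) => r1 r2; lra.
have rcg : ratK K (fun z => (z - c) * g z).
  by apply: ratKM => //; apply: ratKB; [exact: ratK_id|exact: ratK_cst].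
(* Writing [f = f lam + (z - lam) * g], the second part becomes [(z - c) * g], which the slice
   evaluates at its zero [c]. *)
have key : GamC Gam (slice i (bpull (fun x => q x * f x))) =
    f lam * GamC Gam (slice i (bpull q)).
  have h := GamC_b i rcg; rewrite subrr mul0r mulr0 in h.
  rewrite -[RHS]addr0 -h -(GamCL GL); last 2 first.
  - exact: cbf_slice.
  - by apply: cbf_slice; exact: cbf_bpull.
  congr GamC; apply/funext => -[[x Bx] j]; rewrite /slice/= /bpull/=.
  case: eqP => _; last by rewrite mulr0 addr0.
  rewrite (Hg x (boundary_sub (compact_closed_nrm cK) Bx)) /q/=.
  have nz : x - lam != 0 by rewrite -nrm_gt0 xl0.
  by field.
have h1 : nrm (f lam) * (2^-1 * kap i) <= nrm (GamC Gam (slice i (bpull (fun x => q x * f x)))).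
  rewrite key nrmM ler_wpM2l ?nrm_ge0//; apply: le_trans (Re_le_nrm _).
  by apply: slice_Re_ge => // -[[x Bx] j] _; exact: Req.
have h2 : qn (gform Gam) (slice i (bpull (fun x => q x * f x))) <=
    (1 - t)^-1 * qn (gform Gam) (bpull f).
  apply: le_trans (qn_slice_le i bqf) _.
  have -> : (1 - t)^-1 = nrm ((1 - t)^-1%:C : C) by rewrite nrm_real ger0_norm// invr_ge0 ltW.
  rewrite -(qnZ pB) ?(cbf_bpull rf)//; last exact: cbf_bpull.
  apply: (qn_gform_le GL Gp) => //.
    by apply: cbfM; [exact: cbf_cst|exact: cbf_bpull].
  move=> [[x Bx] j]; rewrite /bpull/= nrmM [leRHS]nrmM ler_wpM2r ?nrm_ge0//.
  by rewrite nrm_real ger0_norm ?invr_ge0 ?(ltW t1')//; exact: qle.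
have h3 := slice_CS i bqf.
have h4 : nrm (f lam) * (2^-1 * kap i) <=
    (1 - t)^-1 * qn (gform Gam) (bpull f) * Num.sqrt (kap i).
  by apply: le_trans h1 (le_trans h3 _); rewrite ler_wpM2r// (ltW s0).
move: h4; have e : kap i = Num.sqrt (kap i) ^+ 2 by rewrite sqr_sqrtr// ltW.
rewrite {1}e; move: (Num.sqrt _) s0 => s s0 h4.
have -> : 2 / ((1 - t) * s) * qn (gform Gam) (bpull f) =
   ((1 - t)^-1 * qn (gform Gam) (bpull f) * s) / (2^-1 * s ^+ 2).
  by field; rewrite !gt_eqF.
by rewrite ler_pdivlMr// mulr_gt0// exprn_gt0.
Qed.

End CoreBounds.

(** * Blaschke products *)

Section Blaschke.
Variable R : realType.
Local Notation C := (cplx R).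
Variables (K : set C) (c : C) (rho : R).
Hypotheses (cK : compact K) (rho0 : 0 < rho) (dK : cdisc c rho `<=` K).

Lemma disc_boundary_ge x : boundary K x -> rho <= nrm (x - c).
Proof.
rewrite (boundaryE (compact_closed_nrm cK)) => -[_ nix]; rewrite leNgt.
apply/negP => xc; apply: nix; apply/interior_nrmP.
exists (rho - nrm (x - c)); first by rewrite subr_gt0.
move=> y xy; apply: dK; rewrite /cdisc/=.
have := ler_dist_nrm x y c; rewrite (nrmBC y x); lra.
Qed.

(** The difference of the squares is the product of [rho^2 - |al|^2] and [|xi|^2 - rho^2]. *)
Lemma blaschke_ge (al xi : C) : nrm al <= rho -> rho <= nrm xi ->
  nrm ((rho ^+ 2)%:C - al^* * xi) <= rho * nrm (xi - al).
Proof.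
move=> hal hxi; rewrite -(@ler_pXn2r _ 2)// ?nnegrE ?mulr_ge0 ?nrm_ge0 ?(ltW rho0)//.
rewrite exprMn -subr_ge0.
have -> : rho ^+ 2 * nrm (xi - al) ^+ 2 - nrm ((rho ^+ 2)%:C - al^* * xi) ^+ 2 =
    (rho ^+ 2 - nrm al ^+ 2) * (nrm xi ^+ 2 - rho ^+ 2).
  rewrite !nrm_sqr !ReB !ImB !ReM !ImM !ReJ !ImJ /=; ring.
by rewrite mulr_ge0// subr_ge0 ler_pXn2r// ?nnegrE ?nrm_ge0 ?(ltW rho0).
Qed.

(** Two norms are meant: the supremum over a circle when the zeros accumulate in the interior, and
    the normalized norm of one slice when they tend to the boundary. *)
Variable N : (C -> C) -> R.
Hypothesis N_val : forall f, ratK K f -> nrm (f c) <= N f.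
Hypothesis N_le : forall f g (e : R), ratK K f -> ratK K g -> 0 <= e ->
  (forall x, boundary K x -> nrm (g x) <= nrm (f x) + e) -> N g <= N f + e.

(* Divide [f - f al] by the Blaschke factor of the disc with zero [al]: its
   inverse has modulus at most [1] outside of the disc. *)
Lemma blaschke_step f (al : C) : ratK K f -> nrm (al - c) <= rho ->
  exists f1, [/\ ratK K f1, N f1 <= N f + nrm (f al),
    nrm (f c) <= nrm (f al) + nrm (al - c) / rho * nrm (f1 c)
  & forall z (sig : R), 0 < sig -> nrm (z - c) <= rho -> sig <= nrm (z - al) ->
      nrm (f1 z) <= 2 * rho / sig * (nrm (f z) + nrm (f al))].
Proof.
move=> rf hal; have Kal : K al by exact: dK.
have Kc : K c by apply: dK; rewrite /cdisc/= subrr nrm0 ltW.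
have [g rg Hg] := ratK_quotient rf Kal.
have rh0 : (rho%:C : C) != 0 by rewrite -nrm_gt0 nrm_real gtr0_norm.
pose f1 z := ((rho ^+ 2)%:C - (al - c)^* * (z - c)) / rho%:C * g z.
have rf1 : ratK K f1.
  apply: ratKM => //; apply: ratKM; last exact: ratK_cst.
  apply: ratKB; first exact: ratK_cst.
  by apply: ratKZ; apply: ratKB; [exact: ratK_id|exact: ratK_cst].
exists f1; split => //.
- apply: N_le => //; first exact: nrm_ge0.
  move=> x Bx; have Kx : K x by exact: (boundary_sub (compact_closed_nrm cK)).
  apply: (@le_trans _ _ (nrm (f x - f al))); last exact: ler_nrmB.
  have -> : f x - f al = (x - al) * g x by rewrite Hg// addrAC subrr add0r.
  rewrite /f1 !nrmM ler_wpM2r ?nrm_ge0// nrmV nrm_real gtr0_norm// ler_pdivrMr// [leRHS]mulrC.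
  have -> : x - al = (x - c) - (al - c) by ring.
  by apply: blaschke_ge => //; exact: disc_boundary_ge.
- rewrite {1}(Hg _ Kc) (le_trans (ler_nrmD _ _))// lerD2l.
  rewrite /f1 subrr mulr0 subr0 !nrmM nrmV !nrm_real (gtr0_norm rho0).
  rewrite gtr0_norm ?exprn_gt0// (nrmBC c al).
  have -> : nrm (al - c) / rho * (rho ^+ 2 / rho * nrm (g c)) = nrm (al - c) * nrm (g c).
    by field; rewrite gt_eqF.
  by [].
- move=> z sig s0 zc zal; have Kz : K z by exact: dK.
  have e1 : nrm (z - al) * nrm (g z) <= nrm (f z) + nrm (f al).
    by rewrite -nrmM (_ : _ * _ = f z - f al) ?ler_nrmB// (Hg _ Kz) addrAC subrr add0r.
  rewrite /f1 !nrmM nrmV nrm_real (gtr0_norm rho0).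
  have e2 : nrm ((rho ^+ 2)%:C - (al - c)^* * (z - c)) <= 2 * rho ^+ 2.
    rewrite (le_trans (ler_nrmB _ _))// nrmM nrm_conj nrm_real gtr0_norm ?exprn_gt0//.
    have : nrm (al - c) * nrm (z - c) <= rho * rho by rewrite ler_pM ?nrm_ge0.
    by rewrite expr2; lra.
  have e3 : nrm (g z) <= (nrm (f z) + nrm (f al)) / sig.
    rewrite ler_pdivlMr//; apply: le_trans e1; rewrite mulrC ler_wpM2r ?nrm_ge0//.
  apply: (@le_trans _ _ (2 * rho ^+ 2 / rho * ((nrm (f z) + nrm (f al)) / sig))).
    rewrite ler_pM ?nrm_ge0 ?mulr_ge0 ?nrm_ge0 ?invr_ge0 ?(ltW rho0)//.
    by rewrite ler_wpM2r// invr_ge0 (ltW rho0).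
  by rewrite le_eqVlt; apply/orP; left; apply/eqP; field; rewrite !gt_eqF.
Qed.

(** The points are divided out one at a time by [blaschke_step]. Each contributes its factor
    [|x - c| / rho], and the separation [sig] keeps the values at the remaining points under
    control. The constant depends only on [sig] and the number of points, not on [f] or on their
    positions. *)
Lemma blaschke_bound (sig : R) m : 0 < sig -> exists2 kap : R, 0 <= kap &
  forall (s : seq C) f, size s = m -> ratK K f ->
    pairwise (fun x y => sig <= nrm (y - x)) s ->
    (forall x, x \in s -> nrm (x - c) <= rho) ->
    nrm (f c) <= (\prod_(x <- s) (nrm (x - c) / rho)) * N f + kap * \sum_(x <- s) nrm (f x).
Proof.
move=> s0; elim: m => [|m [kap k0 IH]].
  exists 0 => // s f /size0nil -> rf _ _.
  by rewrite !big_nil mul1r mul0r addr0 N_val.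
pose B := 2 * rho / sig.
have B0 : 0 <= B by rewrite divr_ge0 ?mulr_ge0 ?(ltW rho0) ?(ltW s0).
have kB : 0 <= kap * B * m.+1%:R by apply: mulr_ge0 => //; exact: mulr_ge0.
(* [|f al|] enters directly, once more through [N f1], and [m] times through the remaining values of
   [f1], each at most [B] times the sum of [|f x|] and [|f al|]. *)
exists (2 + kap * B * m.+1%:R); first exact: addr_ge0.
move=> [//|al s] f [sm] rf /= /andP[/allP hal sep] dsc.
have alr : nrm (al - c) <= rho by apply: dsc; rewrite inE eqxx.
have dsc' x : x \in s -> nrm (x - c) <= rho by move=> xs; apply: dsc; rewrite inE xs orbT.
have [f1 [rf1 Nf1 fc f1z]] := blaschke_step rf alr.
have := IH _ _ sm rf1 sep dsc'; rewrite !big_cons.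
set P := \prod_(x <- s) _; set u := nrm (al - c) / rho in fc *.
set S1 := \sum_(x <- s) nrm (f1 x); set S := \sum_(x <- s) nrm (f x) => h.
have u0 : 0 <= u by rewrite divr_ge0 ?nrm_ge0 ?ltW.
have u1 : u <= 1 by rewrite ler_pdivrMr// mul1r.
have P0 : 0 <= P by apply: prodr_ge0 => x _; rewrite divr_ge0 ?nrm_ge0 ?ltW.
have P1 : P <= 1.
  rewrite /P big_seq; apply: prodr_ile1 => x xs.
  by rewrite divr_ge0 ?nrm_ge0 ?(ltW rho0)//= ler_pdivrMr// mul1r dsc'.
have S0 : 0 <= S by apply: sumr_ge0 => x _; exact: nrm_ge0.
have hS1 : S1 <= B * (S + m%:R * nrm (f al)).
  rewrite /S1 /S -sm big_seq.
  apply: (@le_trans _ _ (\sum_(x <- s | x \in s) B * (nrm (f x) + nrm (f al)))).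
    by apply: ler_sum => x xs; apply: f1z => //; [exact: dsc'|exact: hal].
  rewrite -big_seq -mulr_sumr big_split/= (_ : \sum_(x <- s) nrm (f al) = (size s)%:R * nrm (f al))//.
  by rewrite big_const_seq count_predT iter_addr_0 mulr_natl.
have F0 := nrm_ge0 (f al); have N0 : 0 <= N f1 by apply: le_trans (N_val rf1); exact: nrm_ge0.
have h1 : u * nrm (f1 c) <= u * P * N f + nrm (f al) + kap * (B * (S + m%:R * nrm (f al))).
  have h2 : P * N f1 <= P * N f + nrm (f al).
    apply: (@le_trans _ _ (P * (N f + nrm (f al)))); first by rewrite ler_wpM2l.
    by rewrite mulrDr lerD2l ler_piMl.
  have h3 : kap * S1 <= kap * (B * (S + m%:R * nrm (f al))) by rewrite ler_wpM2l.
  have h4 : 0 <= kap * (B * (S + m%:R * nrm (f al))).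
    by apply: mulr_ge0 => //; apply: mulr_ge0 => //; apply: addr_ge0 => //; exact: mulr_ge0.
  apply: (@le_trans _ _ (u * (P * N f + nrm (f al) + kap * (B * (S + m%:R * nrm (f al)))))).
    by rewrite ler_wpM2l// (le_trans h)// lerD.
  move: h4; set X := kap * _ => h4; rewrite !mulrDr mulrA.
  by rewrite lerD ?lerD2l// ler_piMl.
apply: le_trans fc _.
have h5 : 0 <= kap * B by rewrite mulr_ge0.
have m0 : 0 <= m%:R :> R by [].
rewrite -(natr1 m); move: h1; rewrite (mulrA kap); move: (kap * B) (m%:R : R) h5 m0 => X M X0 M0 h1.
have : 0 <= X * M * S by apply: mulr_ge0 => //; exact: mulr_ge0.
have : 0 <= X * nrm (f al) by rewrite mulr_ge0.
by lra.
Qed.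

End Blaschke.

(** * Polynomials in an operator *)

Section PolyOp.
Variable R : realType.
Local Notation C := (cplx R).
Variables (H : hilbertSpace R) (S : H -> H).
Hypothesis bS : bounded_operator S.
Implicit Types (p q : {poly C}) (x y : H).

Lemma bounded_lin (T : H -> H) : bounded_operator T ->
  forall (a : C) x y, T (a *: x + y) = a *: T x + T y.
Proof. by case/bounded_opP. Qed.
Let lS := bounded_lin bS.

Lemma bounded_comp (T T' : H -> H) : bounded_operator T -> bounded_operator T' ->
  bounded_operator (T \o T').
Proof.
move=> /bounded_opP[l [c c0 hc]] /bounded_opP[l' [c' c'0 hc']]; apply/bounded_opP.
split; first by move=> a x y /=; rewrite l' l.
exists (c * c'); first exact: mulr_ge0.
by move=> x /=; rewrite (le_trans (hc _))// -mulrA ler_wpM2l.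
Qed.

Lemma bounded_id : bounded_operator (@id H).
Proof. by apply/bounded_opP; split => //; exists 1 => // x; rewrite mul1r. Qed.

Lemma bounded_sub_scalar (l : C) : bounded_operator (sub_scalar S l).
Proof.
have [_ [c c0 hc]] := (bounded_opP S).1 bS; apply/bounded_opP; split.
  move=> a x y; rewrite /sub_scalar lS scalerDr scalerBr !scalerA mulrC.
  by rewrite opprD addrACA.
exists (c + nrm l); first by rewrite addr_ge0 ?nrm_ge0.
by move=> x; rewrite (le_trans (ler_nrmB _ _))// mulrDl nrmZ lerD.
Qed.

Lemma iterS_lin i (a : C) x y : iter i S (a *: x + y) = a *: iter i S x + iter i S y.
Proof. by elim: i => //= i ->; rewrite lS. Qed.

Lemma poly_op_wide p n x : (size p <= n)%N ->
  poly_op S p x = \sum_(i < n) p`_i *: iter i S x.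
Proof.
move=> pn; rewrite /poly_op (big_ord_widen _ (fun i => p`_i *: iter i S x) pn).
rewrite big_mkcond; apply: eq_bigr => i _; case: ltnP => // h.
by rewrite nth_default// scale0r.
Qed.

Lemma poly_opD p q x : poly_op S (p + q) x = poly_op S p x + poly_op S q x.
Proof.
have hp : (size p <= maxn (size p) (size q))%N by rewrite leq_maxl.
have hq : (size q <= maxn (size p) (size q))%N by rewrite leq_maxr.
rewrite (poly_op_wide x hp) (poly_op_wide x hq) (poly_op_wide x (size_polyD p q)).
by rewrite -big_split/=; apply: eq_bigr => i _; rewrite coefD scalerDl.
Qed.

Lemma poly_opC (c : C) x : poly_op S c%:P x = c *: x.
Proof.
by rewrite (poly_op_wide x (size_polyC_leq1 c)) big_ord1/= coefC.
Qed.

Lemma poly_opMX p x : poly_op S (p * 'X) x = S (poly_op S p x).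
Proof.
have h : (size (p * 'X)%R <= (size p).+1)%N.
  by have [->|p0] := eqVneq p 0; rewrite ?mul0r ?size_poly0// size_mulX.
rewrite (poly_op_wide x h) big_ord_recl/= coefMX scale0r add0r.
rewrite /poly_op (lin_sum lS); apply: eq_bigr => i _.
by rewrite (lin_scale lS) coefMX/=.
Qed.

Lemma poly_op0 x : poly_op S 0 x = 0.
Proof. by rewrite -[0 : {poly C}]polyC0 poly_opC scale0r. Qed.

Lemma poly_op1 x : poly_op S 1 x = x.
Proof. by rewrite -[1 : {poly C}]polyC1 poly_opC scale1r. Qed.

Lemma poly_op_lin p (a : C) x y :
  poly_op S p (a *: x + y) = a *: poly_op S p x + poly_op S p y.
Proof.
rewrite /poly_op scaler_sumr -big_split/=; apply: eq_bigr => i _.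
by rewrite iterS_lin scalerDr !scalerA mulrC.
Qed.

Lemma poly_opZ (c : C) p x : poly_op S (c *: p) x = c *: poly_op S p x.
Proof.
have h : (size (c *: p) <= size p)%N by exact: size_scale_leq.
rewrite (poly_op_wide x h) /poly_op scaler_sumr; apply: eq_bigr => i _.
by rewrite coefZ scalerA.
Qed.

Lemma poly_opM p q x : poly_op S (p * q) x = poly_op S p (poly_op S q x).
Proof.
elim/poly_ind: p => [|p c IH]; first by rewrite mul0r !poly_op0.
rewrite (_ : (_ + _) * q = p * q * 'X + c%:P * q); last by rewrite mulrDl mulrAC.
rewrite !poly_opD !poly_opMX IH; congr (_ + _).
by rewrite mul_polyC poly_opZ poly_opC.
Qed.

Lemma poly_op_comm p q x : poly_op S p (poly_op S q x) = poly_op S q (poly_op S p x).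
Proof. by rewrite -!poly_opM mulrC. Qed.

Lemma poly_opXsub (c : C) x : poly_op S ('X - c%:P) x = sub_scalar S c x.
Proof.
rewrite -polyCN poly_opD -['X]mul1r poly_opMX poly_op1 poly_opC.
by rewrite scaleNr.
Qed.

Lemma bounded_poly_op p : bounded_operator (poly_op S p).
Proof.
apply/bounded_opP; split; first by move=> a x y; exact: poly_op_lin.
have [_ [c c0 hc]] := (bounded_opP S).1 bS.
elim/poly_ind: p => [|p d [c' c'0 IH]].
  by exists 0 => // x; rewrite poly_op0 nrm0 mul0r.
exists (c * c' + nrm d); first by rewrite addr_ge0 ?mulr_ge0 ?nrm_ge0.
move=> x; rewrite poly_opD poly_opMX poly_opC (le_trans (ler_nrmD _ _))// mulrDl.
by rewrite nrmZ lerD// (le_trans (hc _))// -mulrA ler_wpM2l.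
Qed.

Lemma poly_inverse_prod (s : seq C) :
  (forall z, z \in s -> exists T', bounded_inverse (sub_scalar S z) T') ->
  exists Q, bounded_inverse (poly_op S (\prod_(z <- s) ('X - z%:P))) Q.
Proof.
elim: s => [_|z s IH h].
  exists id; split; [exact: bounded_id| |].
    by move=> x; rewrite big_nil poly_op1.
  by move=> x; rewrite big_nil poly_op1.
have [|Q [bQ Q1 Q2]] := IH; first by move=> w ws; apply: h; rewrite inE ws orbT.
have [|T [bT T1 T2]] := h z; first by rewrite inE eqxx.
exists (Q \o T); split; first exact: bounded_comp.
  by move=> x /=; rewrite big_cons poly_opM poly_opXsub T1 Q1.
by move=> x /=; rewrite big_cons poly_opM poly_opXsub Q2 T2.
Qed.

Lemma poly_inverse_off (K : set C) q : K !=set0 -> zero_free K q ->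
  (forall l, ~ K l -> exists T', bounded_inverse (sub_scalar S l) T') ->
  exists Q, bounded_inverse (poly_op S q) Q.
Proof.
move=> [z0 Kz0] zf inv; have q0 : q != 0.
  by apply: contraNneq (zf _ Kz0) => ->; rewrite horner0.
have [s qs] := closed_field_poly_normal q.
have lc : lead_coef q != 0 by rewrite lead_coef_eq0.
have [z zs|Q [bQ Q1 Q2]] := @poly_inverse_prod s.
  apply: inv => /zf; rewrite qs hornerZ; apply/negP; rewrite negbK.
  by rewrite mulf_eq0 -/(root _ z) root_prod_XsubC zs orbT.
exists (fun x => Q ((lead_coef q)^-1 *: x)); split.
- apply: (bounded_comp bQ); apply/bounded_opP; split.
    by move=> a x y; rewrite scalerDr !scalerA mulrC.
  by exists (nrm (lead_coef q)^-1); [exact: nrm_ge0|move=> x; rewrite nrmZ].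
- by move=> x; rewrite qs poly_opZ scalerA -qs mulVf// scale1r Q1.
- by move=> x; rewrite qs poly_opZ -qs Q2 scalerA divff// scale1r.
Qed.

Lemma rat_op_eq A x p q Q : bounded_inverse (poly_op S q) Q -> A = poly_op S p \o Q ->
  poly_op S q (A x) = poly_op S p x.
Proof. by move=> [_ Q1 Q2] ->; rewrite /= poly_op_comm Q2. Qed.

Lemma poly_op_eigen (phi : H -> C) (l : C) p x :
  (forall (a : C) x y, phi (a *: x + y) = a * phi x + phi y) ->
  (forall x, phi (S x) = l * phi x) -> phi (poly_op S p x) = p.[l] * phi x.
Proof.
move=> lphi ev; have phi0 : phi 0 = 0.
  by have := lphi (-1) 0 0; rewrite scaler0 addr0 mulN1r addNr.
elim/poly_ind: p => [|p c IH]; first by rewrite poly_op0 horner0 mul0r.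
rewrite poly_opD poly_opMX poly_opC hornerD hornerMX hornerC mulrDl.
by rewrite -[S _]scale1r lphi mul1r ev IH -[c *: x]addr0 lphi phi0 addr0 mulrA (mulrC l).
Qed.

(** On a Jordan chain of two functionals, a polynomial in [S] acts by its value and its derivative.
    The derivative is what links the behavior at [w J] to the coordinate of index [J]. *)
Lemma poly_op_jordan (phi fp : H -> C) (l e : C) p x :
  (forall (a : C) x y, phi (a *: x + y) = a * phi x + phi y) ->
  (forall (a : C) x y, fp (a *: x + y) = a * fp x + fp y) ->
  (forall x, phi (S x) = l * phi x) -> (forall x, fp (S x) = l * fp x + e * phi x) ->
  fp (poly_op S p x) = p.[l] * fp x + e * p^`().[l] * phi x.
Proof.
move=> lphi lfp ev fev; have fp0 : fp 0 = 0.
  by have := lfp (-1) 0 0; rewrite scaler0 addr0 mulN1r addNr.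
elim/poly_ind: p => [|p c IH]; first by rewrite poly_op0 deriv0 !horner0 fp0; ring.
rewrite poly_opD poly_opMX poly_opC derivD derivM derivX derivC mulr1 addr0.
rewrite !(hornerD, hornerMX, hornerC, hornerM) -[S _]scale1r lfp mul1r fev IH.
rewrite (poly_op_eigen p x lphi ev) -[c *: x]addr0 lfp fp0.
by move: (p.[l]) (p^`().[l]) => u v; ring.
Qed.

End PolyOp.

(** * Uniform boundedness and closed ranges *)

Section UniformBoundedness.
Variable R : realType.
Local Notation C := (cplx R).
Variable H : hilbertSpace R.

(* Gliding hump after Sokal: among [x + r v] and [x - r v], one has an inner
   product with [v] of modulus at least [r |v|^2]. *)
Lemma uniform_boundedness (Phi : set H) :
  (forall h, exists M : R, forall v, Phi v -> nrm (inner h v) <= M) ->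
  exists M : R, forall v, Phi v -> nrm v <= M.
Proof.
move=> pb; apply: contrapT => nb.
(* The step [n] has length at most [3^-n] and all later ones together at most half of it, so the
   limit pairs with [v n] to at least [3^-n / 2] times its norm: more than [(4/3)^n * (n + 1)]. *)
have big n : exists v, Phi v /\ 4 ^+ n * 2 * n.+1%:R < nrm v.
  apply: contrapT => h; apply: nb; exists (4 ^+ n * 2 * n.+1%:R) => v Pv.
  by rewrite leNgt; apply/negP => hv; apply: h; exists v.
have [v Hv] := choice big.
have v0 n : 0 < nrm (v n).
  have [_] := Hv n; apply: le_lt_trans.
  by apply: mulr_ge0 => //; apply: mulr_ge0 => //; exact: exprn_ge0.
have step (n : nat) (x : H) : exists y, nrm (y - x) <= 3^-1 ^+ n /\
    3^-1 ^+ n * nrm (v n) <= nrm (inner y (v n)).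
  pose r : R := 3^-1 ^+ n / nrm (v n).
  have r0 : 0 <= r by rewrite divr_ge0 ?nrm_ge0// exprn_ge0.
  have nr : nrm ((r%:C : C) *: v n) = 3^-1 ^+ n.
    by rewrite nrmZ nrm_real ger0_norm// /r divfK// gt_eqF.
  have e : inner (x + (r%:C : C) *: v n) (v n) - inner (x - (r%:C : C) *: v n) (v n) =
      (2 * (3^-1 ^+ n * nrm (v n)))%:C.
    rewrite !innerDl innerNl innerZl inner_nrm.
    have -> : 3^-1 ^+ n * nrm (v n) = r * nrm (v n) ^+ 2.
      rewrite /r; move: (3^-1 ^+ n : R) (nrm (v n)) (v0 n) => u w w0.
      by field; rewrite gt_eqF.
    by rewrite !rmorphM rmorph_nat; ring.
  have := ler_nrmB (inner (x + (r%:C : C) *: v n) (v n)) (inner (x - (r%:C : C) *: v n) (v n)).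
  rewrite e nrm_real ger0_norm; last first.
    by apply: mulr_ge0 => //; apply: mulr_ge0; rewrite ?nrm_ge0// exprn_ge0.
  have [h _|h h2] := leP (3^-1 ^+ n * nrm (v n)) (nrm (inner (x + (r%:C : C) *: v n) (v n))).
    by exists (x + (r%:C : C) *: v n); rewrite addrAC subrr add0r nr.
  exists (x - (r%:C : C) *: v n); rewrite addrAC subrr add0r nrmN nr; split => //.
  by lra.
have /choice[st Hst] : forall p : nat * H, exists y, nrm (y - p.2) <= 3^-1 ^+ p.1 /\
    3^-1 ^+ p.1 * nrm (v p.1) <= nrm (inner y (v p.1)) by move=> p; exact: step.
pose x := fix x n : H := if n is m.+1 then st (m, x m) else 0.
have xs n : nrm (x n.+1 - x n) <= 3^-1 ^+ n /\
    3^-1 ^+ n * nrm (v n) <= nrm (inner (x n.+1) (v n)) by exact: (Hst (n, x n)).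
have tail n k : nrm (x (n + k)%N - x n) <= 3 / 2 * 3^-1 ^+ n * (1 - 3^-1 ^+ k).
  elim: k => [|k IH]; first by rewrite addn0 subrr nrm0 expr0 subrr mulr0.
  rewrite addnS (le_trans (ler_dist_nrm (x (n + k)%N) _ _))//.
  have [h _] := xs (n + k)%N; move: h IH; rewrite exprD exprS.
  by move: (3^-1 ^+ n : R) (3^-1 ^+ k : R) => p q; lra.
have p3 k : 0 <= (3^-1 : R) ^+ k by rewrite exprn_ge0.
have tail' n m : (n <= m)%N -> nrm (x m - x n) <= 3 / 2 * 3^-1 ^+ n.
  move=> nm; rewrite -(subnKC nm) (le_trans (tail _ _))//.
  have := mulr_ge0 (p3 n) (p3 (m - n)%N).
  by move: (3^-1 ^+ n : R) (3^-1 ^+ (m - n) : R) => p q; lra.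
have geo (e : R) : 0 < e -> exists n, 3 / 2 * 3^-1 ^+ n < e.
  move=> e0; have [N hN] := inv_small e0; exists N.+1.
  apply: le_lt_trans (hN N (leqnn _)).
  have lb : N.+1%:R <= (2 : R) * 3 ^+ N.
    elim: (N) => [|m IH]; first by rewrite expr0 mulr1 ler1n.
    have : 1 <= (3 : R) ^+ m by rewrite exprn_ege1// ler1n.
    by move: IH; rewrite -(natr1 m.+1) exprS; lra.
  rewrite exprS exprVn -[leRHS]mul1r ler_pdivlMr//.
  have z3 : 0 < (3 : R) ^+ N by rewrite exprn_gt0.
  have -> : 3 / 2 * (3^-1 / 3 ^+ N) * N.+1%:R = N.+1%:R / (2 * 3 ^+ N) :> R.
    by move: (3 ^+ N : R) (N.+1%:R : R) z3 => z w z0; field; rewrite gt_eqF.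
  by rewrite ler_pdivrMr ?mul1r// mulr_gt0.
have [l xl] : exists l, tends x l.
  apply: hilbert_complete => e e0; have [N hN] := geo _ (divr_gt0 e0 (ltr0Sn _ 1)).
  exists N => m n Nm Nn; rewrite (le_lt_trans (ler_dist_nrm (x N) _ _))//.
  have := tail' _ _ Nm; have := tail' _ _ Nn; rewrite (nrmBC (x N)); lra.
have lx n : nrm (l - x n.+1) <= 2^-1 * 3^-1 ^+ n.
  apply/ler_addgt0Pr => e e0; have [N hN] := xl _ e0.
  have := ler_dist_nrm (x (maxn N n.+1)) l (x n.+1).
  have := hN _ (leq_maxl N n.+1); rewrite nrmBC.
  have := tail' _ _ (leq_maxr N n.+1); rewrite exprS; lra.
have [M HM] := pb l.
have low n : 2^-1 * 3^-1 ^+ n * nrm (v n) <= M.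
  have [Pv _] := Hv n; apply: le_trans (HM _ Pv).
  have [_ h1] := xs n.
  have h2 := inner_CS (l - x n.+1) (v n).
  have h3 : nrm (inner (l - x n.+1) (v n)) <= 2^-1 * 3^-1 ^+ n * nrm (v n).
    by apply: le_trans h2 _; rewrite ler_wpM2r ?nrm_ge0.
  have e : inner (x n.+1) (v n) = inner l (v n) - inner (l - x n.+1) (v n).
    by rewrite innerBl; ring.
  have := ler_nrmB (inner l (v n)) (inner (l - x n.+1) (v n)); rewrite -e.
  by move: h1 h3; rewrite -!mulrA; move: (3^-1 ^+ n * nrm (v n)) => p; lra.
have arch n : n.+1%:R <= M.
  apply: le_trans (low n); have [_ /ltW h] := Hv n.
  apply: (@le_trans _ _ (2^-1 * 3^-1 ^+ n * (4 ^+ n * 2 * n.+1%:R))); last first.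
    by rewrite ler_wpM2l// mulr_ge0.
  have -> : 2^-1 * 3^-1 ^+ n * (4 ^+ n * 2 * n.+1%:R) = (3^-1 * 4) ^+ n * n.+1%:R :> R.
    by rewrite exprMn; move: (3^-1 ^+ n : R) (4 ^+ n : R) (n.+1%:R : R) => p q r; field.
  by rewrite ler_peMl// exprn_ege1//; lra.
have := arch (Num.truncn M); have M0 : 0 <= M by apply: le_trans (arch 0%N).
have /andP[_] := Num.Theory.truncn_itv M0; lra.
Qed.

(** Bounded inverse theorem by duality, from uniform boundedness alone. The adjoint is bounded below
    on the closed range of [T], hence maps it onto a closed subspace, which is everything by
    injectivity. If [x = T' v], then [|x|^2] is the inner product of [T x] and [v]. *)
Lemma injective_closed_range_below (T : H -> H) : bounded_operator T ->
  closed (range T) -> (forall x, T x = 0 -> x = 0) ->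
  exists2 M : R, 0 <= M & forall x, nrm x <= M * nrm (T x).
Proof.
move=> bT cT inj; have lT := bounded_lin bT.
have [T' adj] := adjoint_exists bT.
have subV : is_subspace (range T).
  split; first by exists 0 => //; exact: lin_0 lT.
  by move=> a _ _ [x _ <-] [y _ <-]; exists (a *: x + y) => //; rewrite lT.
have lT' (a : C) u v : T' (a *: u + v) = a *: T' u + T' v.
  apply/eqP; rewrite -subr_eq0; apply/eqP/inner_eq0; set w := (X in inner X _).
  by rewrite /w innerBr innerDr innerZr -!adj innerDr innerZr subrr.
(* This set is weakly bounded: if [T x] is the projection of [h] to the range, then
   [inner h v = inner x (T' v)]. *)
have [M HM] : exists M : R, forall v, (range T v /\ nrm (T' v) <= 1) -> nrm v <= M.
  apply: (uniform_boundedness (Phi := [set v | range T v /\ nrm (T' v) <= 1])) => h.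
  have [_ [x _ <-] hx] := projection h subV cT.
  exists (nrm x) => v [Vv v1].
  have -> : inner h v = inner x (T' v).
    by rewrite -adj; apply/eqP; rewrite -subr_eq0 -innerBl hx.
  rewrite (le_trans (inner_CS _ _))// -[leRHS]mulr1 ler_wpM2l ?nrm_ge0//.
have M0 : 0 <= M.
  apply: le_trans (HM 0 _); first exact: nrm_ge0.
  by split; [case: subV|rewrite (lin_0 lT') nrm0].
have below v : range T v -> nrm v <= M * nrm (T' v).
  move=> Vv; have [h|h] := eqVneq (nrm (T' v)) 0.
    have T'v : T' v = 0 by apply/eqP; rewrite -nrm_eq0 h.
    suff -> : v = 0 by rewrite nrm0 mulr_ge0 ?nrm_ge0.
    apply: inner_eq0; case: Vv => x _ xv; rewrite -{1}xv adj T'v inner0r//.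
  have t0 : 0 < nrm (T' v) by rewrite lt_def h nrm_ge0.
  have := HM ((nrm (T' v))^-1%:C *: v) _; rewrite nrmZ nrm_real ger0_norm; last first.
    by rewrite invr_ge0 ltW.
  rewrite mulrC ler_pdivrMr//; apply; split.
    have [V0 VL] := subV; have := VL (nrm (T' v))^-1%:C _ _ Vv V0; rewrite addr0//.
  rewrite (lin_scale lT') nrmZ nrm_real ger0_norm ?invr_ge0 ?nrm_ge0// mulVf//.
pose W := [set T' v | v in range T].
have subW : is_subspace W.
  have [V0 VL] := subV; split; first by exists 0 => //; exact: lin_0 lT'.
  by move=> a _ _ [u Vu <-] [v Vv <-]; exists (a *: u + v); rewrite ?lT'//; exact: VL.
have cW : closed W.
  apply/closed_nrmP => x hx.
  have /choice[u Hu] : forall n : nat, exists u, range T u /\ nrm (x - T' u) < n.+1%:R^-1.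
    move=> n; have n0 : 0 < n.+1%:R^-1 :> R by rewrite invr_gt0.
    by have [_ [u Vu <-] h] := hx _ n0; exists u.
  have dif m n : range T (u m - u n).
    have [V0 VL] := subV; have := VL (-1) _ _ (Hu n).1 (Hu m).1.
    by rewrite scaleN1r addrC.
  have [l ul] : exists l, tends u l.
    apply: hilbert_complete => e e0.
    have M1 : 0 < M + 1 by rewrite ltr_wpDl.
    have [N hN] := inv_small (divr_gt0 (divr_gt0 e0 (ltr0Sn _ 1)) M1).
    exists N => m n Nm Nn; rewrite (le_lt_trans (below _ (dif m n)))//.
    rewrite (lin_sub lT') (@le_lt_trans _ _ ((M + 1) * nrm (T' (u m) - T' (u n))))//.
      by rewrite ler_wpM2r ?nrm_ge0// lerDl.
    rewrite mulrC -ltr_pdivlMr//.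
    have := ler_dist_nrm x (T' (u m)) (T' (u n)); rewrite (nrmBC _ x).
    have := lt_trans (Hu m).2 (hN _ Nm); have := lt_trans (Hu n).2 (hN _ Nn).
    have -> : e / (M + 1) = e / 2 / (M + 1) + e / 2 / (M + 1) by field; rewrite gt_eqF.
    by lra.
  exists l; first by apply: (tends_closed cT _ ul) => n; exact: (Hu n).1.
  apply/eqP; rewrite -subr_eq0 -nrm_eq0 eq_le nrm_ge0 andbT.
  have [_ [c c0 hc]] : (forall (a : C) x y, T' (a *: x + y) = a *: T' x + T' y) /\
      exists2 c : R, 0 <= c & forall y, nrm (T' y) <= c * nrm y.
    split => //; have [_ [c c0 hc]] := (bounded_opP T).1 bT; exists c => // y.
    have [->|y0] := eqVneq (T' y) 0; first by rewrite nrm0 mulr_ge0 ?nrm_ge0.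
    have t0 : 0 < nrm (T' y) by rewrite nrm_gt0.
    rewrite -(ler_pM2l t0); have : nrm (inner (T (T' y)) y) = nrm (T' y) * nrm (T' y).
      by rewrite adj inner_nrm nrm_real ger0_norm ?sqr_ge0// expr2.
    move=> <-; rewrite (le_trans (inner_CS _ _))// mulrA ler_wpM2r ?nrm_ge0//.
    by rewrite mulrC; exact: hc.
  apply/ler_addgt0Pr => e e0; rewrite add0r.
  have c1 : 0 < c + 1 by rewrite ltr_wpDl.
  have [N1 hN1] := inv_small (divr_gt0 e0 (ltr0Sn _ 1)).
  have [N2 hN2] := ul _ (divr_gt0 (divr_gt0 e0 (ltr0Sn _ 1)) c1).
  pose n := maxn N1 N2.
  have h1 := lt_trans (Hu n).2 (hN1 _ (leq_maxl N1 N2)).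
  have h2 := hN2 _ (leq_maxr N1 N2).
  have h3 : nrm (T' l - T' (u n)) <= e / 2.
    rewrite -(lin_sub lT') (le_trans (hc _))// nrmBC.
    rewrite (@le_trans _ _ ((c + 1) * nrm (u n - l)))//.
      by rewrite ler_wpM2r ?nrm_ge0// lerDl.
    by rewrite mulrC -ler_pdivlMr// ltW.
  have := ler_dist_nrm (T' (u n)) (T' l) x; rewrite (nrmBC (T' (u n)) x); lra.
(* A vector [y] orthogonal to [T' (T y)] satisfies [T y = 0]. *)
have WT : W = setT.
  apply: ortho_dense => // y hy; apply: inj; apply: inner_eq0.
  by rewrite adj innerC hy ?rmorph0//; exists (T y) => //; exists y.
exists M => // x; have : W x by rewrite WT.
move=> [v Vv vx]; have [->|x0] := eqVneq x 0; first by rewrite nrm0 mulr_ge0 ?nrm_ge0.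
have t0 : 0 < nrm x by rewrite nrm_gt0.
rewrite -(ler_pM2l t0).
have -> : nrm x * nrm x = nrm (inner (T x) v).
  by rewrite adj vx inner_nrm nrm_real ger0_norm ?sqr_ge0// expr2.
rewrite (le_trans (inner_CS _ _))// mulrA [leRHS]mulrC ler_wpM2l ?nrm_ge0// mulrC.
by rewrite (le_trans (below _ Vv))// vx.
Qed.

End UniformBoundedness.

(** * Fredholm theory and resolvents *)

Section Fredholm.
Variable R : realType.
Local Notation C := (cplx R).
Variable H : hilbertSpace R.
Implicit Types (T S : H -> H) (x y v k : H).

Lemma has_dim0 (V : set H) : (forall x, V x -> x = 0) -> has_dim V 0.
Proof.
move=> V0; exists (fun i : 'I_0 => 0); split=> [[]//|x /V0 ->].
by exists 0; split=> [|c _]; [rewrite big_ord0|exact/esym/thinmx0].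
Qed.

Lemma has_dim1 (V : set H) k : V k -> k <> 0 ->
  (forall x, V x -> exists c : C, x = c *: k) -> has_dim V 1.
Proof.
move=> Vk k0 Vc; exists (fun=> k); split=> // x /Vc[c ->].
exists (\row_(i < 1) c); split=> [|d]; first by rewrite big_ord1 mxE.
rewrite big_ord1 => /eqP; rewrite -subr_eq0 -scalerBl scaler_eq0 => /orP[|/eqP//].
by rewrite subr_eq0 => /eqP ->; apply/rowP => i; rewrite mxE (ord1 i).
Qed.

Lemma inverse_fredholm T T' : bounded_operator T -> bounded_inverse T T' ->
  fredholm_dims T 0 0.
Proof.
move=> bT [bT' T1 T2]; have lT := bounded_lin bT; split.
- rewrite (_ : range T = setT); first exact: closedT.
  by rewrite -subTset => y _; exists (T' y).
- by apply: has_dim0 => x Tx; rewrite -(T1 x) Tx (lin_0 (bounded_lin bT')).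
- have [Ta adj] := adjoint_exists bT; exists Ta => //.
  apply: has_dim0 => y Ty; apply: inner_eq0.
  by rewrite -{1}(T2 y) adj Ty inner0r.
Qed.

Lemma closed_range_below T (c : R) : bounded_operator T -> 0 < c ->
  (forall x, c * nrm x <= nrm (T x)) -> closed (range T).
Proof.
move=> bT c0 below; have [lT [M M0 HM]] := (bounded_opP T).1 bT.
apply/closed_nrmP => y hy.
have /choice[u Hu] : forall n : nat, exists u, nrm (y - T u) < n.+1%:R^-1.
  move=> n; have n0 : 0 < n.+1%:R^-1 :> R by rewrite invr_gt0.
  by have [_ [u _ <-] h] := hy _ n0; exists u.
have [l ul] : exists l, tends u l.
  apply: hilbert_complete => e e0.
  have [N hN] := inv_small (divr_gt0 (mulr_gt0 e0 c0) (ltr0Sn _ 1)).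
  exists N => m n Nm Nn; rewrite -(ltr_pM2l c0) (le_lt_trans (below _))// (lin_sub lT).
  have := ler_dist_nrm y (T (u m)) (T (u n)); rewrite (nrmBC (T (u m)) y).
  have := lt_trans (Hu m) (hN _ Nm); have := lt_trans (Hu n) (hN _ Nn).
  lra.
exists l => //; apply/eqP; rewrite -subr_eq0 -nrm_eq0 eq_le nrm_ge0 andbT.
apply/ler_addgt0Pr => e e0; rewrite add0r.
have M1 : 0 < M + 1 by rewrite ltr_wpDl.
have [N1 hN1] := inv_small (divr_gt0 e0 (ltr0Sn _ 1)).
have [N2 hN2] := ul _ (divr_gt0 (divr_gt0 e0 (ltr0Sn _ 1)) M1).
have h1 := lt_trans (Hu (maxn N1 N2)) (hN1 _ (leq_maxl N1 N2)).
have h2 := hN2 _ (leq_maxr N1 N2).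
set n := maxn N1 N2 in h1 h2.
have h3 : nrm (T l - T (u n)) <= e / 2.
  rewrite -(lin_sub lT) (le_trans (HM _))// nrmBC.
  rewrite (@le_trans _ _ ((M + 1) * nrm (u n - l)))//.
    by rewrite ler_wpM2r ?nrm_ge0// lerDl.
  by rewrite mulrC -ler_pdivlMr// ltW.
have := ler_dist_nrm (T (u n)) (T l) y; rewrite (nrmBC (T (u n)) y); lra.
Qed.

Lemma fredholm01 T (c : R) k : bounded_operator T -> 0 < c ->
  (forall x, c * nrm x <= nrm (T x)) -> k <> 0 -> (forall x, inner (T x) k = 0) ->
  (forall y, inner y k = 0 -> range T y) -> fredholm_dims T 0 1.
Proof.
move=> bT c0 below k0 Tk Tr; split; first exact: closed_range_below bT c0 below.
  apply: has_dim0 => x Tx; apply/eqP; rewrite -nrm_eq0 eq_le nrm_ge0 andbT.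
  by have := below x; rewrite Tx nrm0 -ler_pdivlMl// mulr0.
have [Ta adj] := adjoint_exists bT; exists Ta => //.
have kerE y : Ta y = 0 <-> forall x, inner (T x) y = 0.
  split=> [h x|h]; first by rewrite adj h inner0r.
  by apply: inner_eq0; rewrite -adj h.
apply: (@has_dim1 _ k) => //; first exact/kerE.
move=> y /kerE hy; have kk : inner k k != 0 by apply/eqP => /inner_eq0.
exists (inner y k / inner k k); apply/eqP; rewrite -subr_eq0; apply/eqP.
have [|x _ Tx] := Tr (y - (inner y k / inner k k) *: k).
  by rewrite innerBl innerZl divfK// subrr.
by apply: inner_eq0; rewrite -{1}Tx innerBr hy innerZr Tk mulr0 subrr.
Qed.

(* Near [l] there are points [mu] and [b] at distance [d]: if [S - l] were bounded
   below, so would [S - mu], and [k = (S - mu) h] would be too close to [(S - b) h],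
   to which it is orthogonal. *)
Lemma not_bounded_below S (l : C) (V : set H) : bounded_operator S ->
  is_subspace V -> closed V ->
  (forall d : R, 0 < d -> exists mu b k, [/\ nrm (mu - b) < d, nrm (l - mu) < d,
    forall v, V v -> exists2 h, V h & sub_scalar S mu h = v,
    exists2 v, V v & inner v k <> 0
  & forall v, V v -> inner (sub_scalar S b v) k = 0]) ->
  forall c : R, 0 < c -> ~ (forall x, c * nrm x <= nrm (sub_scalar S l x)).
Proof.
move=> bS sV cV hyp c c0 below.
have [|mu [b [k [mub lmu surj [v Vv vk] ker]]]] := hyp (c / 4); first by rewrite divr_gt0.
have [k0 Vk0 hk0] := projection k sV cV.
have kk0 w : V w -> inner w k = inner w k0.
  by move=> Vw; apply/eqP; rewrite -subr_eq0 -innerBr innerC hk0// rmorph0.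
have k0n : 0 < nrm k0.
  by rewrite nrm_gt0; apply/eqP => h; apply: vk; rewrite kk0// h inner0r.
have [h Vh hh] := surj _ Vk0.
have e1 : sub_scalar S b h = k0 + (mu - b) *: h.
  by rewrite -hh /sub_scalar scalerBl addrA subrK.
have Vb : V (sub_scalar S b h).
  by rewrite e1 addrC; case: sV => _; apply.
have := ker _ Vh; rewrite kk0// e1 innerDl innerZl inner_nrm => e2.
have e3 : nrm k0 ^+ 2 = nrm (mu - b) * nrm (inner h k0).
  have := congr1 (@nrm R C) (addr0_eq e2).
  by rewrite nrmN nrm_real nrmM ger0_norm ?sqr_ge0.
have e4 : c / 2 * nrm h <= nrm k0.
  rewrite -hh; have := below h.
  have -> : sub_scalar S l h = sub_scalar S mu h - (l - mu) *: h.
    by rewrite /sub_scalar scalerBl opprB addrA subrK.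
  have := ler_nrmB (sub_scalar S mu h) ((l - mu) *: h); rewrite nrmZ.
  have := nrm_ge0 h; move: lmu; nra.
have e5 : nrm k0 ^+ 2 <= c / 4 * nrm h * nrm k0.
  rewrite e3 -mulrA ler_pM ?nrm_ge0//; first exact: ltW.
  exact: inner_CS.
have : nrm k0 <= c / 4 * nrm h.
  by rewrite -(ler_pM2r k0n) -expr2.
have := e4; lra.
Qed.

Lemma not_fredholm T (m n : nat) : bounded_operator T -> (forall x, T x = 0 -> x = 0) ->
  (forall c : R, 0 < c -> ~ (forall x, c * nrm x <= nrm (T x))) -> ~ fredholm_dims T m n.
Proof.
move=> bT inj nb [cT _ _].
have [M M0 HM] := injective_closed_range_below bT cT inj.
have M1 : 0 < M + 1 by rewrite ltr_wpDl.
apply: (nb (M + 1)^-1); first by rewrite invr_gt0.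
move=> x; rewrite ler_pdivrMl// (le_trans (HM x))// ler_wpM2r ?nrm_ge0// lerDl//.
Qed.

(** For a normal operator an eigenvector is also an eigenvector of the adjoint, for the conjugate
    eigenvalue; this is applied to [J v] in the larger space. *)
Lemma subnormal_eigen S (l : C) v : subnormal_operator S -> S v = l *: v ->
  forall y, inner (S y) v = l * inner y v.
Proof.
move=> [L [J [M [lJ iJ [bM [M' [adj comm]]] MJ]]]] Sv y.
have lM := bounded_lin bM.
have MJv : M (J v) = l *: J v.
  by rewrite MJ Sv -[l *: v]addr0 lJ (lin_0 lJ) addr0.
have M'Jv : M' (J v) = l^* *: J v.
  apply/eqP; rewrite -subr_eq0; apply/eqP/inner_eq0.
  have e : inner (M' (J v)) (M' (J v)) = inner (M (J v)) (M (J v)).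
    by rewrite -adj; have := congr1 (fun f => f (J v)) comm => /= ->; rewrite innerC -adj -innerC.
  have e' : inner (M' (J v)) (J v) = l^* * inner (J v) (J v).
    by rewrite innerC -adj MJv innerZl rmorphM/= -innerC.
  have e'' : inner (J v) (M' (J v)) = l * inner (J v) (J v).
    by rewrite -adj MJv innerZl.
  rewrite innerBl !innerBr !innerZl !innerZr e e' e'' MJv innerZl innerZr.
  have cc : l^*^* = l by apply: ReImE; rewrite ?ReJ ?ImJ ?opprK.
  by rewrite cc; ring.
rewrite -iJ -MJ adj M'Jv innerZr iJ.
by congr (_ * _); apply: ReImE; rewrite ?ReJ ?ImJ ?opprK.
Qed.

(** By [subnormal_eigen] the line through [v] reduces [S], so it is the whole space. For the models
    this excludes eigenvectors, and failure of a lower bound then excludes the Fredholm property. *)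
Lemma irreducible_eigen S (l : C) v : subnormal_operator S -> irreducible_operator S ->
  bounded_operator S -> S v = l *: v -> v <> 0 -> forall y, exists t : C, y = t *: v.
Proof.
move=> sS iS bS Sv v0 y; have lS := bounded_lin bS.
have vv : inner v v != 0 by apply/eqP => /inner_eq0.
pose pr y := (inner y v / inner v v) *: v.
pose V : set H := [set y | y = pr y].
have prL (a : C) x z : pr (a *: x + z) = a *: pr x + pr z.
  by rewrite /pr innerDl innerZl mulrDl scalerDl scalerA mulrA.
have prv (t : C) : pr (t *: v) = t *: v by rewrite /pr innerZl -mulrA divff// mulr1.
have [|h|h] := iS V.
- split.
  + split; first by rewrite /V/= /pr inner0l mul0r scale0r.
    move=> a x z Vx Vz; have ex : x = pr x := Vx; have ez : z = pr z := Vz.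
    by rewrite /V/= prL -ex -ez.
  + apply/closed_nrmP => x hx; apply/eqP; rewrite -subr_eq0 -nrm_eq0 eq_le nrm_ge0 andbT.
    have prc z : nrm (pr z) <= nrm z.
      have nv : 0 < nrm v by rewrite nrm_gt0; apply/eqP.
      rewrite /pr nrmZ nrmM nrmV inner_nrm nrm_real (ger0_norm (sqr_ge0 _)) mulrAC.
      rewrite ler_pdivrMr ?exprn_gt0// expr2 mulrA ler_wpM2r ?nrm_ge0//.
      exact: inner_CS.
    apply/ler_addgt0Pr => e e0; rewrite add0r.
    have [z Vz xz] := hx _ (divr_gt0 e0 (ltr0Sn _ 1)).
    have := ler_dist_nrm z x (pr x); rewrite {2}Vz -(lin_sub prL).
    by have := prc (z - x); rewrite (nrmBC z x); lra.
  + move=> _ [x Vx <-]; rewrite /V/= Vx /pr (lin_scale lS) Sv scalerA; exact/esym/prv.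
  + move=> _ [x Vx <-] z Vz; have ez : z = pr z := Vz.
    rewrite ez /pr innerZl [inner v (S x)]innerC (subnormal_eigen sS Sv).
    rewrite [inner x v]innerC (_ : inner v x = 0) ?rmorph0 ?mulr0 ?rmorph0 ?mulr0//.
    by apply: Vx; rewrite /V/= -[v]scale1r prv.
- have : V v by rewrite /V/= -[v in LHS]scale1r -[v in RHS]scale1r prv.
  by rewrite h.
- by have : V y by [rewrite h]; rewrite /V/= /pr => ->; exists (inner y v / inner v v).
Qed.

Lemma reducing_projection S (V : set H) : bounded_operator S -> reducing_subspace S V ->
  exists P : H -> H, [/\ forall (a : C) x y, P (a *: x + y) = a *: P x + P y,
    forall x, nrm (P x) <= nrm x, forall x y, inner (P x) y = inner x (P y),
    forall x, P (P x) = P x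
  & (forall x, P (S x) = S (P x)) /\ forall x, V x <-> P x = x].
Proof.
move=> bS [sV cV SV SV']; have lS := bounded_lin bS.
have /choice[P HP] : forall x, exists v, V v /\ forall w, V w -> inner (x - v) w = 0.
  by move=> x; have [v Vv hv] := projection x sV cV; exists v.
have [V0 VL] := sV.
have Peq x v : V v -> (forall w, V w -> inner (x - v) w = 0) -> P x = v.
  move=> Vv hv; have [VPx hP] := HP x.
  have Vd : V (P x - v) by have := VL (-1) _ _ Vv VPx; rewrite scaleN1r addrC.
  apply/eqP; rewrite -subr_eq0; apply/eqP/inner_eq0.
  have -> : inner (P x - v) (P x - v) = inner (x - v) (P x - v) - inner (x - P x) (P x - v).
    by rewrite -innerBl (_ : x - v - (x - P x) = P x - v)// opprB addrC addrA subrK.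
  by rewrite hv// hP// subrr.
have PL (a : C) x y : P (a *: x + y) = a *: P x + P y.
  apply: Peq; first by apply: VL; [case: (HP x)|case: (HP y)].
  move=> w Vw; have [_ hx] := HP x; have [_ hy] := HP y.
  by rewrite opprD addrACA -scalerBr innerDl innerZl hx// hy// mulr0 addr0.
have PV x : V x -> P x = x by move=> Vx; apply: Peq => // w _; rewrite subrr inner0l.
have VP x : V (P x) by case: (HP x).
have PS x : P (S x) = S (P x).
  apply: Peq; first by apply: SV; exists (P x).
  move=> w Vw; rewrite -(lin_sub lS) innerC.
  have : ortho_compl V (S (x - P x)).
    apply: SV'; exists (x - P x) => //= z Vz; rewrite innerC.
    by have [_ h] := HP x; rewrite h// rmorph0.
  by move=> /(_ _ Vw) ->; rewrite rmorph0.
have orth x y : inner (P x) (y - P y) = 0.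
  by have [_ h] := HP y; rewrite innerC h// rmorph0.
have Psa x y : inner (P x) y = inner x (P y).
  have h1 : inner (P x) y = inner (P x) (P y).
    by apply/eqP; rewrite -subr_eq0 -innerBr orth.
  have h2 : inner x (P y) = inner (P x) (P y).
    by apply/eqP; rewrite -subr_eq0 -innerBl; have [_ h] := HP x; rewrite h.
  by rewrite h1 h2.
exists P; split => //.
- move=> x; have [->|Px0] := eqVneq (P x) 0; first by rewrite nrm0 nrm_ge0.
  have p0 : 0 < nrm (P x) by rewrite nrm_gt0.
  rewrite -(ler_pM2l p0) -expr2 -[leLHS]ger0_norm ?sqr_ge0// -(@nrm_real R) -inner_nrm.
  by rewrite -Psa (PV _ (VP x)); exact: inner_CS.
- by move=> x; exact: PV.
- by split=> // x; split=> [|<-//]; exact: PV.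
Qed.

End Fredholm.

Section Resolvents.
Variable R : realType.
Local Notation C := (cplx R).

Lemma bounded_below_dense (E : lmodType C) (D : set E) (H : hilbertSpace R) (tau : E -> H)
    (T : H -> H) (c : R) : model D tau -> bounded_operator T -> 0 <= c ->
  (forall x, D x -> c * nrm (tau x) <= nrm (T (tau x))) ->
  forall h, c * nrm h <= nrm (T h).
Proof.
move=> [_ _ _ mD] bT c0 below h; have [lT [M M0 HM]] := (bounded_opP T).1 bT.
apply/ler_addgt0Pr => e e0.
have cM : 0 < c + M + 1 by rewrite ltr_wpDl// addr_ge0.
have [x Dx hx] := mD h _ (divr_gt0 e0 cM).
have h1 : nrm (T (tau x)) <= nrm (T h) + M * nrm (h - tau x).
  have := ler_nrmB (T h) (T (h - tau x)); rewrite {1}(lin_sub lT) opprB addrC subrK.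
  by have := HM (h - tau x); lra.
have h2 : nrm h <= nrm (tau x) + nrm (h - tau x).
  by have := ler_nrmD (tau x) (h - tau x); rewrite addrC subrK.
have := below _ Dx; move: hx; rewrite ltr_pdivlMr// => hx.
have := nrm_ge0 (h - tau x); move: h1 h2 hx; move: (nrm (h - tau x)) => d; nra.
Qed.

Lemma dense_resolvent (E : lmodType C) (D : set E) (H : hilbertSpace R) (tau : E -> H)
    (T : H -> H) (c : R) : model D tau -> bounded_operator T -> 0 < c ->
  (forall x, D x -> c * nrm (tau x) <= nrm (T (tau x))) ->
  (forall x, D x -> exists2 y, D y & T (tau y) = tau x) ->
  (exists T', bounded_inverse T T') /\ forall h, c * nrm h <= nrm (T h).
Proof.
move=> mD bT c0 below onto; have lT := bounded_lin bT.
have bel := bounded_below_dense mD bT (ltW c0) below; split => //.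
have cT := closed_range_below bT c0 bel.
have /choice[T' HT'] : forall y, exists x, T x = y.
  move=> y; have [x _ xy] : range T y; last by exists x.
  apply/((closed_nrmP _).1 cT) => e e0; have [_ _ _ /(_ y e e0)[x Dx yx]] := mD.
  by have [z Dz Tz] := onto _ Dx; exists (T (tau z)); rewrite ?Tz//; exists (tau z).
have inj x y : T x = T y -> x = y.
  move=> h; apply/eqP; rewrite -subr_eq0 -nrm_eq0 eq_le nrm_ge0 andbT.
  by have := bel (x - y); rewrite (lin_sub lT) h subrr nrm0 -ler_pdivlMl// mulr0.
exists T'; split => //; last by move=> x; apply: inj; rewrite HT'.
apply/bounded_opP; split; first by move=> a x y; apply: inj; rewrite lT !HT'.
exists c^-1; first by rewrite invr_ge0 ltW.
by move=> x; rewrite ler_pdivlMl// -{2}(HT' x).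
Qed.

Variable H : hilbertSpace R.
Implicit Types (S : H -> H) (V : set H).

Lemma closure_subspace V : is_subspace V -> is_subspace (closure V).
Proof.
move=> [V0 VL]; split; first exact: subset_closure.
move=> a x y /closure_nrmP hx /closure_nrmP hy; apply/closure_nrmP => e e0.
have a0 : 0 < nrm a + 1 by rewrite ltr_wpDl ?nrm_ge0.
have [x' Vx' xx'] := hx _ (divr_gt0 (divr_gt0 e0 (ltr0Sn _ 1)) a0).
have [y' Vy' yy'] := hy _ (divr_gt0 e0 (ltr0Sn _ 1)).
exists (a *: x' + y'); first exact: VL.
rewrite opprD addrACA -scalerBr (le_lt_trans (ler_nrmD _ _))// nrmZ.
move: xx'; rewrite ltr_pdivlMr//; have := nrm_ge0 (x - x'); have := nrm_ge0 a; nra.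
Qed.

Lemma closure_invariant S V : bounded_operator S -> (forall x, V x -> V (S x)) ->
  forall x, closure V x -> closure V (S x).
Proof.
move=> bS VS x /closure_nrmP hx; apply/closure_nrmP => e e0.
have [lS [M M0 HM]] := (bounded_opP S).1 bS.
have M1 : 0 < M + 1 by rewrite ltr_wpDl.
have [y Vy xy] := hx _ (divr_gt0 e0 M1); exists (S y); first exact: VS.
rewrite -(lin_sub lS) (le_lt_trans (HM _))//; move: xy; rewrite ltr_pdivlMr//.
by have := nrm_ge0 (x - y); nra.
Qed.

(* Since [(S - l0) y = (S - l) y + (l - l0) y], the distance of [y] to [P] is at
   most [|l - l0| / d] times itself. *)
Lemma resolvent_transport S (P : set H) (l l0 : C) (d : R) : bounded_operator S ->
  is_subspace P -> closed P -> 0 < d -> nrm (l - l0) < d ->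
  (forall x, d * nrm x <= nrm (sub_scalar S l0 x)) ->
  (forall x, exists y, sub_scalar S l0 y = x) ->
  (forall x, P x -> exists2 y, P y & sub_scalar S l0 y = x) ->
  forall y, P (sub_scalar S l y) -> P y.
Proof.
move=> bS sP cP d0 ld below onto PR y Py.
have [p Pp hp] := projection y sP cP; have [P0 PL] := sP.
have l0L := bounded_lin (bounded_sub_scalar bS l0).
suff h : y - p = 0 by move/eqP: h; rewrite subr_eq0 => /eqP ->.
have e1 : sub_scalar S l0 y = sub_scalar S l y + (l - l0) *: y.
  by rewrite /sub_scalar scalerBl addrA subrK.
have [w Hw] := onto (y - p).
have [q Pq Hq] : exists2 q, P q & sub_scalar S l0 q = sub_scalar S l y + (l - l0) *: p.
  by apply: PR; rewrite addrC; exact: PL.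
have e2 : y = q + (l - l0) *: w.
  have inj x z : sub_scalar S l0 x = sub_scalar S l0 z -> x = z.
    move=> h; apply/eqP; rewrite -subr_eq0 -nrm_eq0 eq_le nrm_ge0 andbT.
    by have := below (x - z); rewrite (lin_sub l0L) h subrr nrm0 -ler_pdivlMl// mulr0.
  apply: inj; rewrite addrC l0L Hw Hq e1 addrCA; congr (_ + _).
  by rewrite -scalerDr subrK.
have min : nrm (y - p) <= nrm (y - q).
  have o : inner (y - p) (p - q) = 0.
    by apply: hp; have := PL (-1) _ _ Pq Pp; rewrite scaleN1r addrC.
  rewrite -(@ler_pXn2r _ 2)// ?nnegrE ?nrm_ge0//.
  have -> : y - q = (y - p) + (p - q) by rewrite addrA subrK.
  by rewrite (nrm_sqrD (y - p) (p - q)) o/= mulr0 addr0 lerDl sqr_ge0.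
have e3 : nrm (y - q) <= nrm (l - l0) * nrm w by rewrite e2 addrAC subrr add0r nrmZ.
have := below w; rewrite Hw => e4.
apply/eqP; rewrite -nrm_eq0 eq_le nrm_ge0 andbT leNgt; apply/negP => pos.
have w0 : 0 < nrm w.
  rewrite lt_def nrm_ge0 andbT; apply: contraTneq pos => w0.
  by rewrite -leNgt; move: min e3; rewrite w0 mulr0; lra.
by move: e4 e3 min; have := nrm_ge0 (l - l0); nra.
Qed.

(* Runge's theorem: the set of the [l] off [K] whose resolvent leaves [P]
   invariant is open and closed in the complement of [K]. *)
Lemma resolvent_runge S (K : set C) (P : set H) : bounded_operator S ->
  compact K -> connected (~` K) -> is_subspace P -> closed P ->
  (forall x, P x -> P (S x)) ->
  (forall l (d : R), 0 < d -> (forall z, K z -> d <= nrm (z - l)) ->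
     (forall x, d * nrm x <= nrm (sub_scalar S l x)) /\
     forall x, exists y, sub_scalar S l y = x) ->
  forall l y, ~ K l -> P (sub_scalar S l y) -> P y.
Proof.
move=> bS cK conK sP cP PS res.
have dist l : ~ K l -> exists2 d : R, 0 < d & forall z, K z -> d <= nrm (z - l).
  move=> Kl; apply: contrapT => h; apply: Kl.
  apply/((closed_nrmP _).1 (compact_closed_nrm cK)) => e e0; apply: contrapT => h'.
  apply: h; exists e => // z Kz; rewrite leNgt; apply/negP => zl; apply: h'; exists z => //.
  by rewrite nrmBC.
pose good l := forall y, P (sub_scalar S l y) -> P y.
have trans l l0 (d : R) : 0 < d -> (forall z, K z -> d <= nrm (z - l0)) ->
    nrm (l - l0) < d -> good l0 -> good l.
  move=> d0 Kd ld g y; have [below onto] := res _ _ d0 Kd.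
  apply: (resolvent_transport bS sP cP d0 ld below onto) => x Px.
  by have [z hz] := onto x; exists z => //; apply: g; rewrite hz.
pose B := ~` K `&` [set l | good l].
suff e : ~` K = B.
  by move=> l y nK; have [_] : B l by [rewrite -e]; exact.
have [_ [c c0 hc]] := (bounded_opP S).1 bS.
have [M HM] := compact_bounded cK.
symmetry; apply: conK.
(* The starting point lies off [K] and beyond the norm bound of [S]. There [q] is a point of [P]
   with [y - q = L^-1 * S (y - p)], closer to [y] than its projection [p] unless [y = p]. *)
- pose L : C := (`|M| + c + 1)%:C; have nL : nrm L = `|M| + c + 1.
    by rewrite nrm_real ger0_norm// addr_ge0// addr_ge0.
  have KL : ~ K L.
    by move=> /HM; rewrite nL; have := ler_norm M; lra.
  exists L; split => // y Py.
  have [p Pp hp] := projection y sP cP; have [P0 PL] := sP.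
  suff h : y - p = 0 by move/eqP: h; rewrite subr_eq0 => /eqP ->.
  have lS := bounded_lin bS.
  have L0 : L != 0 by rewrite -nrm_gt0 nL ltr_wpDl// addr_ge0.
  pose q := L^-1 *: (S p - sub_scalar S L y).
  have Pq : P q.
    have h1 : P (S p - sub_scalar S L y).
      by have := PL (-1) _ _ Py (PS _ Pp); rewrite scaleN1r addrC.
    by have := PL L^-1 _ _ h1 P0; rewrite addr0.
  have e1 : y - q = L^-1 *: S (y - p).
    apply: (scalerI L0); rewrite /q scalerBr !scalerA divff// !scale1r (lin_sub lS).
    by rewrite /sub_scalar opprB addrA [L *: y + _]addrC subrK.
  have min : nrm (y - p) <= nrm (y - q).
    have o : inner (y - p) (p - q) = 0.
      by apply: hp; have := PL (-1) _ _ Pq Pp; rewrite scaleN1r addrC.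
    rewrite -(@ler_pXn2r _ 2)// ?nnegrE ?nrm_ge0//.
    have -> : y - q = (y - p) + (p - q) by rewrite addrA subrK.
    by rewrite (nrm_sqrD (y - p) (p - q)) o/= mulr0 addr0 lerDl sqr_ge0.
  move: min; rewrite e1 nrmZ nrmV nL ler_pdivlMl; last by rewrite ltr_wpDl// addr_ge0.
  have := hc (y - p) => h1 h2; apply/eqP; rewrite -nrm_eq0 eq_le nrm_ge0 andbT.
  by have := normr_ge0 M; have := nrm_ge0 (y - p); nra.
- exists (interior B); first exact: open_interior.
  apply/seteqP; split=> [l [nK g]|l [_ /interior_subset]//]; split => //.
  have [d d0 Kd] := dist _ nK; apply/interior_nrmP; exists d => // z lz; split.
    by move=> /Kd; rewrite nrmBC leNgt lz.
  have zl : nrm (z - l : C) < d by have := nrmBC (z : C) l; move=> ->.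
  exact: (trans z l d d0 Kd zl g).
- exists (closure B); first exact: closed_closure.
  apply/seteqP; split=> [l [nK g]|l [nK /closure_nrmP cl]]; split => //.
    exact: subset_closure.
  have [d d0 Kd] := dist _ nK.
  have [l0 [_ g0] ll0] := cl _ (divr_gt0 d0 (ltr0Sn _ 1)).
  apply: (trans _ _ (d / 2)) g0; first by rewrite divr_gt0.
    move=> z /Kd h; have := ler_dist_nrm l0 z l; rewrite (nrmBC l0 l); lra.
  by [].
Qed.

Lemma inverse_prod_in S (P : set H) (s : seq C) : bounded_operator S ->
  (forall l y, l \in s -> P (sub_scalar S l y) -> P y) ->
  forall y, P (poly_op S (\prod_(z <- s) ('X - z%:P)) y) -> P y.
Proof.
move=> bS; elim: s => [_ y|z s IH h y]; first by rewrite big_nil poly_op1.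
rewrite big_cons poly_opM// poly_opXsub// => hy.
apply: IH; first by move=> l x ls; apply: h; rewrite inE ls orbT.
by apply: h hy; rewrite inE eqxx.
Qed.

(** The closed polynomial span is invariant under [S], hence by [resolvent_runge] under the
    resolvents off the spectrum. Factoring a denominator into linear factors gives all rational
    functions of [S]. *)
Lemma R2_P2 S (N : nat) (F : 'I_N -> H) : bounded_operator S ->
  compact (spectrum S) -> spectrum S !=set0 -> connected (~` spectrum S) ->
  (forall l (d : R), 0 < d -> (forall z, spectrum S z -> d <= nrm (z - l)) ->
     (forall x, d * nrm x <= nrm (sub_scalar S l x)) /\
     forall x, exists y, sub_scalar S l y = x) ->
  R2 S F `<=` P2 S F.
Proof.
move=> bS cK [z0 Sz0] con res.
pose V := [set x | exists p : 'I_N -> {poly C}, x = \sum_(i < N) poly_op S (p i) (F i)].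
have sV : is_subspace V.
  split; first by exists (fun=> 0); rewrite big1// => i _; rewrite poly_op0.
  move=> a _ _ [p ->] [q ->]; exists (fun i => a *: p i + q i).
  rewrite scaler_sumr -big_split/=; apply: eq_bigr => i _.
  by rewrite poly_opD poly_opZ.
have [P0 PL] := closure_subspace sV.
have cV : closed (closure V) by exact: closed_closure.
have VS x : V x -> V (S x).
  move=> [p ->]; exists (fun i => p i * 'X); rewrite (lin_sum (bounded_lin bS)).
  by apply: eq_bigr => i _; rewrite poly_opMX.
have run := resolvent_runge bS cK con (conj P0 PL) cV (closure_invariant bS VS) res.
have sub x : (exists A : 'I_N -> (H -> H), (forall i, rat_op S (A i)) /\
    x = \sum_(i < N) A i (F i)) -> closure V x.
  move=> [A [rA ->]].
  have Psum (G : 'I_N -> H) : (forall i, closure V (G i)) -> closure V (\sum_(i < N) G i).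
    by move=> hG; apply: big_ind => // u v hu hv; have := PL 1 _ _ hu hv; rewrite scale1r.
  apply: Psum => i; have [p [q [Q [zf invQ AE]]]] := rA i.
  have [s qs] := closed_field_poly_normal q.
  have lc : lead_coef q != 0.
    by rewrite lead_coef_eq0; apply: contraNneq (zf _ Sz0) => ->; rewrite horner0.
  apply: (@inverse_prod_in S (closure V) s bS).
    move=> l y ls; apply: run => Sl; have := zf _ Sl; rewrite qs hornerZ.
    by rewrite mulf_eq0 -/(root _ l) root_prod_XsubC ls orbT.
  have := rat_op_eq bS (F i) invQ AE; rewrite {1}qs poly_opZ => e.
  have -> : poly_op S (\prod_(z <- s) ('X - z%:P)) (A i (F i)) =
      (lead_coef q)^-1 *: poly_op S p (F i) + 0.
    by rewrite addr0 -e scalerA mulVf// scale1r.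
  apply: PL => //; apply: subset_closure; exists (fun j => if j == i then p else 0).
  rewrite (bigD1 i)//= eqxx big1 ?addr0// => j ji; rewrite (negPf ji) poly_op0//.
by move=> x Rx; apply: cV; exact: closure_subset Rx.
Qed.

Lemma P2_R2 S (N : nat) (F : 'I_N -> H) : bounded_operator S -> P2 S F `<=` R2 S F.
Proof.
move=> bS; apply: closure_subset => _ [p ->].
exists (fun i => poly_op S (p i)); split=> // i; exists (p i), 1, id; split.
- exact: zero_free1.
- by split; [exact: bounded_id|move=> x; exact: poly_op1|move=> x; exact: poly_op1].
- by [].
Qed.

End Resolvents.

(** * Multiplication operators on completed function spaces *)

Record gns_data (R : realType) (T : Type) (Gam : (T -> R) -> R) (zeta : T -> cplx R)
    (E : lmodType (cplx R)) (D : set E) (t : E -> T -> (cplx R)^o) (Z : E -> E)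
    (H : hilbertSpace R) (tau : E -> H) (S : H -> H) : Prop := GnsData {
  gns_GamL : forall (c : R) u v, bfun u -> bfun v ->
    Gam (fun s => c * u s + v s) = c * Gam u + Gam v;
  gns_Gam_ge0 : forall u, bfun u -> (forall s, 0 <= u s) -> 0 <= Gam u;
  gns_tL : forall (a : cplx R) x y, D x -> D y -> t (a *: x + y) = a *: t x + t y;
  gns_tb : forall x, D x -> cbf (t x);
  gns_ZD : forall x, D x -> D (Z x);
  gns_tZ : forall x s, D x -> t (Z x) s = zeta s * t x s;
  gns_mod : model D tau;
  gns_inner : forall x y, D x -> D y -> inner (tau x) (tau y) = gform Gam (t x) (t y);
  gns_bounded : bounded_operator S;
  gns_subnormal : subnormal_operator S;
  gns_S : forall x, D x -> S (tau x) = tau (Z x) }.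

Lemma gns_exists (R : realType) (T : Type) (Gam : (T -> R) -> R) (zeta : T -> cplx R)
    (kappa : T -> nat) (M : R) (E : lmodType (cplx R)) (D : set E)
    (t : E -> T -> (cplx R)^o) (Z : E -> E) :
  (forall (a : R) u v, bfun u -> bfun v ->
    Gam (fun t => a * u t + v t) = a * Gam u + Gam v) ->
  (forall u, bfun u -> (forall t, 0 <= u t) -> 0 <= Gam u) ->
  (forall t, nrm (zeta t) <= M) ->
  D 0 -> (forall (a : cplx R) x y, D x -> D y -> D (a *: x + y)) ->
  (forall (a : cplx R) x y, D x -> D y -> t (a *: x + y) = a *: t x + t y) ->
  (forall x, D x -> lip_class zeta kappa (t x)) ->
  (forall x, D x -> D (Z x)) ->
  (forall (a : cplx R) x y, D x -> D y -> Z (a *: x + y) = a *: Z x + Z y) ->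
  (forall x s, D x -> t (Z x) s = zeta s * t x s) ->
  exists (H : hilbertSpace R) (tau : E -> H) (S : H -> H),
    gns_data Gam zeta D t Z tau S.
Proof.
move=> GL Gp zM D0 DL tL tl ZD ZL tZ.
have [H [tau [S [mD iD bS sS HS]]]] := gns_model GL Gp zM D0 DL tL tl ZD ZL tZ.
by exists H, tau, S; split => // x /tl[].
Qed.

Section GnsFacts.
Variables (R : realType).
Local Notation C := (cplx R).
Variables (T : Type) (Gam : (T -> R) -> R) (zeta : T -> C).
Variables (E : lmodType C) (D : set E) (t : E -> T -> C^o) (Z : E -> E).
Variables (H : hilbertSpace R) (tau : E -> H) (S : H -> H).
Hypothesis g : gns_data Gam zeta D t Z tau S.
Let pB := gform_psd (gns_GamL g) (gns_Gam_ge0 g).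

Lemma gns_D0 : D 0. Proof. by case: (gns_mod g). Qed.
Lemma gns_DL (a : C) x y : D x -> D y -> D (a *: x + y).
Proof. by case: (gns_mod g) => _ h _ _; exact: h. Qed.
Lemma gns_tauL (a : C) x y : D x -> D y -> tau (a *: x + y) = a *: tau x + tau y.
Proof. by case: (gns_mod g) => _ _ h _; exact: h. Qed.
Lemma gns_tau0 : tau 0 = 0.
Proof.
have := gns_tauL (-1) gns_D0 gns_D0.
by rewrite scaler0 addr0 scaleN1r addNr.
Qed.
Lemma gns_DD x y : D x -> D y -> D (x + y).
Proof. by move=> Dx Dy; rewrite -[x]scale1r; exact: gns_DL. Qed.
Lemma gns_DZ (a : C) x : D x -> D (a *: x).
Proof. by move=> Dx; rewrite -[_ *: _]addr0; apply: gns_DL => //; exact: gns_D0. Qed.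
Lemma gns_DB x y : D x -> D y -> D (x - y).
Proof. by move=> Dx Dy; rewrite addrC -scaleN1r; exact: gns_DL. Qed.
Lemma gns_tauD x y : D x -> D y -> tau (x + y) = tau x + tau y.
Proof. by move=> Dx Dy; rewrite -[x in LHS]scale1r gns_tauL// scale1r. Qed.
Lemma gns_tauZ (a : C) x : D x -> tau (a *: x) = a *: tau x.
Proof.
by move=> Dx; rewrite -[a *: x in LHS]addr0 gns_tauL ?gns_tau0 ?addr0//; exact: gns_D0.
Qed.
Lemma gns_tauB x y : D x -> D y -> tau (x - y) = tau x - tau y.
Proof.
by move=> Dx Dy; rewrite addrC -scaleN1r gns_tauL// scaleN1r addrC.
Qed.
Lemma gns_tB x y : D x -> D y -> t (x - y) = t x - t y.
Proof.
by move=> Dx Dy; rewrite addrC -scaleN1r (gns_tL g)// scaleN1r addrC.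
Qed.

Lemma gns_nrm x : D x -> nrm (tau x) = qn (gform Gam) (t x).
Proof. by move=> Dx; rewrite -qn_inner /qn (gns_inner g). Qed.

Lemma gns_nrm_le x y : D x -> D y -> (forall s, nrm (t x s) <= nrm (t y s)) ->
  nrm (tau x) <= nrm (tau y).
Proof.
move=> Dx Dy h; rewrite !gns_nrm//.
by apply: (qn_gform_le (gns_GamL g) (gns_Gam_ge0 g)) => //; exact: (gns_tb g).
Qed.

Lemma gns_tau_eq x y : D x -> D y -> (forall s, t x s = t y s) -> tau x = tau y.
Proof.
move=> Dx Dy e; apply/eqP; rewrite -subr_eq0 -nrm_eq0 -gns_tauB//.
rewrite eq_le nrm_ge0 andbT -(nrm0 H) -gns_tau0; apply: gns_nrm_le.
- exact: gns_DB.
- exact: gns_D0.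
- move=> s; rewrite gns_tB// (_ : (t x - t y) s = t x s - t y s)// e subrr nrm0.
  exact: nrm_ge0.
Qed.

Lemma gns_sub_scalar (l : C) x : D x -> sub_scalar S l (tau x) = tau (Z x - l *: x).
Proof.
move=> Dx; rewrite /sub_scalar (gns_S g)// gns_tauB ?gns_tauZ//; last exact: gns_DZ.
exact: (gns_ZD g).
Qed.

Lemma gns_t_sub (l : C) x s : D x -> t (Z x - l *: x) s = (zeta s - l) * t x s.
Proof.
move=> Dx; have DZx : D (Z x) by exact: (gns_ZD g).
rewrite gns_tB//; last exact: gns_DZ.
have -> : t (l *: x) = l *: t x.
  have t0 : t 0 = 0 by rewrite -[X in t X](subrr x) gns_tB// subrr.
  by rewrite -[l *: x]addr0 (gns_tL g)// ?t0 ?addr0//; exact: gns_D0.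
rewrite (_ : (t (Z x) - l *: t x) s = t (Z x) s - l * t x s)// (gns_tZ g)//.
have hs (b c d : C) : b * d - c * d = (b - c) * d by ring.
exact: hs.
Qed.

Lemma gns_below (l : C) (d : R) x : D x -> 0 <= d ->
  (forall s, d * nrm (t x s) <= nrm (zeta s - l) * nrm (t x s)) ->
  d * nrm (tau x) <= nrm (sub_scalar S l (tau x)).
Proof.
move=> Dx d0 h; have Dd : D (d%:C *: x) by exact: gns_DZ.
have -> : d * nrm (tau x) = nrm (tau (d%:C *: x)).
  by rewrite gns_tauZ// nrmZ nrm_real ger0_norm.
rewrite gns_sub_scalar//; apply: gns_nrm_le => //.
  by apply: gns_DB; [exact: (gns_ZD g)|exact: gns_DZ].
move=> s; rewrite gns_t_sub// nrmM.
have t0 : t 0 = 0 by rewrite -[X in t X](subrr x) gns_tB// subrr.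
rewrite -[d%:C *: x]addr0 (gns_tL g)// ?t0 ?addr0; last exact: gns_D0.
by rewrite (_ : (d%:C *: t x) s = d%:C * t x s)// nrmM nrm_real ger0_norm.
Qed.

Lemma gns_riesz (phi : E -> C) (c : R) : 0 <= c ->
  (forall (a : C) x y, D x -> D y -> phi (a *: x + y) = a * phi x + phi y) ->
  (forall x, D x -> nrm (phi x) <= c * nrm (tau x)) ->
  exists k, forall x, D x -> phi x = inner (tau x) k.
Proof. by move=> c0 pL pb; exact: (dense_riesz (gns_mod g) c0 pL pb). Qed.

Lemma gns_vector_le (k : H) (c : R) : 0 <= c ->
  (forall x, D x -> nrm (inner (tau x) k) <= c * nrm (tau x)) -> nrm k <= c.
Proof.
move=> c0 hk; have [->|k0] := eqVneq k 0; first by rewrite nrm0.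
have k1 : 0 < nrm k by rewrite nrm_gt0.
rewrite -(ler_pM2r k1) -expr2; apply/ler_addgt0Pr => e e0.
have p0 : 0 < nrm k + c by rewrite ltr_wpDr.
have [_ _ _ /(_ k _ (divr_gt0 e0 p0))[x Dx kx]] := gns_mod g.
have := hk _ Dx; have := inner_CS (k - tau x) k.
have := ler_nrmD (inner (tau x) k) (inner (k - tau x) k).
rewrite -innerDl addrC subrK inner_nrm nrm_real ger0_norm ?sqr_ge0//.
have := ler_nrmB k (k - tau x); rewrite opprB addrC subrK.
by move: kx; rewrite ltr_pdivlMr//; move: (nrm (k - tau x)) => d; nra.
Qed.

Lemma gns_inner_ext (A B : H -> H) (k k' : H) : bounded_operator A -> bounded_operator B ->
  (forall x, D x -> inner (A (tau x)) k = inner (B (tau x)) k') ->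
  forall h, inner (A h) k = inner (B h) k'.
Proof.
move=> bA bB e h; have [lA [cA cA0 hA]] := (bounded_opP A).1 bA.
have [lB [cB cB0 hB]] := (bounded_opP B).1 bB; move: h.
apply: (dense_inner_eq (gns_mod g) (c := cA * nrm k + cB * nrm k')) => //.
- move=> x y; rewrite -innerBl -(lin_sub lA) (le_trans (inner_CS _ _))// mulrDl.
  rewrite ler_wpDr ?mulr_ge0 ?nrm_ge0// mulrAC ler_wpM2r ?nrm_ge0//.
- move=> x y; rewrite -innerBl -(lin_sub lB) (le_trans (inner_CS _ _))// mulrDl.
  rewrite ler_wpDl ?mulr_ge0 ?nrm_ge0// mulrAC ler_wpM2r ?nrm_ge0//.
Qed.

Lemma gns_eigen (k : H) (l : C) :
  (forall x, D x -> inner (tau (Z x)) k = l * inner (tau x) k) ->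
  forall h, inner (S h) k = l * inner h k.
Proof.
move=> e h; rewrite -innerZl; move: h.
apply: (gns_inner_ext (A := S) (B := fun h => l *: h)).
- exact: (gns_bounded g).
- apply/bounded_opP; split; first by move=> a x y; rewrite scalerDr !scalerA mulrC.
  by exists (nrm l); [exact: nrm_ge0|move=> x; rewrite nrmZ].
- by move=> x Dx; rewrite (gns_S g)// e// innerZl.
Qed.

Lemma gns_poly_op (m : {poly C} -> E -> E) p x : D x ->
  (forall p, D (m p x)) ->
  (forall p s, t (m p x) s = p.[zeta s] * t x s) -> poly_op S p (tau x) = tau (m p x).
Proof.
move=> Dx Dm tm; have bS := gns_bounded g.
elim/poly_ind: p => [|p c IH].
  rewrite poly_op0//; apply/esym/eqP; rewrite -nrm_eq0 gns_nrm//.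
  rewrite (_ : t (m 0 x) = fun=> 0); last first.
    by apply/funext => s; rewrite tm horner0; exact: mul0r.
  have := qn0 pB; rewrite (_ : (0 : T -> C^o) = fun=> 0)// => ->.
  by [].
rewrite poly_opD// poly_opMX// IH poly_opC// (gns_S g)// -gns_tauZ// -gns_tauD; last 2 first.
- exact: (gns_ZD g).
- exact: gns_DZ.
apply: gns_tau_eq => // [|s].
  by apply: gns_DD; [exact: (gns_ZD g)|exact: gns_DZ].
rewrite addrC (gns_tL g)//; last exact: (gns_ZD g).
rewrite (_ : (c *: t x + t (Z (m p x))) s = c * t x s + t (Z (m p x)) s)//.
rewrite (gns_tZ g)// !tm hornerD hornerMX hornerC.
have hs (u v z : C) : c * u + z * (v * u) = (v * z + c) * u by ring.
exact: hs.
Qed.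

End GnsFacts.

(** * The model for compact sets with interior *)

Section FiniteSums.
Variable R : realType.
Local Notation C := (cplx R).
Implicit Types (d : {poly C}) (c : nat -> C).

(* Polynomials serve as finitely supported sequences. *)
Definition fsum d c : C := \sum_(j < size d) d`_j * c j.

Definition wmul (w : nat -> C) d : {poly C} := \poly_(j < size d) (d`_j * w j).

Lemma fsum_wide d c n : (size d <= n)%N -> fsum d c = \sum_(j < n) d`_j * c j.
Proof.
move=> dn; rewrite /fsum (big_ord_widen _ (fun j => d`_j * c j) dn).
rewrite big_mkcond; apply: eq_bigr => i _; case: ltnP => // h.
by rewrite nth_default// mul0r.
Qed.

Lemma fsum_lin (a : C) d d' c : fsum (a *: d + d') c = a * fsum d c + fsum d' c.
Proof.
pose n := maxn (size d) (size d').
have h1 : (size d <= n)%N by rewrite leq_maxl.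
have h2 : (size d' <= n)%N by rewrite leq_maxr.
have h3 : (size (a *: d + d')%R <= n)%N.
  by rewrite (leq_trans (size_polyD _ _))// geq_max h2 andbT (leq_trans (size_scale_leq _ _)).
rewrite (fsum_wide _ h1) (fsum_wide _ h2) (fsum_wide _ h3) mulr_sumr -big_split/=.
by apply: eq_bigr => i _; rewrite coefD coefZ mulrDl mulrA.
Qed.

Lemma coef_wmul w d j : (wmul w d)`_j = d`_j * w j.
Proof.
by rewrite coef_poly; case: ltnP => // h; rewrite nth_default// mul0r.
Qed.

Lemma wmul_lin w (a : C) d d' : wmul w (a *: d + d') = a *: wmul w d + wmul w d'.
Proof.
by apply/polyP => j; rewrite coefD coefZ !coef_wmul coefD coefZ mulrDl mulrA.
Qed.

Lemma fsum_wmul w d c : fsum (wmul w d) c = fsum d (fun j => w j * c j).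
Proof.
have h : (size (wmul w d) <= size d)%N by exact: size_poly.
rewrite (fsum_wide _ h); apply: eq_bigr => j _.
by rewrite coef_wmul mulrA.
Qed.

Lemma fsumD d c c' : fsum d (fun j => c j + c' j) = fsum d c + fsum d c'.
Proof. by rewrite -big_split/=; apply: eq_bigr => j _; rewrite mulrDr. Qed.

Lemma fsumZ d (a : C) c : fsum d (fun j => a * c j) = a * fsum d c.
Proof. by rewrite mulr_sumr; apply: eq_bigr => j _; rewrite mulrCA. Qed.

Lemma eq_fsum d c c' : (forall j, d`_j != 0 -> c j = c' j) -> fsum d c = fsum d c'.
Proof.
move=> h; apply: eq_bigr => j _; have [->|/h ->//] := eqVneq d`_j 0.
by rewrite !mul0r.
Qed.

Lemma fsum_monom n c : fsum 'X^n c = c n.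
Proof.
rewrite /fsum size_polyXn big_ord_recr/= coefXn eqxx mul1r big1 ?add0r// => j _.
by rewrite coefXn (ltn_eqF (ltn_ord j)) mul0r.
Qed.

Lemma fsum0 c : fsum 0 c = 0.
Proof. by rewrite /fsum size_poly0 big_ord0. Qed.

Lemma geo_half n : \sum_(i < n) (2^-1 : R) ^+ i.+1 <= 1.
Proof.
suff -> : \sum_(i < n) (2^-1 : R) ^+ i.+1 = 1 - 2^-1 ^+ n by rewrite lerBlDr lerDl exprn_ge0.
elim: n => [|n IH]; first by rewrite big_ord0 expr0 subrr.
by rewrite big_ord_recr/= IH exprS; lra.
Qed.

End FiniteSums.

Section SequenceModel.
Variable R : realType.
Local Notation C := (cplx R).
Variables (K : set C) (a : C) (b : nat -> C) (kap : nat -> R).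
Variable Gam : (bd_type K * nat -> R) -> R.
Hypothesis cd : core_data a b kap Gam.
Variables (w : nat -> C) (eps delta : nat -> R).

(** [seq_eps] makes the sum of the poles small on the boundary compared with the coordinates,
    weighted by the square roots of [kap]. [seq_sep] does the same for the poles of later index seen
    from an earlier [w i], which keeps the regularized evaluation at [w i] bounded. *)
Record seq_data : Prop := SeqData {
  seq_int : forall j, interior K (w j);
  seq_inj : injective w;
  seq_eps0 : forall j, 0 < eps j;
  seq_delta0 : forall j, 0 < delta j;
  seq_delta1 : forall j, delta j <= 1;
  seq_delta : forall j x, boundary K x -> delta j <= nrm (x - w j);
  seq_eps : forall j, eps j <= 2^-1 ^+ j.+1 * delta j * Num.sqrt (kap j);
  seq_sep : forall i j, (i < j)%N ->
    eps j <= 2^-1 ^+ j.+1 * nrm (w j - w i) * Num.sqrt (kap j) }.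

Hypothesis sd : seq_data.
Let cK := core_compact cd.
Let GL := core_GamL cd.
Let Gp := core_Gam_ge0 cd.
Let pB := gform_psd GL Gp.
Let W : Type := (bd_type K * nat)%type.
Let E : Type := ((C -> C^o) * {poly C})%type.
Definition seqD : set ((C -> C^o) * {poly C}) := [set x | ratK K x.1].

Definition poles (d : {poly C}) (z : C) : C := fsum d (fun j => (eps j)%:C / (z - w j)).

Definition seqF (x : (C -> C^o) * {poly C}) (z : C) : C := x.1 z + poles x.2 z.

(* The second copy of the boundary carries, on its [j]-th slice, the [j]-th
   coordinate: it plays the role of a point mass [kap j] at [w j]. *)
Definition seqt (x : (C -> C^o) * {poly C}) : W * bool -> C^o :=
  fun s => if s.2 then x.2`_(s.1.2) else seqF x (bd_val s.1.1).

(** Multiplication by [z]: since [z * eps / (z - w) = eps + w * eps / (z - w)], each pole passes a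
    constant to the rational part, and its coordinate is multiplied by [w]. *)
Definition seqZ (x : (C -> C^o) * {poly C}) : (C -> C^o) * {poly C} :=
  (fun z => z * x.1 z + fsum x.2 (fun j => (eps j)%:C), wmul w x.2).

Definition seq_zeta (s : W * bool) : C := if s.2 then w s.1.2 else bd_val s.1.1.
(** Each slice of the second copy is a level of its own, on which [seq_zeta] is constant; level 0 is
    kept for the first copy. *)
Definition seq_kappa (s : W * bool) : nat := if s.2 then s.1.2.+1 else 0%N.
Definition seq_Gam (u : W * bool -> R) : R :=
  Gam (fun v => u (v, false)) + Gam (fun v => u (v, true)).

Lemma w_in j : K (w j). Proof. exact: interior_subset (seq_int sd j). Qed.

Lemma bd_neq_w j x : boundary K x -> x - w j != 0.
Proof.
move=> /(seq_delta sd j) h; rewrite -nrm_gt0; apply: lt_le_trans h.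
exact: seq_delta0 sd j.
Qed.

Lemma poles_ratK d : ratK (boundary K) (poles d).
Proof.
rewrite /poles /fsum; apply: (@ratK_sum _ _ _ _ (fun (j : 'I_(size d)) z =>
  d`_j * ((eps j)%:C / (z - w j)))) => j.
apply: ratKZ; apply: ratKZ; apply: ratK_resolvent => Bw.
by have := bd_neq_w j Bw; rewrite subrr eqxx.
Qed.

Lemma seqF_ratK x : seqD x -> ratK (boundary K) (seqF x).
Proof.
move=> Dx; apply: ratKD; last exact: poles_ratK.
exact: ratK_sub (boundary_sub (compact_closed_nrm cK)) Dx.
Qed.

Lemma seq_half (u : W * bool -> R) : bfun u -> bfun (fun v : W => u (v, false)) /\ bfun (fun v : W => u (v, true)).
Proof. by move=> [M HM]; split; exists M => v; exact: HM. Qed.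

Lemma seq_GamL (c : R) u v : bfun u -> bfun v ->
  seq_Gam (fun s => c * u s + v s) = c * seq_Gam u + seq_Gam v.
Proof.
move=> /seq_half[u1 u2] /seq_half[v1 v2].
by rewrite /seq_Gam (GL c u1 v1) (GL c u2 v2); ring.
Qed.

Lemma seq_Gam_ge0 u : bfun u -> (forall s, 0 <= u s) -> 0 <= seq_Gam u.
Proof. by move=> /seq_half[u1 u2] h; apply: addr_ge0; exact: Gp. Qed.

Lemma seqD0 : seqD 0. Proof. exact: ratK_cst. Qed.

Lemma seqDL (c : C) x y : seqD x -> seqD y -> seqD (c *: x + y).
Proof. by move=> Dx Dy; apply: ratKD => //; exact: ratKZ. Qed.

Lemma seqFL (c : C) x y z : seqF (c *: x + y) z = c * seqF x z + seqF y z.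
Proof.
rewrite /seqF /poles/= fsum_lin.
rewrite (_ : (c *: x.1 + y.1) z = c * x.1 z + y.1 z)//.
have hs (p q r s : C) : c * p + q + (c * r + s) = c * (p + r) + (q + s) by ring.
exact: hs.
Qed.

Lemma seqtL (c : C) x y : seqt (c *: x + y) = c *: seqt x + seqt y.
Proof.
apply/funext => -[v []].
  by rewrite /seqt/= coefD coefZ.
by rewrite /seqt [in LHS]/= seqFL.
Qed.

Lemma seqZL (c : C) x y : seqZ (c *: x + y) = c *: seqZ x + seqZ y.
Proof.
rewrite /seqZ/= wmul_lin; congr (_, _); apply/funext => z; rewrite fsum_lin.
rewrite (_ : (c *: x.1 + y.1) z = c * x.1 z + y.1 z)//.
have hs (p q r s : C) : z * (c * p + q) + (c * r + s) = c * (z * p + r) + (z * q + s) by ring.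
exact: hs.
Qed.

Lemma seqZD x : seqD x -> seqD (seqZ x).
Proof. by move=> Dx; apply: ratKD; [apply: ratKM => //; exact: ratK_id|exact: ratK_cst]. Qed.

Lemma poles_mul (d : {poly C}) z : (forall j, z - w j != 0) ->
  z * poles d z = fsum d (fun j => (eps j)%:C) + poles (wmul w d) z.
Proof.
move=> zw; rewrite /poles fsum_wmul -fsumZ -fsumD; apply: eq_fsum => j _.
have := zw j; move: ((eps j)%:C : C) (w j) => e v zv.
by field.
Qed.

Lemma seqtZ x s : seqt (seqZ x) s = seq_zeta s * seqt x s.
Proof.
case: s => -[[y By] j] []; rewrite /seqt /seq_zeta/=.
  by rewrite coef_wmul mulrC.
rewrite /seqF/= mulrDr poles_mul; last by move=> i; exact: bd_neq_w.
by rewrite /bd_val/= addrA.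
Qed.

Lemma seqt_lip x : seqD x -> lip_class seq_zeta seq_kappa (seqt x).
Proof.
move=> Dx; have cB := compact_boundary cK.
have [M M0 HM] := ratK_bounded cB (seqF_ratK Dx).
have [L L0 HL] := ratK_lipschitz cB (seqF_ratK Dx).
split.
- exists (M + \sum_(i < size x.2) nrm x.2`_i) => -[[[y By] j] []]; rewrite /seqt/=.
    rewrite ler_wpDl//; have [h|h] := ltnP j (size x.2).
      by rewrite (bigD1 (Ordinal h))//= lerDl sumr_ge0// => i _; exact: nrm_ge0.
    by rewrite nth_default// nrm0 sumr_ge0// => i _; exact: nrm_ge0.
  by rewrite ler_wpDr// ?HM// sumr_ge0// => i _; exact: nrm_ge0.
- exists (size x.2).+1 => -[[y j] []]; rewrite /seq_kappa /seqt/= ?ltn0// ltnS => h.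
  by rewrite nth_default.
- exists L => // -[[[y By] j] []] [[[y' By'] j'] []]; rewrite /seq_kappa /seqt /seq_zeta//=.
    by move=> [->]; rewrite !subrr !nrm0 mulr0.
  by move=> _; apply: HL.
Qed.

Lemma seq_zeta_bounded : exists M : R, forall s, nrm (seq_zeta s) <= M.
Proof.
have [M HM] := compact_bounded cK; exists M => -[[y j] []]; rewrite /seq_zeta/=.
  exact/HM/w_in.
by apply: HM; exact: (bd_in cd).
Qed.

Lemma seq_model_exists : exists (H : hilbertSpace R) tau (S : H -> H),
  gns_data seq_Gam seq_zeta seqD seqt seqZ tau S.
Proof.
have [M HM] := seq_zeta_bounded.
apply: (gns_exists (kappa := seq_kappa) (M := M)) => //.
- exact: seq_GamL.
- exact: seq_Gam_ge0.
- exact: seqD0.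
- exact: seqDL.
- by move=> c x y _ _; exact: seqtL.
- exact: seqt_lip.
- exact: seqZD.
- by move=> c x y _ _; exact: seqZL.
- by move=> x s _; exact: seqtZ.
Qed.

Variables (H : hilbertSpace R) (tau : (C -> C^o) * {poly C} -> H) (S : H -> H).
Hypothesis g : gns_data seq_Gam seq_zeta seqD seqt seqZ tau S.

Lemma seq_sqr x : seqD x -> nrm (tau x) ^+ 2 =
  qn (gform Gam) (bpull (seqF x)) ^+ 2 + Gam (fun v => nrm x.2`_(v.2) ^+ 2).
Proof.
move=> Dx; rewrite (gns_nrm g Dx) (qn_gform seq_GamL seq_Gam_ge0 (gns_tb g Dx)).
rewrite (qn_gform GL Gp)//.
have [M HM] := gns_tb g Dx; exists M => v; exact: (HM (v, false)).
Qed.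

Lemma cbf_coef (d : {poly C}) : bfun (fun v : W => nrm d`_(v.2) ^+ 2).
Proof.
apply: bfun_nrm; exists (\sum_(i < size d) nrm d`_i) => -[y j] /=.
have [h|h] := ltnP j (size d).
  by rewrite (bigD1 (Ordinal h))//= lerDl sumr_ge0// => i _; exact: nrm_ge0.
by rewrite nth_default// nrm0 sumr_ge0// => i _; exact: nrm_ge0.
Qed.

Lemma left_le x : seqD x -> qn (gform Gam) (bpull (seqF x)) <= nrm (tau x).
Proof.
move=> Dx; rewrite -(@ler_pXn2r _ 2)// ?nnegrE ?nrm_ge0 ?qn_ge0// seq_sqr// lerDl.
by apply: Gp; [exact: cbf_coef|move=> v; exact: sqr_ge0].
Qed.

Lemma right_partial (d : {poly C}) n : \sum_(j < n) kap j * nrm d`_j ^+ 2 =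
  Gam (fun v => (v.2 < n)%:R * nrm d`_(v.2) ^+ 2).
Proof.
elim: n => [|n IH].
  rewrite big_ord0 -(Gam0 GL); congr Gam; apply/funext => v.
  by rewrite ltn0 mul0r.
rewrite big_ord_recr/= IH.
have h1 := core_Gam_b cd n (ratK_cst K 1); rewrite mulr1 in h1.
have bI : bfun (fun v : W => (v.2 == n)%:R * complex.Re (1 : C)).
  by exists 1 => v; case: eqP => _; rewrite ?mul1r ?mul0r ?normr1 ?normr0.
rewrite -h1 mulrC -(GamZ GL _ bI) -(GamD GL); last 2 first.
- apply: bfunM; last exact: cbf_coef.
  by exists 1 => v; case: ltnP => _; rewrite ?normr1 ?normr0.
- exact: bfunZ.
congr Gam; apply/funext => v; rewrite ltnS [(v.2 <= n)%N]leq_eqVlt mulr1.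
by case: eqVneq => [ev|_]; rewrite ?ev ?ltnn ?mul0r ?mulr0 ?add0r ?addr0 ?mul1r ?mulr1.
Qed.

Lemma right_eq (d : {poly C}) :
  Gam (fun v => nrm d`_(v.2) ^+ 2) = \sum_(j < size d) kap j * nrm d`_j ^+ 2.
Proof.
rewrite right_partial; congr Gam; apply/funext => v; case: ltnP => h.
  by rewrite mul1r.
by rewrite nth_default// nrm0 expr0n/= mulr0.
Qed.

(** Finitely many slices of the second copy lie below the whole of it; finite additivity and
    positivity suffice. *)
Lemma bessel N x : seqD x -> \sum_(j < N) kap j * nrm x.2`_j ^+ 2 <= nrm (tau x) ^+ 2.
Proof.
move=> Dx; rewrite seq_sqr// ler_wpDl ?sqr_ge0// right_partial.
apply: (Gam_mono GL Gp).
- apply: bfunM; last exact: cbf_coef.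
  by exists 1 => v; case: ltnP => _; rewrite ?normr1 ?normr0.
- exact: cbf_coef.
- by move=> v; case: ltnP => _; rewrite ?mul1r ?mul0r ?sqr_ge0.
Qed.

Lemma coef_le j x : seqD x -> nrm x.2`_j * Num.sqrt (kap j) <= nrm (tau x).
Proof.
move=> Dx; have k0 := core_kap0 cd j.
rewrite -(@ler_pXn2r _ 2)// ?nnegrE ?mulr_ge0 ?nrm_ge0 ?sqrtr_ge0//.
apply: le_trans (bessel j.+1 Dx); rewrite big_ord_recr/= exprMn (sqr_sqrtr (ltW k0)).
rewrite mulrC lerDr sumr_ge0// => i _; apply: mulr_ge0; last exact: sqr_ge0.
exact: ltW (core_kap0 cd i).
Qed.

Lemma fsum_le (B : R) (c : nat -> C) x : seqD x -> 0 <= B ->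
  (forall j, nrm (c j) <= B * 2^-1 ^+ j.+1 * Num.sqrt (kap j)) ->
  nrm (fsum x.2 c) <= B * nrm (tau x).
Proof.
move=> Dx B0 cB; rewrite /fsum (le_trans (ler_nrm_sum _ _ _))//.
apply: (@le_trans _ _ (\sum_(j < size x.2) 2^-1 ^+ j.+1 * (B * nrm (tau x)))).
  apply: ler_sum => j _; rewrite nrmM.
  apply: (@le_trans _ _ (nrm x.2`_j * (B * 2^-1 ^+ j.+1 * Num.sqrt (kap j)))).
    by rewrite ler_wpM2l ?nrm_ge0.
  have -> : nrm x.2`_j * (B * 2^-1 ^+ j.+1 * Num.sqrt (kap j)) =
      2^-1 ^+ j.+1 * B * (nrm x.2`_j * Num.sqrt (kap j)) by ring.
  by rewrite [leRHS]mulrA ler_wpM2l ?coef_le// mulr_ge0// exprn_ge0.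
by rewrite -mulr_suml ler_piMl ?geo_half// mulr_ge0// nrm_ge0.
Qed.

Lemma Gam1 : Gam (fun=> 1) = 1.
Proof. by have := core_Gam_a cd (ratK_cst K 1). Qed.

Lemma cbf_bd f : ratK (boundary K) f -> cbf (bpull f : W -> C^o).
Proof.
move=> rf; have [M _ HM] := ratK_bounded (compact_boundary cK) rf.
by exists M => -[[y By] j]; exact: HM.
Qed.

Lemma poles_le d : qn (gform Gam) (bpull (poles d)) <=
  \sum_(j < size d) nrm d`_j * (eps j / delta j).
Proof.
have S0 : 0 <= \sum_(j < size d) nrm d`_j * (eps j / delta j).
  apply: sumr_ge0 => j _; rewrite mulr_ge0 ?nrm_ge0// divr_ge0//.
    exact: ltW (seq_eps0 sd j).
  exact: ltW (seq_delta0 sd j).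
have := @qn_gform_bound _ _ _ GL Gp (bpull (poles d)) _ S0; rewrite Gam1 sqrtr1 mulr1.
apply => -[[y By] i]; rewrite /bpull/= /poles /fsum (le_trans (ler_nrm_sum _ _ _))//.
apply: ler_sum => j _; rewrite nrmM ler_wpM2l ?nrm_ge0// nrmM nrmV nrm_real.
rewrite (gtr0_norm (seq_eps0 sd j)) ler_pM2l ?(seq_eps0 sd)//.
rewrite lef_pV2 ?posrE ?(seq_delta0 sd)//; first exact: seq_delta.
by rewrite nrm_gt0 bd_neq_w.
Qed.

(** The norm controls [f] plus its poles, and by [seq_eps] the poles are dominated by the
    coordinates, so the rational part alone is controlled too. *)
Lemma rat_le x : seqD x -> qn (gform Gam) (bpull x.1) <= 2 * nrm (tau x).
Proof.
move=> Dx.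
have h1 := cbf_bd (seqF_ratK Dx); have h2 := cbf_bd (poles_ratK x.2).
have -> : (bpull x.1 : W -> C^o) = bpull (seqF x) - bpull (poles x.2).
  apply/funext => v; rewrite /bpull/=.
  have hs (p q : C) : p = p + q - q by ring.
  exact: hs.
rewrite (le_trans (qnB pB h1 h2))// mulrDl mul1r lerD ?left_le//.
rewrite (le_trans (poles_le _))//.
apply: (@le_trans _ _ (\sum_(j < size x.2) 2^-1 ^+ j.+1 * nrm (tau x))).
  apply: ler_sum => j _; have d0 := seq_delta0 sd j; have e0 := seq_eps sd j.
  apply: (@le_trans _ _ (nrm x.2`_j * (2^-1 ^+ j.+1 * Num.sqrt (kap j)))).
    rewrite ler_wpM2l ?nrm_ge0// ler_pdivrMr//; apply: le_trans e0 _.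
    by rewrite mulrAC.
  by rewrite mulrCA ler_wpM2l ?coef_le// exprn_ge0.
by rewrite -mulr_suml ler_piMl ?geo_half// nrm_ge0.
Qed.

(** For [c j = eps j / (l - w j)] this is evaluation at [l] of the function with its poles. Free
    coefficients also cover the evaluation of the rational part alone and the finite part at a
    pole. *)
Definition phi (l : C) (c : nat -> C) (x : (C -> C^o) * {poly C}) : C := x.1 l + fsum x.2 c.

Lemma phi_lin l c (s : C) x y : phi l c (s *: x + y) = s * phi l c x + phi l c y.
Proof.
rewrite /phi/= fsum_lin (_ : (s *: x.1 + y.1) l = s * x.1 l + y.1 l)//.
have hs (p q r u : C) : s * p + q + (s * r + u) = s * (p + r) + (q + u) by ring.
exact: hs.
Qed.

Definition evb (l : C) (A : R) := forall f, ratK K f ->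
  nrm (f l) <= A * qn (gform Gam) (bpull f).

Lemma phi_le l c (A B : R) : 0 <= A -> 0 <= B -> evb l A ->
  (forall j, nrm (c j) <= B * 2^-1 ^+ j.+1 * Num.sqrt (kap j)) ->
  forall x, seqD x -> nrm (phi l c x) <= (2 * A + B) * nrm (tau x).
Proof.
move=> A0 B0 ev cB x Dx; rewrite (le_trans (ler_nrmD _ _))// mulrDl lerD ?fsum_le//.
apply: le_trans (ev _ Dx) (le_trans (ler_wpM2l A0 (rat_le Dx)) _).
by rewrite mulrCA mulrA.
Qed.

Lemma phi_vector l c (A B : R) : 0 <= A -> 0 <= B -> evb l A ->
  (forall j, nrm (c j) <= B * 2^-1 ^+ j.+1 * Num.sqrt (kap j)) ->
  exists2 k, nrm k <= 2 * A + B & forall x, seqD x -> phi l c x = inner (tau x) k.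
Proof.
move=> A0 B0 ev cB; have AB : 0 <= 2 * A + B by rewrite addr_ge0// mulr_ge0.
have [k hk] := gns_riesz g AB (fun s x y _ _ => phi_lin l c s x y) (phi_le A0 B0 ev cB).
exists k => //; apply: (gns_vector_le g AB) => x Dx.
by rewrite -hk//; exact: phi_le.
Qed.

Lemma coef_vector j : exists k, forall x, seqD x -> x.2`_j = inner (tau x) k.
Proof.
have s0 : 0 < Num.sqrt (kap j) by rewrite sqrtr_gt0; exact: core_kap0 cd j.
apply: (gns_riesz g (c := (Num.sqrt (kap j))^-1)); first by rewrite invr_ge0 ltW.
  by move=> s x y _ _; rewrite coefD coefZ.
by move=> x Dx; rewrite ler_pdivlMl// mulrC coef_le.
Qed.

End SequenceModel.

Lemma Re_sum (R : realType) (I : Type) (r : seq I) (P : pred I) (F : I -> cplx R) :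
  complex.Re (\sum_(i <- r | P i) F i) = \sum_(i <- r | P i) complex.Re (F i).
Proof. by apply: (big_morph (@complex.Re R)) => //; exact: ReD. Qed.

Section KernelTools.
Variable R : realType.
Local Notation C := (cplx R).
Variables (E : lmodType C) (D : set E) (H : hilbertSpace R) (tau : E -> H).
Hypothesis mD : model D tau.

(** A vector of the dense part near the kernel of [k] is moved into it by a small multiple of
    [tau u]. *)
Lemma range_of_kernel (T : H -> H) (k : H) (u : E) : D u -> inner (tau u) k = 1 ->
  closed (range T) -> (forall x, D x -> inner (tau x) k = 0 -> range T (tau x)) ->
  forall y, inner y k = 0 -> range T y.
Proof.
move=> Du uk cT Tk y yk; apply/((closed_nrmP _).1 cT) => e e0.
have p0 : 0 < 1 + nrm k * nrm (tau u) by rewrite ltr_wpDr// mulr_ge0 ?nrm_ge0.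
have [_ DL tL /(_ y _ (divr_gt0 e0 p0))[x Dx yx]] := mD.
exists (tau (- inner (tau x) k *: u + x)).
  apply: Tk; first exact: DL.
  by rewrite tL// innerDl innerZl uk mulr1 addNr.
rewrite tL//.
have -> : y - (- inner (tau x) k *: tau u + tau x) = (y - tau x) + inner (tau x) k *: tau u.
  by rewrite scaleNr opprD opprK addrCA addrC.
have -> : inner (tau x) k = - inner (y - tau x) k by rewrite innerBl yk sub0r opprK.
rewrite (le_lt_trans (ler_nrmD _ _))// nrmZ nrmN.
have := inner_CS (y - tau x) k; move: yx; rewrite ltr_pdivlMr//.
have := nrm_ge0 (tau u); have := nrm_ge0 (y - tau x); nra.
Qed.

Lemma inner_closure0 (T : H -> H) (k : H) (V : set H) : bounded_operator T ->
  (forall v, V v -> inner (T v) k = 0) -> forall v, closure V v -> inner (T v) k = 0.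
Proof.
move=> bT h v /closure_nrmP cv; have [lT [c c0 hc]] := (bounded_opP T).1 bT.
apply/eqP; rewrite -nrm_eq0 eq_le nrm_ge0 andbT; apply/ler_addgt0Pr => e e0.
have p0 : 0 < c * nrm k + 1 by rewrite ltr_wpDl// mulr_ge0 ?nrm_ge0.
have [x Vx vx] := cv _ (divr_gt0 e0 p0); rewrite add0r.
have -> : inner (T v) k = inner (T (v - x)) k.
  by rewrite (lin_sub lT) innerBl (h _ Vx) subr0.
have := inner_CS (T (v - x)) k; have := hc (v - x); move: vx; rewrite ltr_pdivlMr//.
by have := nrm_ge0 k; have := nrm_ge0 (v - x); nra.
Qed.

End KernelTools.

(** * Fredholm properties and irreducibility of the model *)

Section SeqSpectrum.
Variable R : realType.
Local Notation C := (cplx R).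
Variables (K : set C) (a : C) (b : nat -> C) (kap : nat -> R).
Variable Gam : (bd_type K * nat -> R) -> R.
Hypothesis cd : core_data a b kap Gam.
Variables (w : nat -> C) (eps delta : nat -> R).
Hypothesis sd : seq_data K kap w eps delta.
Let E : lmodType C := ((C -> C^o) * {poly C})%type.
Local Notation D := (@seqD R K).
Local Notation Z := (seqZ w eps).
Variables (H : hilbertSpace R) (tau : (C -> C^o) * {poly C} -> H) (S : H -> H).
Hypothesis g : gns_data (seq_Gam Gam) (@seq_zeta R K w) D
  (@seqt R K w eps) Z tau S.
Let cK := core_compact cd.
Let clK := compact_closed_nrm cK.
Let bS := gns_bounded g.
Let lS := bounded_lin bS.
Let mD := gns_mod g.

Definition sq_u0 : (C -> C^o) * {poly C} := (fun=> 1, 0).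
Definition sq_e (j : nat) : (C -> C^o) * {poly C} := (fun=> 0, 'X^j).

Lemma D_u0 : D sq_u0. Proof. exact: ratK_cst. Qed.
Lemma D_e j : D (sq_e j). Proof. exact: ratK_cst. Qed.

Lemma evb_b i : evb Gam (b i) (Num.sqrt (kap i))^-1.
Proof.
move=> f rf; have s0 : 0 < Num.sqrt (kap i) by rewrite sqrtr_gt0; exact: core_kap0 cd i.
apply: le_trans (slice_value cd i rf) _; rewrite mulrC ler_wpM2l ?invr_ge0 ?sqrtr_ge0//.
exact: (qn_slice_le cd i (cbf_bpull cd rf)).
Qed.

Lemma evb_int l : interior K l -> exists A r : R, [/\ 0 <= A, 0 < r &
  forall l', nrm (l' - l) <= r -> K l' /\ evb Gam l' A].
Proof.
move=> /interior_nrmP[e e0 he].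
have Kl : K l by apply: he; rewrite subrr nrm0.
(* With [b i] within [e / 8] of [l], the boundary is at distance at least [7 e / 8] from [b i],
   while all [l'] within [e / 8] of [l] are within [e / 4] of it: less than half of that, as
   [ev_bound] with ratio [1 / 2] asks. *)
have e8 : 0 < e / 8 by rewrite divr_gt0.
have [i hi] := core_dense cd Kl e8.
have bd x : boundary K x -> e <= nrm (x - l).
  move=> Bx; rewrite leNgt; apply/negP => xl; move: Bx; rewrite (boundaryE clK) => -[_]; apply.
  apply/interior_nrmP; exists (e - nrm (x - l)); first by rewrite subr_gt0.
  by move=> y xy; apply: he; have := ler_dist_nrm x l y; rewrite (nrmBC l x); lra.
have s0 : 0 < Num.sqrt (kap i) by rewrite sqrtr_gt0; exact: core_kap0 cd i.
exists (2 / ((1 - 2^-1) * Num.sqrt (kap i))), (e / 8); split => //.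
  by rewrite divr_ge0// mulr_ge0 ?(ltW s0)//; lra.
move=> l' ll'; have Kl' : K l' by apply: he; rewrite nrmBC; lra.
split => // f rf; apply: (ev_bound cd (d := 7 / 8 * e)) => //; try lra.
- by move=> x /bd; have := ler_dist_nrm (b i) x l; rewrite (nrmBC (b i) l); lra.
- by have := ler_dist_nrm l l' (b i); lra.
Qed.

(* [z -> (f z - sum eps d') / (z - l)] paired with [d'] solves [(S - l) y = x]. *)
Lemma solve (l : C) x (d' : {poly C}) h : D x ->
  (forall j, d'`_j * (w j - l) = x.2`_j) -> ratK K h ->
  (forall z, K z -> x.1 z - fsum d' (fun j => (eps j)%:C) = (z - l) * h z) ->
  exists2 y, D y & y.2 = d' /\ sub_scalar S l (tau y) = tau x.
Proof.
move=> Dx hd rh hh; have Dy : D (h, d') by [].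
exists (h, d') => //; split => //; rewrite (gns_sub_scalar g)//; apply: (gns_tau_eq g) => //.
  by apply: (gns_DB g); [exact: (gns_ZD g)|exact: (gns_DZ g)].
move=> s; rewrite (gns_t_sub g)//; case: s => -[[y By] j] []; rewrite /seqt /seq_zeta/=.
  by rewrite mulrC hd.
have e2 : x.2 = wmul w d' - l *: d'.
  by apply/polyP => i; rewrite coefB coefZ coef_wmul -hd; ring.
rewrite /seqF/= /bd_val/=.
have e3 : poles w eps x.2 y = poles w eps (wmul w d') y - l * poles w eps d' y.
  by rewrite e2 /poles -scaleNr addrC fsum_lin; ring.
have e4 := poles_mul eps d' (fun j => bd_neq_w sd j By).
rewrite e3 -[x.1 y](subrK (fsum d' (fun j => (eps j)%:C))).
rewrite (hh _ (boundary_sub clK By)).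
have -> : (y - l) * (h y + poles w eps d' y) =
    (y - l) * h y + (y * poles w eps d' y) - l * poles w eps d' y by ring.
by rewrite e4; ring.
Qed.

Lemma seq_resolvent (l : C) (d : R) : 0 < d -> (forall z, K z -> d <= nrm (z - l)) ->
  (exists T', bounded_inverse (sub_scalar S l) T') /\
  forall h, d * nrm h <= nrm (sub_scalar S l h).
Proof.
move=> d0 Kd; have nK : ~ K l by move=> /Kd; rewrite subrr nrm0; lra.
apply: (dense_resolvent mD (bounded_sub_scalar bS l) d0) => x Dx.
  apply: (gns_below g) => //; first exact: ltW.
  move=> s; rewrite ler_wpM2r ?nrm_ge0//; apply: Kd.
  by case: s => -[y j] []; [exact: (w_in sd)|exact: (bd_in cd)].
have wl j : w j - l != 0.
  by rewrite subr_eq0; apply/eqP => h; apply: nK; rewrite -h; exact: w_in sd j.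
pose d' : {poly C} := \poly_(j < size x.2) (x.2`_j / (w j - l)).
pose h z := (x.1 z - fsum d' (fun j => (eps j)%:C)) / (z - l).
have zl z : K z -> z - l != 0 by move=> /Kd h1; rewrite -nrm_gt0; lra.
have [||||y Dy [_ e]] := @solve l x d' h => //; last by exists y.
- move=> j; rewrite coef_poly; case: ltnP => hj; first by rewrite divfK.
  by rewrite mul0r nth_default.
- apply: ratK_div; first by apply: ratKB => //; exact: ratK_cst.
    by apply: ratKB; [exact: ratK_id|exact: ratK_cst].
  exact: zl.
- by move=> z /zl zl0; rewrite /h mulrC divfK.
Qed.

Lemma phi_Z l c x : (forall j, c j * (l - w j) = (eps j)%:C) ->
  phi l c (Z x) = l * phi l c x.
Proof.
move=> hc; rewrite /phi/= fsum_wmul mulrDr -fsumZ -addrA; congr (_ + _).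
rewrite -fsumD; apply: eq_fsum => j _; rewrite -hc; ring.
Qed.

(** Finite part at the pole [w J]. It is no eigenfunctional but the second member of a Jordan chain
    over the coordinate of index [J]; see [fp_Z]. *)
Definition fpc J : nat -> C := fun j => if j == J then 0 else (eps j)%:C / (w J - w j).
Definition hatc l : nat -> C := fun j => (eps j)%:C / (l - w j).

Lemma fsum_if d J (f : nat -> C) :
  fsum d (fun j => if j == J then f j else 0) = d`_J * f J.
Proof.
have h : (size d <= maxn (size d) J.+1)%N by rewrite leq_maxl.
have JN : (J < maxn (size d) J.+1)%N by rewrite leq_maxr.
rewrite (fsum_wide _ h) (bigD1 (Ordinal JN))//= eqxx big1 ?addr0// => i iJ.
case: eqP => [e|_]; last by rewrite mulr0.
by case/eqP: iJ; exact: val_inj.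
Qed.

Lemma fp_Z J x : phi (w J) (fpc J) (Z x) = w J * phi (w J) (fpc J) x + (eps J)%:C * x.2`_J.
Proof.
rewrite /phi/= fsum_wmul mulrDr -fsumZ -!addrA; congr (_ + _).
rewrite -fsumD [_ * x.2`_J]mulrC -(fsum_if x.2 J (fun j => (eps j)%:C)) -fsumD.
apply: eq_fsum => j _; rewrite /fpc; case: eqVneq => [->|jJ]; first by ring.
have n0 : w J - w j != 0 by rewrite subr_eq0; apply: contraNneq jJ => /(seq_inj sd) ->.
by move: ((eps j)%:C : C) => e; field.
Qed.

Lemma w_neq i j : i != j -> w i - w j != 0.
Proof. by move=> ij; rewrite subr_eq0; apply: contraNneq ij => /(seq_inj sd) ->. Qed.

Let sk j : 0 < Num.sqrt (kap j).
Proof. by rewrite sqrtr_gt0; exact: core_kap0 cd j. Qed.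

Lemma fp_vector J : exists k, forall x, D x -> phi (w J) (fpc J) x = inner (tau x) k.
Proof.
have [A [r [A0 r0 hA]]] := evb_int (seq_int sd J).
have evA : evb Gam (w J) A by case: (hA (w J)) => //; rewrite subrr nrm0 ltW.
have p0 j : 0 < 2^-1 ^+ j.+1 * Num.sqrt (kap j) by rewrite mulr_gt0 ?exprn_gt0.
(* The finitely many indices below [J] are absorbed into the sum; those above [J] satisfy the bound
   with constant 1 by [seq_sep]. *)
pose B := 1 + \sum_(i < J) nrm (fpc J i) / (2^-1 ^+ i.+1 * Num.sqrt (kap i)).
have B0 : 0 <= B.
  by rewrite addr_ge0// sumr_ge0// => i _; rewrite divr_ge0 ?nrm_ge0// ltW.
have [|k _ hk] := phi_vector cd sd g A0 B0 evA (c := fpc J); last by exists k.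
move=> j; rewrite -mulrA; have [jJ|Jj|->] := ltngtP j J.
- rewrite -ler_pdivrMr// /B (bigD1 (Ordinal jJ))//= addrCA lerDl addr_ge0// sumr_ge0// => i _.
  by rewrite divr_ge0 ?nrm_ge0// ltW.
- apply: (@le_trans _ _ (1 * (2^-1 ^+ j.+1 * Num.sqrt (kap j)))); last first.
    rewrite ler_wpM2r ?(ltW (p0 _))// lerDl sumr_ge0// => i _.
    by rewrite divr_ge0 ?nrm_ge0// ltW.
  rewrite /fpc gtn_eqF// nrmM nrmV nrm_real (gtr0_norm (seq_eps0 sd j)) mul1r.
  rewrite ler_pdivrMr; last by rewrite nrm_gt0 w_neq// ltn_eqF.
  have := seq_sep sd Jj; rewrite (nrmBC (w j)); lra.
- by rewrite /fpc eqxx nrm0 mulr_ge0// ltW.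
Qed.

Lemma hat_vector l (A m : R) : 0 <= A -> evb Gam l A -> 0 < m ->
  (forall j, m <= nrm (l - w j)) ->
  exists2 k, nrm k <= 2 * A + m^-1 & forall x, D x -> phi l (hatc l) x = inner (tau x) k.
Proof.
move=> A0 ev m0 hm.
apply: (phi_vector cd sd g A0 _ ev); first by rewrite invr_ge0 ltW.
move=> j; rewrite /hatc nrmM nrmV nrm_real (gtr0_norm (seq_eps0 sd j)).
have lw : 0 < nrm (l - w j) by apply: lt_le_trans (hm j).
rewrite ler_pdivrMr// -!mulrA ler_pdivlMl//.
have h1 := seq_eps sd j; have h2 := seq_delta1 sd j; have h3 := hm j.
have h4 : 0 < 2^-1 ^+ j.+1 * Num.sqrt (kap j) by rewrite mulr_gt0 ?exprn_gt0.
have h5 : eps j <= 2^-1 ^+ j.+1 * Num.sqrt (kap j).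
  by apply: le_trans h1 _; rewrite mulrAC ler_piMr// ltW.
have h6 := seq_eps0 sd j.
by rewrite mulrA; move: (2^-1 ^+ j.+1 * _) h4 h5 => p p0 ep; nra.
Qed.

Lemma hatcE l j : l - w j != 0 -> hatc l j * (l - w j) = (eps j)%:C.
Proof. by move=> h; rewrite /hatc divfK. Qed.

(** The relation behind the whole construction: up to a small multiple of the constant function, the
    unit vector is an eigenvector, yet it is not one. *)
Lemma e_rel j : sub_scalar S (w j) (tau (sq_e j)) = (eps j)%:C *: tau sq_u0.
Proof.
rewrite (gns_sub_scalar g (w j) (D_e j)) -(gns_tauZ g _ D_u0); congr tau.
apply: injective_projections.
  apply/funext => z.
  transitivity (z * 0 + fsum 'X^j (fun j => (eps j)%:C) - w j * 0 : C); first by [].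
  by rewrite fsum_monom !mulr0 add0r subr0; exact/esym/mulr1.
apply/polyP => i; rewrite coefB coefZ coef_wmul coefZ coef0 mulr0 coefXn.
by case: eqVneq => [->|_]; rewrite ?mul0r ?mulr0 ?subrr// mul1r mulr1 subrr.
Qed.

Lemma seq_fredholm l (m : R) : interior K l -> 0 < m ->
  (forall j, w j != l -> m <= nrm (w j - l)) -> fredholm_dims (sub_scalar S l) 0 1.
Proof.
move=> Il m0 hm; have Kl : K l by exact: interior_subset Il.
have bT := bounded_sub_scalar bS l; have lT := bounded_lin bT.
have [d0 d00 hd0] := interior_dist clK Il.
pose d := Num.min m d0; have dp : 0 < d by rewrite lt_min m0.
have dm : d <= m by rewrite ge_min lexx.
have dd : d <= d0 by rewrite ge_min lexx orbT.
have [[J eJ]|nJ] := pselect (exists J, w J = l).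
(* At [l = w J] the coordinate of index [J] spans the cokernel. Multiplication by [zeta - l] loses
   this coordinate; it is recovered from the finite part, whose value at [(S - l) x] is [eps J]
   times the coordinate. *)
- have [k hk] := coef_vector cd g J; have [kf hkf] := fp_vector J.
  have ek j : inner (tau (sq_e j)) k = (j == J)%:R.
    by rewrite -hk ?coefXn//; [rewrite eq_sym|exact: D_e].
  have kn0 : k <> 0 by move=> k0; have := ek J; rewrite k0 inner0r eqxx => /eqP; rewrite eq_sym oner_eq0.
  have eig h : inner (sub_scalar S l h) k = 0.
    rewrite innerBl innerZl (gns_eigen g (k := k) (l := l)) ?subrr// => x Dx.
    by rewrite -!hk//; [rewrite coef_wmul -eJ mulrC|exact: seqZD].
  have ff x : D x -> (eps J)%:C * x.2`_J = inner (sub_scalar S l (tau x)) kf.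
    move=> Dx; rewrite innerBl innerZl (gns_S g)// -!hkf//; last exact: seqZD.
    by rewrite fp_Z -eJ addrAC subrr add0r.
  have ep := seq_eps0 sd J.
  pose u := nrm (tau sq_u0); pose v := nrm (tau (sq_e J)).
  have u0 : 0 <= u by exact: nrm_ge0. have v0 : 0 <= v by exact: nrm_ge0.
  pose c := (d^-1 * (1 + nrm kf * u) + nrm kf * v / eps J).
  have c0 : 0 <= c.
    rewrite addr_ge0 ?mulr_ge0 ?nrm_ge0 ?invr_ge0 ?(ltW dp) ?(ltW ep)//.
    by rewrite addr_ge0// mulr_ge0 ?nrm_ge0.
  have below h : (c + 1)^-1 * nrm h <= nrm (sub_scalar S l h).
    have c1 : 0 < c + 1 by rewrite ltr_wpDl.
    apply: (bounded_below_dense mD bT) => [|x Dx]; first by rewrite invr_ge0 ltW.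
    rewrite ler_pdivrMl//; set y := sub_scalar S l (tau x).
    (* Without its coordinate of index [J], the vector lives where [zeta - l] is bounded below by
       [d]. *)
    pose s := x.2`_J; pose x' := x - s *: sq_e J.
    have De : D (s *: sq_e J) by apply: (gns_DZ g); exact: D_e.
    have Dx' : D x' by exact: (gns_DB g).
    have sy : eps J * nrm s <= nrm kf * nrm y.
      rewrite mulrC; have := inner_CS y kf; rewrite -ff// nrmM nrm_real gtr0_norm// mulrC.
      by rewrite [X in _ <= X -> _]mulrC.
    have x'y : d * nrm (tau x') <= nrm y + nrm kf * u * nrm y.
      have h1 : d * nrm (tau x') <= nrm (sub_scalar S l (tau x')).
        apply: (gns_below g) => //; first exact: ltW.
        move=> [[[z Bz] j] []]; rewrite /seqt /seq_zeta/=.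
          have [wl|wl] := eqVneq (w j) l; last first.
            by rewrite ler_wpM2r ?nrm_ge0// (le_trans dm)// hm.
          have -> : j = J by apply: (seq_inj sd); rewrite wl eJ.
          by rewrite coefB coefZ coefXn eqxx mulr1 subrr nrm0 !mulr0.
        by rewrite ler_wpM2r ?nrm_ge0// (le_trans dd)// hd0.
      apply: le_trans h1 _.
      rewrite (gns_tauB g)// (gns_tauZ g _ (D_e J)) (lin_sub lT) (lin_scale lT) -eJ e_rel eJ.
      rewrite (le_trans (ler_nrmB _ _))// lerD2l !nrmZ nrm_real gtr0_norm// mulrA -/u.
      by rewrite [leRHS]mulrAC ler_wpM2r// mulrC.
    have xx : nrm (tau x) <= nrm (tau x') + nrm s * v.
      have := ler_nrmD (tau x') (tau (s *: sq_e J)).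
      by rewrite -(gns_tauD g)// subrK (gns_tauZ g _ (D_e J)) nrmZ.
    apply: le_trans xx _; rewrite mulrDl mul1r ler_wpDr ?nrm_ge0// /c mulrDl lerD//.
      by rewrite -mulrA ler_pdivlMl// mulrDl mul1r.
    by rewrite -(ler_pM2l ep) mulrA (le_trans (ler_wpM2r v0 sy))//
      le_eqVlt; apply/orP; left; apply/eqP; field; rewrite gt_eqF.
  have c1 : 0 < (c + 1)^-1 by rewrite invr_gt0 ltr_wpDl.
  apply: (fredholm01 bT c1 below kn0 eig).
  apply: (range_of_kernel mD (u := sq_e J)) => //.
  + exact: D_e.
  + by rewrite ek eqxx.
  + exact: closed_range_below bT c1 below.
  + move=> x Dx; rewrite -hk// => xJ.
    have epC : ((eps J)%:C : C) != 0 by rewrite -nrm_gt0 nrm_real gtr0_norm.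
    pose d1 : {poly C} := \poly_(j < size x.2) (x.2`_j / (w j - l)).
    (* The equation leaves the entry of index [J] free, as both sides vanish there. It is chosen so
       that the numerator of the rational part vanishes at [l] and can be divided by [z - l]. *)
    pose q := (x.1 l - fsum d1 (fun j => (eps j)%:C)) / (eps J)%:C.
    pose d' := q *: 'X^J + d1.
    have fd' : fsum d' (fun j => (eps j)%:C) = x.1 l.
      by rewrite fsum_lin fsum_monom /q divfK// subrK.
    have rf : ratK K (fun z => x.1 z - fsum d' (fun j => (eps j)%:C)).
      by apply: ratKB => //; exact: ratK_cst.
    have [h rh hh] := ratK_quotient rf Kl.
    have [|z Kz|y Dy [_ e]] := @solve l x d' h Dx _ rh; last by exists (tau y).
    * move=> j; rewrite coefD coefZ coefXn coef_poly -eJ.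
      have [->|jJ] := eqVneq j J; first by rewrite subrr mulr0 xJ.
      rewrite mulr0 add0r; case: ltnP => hj; first by rewrite divfK// w_neq.
      by rewrite mul0r nth_default.
    * by rewrite hh// fd' subrr add0r.
(* Away from the [w j], multiplication by [zeta - l] is bounded below and the cokernel is spanned by
   evaluation at [l], poles included. *)
- have wl j : l - w j != 0 by rewrite subr_eq0; apply/eqP => h; apply: nJ; exists j.
  have wl' j : w j - l != 0 by rewrite -oppr_eq0 opprB.
  have [A [r [A0 r0 hA]]] := evb_int Il.
  have evA : evb Gam l A by case: (hA l) => //; rewrite subrr nrm0 ltW.
  have [|k _ hk] := hat_vector A0 evA m0.
    by move=> j; rewrite nrmBC; apply: hm; rewrite -subr_eq0.
  have uk : inner (tau sq_u0) k = 1 by rewrite -(hk _ D_u0) /phi/= fsum0 addr0.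
  have kn0 : k <> 0 by move=> k0; move/eqP: uk; rewrite k0 inner0r eq_sym oner_eq0.
  have eig h : inner (sub_scalar S l h) k = 0.
    rewrite innerBl innerZl (gns_eigen g (k := k) (l := l)) ?subrr// => x Dx.
    rewrite -!hk//; [|exact: seqZD]; apply: phi_Z => j; exact: hatcE.
  have below h : d * nrm h <= nrm (sub_scalar S l h).
    apply: (bounded_below_dense mD bT (ltW dp)) => x Dx.
    apply: (gns_below g) => //; first exact: ltW.
    move=> [[[z Bz] j] []]; rewrite /seq_zeta/= ler_wpM2r ?nrm_ge0//.
      by rewrite (le_trans dm)// hm// -subr_eq0.
    by rewrite (le_trans dd)// hd0.
  apply: (fredholm01 bT dp below kn0 eig).
  apply: (range_of_kernel mD (u := sq_u0)) => //.
  + exact: D_u0.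
  + exact: closed_range_below bT dp below.
  + move=> x Dx; rewrite -hk// => xl.
    pose d' : {poly C} := \poly_(j < size x.2) (x.2`_j / (w j - l)).
    have rf : ratK K (fun z => x.1 z - fsum d' (fun j => (eps j)%:C)).
      by apply: ratKB => //; exact: ratK_cst.
    have [h rh hh] := ratK_quotient rf Kl.
    have fd' : fsum d' (fun j => (eps j)%:C) = - fsum x.2 (hatc l).
      have sz : (size d' <= size x.2)%N by exact: size_poly.
      rewrite (fsum_wide _ sz) -sumrN; apply: eq_bigr => j _.
      rewrite coef_poly ltn_ord /hatc.
      have := wl j; have := wl' j; move: ((eps j)%:C : C) (w j) => e wj h1 h2.
      by field; rewrite h1 h2.
    have [|z Kz|y Dy [_ e]] := @solve l x d' h Dx _ rh; last by exists (tau y).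
    * move=> j; rewrite coef_poly; case: ltnP => hj; first by rewrite divfK.
      by rewrite mul0r nth_default.
    * by rewrite hh// fd' opprK -[X in X + _]/(phi l (hatc l) x) xl add0r.
Qed.

Lemma nrm_e_ge j : Num.sqrt (kap j) <= nrm (tau (sq_e j)).
Proof.
by have := coef_le cd g j (D_e j); rewrite coefXn eqxx nrm1 mul1r.
Qed.

(** Tested on the unit vectors: [(S - l) e_j = eps j * u0 + (w j - l) * e_j], and [eps j] is small
    compared with the norm of [e_j], which is at least the square root of [kap j]. *)
Lemma not_below_limit l : (forall (e : R) N, 0 < e -> exists2 j, (N <= j)%N & nrm (w j - l) < e) ->
  forall c : R, 0 < c -> ~ (forall x, c * nrm x <= nrm (sub_scalar S l x)).
Proof.
move=> lim c c0 below; pose u := nrm (tau sq_u0).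
have u0 : 0 <= u by exact: nrm_ge0.
have c2 : 0 < c / 2 by rewrite divr_gt0.
have cu : 0 < c / 2 / (u + 1) by rewrite divr_gt0// ltr_wpDl.
have [N hN] := inv_small cu; have [j Nj wl] := lim _ N c2.
have e1 : sub_scalar S l (tau (sq_e j)) =
    (eps j)%:C *: tau sq_u0 + (w j - l) *: tau (sq_e j).
  by rewrite -e_rel /sub_scalar scalerBl addrA subrK.
have pw n : (2^-1 : R) ^+ n.+1 <= n.+1%:R^-1.
  rewrite exprVn lef_pV2 ?posrE ?exprn_gt0//.
  by rewrite -natrX ler_nat ltnW// ltn_expl.
have e2 : eps j <= j.+1%:R^-1 * nrm (tau (sq_e j)).
  apply: le_trans (seq_eps sd j) _; apply: ler_pM.
  - by rewrite mulr_ge0 ?exprn_ge0// ltW// (seq_delta0 sd).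
  - exact: sqrtr_ge0.
  - apply: le_trans (pw j); rewrite ler_piMr ?exprn_ge0//; exact: seq_delta1 sd j.
  - exact: nrm_e_ge.
have := below (tau (sq_e j)); rewrite e1.
have := ler_nrmD ((eps j)%:C *: tau sq_u0) ((w j - l) *: tau (sq_e j)).
rewrite !nrmZ nrm_real (gtr0_norm (seq_eps0 sd j)) -/u.
have v0 : 0 < nrm (tau (sq_e j)) by apply: lt_le_trans (nrm_e_ge j).
have := hN j Nj; rewrite ltr_pdivlMr; last by rewrite ltr_wpDl.
move: (nrm _) v0 e2 wl => v v0 e2 wl.
have i0 : 0 <= j.+1%:R^-1 :> R by rewrite invr_ge0.
move: (j.+1%:R^-1 : R) i0 e2 => i i0 e2 h1 h2 h3.
have : eps j * u <= i * v * u by rewrite ler_wpM2r.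
by move: h1 h2 h3 wl; nra.
Qed.

(** An invariant subspace on which evaluation of the rational part alone is an eigenfunctional, at
    every [b i] and at [a]; the [w j] do not interfere there. *)
Definition rat_part : set H := closure [set tau x | x in [set x | D x /\ x.2 = 0]].

Lemma rat_part_tau x : D x -> x.2 = 0 -> rat_part (tau x).
Proof. by move=> Dx x2; apply: subset_closure; exists x. Qed.

Lemma rat_part_subspace : is_subspace rat_part.
Proof.
apply: closure_subspace; split.
  by exists 0; [split; [exact: seqD0|]|exact: gns_tau0 g].
move=> s _ _ [x [Dx x2] <-] [y [Dy y2] <-]; exists (s *: x + y).
  by split; [exact: seqDL|rewrite /= x2 y2 scaler0 addr0].
exact: (gns_tauL g).
Qed.

Lemma rat_part_closed : closed rat_part. Proof. exact: closed_closure. Qed.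

(** For [not_bounded_below], [mu] is taken off [K] near [l], where the resolvent preserves
    [rat_part], and [b i] near [l], where evaluation is bounded. *)
Lemma not_below_boundary l : boundary K l ->
  forall c : R, 0 < c -> ~ (forall x, c * nrm x <= nrm (sub_scalar S l x)).
Proof.
move=> Bl; apply: (not_bounded_below bS rat_part_subspace rat_part_closed) => d d0.
have d2 : 0 < d / 2 by rewrite divr_gt0.
have [mu nK lmu] : exists2 mu, ~ K mu & nrm (l - mu) < d / 2.
  apply: contrapT => h; move: Bl; rewrite (boundaryE clK) => -[_]; apply.
  apply/interior_nrmP; exists (d / 2) => // y ly; apply: contrapT => nKy.
  by apply: h; exists y.
have Kl : K l by exact: (boundary_sub clK).
have [i hi] := core_dense cd Kl d2.
have [A evA] : exists2 A : R, 0 <= A & evb Gam (b i) A.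
  by exists (Num.sqrt (kap i))^-1; [rewrite invr_ge0 sqrtr_ge0|exact: evb_b].
have z0 j : nrm (0 : C) <= 0 * 2^-1 ^+ j.+1 * Num.sqrt (kap j) by rewrite nrm0 !mul0r.
move=> evb'; have [k _ hk] := phi_vector cd sd g evA (lexx 0) evb' (c := fun=> 0) z0.
exists mu, (b i), k; split.
- by have := ler_dist_nrm l mu (b i); rewrite (nrmBC mu l); lra.
- by move: lmu; lra.
- have [dm dm0 hdm] : exists2 dm : R, 0 < dm & forall z, K z -> dm <= nrm (z - mu).
    apply: contrapT => h; apply: nK; apply/((closed_nrmP _).1 clK) => e e0.
    apply: contrapT => h'; apply: h; exists e => // z Kz; rewrite leNgt.
    by apply/negP => zl; apply: h'; exists z => //; rewrite nrmBC.
  have [[T' [bT' T1 T2]] _] := seq_resolvent dm0 hdm.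
  move=> v Vv; exists (T' v); last exact: T2.
  apply: (closure_invariant bT') Vv => _ [x [Dx x2] <-].
  have [|||y Dy [y2 hy]] := @solve mu x 0 (fun z => x.1 z / (z - mu)) Dx.
  + by move=> j; rewrite x2 coef0 mul0r.
  + apply: ratK_div => //; first by apply: ratKB; [exact: ratK_id|exact: ratK_cst].
    by move=> z /hdm h; rewrite -nrm_gt0; lra.
  + move=> z /hdm h; rewrite fsum0 subr0 mulrC divfK// -nrm_gt0; lra.
  + by exists y => //; rewrite -hy T1.
- exists (tau sq_u0); first by apply: rat_part_tau => //; exact: D_u0.
  by rewrite -(hk _ D_u0) /phi/= fsum0 addr0; apply/eqP; exact: oner_neq0.
- apply: (inner_closure0 (bounded_sub_scalar bS (b i))) => _ [x [Dx x2] <-].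
  rewrite innerBl innerZl (gns_S g)// -!hk//; last exact: seqZD.
  by rewrite /phi/= x2 fsum_wmul !fsum0 !addr0 subrr.
Qed.

Lemma coef_vectors : exists kc : nat -> H, forall j x, D x -> x.2`_j = inner (tau x) (kc j).
Proof.
have /choice[kc hkc] : forall j, exists k, forall x, D x -> x.2`_j = inner (tau x) k.
  by move=> j; exact: (coef_vector cd g j).
by exists kc.
Qed.

Variable kc : nat -> H.
Hypothesis hkc : forall j x, D x -> x.2`_j = inner (tau x) (kc j).

Lemma kc_eigen j h : inner (S h) (kc j) = w j * inner h (kc j).
Proof.
apply: (gns_eigen g) => x Dx; rewrite -!hkc//; last exact: seqZD.
by rewrite coef_wmul mulrC.
Qed.

(** The left side is the square of a bounded seminorm, so [bessel] extends from the dense part by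
    the triangle inequality. *)
Lemma bessel_H N h : \sum_(j < N) kap j * nrm (inner h (kc j)) ^+ 2 <= nrm h ^+ 2.
Proof.
pose B x y := \sum_(j < N) (kap j)%:C * (inner x (kc j) * (inner y (kc j))^*).
have psdB : psd_form B setT.
  split => //.
  - move=> c x y z _ _ _; rewrite /B mulr_sumr -big_split/=; apply: eq_bigr => j _.
    rewrite innerDl innerZl; ring.
  - move=> x y _ _; rewrite /B rmorph_sum/=; apply: eq_bigr => j _.
    by rewrite rmorphM/= conj_mulJ; congr (_ * _); apply: ReImE; rewrite ?ReJ ?ImJ/= ?oppr0.
  - move=> x _; rewrite /B; rewrite (_ : complex.Re _ = \sum_(j < N) kap j * nrm (inner x (kc j)) ^+ 2).
      by apply: sumr_ge0 => j _; rewrite mulr_ge0 ?sqr_ge0// ltW// (core_kap0 cd).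
    rewrite Re_sum; apply: eq_bigr => j _.
    by rewrite ReRM mul_conj.
have qE x : qn B x ^+ 2 = \sum_(j < N) kap j * nrm (inner x (kc j)) ^+ 2.
  rewrite (qn_sqr psdB)// Re_sum; apply: eq_bigr => j _.
  by rewrite ReRM mul_conj.
have [M M0 HM] : exists2 M : R, 0 <= M & forall x, qn B x <= M * nrm x.
  pose M2 := \sum_(j < N) kap j * nrm (kc j) ^+ 2.
  have M20 : 0 <= M2.
    by apply: sumr_ge0 => j _; rewrite mulr_ge0 ?sqr_ge0// ltW// (core_kap0 cd).
  exists (Num.sqrt M2); first exact: sqrtr_ge0.
  move=> x; rewrite -(@ler_pXn2r _ 2)// ?nnegrE ?mulr_ge0 ?nrm_ge0 ?sqrtr_ge0 ?qn_ge0//.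
  rewrite qE exprMn (sqr_sqrtr M20) mulr_suml; apply: ler_sum => j _.
  rewrite -mulrA ler_wpM2l ?(ltW (core_kap0 cd j))// -exprMn mulrC.
  by rewrite ler_pXn2r ?nnegrE ?mulr_ge0 ?nrm_ge0// inner_CS.
rewrite -qE ler_pXn2r ?nnegrE ?nrm_ge0 ?qn_ge0//.
apply/ler_addgt0Pr => e e0; have M1 : 0 < M + 1 by rewrite ltr_wpDl.
have [_ _ _ /(_ h _ (divr_gt0 e0 M1))[x Dx hx]] := mD.
have h1 : qn B (tau x) <= nrm (tau x).
  rewrite -(@ler_pXn2r _ 2)// ?nnegrE ?nrm_ge0 ?qn_ge0// qE.
  apply: le_trans (bessel cd g N Dx); apply: ler_sum => j _; by rewrite -hkc.
have h2 := @qnD _ _ _ _ psdB (tau x) (h - tau x) I I; rewrite addrC subrK in h2.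
have h3 := HM (h - tau x).
have := ler_nrmB h (h - tau x); rewrite opprB addrC subrK.
by move: hx; rewrite ltr_pdivlMr// => hx; nra.
Qed.

(** If [(f, d)] approximates [h], Bessel's inequality makes [d] small, and with it the poles; hence
    [(f, 0)] approximates [h] as well. *)
Lemma rat_part_char h : (forall j, inner h (kc j) = 0) -> rat_part h.
Proof.
move=> h0; apply/closure_nrmP => e e0; have e4 : 0 < e / 4 by rewrite divr_gt0.
have [_ _ _ /(_ h _ e4)[x Dx hx]] := mD.
have D1 : D (x.1, 0) by exact: Dx.
have D2 : D (fun=> 0, x.2) by exact: ratK_cst.
exists (tau (x.1, 0)); first by exists (x.1, 0).
have e1 : tau x = tau (x.1, 0) + tau (fun=> 0, x.2).
  rewrite -(gns_tauD g)//; congr tau; apply: injective_projections; rewrite /= ?add0r//.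
  by apply/funext => z; exact/esym/addr0.
have e2 : nrm (tau (fun=> 0, x.2)) <= e / 2.
  have S1 : \sum_(j < size x.2) kap j * nrm x.2`_j ^+ 2 <= (e / 4) ^+ 2.
    apply: (@le_trans _ _ (nrm (h - tau x) ^+ 2)); last first.
      by rewrite ler_pXn2r ?nnegrE ?nrm_ge0 ?(ltW e4)// ltW.
    apply: le_trans (bessel_H (size x.2) _); apply: ler_sum => j _.
    by rewrite innerBl h0 sub0r nrmN -hkc.
  have c1 (j : 'I_(size x.2)) : nrm x.2`_j * Num.sqrt (kap j) <= e / 4.
    rewrite -(@ler_pXn2r _ 2)// ?nnegrE ?mulr_ge0 ?nrm_ge0 ?sqrtr_ge0 ?(ltW e0)//.
    apply: le_trans S1; rewrite (bigD1 j)//= exprMn (sqr_sqrtr (ltW (core_kap0 cd j))).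
    rewrite mulrC lerDl; apply: sumr_ge0 => i _; apply: mulr_ge0; last exact: sqr_ge0.
    by exact: ltW (core_kap0 cd i).
  have l1 : qn (gform Gam) (bpull (seqF w eps (fun=> 0, x.2))) <= e / 4.
    rewrite (_ : bpull _ = bpull (poles w eps x.2)); last first.
      by apply/funext => v; exact: add0r.
    apply: le_trans (poles_le cd sd _) _.
    apply: (@le_trans _ _ (\sum_(j < size x.2) 2^-1 ^+ j.+1 * (e / 4))).
      apply: ler_sum => j _; have dj := seq_delta0 sd j; have ej := seq_eps sd j.
      apply: (@le_trans _ _ (nrm x.2`_j * (2^-1 ^+ j.+1 * Num.sqrt (kap j)))).
        rewrite ler_wpM2l ?nrm_ge0// ler_pdivrMr//; apply: le_trans ej _.
        by rewrite mulrAC.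
      by rewrite mulrCA ler_wpM2l ?c1// exprn_ge0.
    by rewrite -mulr_suml ler_piMl ?geo_half// ltW.
  have e2 := divr_gt0 e0 (ltr0Sn _ 1).
  rewrite -(@ler_pXn2r _ 2)// ?nnegrE ?nrm_ge0 ?(ltW e2)//.
  rewrite (seq_sqr cd g D2) (right_eq cd)/=.
  have l2 : qn (gform Gam) (bpull (seqF w eps (fun=> 0, x.2))) ^+ 2 <= (e / 4) ^+ 2.
    by rewrite ler_pXn2r ?nnegrE ?qn_ge0 ?(ltW e4).
  by move: l2 S1; rewrite !expr2; have := mulr_gt0 e0 e0; lra.
have := ler_nrmD (h - tau x) (tau (fun=> 0, x.2)).
have -> : h - tau x + tau (fun=> 0, x.2) = h - tau (x.1, 0) by rewrite e1 opprD addrA subrK.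
by lra.
Qed.

Lemma K_nonempty : K !=set0. Proof. by exists a; exact: core_Ka cd. Qed.

Lemma off_dist l : ~ K l -> exists2 d : R, 0 < d & forall z, K z -> d <= nrm (z - l).
Proof.
move=> nK; apply: contrapT => h; apply: nK; apply/((closed_nrmP _).1 clK) => e e0.
apply: contrapT => h'; apply: h; exists e => // z Kz; rewrite leNgt.
by apply/negP => zl; apply: h'; exists z => //; rewrite nrmBC.
Qed.

Lemma seq_poly_inverse q : zero_free K q -> exists Q, bounded_inverse (poly_op S q) Q.
Proof.
move=> zf; apply: (poly_inverse_off bS K_nonempty zf) => l /off_dist[d d0 hd].
by have [] := seq_resolvent d0 hd.
Qed.

Lemma poly_op_rat (f : C -> C) p q : ratK K f -> (forall z, K z -> q.[z] * f z = p.[z]) ->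
  poly_op S q (tau (f, 0)) = poly_op S p (tau sq_u0).
Proof.
move=> rf e.
have m1 (h : C -> C) (r : {poly C}) : ratK K h ->
    poly_op S r (tau (h, 0)) = tau (fun z => r.[z] * h z, 0).
  move=> rh; apply: (gns_poly_op g (m := fun r x => (fun z => r.[z] * x.1 z, 0))) => //.
    by move=> r'; apply: ratKM => //; exact: ratK_poly.
  move=> r' [[[y By] j] []]; rewrite /seqt/= ?coef0 ?mulr0// /seqF/= /poles !fsum0 !addr0//.
rewrite (m1 _ _ rf) (m1 (fun=> 1) _ (ratK_cst K 1)); apply: (gns_tau_eq g).
- by apply: ratKM => //; exact: ratK_poly.
- by apply: ratKM; [exact: ratK_poly|exact: ratK_cst].
- move=> [[[y By] j] []]; rewrite /seqt/= ?coef0// /seqF/= /poles !fsum0 !addr0 mulr1.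
  by apply: e; exact: (boundary_sub clK).
Qed.

Lemma ratK_frac f : ratK K f -> exists p q : {poly C}, zero_free K q /\
  forall z, K z -> q.[z] * f z = p.[z].
Proof.
move=> [p [q [zf e]]]; exists p, q; split => // z Kz.
by rewrite e// mulrC divfK// zf.
Qed.

Lemma tau_split x : D x -> tau x = tau (x.1, 0) + \sum_(j < size x.2) x.2`_j *: tau (sq_e j).
Proof.
move=> Dx; have D1 : D (x.1, 0) by exact: Dx.
have Ds n (c : nat -> C) : D (\sum_(j < n) c j *: sq_e j) /\
    tau (\sum_(j < n) c j *: sq_e j) = \sum_(j < n) c j *: tau (sq_e j).
  elim: n => [|n [IH1 IH2]].
    by rewrite !big_ord0; split; [exact: seqD0|exact: gns_tau0 g].
  rewrite !big_ord_recr/=; have De := gns_DZ g (c n) (D_e n).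
  by split; [exact: (gns_DD g)|rewrite (gns_tauD g)// IH2 (gns_tauZ g _ (D_e n))].
have [D2 <-] := Ds (size x.2) (fun j => x.2`_j); rewrite -(gns_tauD g)//; congr tau.
apply: injective_projections => /=.
  rewrite (big_morph (fun y : E => y.1) (id1 := 0) (op1 := +%R))// big1 ?addr0// => j _.
  by rewrite /= scaler0.
rewrite add0r (big_morph (fun y : E => y.2) (id1 := 0) (op1 := +%R))//=.
by rewrite -[LHS]coefK poly_def.
Qed.

(** By subnormality [v] gives an eigenfunctional. By [e_rel] it annihilates the constant, hence the
    rational functions, and the unit vectors of index other than [j], so [v] is a multiple of
    [kc j]. The Jordan relation at [w j], applied to [v] itself, forces its coordinate of index [j]
    to vanish. *)
Lemma seq_kernel j v : S v = w j *: v -> v = 0.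
Proof.
move=> Sv; have ev := subnormal_eigen (gns_subnormal g) Sv.
have e0 i : (eps i)%:C * inner (tau sq_u0) v = (w j - w i) * inner (tau (sq_e i)) v.
  by rewrite -[LHS]innerZl -e_rel /sub_scalar innerBl innerZl ev mulrBl.
have epC i : ((eps i)%:C : C) != 0.
  by rewrite -nrm_gt0 nrm_real gtr0_norm (seq_eps0 sd).
have u0v : inner (tau sq_u0) v = 0.
  by have /eqP := e0 j; rewrite subrr mul0r mulf_eq0 (negPf (epC j)) => /eqP.
have eiv i : i != j -> inner (tau (sq_e i)) v = 0.
  move=> ij; have /eqP := e0 i; rewrite u0v mulr0 eq_sym mulf_eq0.
  by rewrite (negPf (w_neq _)) 1?eq_sym// => /eqP.
have fv f : ratK K f -> inner (tau (f, 0)) v = 0.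
  move=> rf; have [p [q [zf e]]] := ratK_frac rf.
  have lv (c : C) x y : inner (c *: x + y) v = c * inner x v + inner y v.
    by rewrite innerDl innerZl.
  have := poly_op_eigen bS q (tau (f, 0)) lv ev.
  rewrite (poly_op_rat rf e) (poly_op_eigen bS p (tau sq_u0) lv ev) u0v mulr0 => /esym/eqP.
  by rewrite mulf_eq0 (negPf (zf _ (w_in sd j))) => /eqP.
pose s := inner (tau (sq_e j)) v.
have xv x : D x -> inner (tau x) v = s * x.2`_j.
  move=> Dx; rewrite tau_split// innerDl fv// add0r.
  have h : (size x.2 <= maxn (size x.2) j.+1)%N by rewrite leq_maxl.
  have jN : (j < maxn (size x.2) j.+1)%N by rewrite leq_maxr.
  rewrite (big_morph (fun y => inner y v) (fun y z => innerDl y z v) (inner0l v)).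
  transitivity (fsum x.2 (fun i => inner (tau (sq_e i)) v)).
    by apply: eq_bigr => i _; rewrite innerZl.
  rewrite (fsum_wide _ h) (bigD1 (Ordinal jN))//= big1 ?addr0 1?mulrC// => i ij.
  by rewrite eiv ?mulr0.
have vE : v = s^* *: kc j.
  apply/eqP; rewrite -subr_eq0; apply/eqP; apply: (dense_ortho mD) => x Dx.
  rewrite innerBr innerZr xv// (hkc j Dx).
  have -> : s^*^* = s by apply: ReImE; rewrite ?ReJ ?ImJ ?opprK.
  by rewrite subrr.
have [kf hkf] := fp_vector j.
have fpe h : inner (S h) kf = w j * inner h kf + (eps j)%:C * inner h (kc j).
  have cc (z : C) : z^*^* = z by apply: ReImE; rewrite ?ReJ ?ImJ ?opprK.
  rewrite -[w j]cc -[(eps j)%:C]cc -!innerZr -innerDr; move: h.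
  apply: (gns_inner_ext g (A := S) (B := id) bS (bounded_id H)) => x Dx.
  rewrite (gns_S g)// innerDr !innerZr !cc -hkf//; last exact: seqZD.
  by rewrite fp_Z -hkf// -hkc.
have := fpe v; rewrite Sv innerZl => /eqP; rewrite addrC -subr_eq subrr eq_sym.
rewrite mulf_eq0 (negPf (epC j)) => /eqP vk.
by apply: inner_eq0; rewrite {2}vE innerZr vk mulr0.
Qed.

Lemma inner_u0 x : D x -> x.2 = 0 -> inner (tau x) (tau sq_u0) = x.1 a.
Proof.
move=> Dx x2; rewrite (gns_inner g Dx D_u0) -(GamC_a cd Dx) /gform.
have e (v : bd_type K * nat) : seqt w eps x (v, false) * (seqt w eps sq_u0 (v, false))^* = bpull x.1 v.
  rewrite /seqt/= /seqF/= x2 /poles !fsum0 !addr0.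
  by apply: ReImE; rewrite ?ReM ?ImM ReJ ImJ/=; ring.
have e0 (v : bd_type K * nat) : seqt w eps x (v, true) * (seqt w eps sq_u0 (v, true))^* = 0.
  by rewrite /seqt/= x2 !coef0; exact: mul0r.
apply: ReImE; rewrite /GamC/= /seq_Gam.
  rewrite -[RHS]addr0 -[X in _ = _ + X](Gam0 (core_GamL cd)).
  by congr (Gam _ + Gam _); apply/funext => v; [exact: (congr1 (@complex.Re R) (e v))
    |exact: (congr1 (@complex.Re R) (e0 v))].
rewrite -[RHS]addr0 -[X in _ = _ + X](Gam0 (core_GamL cd)).
by congr (Gam _ + Gam _); apply/funext => v; [exact: (congr1 (@complex.Im R) (e v))
  |exact: (congr1 (@complex.Im R) (e0 v))].
Qed.

Lemma seq_irreducible : irreducible_operator S.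
Proof.
move=> V redV; have [P [PL Pn Psa PP [PS VP]]] := reducing_projection bS redV.
have epC i : ((eps i)%:C : C) != 0.
  by rewrite -nrm_gt0 nrm_real gtr0_norm (seq_eps0 sd).
have Ppoly (Q : H -> H) p x : (forall (c : C) x y, Q (c *: x + y) = c *: Q x + Q y) ->
    (forall x, Q (S x) = S (Q x)) -> Q (poly_op S p x) = poly_op S p (Q x).
  move=> QL QS; elim/poly_ind: p => [|p c IH]; first by rewrite !poly_op0// (lin_0 QL).
  by rewrite !poly_opD// !poly_opMX// !poly_opC// (lin_add QL) QS IH (lin_scale QL).
(* An operator in the commutant is determined by its value at [u0]: if this is 0, then [e_rel] makes
   [Q e_j] an eigenvector, which vanishes by [seq_kernel]. *)
have zero (Q : H -> H) : (forall (c : C) x y, Q (c *: x + y) = c *: Q x + Q y) ->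
    (forall x, Q (S x) = S (Q x)) -> (forall x y, nrm (Q x - Q y) <= 2 * nrm (x - y)) ->
    Q (tau sq_u0) = 0 -> forall h, Q h = 0.
  move=> QL QS Qn Qu; apply: (dense_eq0 mD Qn) => x Dx.
  rewrite tau_split// (lin_add QL) (lin_sum QL) big1 ?addr0.
    have [p [q [zf e]]] := ratK_frac Dx; have [Qi [bQ Q1 Q2]] := seq_poly_inverse zf.
    rewrite -[LHS]Q1 -Ppoly// (poly_op_rat Dx e) Ppoly// Qu.
    by rewrite (lin_0 (bounded_lin (bounded_poly_op bS p))) (lin_0 (bounded_lin bQ)).
  move=> j _; rewrite (lin_scale QL) (_ : Q (tau (sq_e j)) = 0) ?scaler0//.
  apply: (@seq_kernel j); apply/eqP; rewrite -subr_eq0 -QS -(lin_scale QL) -(lin_sub QL).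
  by rewrite -/(sub_scalar S (w j) (tau (sq_e j))) e_rel (lin_scale QL) Qu scaler0.
(* [eps j * P u0] lies in the range of [S - w j], which is orthogonal to [kc j]. *)
have Puk j : inner (P (tau sq_u0)) (kc j) = 0.
  have h : sub_scalar S (w j) (P (tau (sq_e j))) = (eps j)%:C *: P (tau sq_u0).
    by rewrite /sub_scalar -PS -(lin_scale PL) -(lin_sub PL) -(lin_scale PL) -e_rel.
  have := congr1 (fun y => inner y (kc j)) h.
  rewrite innerBl innerZl kc_eigen subrr innerZl => /esym/eqP.
  by rewrite mulf_eq0 (negPf (epC j)) => /eqP.
pose y := P (tau sq_u0); pose u := tau sq_u0.
have Vy : rat_part y by exact: rat_part_char.
have psi v p : rat_part v -> rat_part (poly_op S p v) /\
    inner (poly_op S p v) u = p.[a] * inner v u.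
  move=> Vv; have SV x : rat_part x -> rat_part (S x).
    apply: (closure_invariant bS) => _ [z [Dz z2] <-]; exists (seqZ w eps z).
      split; first exact: seqZD.
      by rewrite /= z2; apply/polyP => i; rewrite coef_wmul !coef0 mul0r.
    by rewrite (gns_S g).
  have Se x : rat_part x -> inner (S x) u = a * inner x u.
    move=> Vx; apply/eqP; rewrite -subr_eq0 -innerZl -innerBl -/(sub_scalar S a x); apply/eqP.
    apply: (inner_closure0 (bounded_sub_scalar bS a)) Vx => _ [z [Dz z2] <-].
    have z2' : (seqZ w eps z).2 = 0.
      by rewrite /= z2; apply/polyP => i; rewrite coef_wmul !coef0 mul0r.
    rewrite innerBl innerZl (gns_S g)// !inner_u0//; last exact: seqZD.
    by rewrite /= z2 fsum0 addr0 subrr.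
  have [sV0 sVL] := rat_part_subspace.
  elim/poly_ind: p => [|p c [IH1 IH2]].
    by rewrite poly_op0// inner0l horner0 mul0r.
  rewrite poly_opD// poly_opMX// poly_opC// addrC; split; first by apply: sVL => //; exact: SV.
  by rewrite innerDl innerZl Se// IH2 hornerD hornerMX hornerC; ring.
pose t := inner y u.
have tr : t^* = t.
  by rewrite /t /y -PP Psa -/u -/y inner_nrm; apply: ReImE; rewrite ?ReJ ?ImJ/= ?oppr0.
(* The image of [f] under [P] stays in [rat_part], where pairing with [u0] is evaluation at [a]; so
   [f] pairs with [P u0] to [t * f a], as it does with [t * u0]. *)
have Au f : ratK K f -> inner (tau (f, 0)) (y - t *: u) = 0.
  move=> rf; have [p [q [zf e]]] := ratK_frac rf.
  have qP : poly_op S q (P (tau (f, 0))) = poly_op S p y.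
    by rewrite -Ppoly// (poly_op_rat rf e) Ppoly.
  have kl j (c : C) x z : inner (c *: x + z) (kc j) = c * inner x (kc j) + inner z (kc j).
    by rewrite innerDl innerZl.
  have VA : rat_part (P (tau (f, 0))).
    apply: rat_part_char => j; have := congr1 (fun x => inner x (kc j)) qP.
    rewrite !(poly_op_eigen bS _ _ (kl j) (kc_eigen j)) Puk mulr0 => /eqP.
    by rewrite mulf_eq0 (negPf (zf _ (w_in sd j))) => /eqP.
  have [_ h1] := psi _ q VA; have [_ h2] := psi _ p Vy.
  move: h1; rewrite qP h2 -e; last exact: core_Ka cd.
  rewrite -mulrA => /(mulfI (zf _ (core_Ka cd))) h3.
  by rewrite innerBr innerZr tr -[inner _ y]Psa -h3 inner_u0//= mulrC subrr.
have yu : y = t *: u.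
  apply/eqP; rewrite -subr_eq0; apply/eqP/inner_eq0.
  have Vd : rat_part (y - t *: u).
    have [V0 VL] := rat_part_subspace.
    by rewrite addrC -scaleNr; apply: VL => //; apply: rat_part_tau => //; exact: D_u0.
  apply: (inner_closure0 (bounded_id H)) Vd => _ [[f d] [/= Df ->] <-].
  exact: Au.
have uu : inner u u = 1 by rewrite inner_u0//; exact: D_u0.
have un0 : u != 0 by apply/eqP => h; move/eqP: uu; rewrite h inner0l eq_sym oner_eq0.
have tt : t * t = t.
  have h : P y = y by rewrite /y PP.
  move: h; rewrite yu (lin_scale PL) -/y yu scalerA => /eqP.
  by rewrite -subr_eq0 -scalerBl scaler_eq0 (negPf un0) orbF subr_eq0 => /eqP.
have [t0|t1] : t = 0 \/ t = 1.
  have /eqP : t * (t - 1) = 0 by rewrite mulrBr mulr1 tt subrr.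
  by rewrite mulf_eq0 subr_eq0 => /orP[/eqP|/eqP]; [left|right].
- left; apply/seteqP; split=> [x /VP <-|x ->] /=.
    apply: zero => //; last by rewrite -/u -/y yu t0 scale0r.
    move=> x' y'; rewrite -(lin_sub PL) (le_trans (Pn _))// ler_peMl ?nrm_ge0//; lra.
  by apply/VP; exact: lin_0 PL.
- right; apply/seteqP; split=> // x _; apply/VP/eqP; rewrite eq_sym -subr_eq0; apply/eqP.
  apply: (zero (fun x => x - P x)).
  + by move=> c x' y'; rewrite PL opprD addrACA scalerBr.
  + by move=> x'; rewrite PS (lin_sub lS).
  + move=> x' y'; have -> : x' - P x' - (y' - P y') = (x' - y') - P (x' - y').
      by rewrite (lin_sub PL) subrACA.
    have := Pn (x' - y'); have := ler_nrmB (x' - y') (P (x' - y')); lra.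
  + by rewrite -/u -/y yu t1 scale1r subrr.
Qed.

End SeqSpectrum.

(** * Essential spectrum and two generators *)

Section SeqCyclic.
Variable R : realType.
Local Notation C := (cplx R).
Variables (K : set C) (a : C) (b : nat -> C) (kap : nat -> R).
Variable Gam : (bd_type K * nat -> R) -> R.
Hypothesis cd : core_data a b kap Gam.
Variables (w : nat -> C) (eps delta : nat -> R).
Hypothesis sd : seq_data K kap w eps delta.
Local Notation D := (@seqD R K).
Local Notation Z := (seqZ w eps).
Variables (H : hilbertSpace R) (tau : (C -> C^o) * {poly C} -> H) (S : H -> H).
Hypothesis g : gns_data (seq_Gam Gam) (@seq_zeta R K w) D
  (@seqt R K w eps) Z tau S.
Variable kc : nat -> H.
Hypothesis hkc : forall j x, D x -> x.2`_j = inner (tau x) (kc j).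
Let cK := core_compact cd.
Let clK := compact_closed_nrm cK.
Let bS := gns_bounded g.
Let lS := bounded_lin bS.
Let mD := gns_mod g.
Local Notation u0 := (tau (sq_u0 R)).
Local Notation e_ j := (tau (sq_e R j)).

Definition accum (l : C) := forall m : R, 0 < m -> exists j, w j != l /\ nrm (w j - l) < m.

Lemma accum_tail l : accum l ->
  forall (e : R) N, 0 < e -> exists2 j, (N <= j)%N & w j != l /\ nrm (w j - l) < e.
Proof.
move=> acc e N e0.
have [m m0 [me hm]] : exists2 m : R, 0 < m & m <= e /\
    forall i, (i < N)%N -> w i != l -> m <= nrm (w i - l).
  elim: N => [|N [m m0 [me IH]]]; first by exists e.
  have [wl|wl] := eqVneq (w N) l.
    exists m => //; split=> // i; rewrite ltnS leq_eqVlt => /orP[/eqP ->|iN].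
      by rewrite wl eqxx.
    exact: IH.
  have w0 : 0 < nrm (w N - l) by rewrite nrm_gt0 subr_eq0.
  exists (Num.min m (nrm (w N - l))); first by rewrite lt_min m0.
  split; first by rewrite (le_trans _ me)// ge_min lexx.
  move=> i; rewrite ltnS leq_eqVlt => /orP[/eqP -> _|iN wi].
    by rewrite ge_min lexx orbT.
  by rewrite (le_trans _ (IH _ iN wi))// ge_min lexx.
have [j [wj jm]] := acc _ m0; exists j; last by split => //; exact: lt_le_trans jm me.
by rewrite leqNgt; apply/negP => jN; have := hm _ jN wj; rewrite leNgt jm.
Qed.

Lemma interior_dichotomy l : interior K l ->
  (accum l /\ forall c : R, 0 < c -> ~ (forall x, c * nrm x <= nrm (sub_scalar S l x))) \/
  (~ accum l /\ fredholm_dims (sub_scalar S l) 0 1).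
Proof.
move=> Il; have [acc|nacc] := pselect (accum l).
  left; split => //; apply: (not_below_limit cd sd g) => e N e0.
  by have [j Nj [_ h]] := accum_tail acc N e0; exists j.
right; split => //.
have [m m0 hm] : exists2 m : R, 0 < m & forall j, w j != l -> m <= nrm (w j - l).
  apply: contrapT => h; apply: nacc => m m0; apply: contrapT => h'; apply: h.
  exists m => // j wj; rewrite leNgt; apply/negP => jm; apply: h'; by exists j.
exact: (seq_fredholm cd sd g Il m0 hm).
Qed.

Lemma inverse_below (T T' : H -> H) : bounded_inverse T T' ->
  exists2 c : R, 0 < c & forall x, c * nrm x <= nrm (T x).
Proof.
move=> [bT' T1 _]; have [_ [c c0 hc]] := (bounded_opP T').1 bT'.
have c1 : 0 < c + 1 by rewrite ltr_wpDl.
exists (c + 1)^-1; first by rewrite invr_gt0.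
move=> x; rewrite ler_pdivrMl// -{1}(T1 x) (le_trans (hc _))//.
by rewrite ler_wpM2r ?nrm_ge0// lerDl.
Qed.

Lemma seq_spectrum : spectrum S = K.
Proof.
apply/seteqP; split=> l.
  apply: contra_notP => nK; have [d d0 hd] := off_dist cd nK.
  by have [] := seq_resolvent cd sd g d0 hd.
move=> Kl [T' inv]; have [c c0 below] := inverse_below inv.
have [Bl|Il] := boundary_or_interior clK Kl.
  exact: (not_below_boundary cd sd g Bl c0 below).
have [[_ h]|[_ [_ _ [Ta adj [e [ke ue]]]]]] := interior_dichotomy Il.
  exact: (h _ c0 below).
have [bT' T1 T2] := inv.
have z y : Ta y = 0 -> y = 0.
  by move=> Ty; apply: inner_eq0; rewrite -{1}(T2 y) adj Ty inner0r.
have e0 : e ord0 = 0 by apply: z; exact: ke.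
have [|c1 [_ uni]] := ue 0; first by have := ke ord0; rewrite e0.
have := uni 0 _; rewrite big_ord1 mxE scale0r => /(_ erefl) h0.
have := uni (const_mx 1) _; rewrite big_ord1 e0 scaler0 => /(_ erefl) h1.
have := congr1 (fun M : 'rV[C]_1 => M 0 0) (etrans (esym h0) h1).
by rewrite !mxE => /eqP; rewrite eq_sym oner_eq0.
Qed.

Lemma seq_no_eigen l v : S v = l *: v -> v = 0.
Proof.
move=> Sv; apply: contrapT => v0.
have one := irreducible_eigen (gns_subnormal g) (seq_irreducible cd sd g hkc) bS Sv v0.
have [t1 h1] := one u0; have [t2 h2] := one (e_ 0%N).
have k1 : inner u0 (kc 0%N) = 0 by rewrite -hkc ?coef0//; exact: D_u0.
have k2 : inner (e_ 0%N) (kc 0%N) = 1 by rewrite -hkc ?coefXn//; exact: D_e.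
have vk : inner v (kc 0%N) != 0.
  by apply/eqP => h; move/eqP: k2; rewrite h2 innerZl h mulr0 eq_sym oner_eq0.
have t10 : t1 = 0.
  by move/eqP: k1; rewrite h1 innerZl mulf_eq0 (negPf vk) orbF => /eqP.
have := inner_u0 cd g (D_u0 K) erefl.
by rewrite h1 t10 scale0r inner0l => /eqP; rewrite eq_sym oner_eq0.
Qed.

Lemma not_below_not_fredholm l :
  (forall c : R, 0 < c -> ~ (forall x, c * nrm x <= nrm (sub_scalar S l x))) ->
  ~ fredholm (sub_scalar S l).
Proof.
move=> nb [m [n]]; apply: (not_fredholm (bounded_sub_scalar bS l) _ nb) => x /eqP.
by rewrite /sub_scalar subr_eq0 => /eqP /seq_no_eigen.
Qed.

Lemma seq_essential (Ke : set C) : boundary K `<=` Ke -> Ke `<=` K ->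
  (forall l, interior K l -> Ke l <-> accum l) ->
  essential_spectrum S = Ke /\
  forall l, (K `\` Ke) l -> fredholm_index (sub_scalar S l) (-1).
Proof.
move=> BKe KeK Kacc.
have int l : (K `\` Ke) l -> interior K l.
  move=> [Kl nKe]; have [Bl|//] := boundary_or_interior clK Kl.
  by case: nKe; exact: BKe.
have fred l : (K `\` Ke) l -> fredholm_dims (sub_scalar S l) 0 1.
  move=> h; have Il := int _ h; have [_ nKe] := h.
  have [[acc _]|[_ //]] := interior_dichotomy Il.
  by case: nKe; apply/(Kacc _ Il).
split; last by move=> l h; exists 0%N, 1%N; split => //; exact: fred.
apply/seteqP; split=> l.
  apply: contra_notP => nKe; have [Kl|nK] := pselect (K l).
    by exists 0%N, 1%N; exact: fred.
  have [d d0 hd] := off_dist cd nK.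
  have [[T' inv] _] := seq_resolvent cd sd g d0 hd.
  by exists 0%N, 0%N; exact: (inverse_fredholm (bounded_sub_scalar bS l) inv).
move=> Kel; apply: not_below_not_fredholm.
have [Bl|Il] := boundary_or_interior clK (KeK _ Kel).
  exact: (not_below_boundary cd sd g Bl).
have [[_ //]|[nacc _]] := interior_dichotomy Il.
by case: nacc; apply/(Kacc _ Il).
Qed.

Lemma poly_op_e p i : exists q : {poly C},
  poly_op S p (e_ i) = p.[w i] *: e_ i + poly_op S q u0.
Proof.
have : root (p - (p.[w i])%:P) (w i) by rewrite /root hornerD hornerN hornerC subrr.
move=> /factor_theorem[q hq]; exists ((eps i)%:C *: q).
rewrite -[p in LHS](subrK (p.[w i])%:P) hq poly_opD// poly_opM// poly_opXsub// poly_opC//.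
rewrite addrC (e_rel g) (lin_scale (bounded_lin (bounded_poly_op bS q))).
by rewrite poly_opZ.
Qed.

(** Lagrange polynomial of the node [w j] among the first [n] nodes. *)
Definition ipoly (j n : nat) : {poly C} :=
  \prod_(i <- iota 0 n | i != j) ((w j - w i)^-1 *: ('X - (w i)%:P)).

Lemma ipoly1 j n : (ipoly j n).[w j] = 1.
Proof.
rewrite /ipoly horner_prod big1// => i ij.
by rewrite hornerZ hornerXsubC mulVf// (w_neq sd)// eq_sym.
Qed.

Lemma ipoly0 j n i : (i < n)%N -> i != j -> (ipoly j n).[w i] = 0.
Proof.
move=> iN ij; rewrite /ipoly horner_prod; apply/eqP.
rewrite prodf_seq_eq0; apply/hasP; exists i; first by rewrite mem_iota.
by rewrite ij hornerZ hornerXsubC subrr mulr0 eqxx.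
Qed.

(** The generators are [u0] and the sum of the [eta i * e_i]. A polynomial [P] in [S] multiplies
    [e_i] by [P (w i)] up to a vector of the cyclic space of [u0], so interpolation recovers any
    finite [d]; the [eta i] decay too fast for the values of [P] at later nodes to matter. *)
Lemma seq_two_cyclic : exists F : 'I_2 -> H, R2 S F = setT.
Proof.
have [M0 HM0] := compact_bounded cK.
have /choice[Bd HBd] : forall p : nat * nat, exists B : R, 0 <= B /\
    forall z, K z -> nrm (ipoly p.1 p.2).[z] <= B.
  move=> [j n]; have [L L0 HL] := poly_bounded (ipoly j n) M0.
  by exists L; split => // z Kz; apply: HL; exact: HM0.
(* Bounds on [K] all Lagrange polynomials with parameters up to [i]; [eta i] is chosen against
   it. *)
pose BB i := 1 + \sum_(n < i.+1) \sum_(j < i.+1) Bd (j : nat, n : nat).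
have BB1 i : 1 <= BB i.
  by rewrite lerDl; apply: sumr_ge0 => n _; apply: sumr_ge0 => j _; case: (HBd (j : nat, n : nat)).
have BBge i j n : (n <= i)%N -> (j <= i)%N -> Bd (j, n) <= BB i.
  move=> ni ji; have Bp p : 0 <= Bd p by case: (HBd p).
  apply: (@le_trans _ _ (\sum_(j < i.+1) Bd (j : nat, n))).
    rewrite (bigD1 (Ordinal (ji : (j < i.+1)%N)))//= lerDl; exact: sumr_ge0.
  apply: (@le_trans _ _ (\sum_(n < i.+1) \sum_(j < i.+1) Bd (j : nat, n : nat))).
    rewrite [leRHS](bigD1 (Ordinal (ni : (n < i.+1)%N)))//= lerDl.
    by apply: sumr_ge0 => k _; exact: sumr_ge0.
  by rewrite lerDr.
pose ne i := nrm (e_ i) + 1.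
have ne1 i : 0 < ne i by rewrite ltr_wpDl ?nrm_ge0.
pose eta i := 2^-1 ^+ i.+1 / (ne i * BB i) : R.
have BB0 i : 0 < BB i by apply: lt_le_trans (BB1 i).
have eta0 i : 0 < eta i by rewrite divr_gt0 ?exprn_gt0// mulr_gt0.
have eta_e i : eta i * nrm (e_ i) * BB i <= 2^-1 ^+ i.+1.
  rewrite mulrAC /eta invfM mulrA divfK ?gt_eqF// mulrAC -mulrA ler_piMr ?exprn_ge0//.
  by rewrite ler_pdivrMr// mul1r lerDl.
pose x n := \sum_(i < n) (eta i)%:C *: e_ i.
have half (m n : nat) : (m <= n)%N -> \sum_(m <= i < n) (2^-1 : R) ^+ i.+1 <= 2^-1 ^+ m.
  move=> mn; rewrite -(subnKC mn); elim: (n - m)%N => [|k IH].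
    by rewrite addn0 big_geq// exprn_ge0.
  suff h : \sum_(m <= i < m + k) (2^-1 : R) ^+ i.+1 = 2^-1 ^+ m - 2^-1 ^+ (m + k).
    rewrite addnS big_nat_recr ?leq_addr//= h exprS.
    have : 0 <= (2^-1 : R) ^+ (m + k) by rewrite exprn_ge0.
    lra.
  elim: (k) => [|k' IH']; first by rewrite addn0 big_geq// subrr.
  by rewrite addnS big_nat_recr ?leq_addr//= IH' !exprS; lra.
have small (e : R) : 0 < e -> exists N, forall n, (N <= n)%N -> (2^-1 : R) ^+ n < e.
  move=> e0; have [N hN] := inv_small e0; exists N.+1 => -[//|n] Nn.
  apply: le_lt_trans (hN n Nn); rewrite exprVn lef_pV2 ?posrE ?exprn_gt0//.
  by rewrite -natrX ler_nat ltnW// ltn_expl.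
have xsplit (m n : nat) : (m <= n)%N -> x n = x m + \sum_(m <= i < n) (eta i)%:C *: e_ i.
  move=> mn; rewrite /x -!(big_mkord xpredT (fun i => (eta i)%:C *: e_ i)).
  by rewrite (big_cat_nat (n := m)).
have xdif (m n : nat) : (m <= n)%N -> nrm (x n - x m) <= 2^-1 ^+ m.
  move=> mn; rewrite (xsplit _ _ mn) addrAC subrr add0r (le_trans (ler_nrm_sum _ _ _))//.
  apply: le_trans (half _ _ mn); apply: ler_sum => i _; rewrite nrmZ nrm_real.
  rewrite (gtr0_norm (eta0 i)); apply: le_trans (eta_e i).
  by rewrite ler_peMr// mulr_ge0 ?nrm_ge0// ltW.
have [F1 xF] : exists F1, tends x F1.
  apply: hilbert_complete => e e0; have [N hN] := small _ (divr_gt0 e0 (ltr0Sn _ 1)).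
  exists N => m n Nm Nn.
  have := ler_dist_nrm (x N) (x m) (x n); have := xdif _ _ Nm; have := xdif _ _ Nn.
  by rewrite (nrmBC (x N) (x n)); have := hN N (leqnn _); lra.
pose F (i : 'I_2) := if i == ord0 then u0 else F1.
exists F; rewrite -subTset => y _; apply/closure_nrmP => e e0.
have e2 := divr_gt0 e0 (ltr0Sn _ 1).
have [_ _ _ /(_ y _ e2)[[f d] Df hx]] := mD.
pose N := size d.
pose cst := \sum_(j < N) nrm d`_j / eta j.
have cst0 : 0 <= cst.
  by apply: sumr_ge0 => j _; rewrite divr_ge0 ?nrm_ge0// ltW.
have c1 : 0 < cst + 1 by rewrite ltr_wpDl.
(* The number [n] of nodes may grow after [cst] is fixed: the extra nodes carry the value 0, and the
   remaining tail is at most [cst * 2^-n]. *)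
have [n0 hn0] := small _ (divr_gt0 (divr_gt0 e0 (ltr0Sn _ 3)) c1).
pose n := maxn N n0.
pose P := \sum_(j < N) (d`_j / (eta j)%:C) *: ipoly j n.
have PE i : P.[w i] = \sum_(j < N) d`_j / (eta j)%:C * (ipoly j n).[w i].
  by rewrite horner_sum; apply: eq_bigr => j _; rewrite hornerZ.
have etaC i : ((eta i)%:C : C) != 0 by rewrite -nrm_gt0 nrm_real gtr0_norm.
have Pn i : (i < n)%N -> (eta i)%:C * P.[w i] = d`_i.
  move=> iN; rewrite PE; have [iN'|Ni] := ltnP i N.
    rewrite (bigD1 (Ordinal iN'))//= ipoly1 mulr1 big1 ?addr0 => [|j ji].
      by rewrite mulrC divfK.
    rewrite ipoly0 ?mulr0//; apply: contraNneq ji => ij.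
    by apply/eqP; exact: val_inj.
  rewrite nth_default// big1 ?mulr0// => j _; rewrite ipoly0 ?mulr0//.
  by apply: contraTneq Ni => ->; rewrite -ltnNge.
have Pbig i : (n <= i)%N -> eta i * nrm (P.[w i]) * nrm (e_ i) <= cst * 2^-1 ^+ i.+1.
  move=> ni; have h : nrm P.[w i] <= cst * BB i.
    rewrite PE (le_trans (ler_nrm_sum _ _ _))// /cst mulr_suml; apply: ler_sum => j _.
    rewrite !nrmM nrmV nrm_real (gtr0_norm (eta0 j)); apply: ler_wpM2l.
      by apply: mulr_ge0; [exact: nrm_ge0|rewrite invr_ge0; exact: ltW (eta0 j)].
    have [_ hB] := HBd (j : nat, n); apply: le_trans (hB _ (w_in sd i)) _.
    apply: BBge => //; apply: leq_trans ni; apply: leq_trans (ltnW (ltn_ord j)) _.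
    exact: leq_maxl.
  apply: (@le_trans _ _ (cst * (eta i * nrm (e_ i) * BB i))); last by rewrite ler_wpM2l.
  rewrite mulrAC; have p0 : 0 <= eta i * nrm (e_ i) by rewrite mulr_ge0 ?nrm_ge0// ltW.
  by have := ler_wpM2l p0 h; lra.
have [_ [cP cP0 hcP]] := (bounded_opP (poly_op S P)).1 (bounded_poly_op bS P).
have cP1 : 0 < cP + 1 by rewrite ltr_wpDl.
have [M1 hM1] := xF _ (divr_gt0 (divr_gt0 e0 (ltr0Sn _ 3)) cP1).
pose M := maxn M1 n.
have /choice[G HG] : forall i, exists q, poly_op S P (e_ i) = P.[w i] *: e_ i + poly_op S q u0.
  by move=> i; exact: poly_op_e.
pose Gt := \sum_(i < M) (eta i)%:C *: G i.
have lP := bounded_lin (bounded_poly_op bS P).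
have Px : poly_op S P (x M) = \sum_(i < M) ((eta i)%:C * P.[w i]) *: e_ i + poly_op S Gt u0.
  rewrite /x (lin_sum lP) /Gt.
  have -> : poly_op S (\sum_(i < M) (eta i)%:C *: G i) u0 =
      \sum_(i < M) (eta i)%:C *: poly_op S (G i) u0.
    rewrite (big_morph (fun q => poly_op S q u0) (id1 := 0) (op1 := +%R)).
    - by apply: eq_bigr => i _; rewrite poly_opZ.
    - by move=> q q'; rewrite poly_opD.
    - by rewrite poly_op0.
  rewrite -big_split/=; apply: eq_bigr => i _.
  by rewrite (lin_scale lP) HG scalerDr scalerA.
have [p [q [zf pq]]] := ratK_frac Df.
have [Q invQ] := seq_poly_inverse cd sd g zf.
have [bQ Q1 Q2] := invQ.
(* The coefficient of [u0] supplies [f] and cancels the multiples [Gt] of [u0] left over by [P]. *)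
pose A0 := poly_op S (p - Gt * q) \o Q.
have A0u : A0 u0 = tau (f, 0) - poly_op S Gt u0.
  have h : poly_op S q (A0 u0) = poly_op S (p - Gt * q) u0 by exact: (rat_op_eq bS _ invQ).
  rewrite -[LHS]Q1 h -[RHS]Q1; congr (Q _).
  have e1 := poly_opD S (p - Gt * q) (Gt * q) u0.
  rewrite subrK (poly_opM bS) (poly_op_comm bS) in e1.
  rewrite (lin_sub (bounded_lin (bounded_poly_op bS q))) (poly_op_rat cd g Df pq) e1.
  by rewrite addrK.
exists (A0 u0 + poly_op S P F1).
  exists (fun i => if i == ord0 then A0 else poly_op S P); split.
    move=> i; case: ifP => _.
      by exists (p - Gt * q), q, Q; split => //; rewrite seq_spectrum.
    exists P, 1, id; split; first exact: zero_free1.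
      by split; [exact: bounded_id|move=> z; exact: poly_op1|move=> z; exact: poly_op1].
    by [].
  by rewrite big_ord_recl big_ord1/= /F eqxx.
have split2 : tau (f, d) - (A0 u0 + poly_op S P F1) =
    - (\sum_(n <= i < M) ((eta i)%:C * P.[w i]) *: e_ i) + poly_op S P (x M - F1).
  rewrite A0u (tau_split g Df)/= (lin_sub lP) Px.
  rewrite -(big_mkord xpredT (fun i => ((eta i)%:C * P.[w i]) *: e_ i)).
  have -> : \sum_(0 <= i < M) ((eta i)%:C * P.[w i]) *: e_ i =
      \sum_(0 <= i < n) ((eta i)%:C * P.[w i]) *: e_ i +
      \sum_(n <= i < M) ((eta i)%:C * P.[w i]) *: e_ i.
    by rewrite (big_cat_nat (n := n))//; exact: leq_maxr.
  have -> : \sum_(0 <= i < n) ((eta i)%:C * P.[w i]) *: e_ i = \sum_(j < size d) d`_j *: e_ j.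
    rewrite big_mkord (eq_bigr (fun i : 'I_n => d`_i *: e_ i)); last by move=> i _; rewrite Pn.
    rewrite -!(big_mkord xpredT (fun i => d`_i *: e_ i)).
    rewrite (big_cat_nat (n := size d))//=; last exact: leq_maxl.
    rewrite [X in _ + X]big_nat_cond [X in _ + X]big1 ?addr0// => i /andP[/andP[di _] _].
    by rewrite nth_default// scale0r.
  set X1 := \sum_(j < _) _; set X2 := \sum_(n <= i < M) _; set X3 := poly_op S Gt u0.
  set X4 := poly_op S P F1; set X0 := tau (f, 0).
  have zid (V : zmodType) (x0 x1 x2 x3 x4 : V) :
      x0 + x1 - (x0 - x3 + x4) = - x2 + (x1 + x2 + x3 - x4).
    rewrite [x1 + x2]addrC !addrA addNr add0r opprD opprB addrA [x0 + x1]addrC.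
    by rewrite -(addrA x1) [x0 + _]addrC subrK.
  exact: zid.
have -> : y - (A0 u0 + poly_op S P F1) = (y - tau (f, d)) + (tau (f, d) - (A0 u0 + poly_op S P F1)).
  by rewrite addrA subrK.
rewrite (le_lt_trans (ler_nrmD _ _))// split2.
have r1 : nrm (\sum_(n <= i < M) ((eta i)%:C * P.[w i]) *: e_ i) <= e / 4.
  rewrite (le_trans (ler_nrm_sum _ _ _))//.
  apply: (@le_trans _ _ (\sum_(n <= i < M) cst * 2^-1 ^+ i.+1)).
    rewrite big_nat_cond [leRHS]big_nat_cond; apply: ler_sum => i /andP[/andP[ni _] _].
    by rewrite nrmZ nrmM nrm_real (gtr0_norm (eta0 i)); exact: Pbig.
  rewrite -mulr_sumr; have h1 := half _ _ (leq_maxr M1 n).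
  have h2 := hn0 _ (leq_maxr N n0); rewrite -/n ltr_pdivlMr// in h2.
  apply: (@le_trans _ _ (cst * 2^-1 ^+ n)); first by rewrite ler_wpM2l.
  have : 0 <= (2^-1 : R) ^+ n by rewrite exprn_ge0.
  by move: h2; rewrite mulrDr mulr1 mulrC; lra.
have r2 : nrm (poly_op S P (x M - F1)) <= e / 4.
  apply: le_trans (hcP _) _; have := hM1 _ (leq_maxl M1 n); rewrite -/M ltr_pdivlMr// => h.
  by have := nrm_ge0 (x M - F1); move: h; rewrite mulrDr mulr1 mulrC; lra.
have := ler_nrmD (- \sum_(n <= i < M) ((eta i)%:C * P.[w i]) *: e_ i) (poly_op S P (x M - F1)).
by rewrite nrmN; move: hx r1 r2; lra.
Qed.

End SeqCyclic.

(** * One generator is not enough *)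

Section Separation.
Variable R : realType.
Local Notation C := (cplx R).

Lemma uniq_separated (s : seq C) : uniq s ->
  exists2 sig : R, 0 < sig & pairwise (fun x y => sig <= nrm (y - x)) s.
Proof.
elim: s => [_|x s IH /= /andP[xs us]]; first by exists 1.
have [sig sig0 hs] := IH us.
have [m m0 hm] : exists2 m : R, 0 < m & forall y, y \in s -> m <= nrm (y - x).
  elim: s xs {us IH hs} => [_|y s IH]; first by exists 1.
  rewrite inE negb_or => /andP[xy /IH[m m0 hm]].
  have y0 : 0 < nrm (y - x) by rewrite nrm_gt0 subr_eq0 eq_sym.
  exists (Num.min m (nrm (y - x))); first by rewrite lt_min m0.
  move=> z; rewrite inE => /orP[/eqP ->|zs]; first by rewrite ge_min lexx orbT.
  by rewrite (le_trans _ (hm _ zs))// ge_min lexx.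
exists (Num.min sig m); first by rewrite lt_min sig0.
apply/andP; split; first by apply/allP => y ys; rewrite (le_trans _ (hm _ ys))// ge_min lexx orbT.
apply: sub_pairwise hs => y z; apply: le_trans; by rewrite ge_min lexx.
Qed.

Definition supN (K : set C) (f : C -> C) : R := sup [set nrm (f x) | x in boundary K].

Lemma supN_ub (K : set C) f x : compact K -> ratK K f -> boundary K x -> nrm (f x) <= supN K f.
Proof.
move=> cK rf Bx; apply: sup_upper_bound; last by exists x.
split; first by exists (nrm (f x)), x.
have [L _ HL] := ratK_bounded cK rf; exists L => _ [y By <-].
by apply: HL; exact: (boundary_sub (compact_closed_nrm cK)).
Qed.

Lemma supN_le (K : set C) f (M : R) : boundary K !=set0 ->
  (forall x, boundary K x -> nrm (f x) <= M) -> supN K f <= M.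
Proof.
move=> [x Bx] h; apply: ge_sup; first by exists (nrm (f x)), x.
by move=> _ [y By <-]; exact: h.
Qed.

End Separation.

Section Orbits.
Variable R : realType.
Local Notation C := (cplx R).
Variables (K : set C) (H : hilbertSpace R) (S : H -> H).
Hypothesis bS : bounded_operator S.

(** Denominators are cleared: an eigenfunctional applied to [q (S) x = p (S) G0] gives its value at
    [x] without inverting any operator. *)
Definition orbit_dense (G0 : H) := forall y (e : R), 0 < e -> exists (p q : {poly C}) x,
  [/\ zero_free K q, poly_op S q x = poly_op S p G0 & nrm (y - x) < e].

Lemma cyclic_orbit (G : 'I_1 -> H) : spectrum S = K -> R2 S G = setT -> orbit_dense (G ord0).
Proof.
move=> spS RT y e e0; have : R2 S G y by rewrite RT.
move=> /closure_nrmP /(_ _ e0)[x [A [rA ->]] yx].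
have [p [q [Q [zf invQ AE]]]] := rA ord0.
exists p, q, (A ord0 (G ord0)); split.
- by move: zf; rewrite spS.
- exact: (rat_op_eq bS _ invQ AE).
- by move: yx; rewrite big_ord1.
Qed.

Lemma inner_lin (k : H) (c : C) x y : inner (c *: x + y) k = c * inner x k + inner y k.
Proof. by rewrite innerDl innerZl. Qed.

Lemma orbit_eigen (G0 k : H) (l : C) p q x : K l -> zero_free K q ->
  (forall h, inner (S h) k = l * inner h k) -> poly_op S q x = poly_op S p G0 ->
  inner x k = p.[l] / q.[l] * inner G0 k.
Proof.
move=> Kl zf ek e; have := congr1 (fun h => inner h k) e.
rewrite !(poly_op_eigen bS _ _ (inner_lin k) ek) => h.
by apply: (mulfI (zf _ Kl)); rewrite h mulrA [q.[l] * _]mulrC divfK// zf.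
Qed.

End Orbits.

Section SeqNotCyclic.
Variable R : realType.
Local Notation C := (cplx R).
Variables (K : set C) (a : C) (b : nat -> C) (kap : nat -> R).
Variable Gam : (bd_type K * nat -> R) -> R.
Hypothesis cd : core_data a b kap Gam.
Variables (w : nat -> C) (eps delta : nat -> R).
Hypothesis sd : seq_data K kap w eps delta.
Local Notation D := (@seqD R K).
Local Notation Z := (seqZ w eps).
Variables (H : hilbertSpace R) (tau : (C -> C^o) * {poly C} -> H) (S : H -> H).
Hypothesis g : gns_data (seq_Gam Gam) (@seq_zeta R K w) D
  (@seqt R K w eps) Z tau S.
Variable kc : nat -> H.
Hypothesis hkc : forall j x, D x -> x.2`_j = inner (tau x) (kc j).
Let cK := core_compact cd.
Let clK := compact_closed_nrm cK.
Let bS := gns_bounded g.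
Let lS := bounded_lin bS.
Let mD := gns_mod g.
Local Notation u0 := (tau (sq_u0 R)).
Local Notation e_ j := (tau (sq_e R j)).

Variable G0 : H.
Hypothesis oG : orbit_dense K S G0.

(** Otherwise the whole orbit lies in the kernel of this eigenfunctional and stays away from
    [e_j]. *)
Lemma orbit_coef j : inner G0 (kc j) != 0.
Proof.
apply/eqP => G0k; have n0 : 0 < nrm (kc j) + 1 by rewrite ltr_wpDl ?nrm_ge0.
have i0 : 0 < (nrm (kc j) + 1)^-1 by rewrite invr_gt0.
have [p [q [x [zf e ex]]]] := oG (e_ j) i0.
have xk := orbit_eigen bS (w_in sd j) zf (kc_eigen g hkc j) e.
have : inner (e_ j - x) (kc j) = 1.
  by rewrite innerBl xk G0k mulr0 subr0 -hkc ?coefXn ?eqxx//; exact: D_e.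
have := inner_CS (e_ j - x) (kc j) => /[swap] ->; rewrite nrm1.
move: ex; rewrite -[X in _ < X]mul1r ltr_pdivlMr// => h.
by have := nrm_ge0 (e_ j - x); have := nrm_ge0 (kc j); nra.
Qed.

Lemma nrm_kc j : nrm (kc j) <= (Num.sqrt (kap j))^-1.
Proof.
have s0 : 0 < Num.sqrt (kap j) by rewrite sqrtr_gt0; exact: core_kap0 cd j.
apply: (gns_vector_le g); first by rewrite invr_ge0 ltW.
by move=> x Dx; rewrite -hkc// ler_pdivlMl// mulrC; exact: (coef_le cd g).
Qed.

Lemma hat_eigen l k : (forall j, l - w j != 0) ->
  (forall x, D x -> phi l (hatc w eps l) x = inner (tau x) k) ->
  forall h, inner (S h) k = l * inner h k.
Proof.
move=> lw hk; apply: (gns_eigen g) => x Dx; rewrite -!hk//; last exact: seqZD.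
by apply: phi_Z => j; exact: hatcE.
Qed.

Lemma hat_vector1 l A : 0 <= A -> evb Gam l A -> (forall j, l - w j != 0) ->
  (forall j, eps j <= 2^-1 ^+ j.+1 * nrm (l - w j) * Num.sqrt (kap j)) ->
  exists k, [/\ nrm k <= 2 * A + 1, forall x, D x -> phi l (hatc w eps l) x = inner (tau x) k
    & inner u0 k = 1].
Proof.
move=> A0 ev lw he; have [|k nk hk] := phi_vector cd sd g A0 ler01 ev (c := hatc w eps l).
  move=> j; rewrite /hatc nrmM nrmV nrm_real (gtr0_norm (seq_eps0 sd j)) mul1r.
  by rewrite ler_pdivrMr ?nrm_gt0// mulrAC.
by exists k; split => //; rewrite -hk ?/phi/= ?fsum0 ?addr0//; exact: D_u0.
Qed.

Lemma nat_points l (r : R) m : 0 < r -> accum w l ->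
  exists s : seq nat, [/\ size s = m, uniq s & forall j, j \in s -> nrm (w j - l) <= r].
Proof.
move=> r0 acc; elim: m => [|m [s [sm us hs]]]; first by exists [::].
have [j Nj [_ jr]] := accum_tail acc (\max_(i <- s) i).+1 r0.
exists (j :: s); split; rewrite /= ?sm//.
  rewrite us andbT; apply/negP => js; move: Nj; rewrite leqNgt ltnS.
  by rewrite (big_rem _ js)/= leq_maxl.
by move=> i; rewrite inE => /orP[/eqP ->|/hs//]; exact: ltW.
Qed.

(* The rational functions sending [G0] near [u0] are bounded on a circle around
   [l0] and tend to zero at each [w j], hence at [l0] by the Blaschke bound, where
   their products with a constant tend to [1]. *)
Lemma not_cyclic_accum l0 (Rad A : R) : 0 < Rad -> 0 <= A ->
  (forall l, nrm (l - l0) <= Rad -> K l /\ evb Gam l A) ->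
  (forall l, l = l0 \/ nrm (l - l0) = Rad -> forall j, l - w j != 0 /\
    eps j <= 2^-1 ^+ j.+1 * nrm (l - w j) * Num.sqrt (kap j)) ->
  accum w l0 -> False.
Proof.
move=> Rad0 A0 evA sep acc; pose C0 := 2 * A + 1.
have C00 : 0 < C0 by rewrite ltr_wpDl// mulr_ge0.
have vec l : l = l0 \/ nrm (l - l0) = Rad -> exists k, [/\ nrm k <= C0,
    forall h, inner (S h) k = l * inner h k & inner u0 k = 1].
  move=> hl; have [|_ evl] := evA l.
    by case: hl => [->|->//]; rewrite subrr nrm0 ltW.
  have lw j : l - w j != 0 by have [] := sep _ hl j.
  have [k [nk hk uk]] := hat_vector1 A0 evl lw (fun j => (sep _ hl j).2).
  by exists k; split => //; exact: hat_eigen.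
have appr l k p q x : K l -> zero_free K q -> poly_op S q x = poly_op S p G0 ->
    nrm k <= C0 -> (forall h, inner (S h) k = l * inner h k) -> inner u0 k = 1 ->
    nrm (1 - p.[l] / q.[l] * inner G0 k) <= C0 * nrm (u0 - x).
  move=> Kl zf e nk ek uk; rewrite -(orbit_eigen bS Kl zf ek e) -uk -innerBl.
  by rewrite (le_trans (inner_CS _ _))// mulrC ler_wpM2r ?nrm_ge0.
(* Within this distance of [u0], the product of [p / q] and the pairing of [G0] with a vector of
   norm at most [C0] is within one half of 1. *)
have d1 : 0 < (2 * C0)^-1 by rewrite invr_gt0 mulr_gt0.
have half (t : R) : t < (2 * C0)^-1 -> C0 * t <= 2^-1.
  by rewrite -[X in _ < X]mul1r ltr_pdivlMr ?mulr_gt0//; lra.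
have [p1 [q1 [x1 [zf1 e1 hx1]]]] := oG u0 d1.
have rr p q : zero_free K q -> ratK K (fun z => p.[z] / q.[z]).
  by move=> zf; exists p, q.
have [L L0 HL] := ratK_bounded cK (rr p1 q1 zf1).
have diskK l : nrm (l - l0) = Rad -> K l by move=> h; have [] := evA l; rewrite ?h.
(* One fixed approximation, bounded by [L] on [K], keeps the pairings of [G0] away from zero along
   the circle. All better approximations are then bounded there by [3 * L]. *)
have lowG l k : nrm (l - l0) = Rad -> nrm k <= C0 -> (forall h, inner (S h) k = l * inner h k) ->
    inner u0 k = 1 -> 2^-1 <= L * nrm (inner G0 k).
  move=> hl nk ek uk; have Kl := diskK _ hl.
  have h1 := appr _ _ _ _ _ Kl zf1 e1 nk ek uk.
  have := ler_nrmD (1 - p1.[l] / q1.[l] * inner G0 k) (p1.[l] / q1.[l] * inner G0 k).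
  rewrite subrK nrm1 (nrmM (_ / _)); have := half _ hx1; have := HL _ Kl.
  have := nrm_ge0 (inner G0 k); nra.
have Lp : 0 < L.
  rewrite lt_def L0 andbT; apply/eqP => L00.
  have Rl : nrm (l0 + Rad%:C - l0) = Rad.
    by rewrite addrAC subrr add0r nrm_real gtr0_norm.
  have [k [nk ek uk]] := vec _ (or_intror Rl).
  by have := lowG _ _ Rl nk ek uk; rewrite L00 mul0r; lra.
have bnd l p q x : nrm (l - l0) = Rad -> zero_free K q -> poly_op S q x = poly_op S p G0 ->
    nrm (u0 - x) < (2 * C0)^-1 -> nrm (p.[l] / q.[l]) <= 3 * L.
  move=> hl zf e hx; have [k [nk ek uk]] := vec _ (or_intror hl).
  have Kl := diskK _ hl.
  have h1 := appr _ _ _ _ _ Kl zf e nk ek uk; have h2 := half _ hx.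
  have h3 := lowG _ _ hl nk ek uk.
  have := ler_nrmB 1 (1 - p.[l] / q.[l] * inner G0 k).
  rewrite opprB addrC subrK nrm1 nrmM => h4.
  have h5 : nrm (p.[l] / q.[l]) * nrm (inner G0 k) <= 3 / 2 by lra.
  have := nrm_ge0 (p.[l] / q.[l]); move: h3 h5; move: (nrm (p.[l] / q.[l])) (nrm (inner G0 k)).
  by move=> r s h3 h5 r0; nra.
have [k0 [nk0 ek0 uk0]] := vec _ (or_introl erefl).
have K0 : K l0 by have [] := evA l0; rewrite ?subrr ?nrm0 ?ltW.
pose gk := nrm (inner G0 k0); have gk0 : 0 <= gk by exact: nrm_ge0.
(* Each [w j] within half the radius contributes a Blaschke factor at most one half; [m] of them
   beat the bound [3 * L]. *)
have [m hm] : exists m, (2^-1 : R) ^+ m * (3 * L) * gk <= 4^-1.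
  have p0 : 0 < 4 * (3 * L * gk + 1).
    by rewrite mulr_gt0// ltr_wpDl// !mulr_ge0.
  have [m hm] := inv_small (divr_gt0 (@ltr01 R) p0); exists m.
  have h1 : (2^-1 : R) ^+ m <= (4 * (3 * L * gk + 1))^-1.
    have := hm m (leqnn m); rewrite div1r => /ltW; apply: le_trans.
    rewrite exprVn lef_pV2 ?posrE ?exprn_gt0//.
    by rewrite -natrX ler_nat ltn_expl.
  rewrite -mulrA; apply: (@le_trans _ _ ((4 * (3 * L * gk + 1))^-1 * (3 * L * gk))).
    by rewrite ler_wpM2r// !mulr_ge0.
  rewrite mulrC ler_pdivrMr//; have : 0 <= 3 * L * gk by rewrite !mulr_ge0.
  by lra.
have R2 : 0 < Rad / 2 by rewrite divr_gt0.
have [s [sm us hs]] := nat_points m R2 acc.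
have [|sig sig0 hsig] := @uniq_separated R (map w s).
  by rewrite map_inj_uniq//; exact: seq_inj sd.
pose K' := cdisc l0 Rad.
have K'K : K' `<=` K by move=> z hz; have [] := evA z.
have cK' : compact K' by apply: (closed_sub_compact cK) => //; exact: cdisc_closed.
have B0 : boundary K' !=set0.
  by apply: (boundary_nonempty cK'); exists l0; rewrite /K' /cdisc/= subrr nrm0 ltW.
have Nval f : ratK K' f -> nrm (f l0) <= supN K' f.
  move=> rf; apply: (max_modulus cK' rf) => [z Bz|]; first exact: supN_ub.
  by rewrite /K' /cdisc/= subrr nrm0 ltW.
have Nle f h (e : R) : ratK K' f -> ratK K' h -> 0 <= e ->
    (forall x, boundary K' x -> nrm (h x) <= nrm (f x) + e) -> supN K' h <= supN K' f + e.
  move=> rf rh e0 hfe; apply: supN_le => // x Bx.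
  by rewrite (le_trans (hfe _ Bx))// lerD2r; exact: supN_ub.
have dK' : cdisc l0 Rad `<=` K' by [].
have [kp kp0 hkp] := blaschke_bound cK' Rad0 dK' Nval Nle m sig0.
pose cs := \sum_(j <- s) nrm (kc j) / nrm (inner G0 (kc j)).
have cs0 : 0 <= cs by apply: sumr_ge0 => j _; rewrite divr_ge0 ?nrm_ge0.
(* Chosen after the [m] points, so that the error at [l0] and the values at the [w j], amplified by
   [kp], together stay below [1 / 4]. *)
pose del := Num.min (2 * C0)^-1 (8 * (kp * cs * gk + C0 + 1))^-1.
have q0 : 0 < 8 * (kp * cs * gk + C0 + 1).
  by rewrite mulr_gt0// ltr_wpDl// addr_ge0 ?(ltW C00)// !mulr_ge0.
have del0 : 0 < del by rewrite lt_min d1 invr_gt0.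
have [p [q [x [zf e hx]]]] := oG u0 del0.
have hx1' : nrm (u0 - x) < (2 * C0)^-1 by apply: lt_le_trans hx _; rewrite ge_min lexx.
have hx2 : nrm (u0 - x) * (8 * (kp * cs * gk + C0 + 1)) <= 1.
  rewrite -ler_pdivlMr// div1r ltW//; apply: lt_le_trans hx _; by rewrite ge_min lexx orbT.
pose r z := p.[z] / q.[z].
have rj j : nrm (r (w j)) <= nrm (u0 - x) * (nrm (kc j) / nrm (inner G0 (kc j))).
  have n0 : 0 < nrm (inner G0 (kc j)) by rewrite nrm_gt0 orbit_coef.
  rewrite mulrA ler_pdivlMr// -nrmM.
  rewrite -(orbit_eigen bS (w_in sd j) zf (kc_eigen g hkc j) e).
  have -> : inner x (kc j) = - inner (u0 - x) (kc j).
    by rewrite innerBl -hkc ?coef0 ?sub0r ?opprK//; exact: D_u0.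
  by rewrite nrmN inner_CS.
have rK : ratK K' r by apply: (ratK_sub K'K); exact: rr.
have := hkp (map w s) r _ rK hsig _.
rewrite size_map sm => /(_ erefl) h1.
have {}h1 : nrm (r l0) <= \prod_(x <- map w s) (nrm (x - l0) / Rad) * supN K' r +
    kp * \sum_(x <- map w s) nrm (r x).
  apply: h1 => _ /mapP[j js ->]; have := hs _ js; have := ltW Rad0; lra.
have Nr : supN K' r <= 3 * L.
  apply: supN_le => // z Bz; apply: (bnd z p q x) => //.
  exact: cdisc_boundary Bz.
have pr : \prod_(x <- map w s) (nrm (x - l0) / Rad) <= 2^-1 ^+ m.
  rewrite -sm big_map; elim: (s) hs => [_|j t IH ht]; first by rewrite big_nil.
  rewrite big_cons exprS ler_pM ?divr_ge0 ?nrm_ge0 ?(ltW Rad0)//.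
  - by apply: prodr_ge0 => i _; rewrite divr_ge0 ?nrm_ge0 ?(ltW Rad0).
  - by rewrite ler_pdivrMr// mulrC; apply: ht; rewrite inE eqxx.
  - by apply: IH => i it; apply: ht; rewrite inE it orbT.
have sr : \sum_(x <- map w s) nrm (r x) <= nrm (u0 - x) * cs.
  by rewrite big_map /cs mulr_sumr; apply: ler_sum => j _; exact: rj.
have h2 : nrm (r l0) <= 2^-1 ^+ m * (3 * L) + kp * (nrm (u0 - x) * cs).
  apply: le_trans h1 _; rewrite lerD ?ler_wpM2l// ler_pM//.
    by apply: prodr_ge0 => i _; rewrite divr_ge0 ?nrm_ge0 ?(ltW Rad0).
  by apply: le_trans (Nval _ rK); exact: nrm_ge0.
have h3 := appr _ _ _ _ _ K0 zf e nk0 ek0 uk0.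
have := ler_nrmD (1 - r l0 * inner G0 k0) (r l0 * inner G0 k0).
rewrite subrK nrm1 nrmM -/gk => h4.
have h5 : nrm (r l0) * gk <= (2^-1 ^+ m * (3 * L) + kp * (nrm (u0 - x) * cs)) * gk.
  by rewrite ler_wpM2r.
have u0' := nrm_ge0 (u0 - x).
have k1 : 0 <= kp * cs * gk by rewrite !mulr_ge0.
have e6 : (2^-1 ^+ m * (3 * L) + kp * (nrm (u0 - x) * cs)) * gk =
    2^-1 ^+ m * (3 * L) * gk + nrm (u0 - x) * (kp * cs * gk) by ring.
rewrite e6 in h5; move: h3 h4 h5 hm hx2; rewrite -/(r l0).
move: (nrm (u0 - x)) u0' (kp * cs * gk) k1 => u u0' X X0 h3 h4 h5 hm' hx2.
have : 0 <= u * X by rewrite mulr_ge0.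
have : 0 <= u * C0 by rewrite mulr_ge0// ltW.
lra.
Qed.

Lemma fp_rel J kf : (forall x, D x -> phi (w J) (fpc w eps J) x = inner (tau x) kf) ->
  forall h, inner (S h) kf = w J * inner h kf + (eps J)%:C * inner h (kc J).
Proof.
move=> hkf h; have cc (z : C) : z^*^* = z by apply: ReImE; rewrite ?ReJ ?ImJ ?opprK.
rewrite -[w J]cc -[(eps J)%:C]cc -!innerZr -innerDr; move: h.
apply: (gns_inner_ext g (A := S) (B := id) bS (bounded_id H)) => x Dx.
rewrite (gns_S g)// innerDr !innerZr !cc -hkf//; last exact: seqZD.
by rewrite (fp_Z sd) -hkf// -hkc.
Qed.

(* Otherwise the rational functions sending [G0] near [u0] would be bounded on the
   circle and would be small at its center, hence also their derivatives, against
   the Jordan relation of [fp_rel]. *)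
Lemma small_hat J (s A : R) : 0 < s -> 0 <= A -> cdisc (w J) s `<=` K ->
  (forall z, nrm (z - w J) = s -> evb Gam z A) ->
  (forall z, nrm (z - w J) = s -> forall j, z - w j != 0 /\
    eps j <= 2^-1 ^+ j.+1 * nrm (z - w j) * Num.sqrt (kap j)) ->
  exists z k, [/\ nrm (z - w J) = s,
    forall x, D x -> phi z (hatc w eps z) x = inner (tau x) k &
    nrm (inner G0 k) <= 8 * eps J * nrm (inner G0 (kc J)) / s].
Proof.
move=> s0 A0 dK evA sep; apply: contrapT => no.
have c0 : 0 < nrm (inner G0 (kc J)) by rewrite nrm_gt0 orbit_coef.
have ep := seq_eps0 sd J; set cf := inner G0 (kc J) in c0 *.
(* If all pairings exceed [t] on the circle, [r] is at most [2 / t] on the disc and its derivative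
   at [w J] at most [4 / (t * s)]; the factor 8 makes the derivative term at most one half. *)
pose t := 8 * eps J * nrm cf / s.
have t0 : 0 < t by rewrite divr_gt0// !mulr_gt0.
pose C0 := 2 * A + 1; have C00 : 0 < C0 by rewrite ltr_wpDl// mulr_ge0.
have circK z : nrm (z - w J) = s -> K z by move=> h; apply: dK; rewrite /cdisc/= h.
have [kf hkf] := fp_vector cd sd g J; have fr := fp_rel hkf.
have uf : inner u0 kf = 1 by rewrite -(hkf _ (D_u0 K)) /phi/= fsum0 addr0.
(* Makes the remaining errors, in the pairing with [kf] and in the value of [r] at [w J], add up to
   less than [1 / 4]. *)
pose q0 := 4 * (nrm kf + nrm (kc J) * nrm (inner G0 kf) / nrm cf + C0).
have q00 : 0 < q0.
  rewrite mulr_gt0// ltr_wpDl// addr_ge0 ?nrm_ge0//.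
  by rewrite divr_ge0 ?nrm_ge0// mulr_ge0 ?nrm_ge0.
have i0 : 0 < q0^-1 by rewrite invr_gt0.
have [p [q [x [zf e hx]]]] := oG u0 i0.
have hx' : nrm (u0 - x) * q0 < 1 by rewrite -ltr_pdivlMr// div1r.
pose r z := p.[z] / q.[z].
have rK : ratK K r by exists p, q.
have rb z : nrm (z - w J) = s -> nrm (r z) <= 2 / t.
  move=> hz; have Kz := circK _ hz.
  have [k [nk hk uk]] := hat_vector1 A0 (evA _ hz) (fun j => (sep _ hz j).1) (fun j => (sep _ hz j).2).
  have ek := hat_eigen (fun j => (sep _ hz j).1) hk.
  have xk := orbit_eigen bS Kz zf ek e.
  have big : t < nrm (inner G0 k).
    by rewrite ltNge; apply/negP => h; apply: no; exists z, k.
  have h1 : nrm (inner (u0 - x) k) <= 1.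
    apply: le_trans (inner_CS _ _) _; apply: le_trans (ltW hx').
    rewrite ler_wpM2l ?nrm_ge0// (le_trans nk)// /q0 -/C0.
    have : 0 <= nrm kf + nrm (kc J) * nrm (inner G0 kf) / nrm cf.
      by rewrite addr_ge0 ?nrm_ge0// divr_ge0 ?nrm_ge0// mulr_ge0 ?nrm_ge0.
    by lra.
  have h2 : nrm (inner x k) <= 2.
    have := ler_nrmB (inner u0 k) (inner (u0 - x) k).
    by rewrite innerBl opprB addrC subrK uk nrm1; move: h1; rewrite innerBl uk; lra.
  rewrite ler_pdivlMr//; apply: le_trans h2; rewrite xk -/(r z) [leRHS]nrmM.
  by rewrite ler_wpM2l ?nrm_ge0// ltW.
have rw : nrm (r (w J)) <= 2 / t.
  by apply: (disc_max_modulus cK dK rK rb); rewrite subrr nrm0 ltW.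
have : root (p - (r (w J)) *: q) (w J).
  by rewrite /root hornerD hornerN hornerZ /r divfK ?subrr// (zf _ (w_in sd J)).
move=> /factor_theorem[M hM].
have gK : ratK K (fun z => M.[z] / q.[z]) by exists M, q.
have gE z : K z -> (z - w J) * (M.[z] / q.[z]) = r z - r (w J).
  move=> Kz; have := congr1 (fun f : {poly C} => f.[z]) hM.
  rewrite hornerD hornerN hornerZ hornerM hornerXsubC => h.
  rewrite mulrA [_ * M.[z]]mulrC -h /r mulrBl mulfK// zf//.
have gw : nrm (M.[w J] / q.[w J]) <= 4 / t / s.
  apply: (disc_max_modulus cK dK gK) => [z hz|]; last by rewrite subrr nrm0 ltW.
  rewrite ler_pdivlMr// mulrC -{1}hz -nrmM gE; last exact: circK.
  have := ler_nrmB (r z) (r (w J)); have := rb _ hz; move: rw.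
  have -> : 4 / t = 2 / t + 2 / t by rewrite -mulrDl -natrD.
  by move: (2 / t) => y; lra.
(* [M / q] is the difference quotient of [r = p / q] at [w J]; its value there is the derivative of
   [r]. *)
have dM : M.[w J] = p^`().[w J] - r (w J) * q^`().[w J].
  have := congr1 (fun f : {poly C} => f^`().[w J]) hM.
  rewrite derivB derivZ derivM derivXsubC mulr1 hornerD hornerN hornerZ => ->.
  by rewrite hornerD hornerM hornerXsubC subrr mulr0 add0r.
have xf : inner x kf = r (w J) * inner G0 kf + (eps J)%:C * cf * (M.[w J] / q.[w J]).
  have := congr1 (fun h => inner h kf) e.
  rewrite !(poly_op_jordan bS _ _ (inner_lin (kc J)) (inner_lin kf) (kc_eigen g hkc J) fr).
  rewrite (orbit_eigen bS (w_in sd J) zf (kc_eigen g hkc J) e) -/(r (w J)) -/cf dM => h.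
  have qn0 := zf _ (w_in sd J); apply: (mulfI qn0).
  have -> : q.[w J] * inner x kf = p.[w J] * inner G0 kf + (eps J)%:C * p^`().[w J] * cf -
     (eps J)%:C * q^`().[w J] * (r (w J) * cf) by rewrite -h; ring.
  rewrite /r; move: (p.[w J]) (q.[w J]) (p^`().[w J]) (q^`().[w J]) qn0 => p0 q1 p' q' qn0.
  by move: ((eps J)%:C : C) (inner G0 kf) => e1 e2; field.
have rw' : nrm (r (w J)) * nrm cf <= nrm (u0 - x) * nrm (kc J).
  rewrite -nrmM -(orbit_eigen bS (w_in sd J) zf (kc_eigen g hkc J) e).
  have -> : inner x (kc J) = - inner (u0 - x) (kc J).
    by rewrite innerBl -hkc ?coef0 ?sub0r ?opprK//; exact: D_u0.
  by rewrite nrmN inner_CS.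
have h1 : nrm ((eps J)%:C * cf * (M.[w J] / q.[w J])) <= 2^-1.
  rewrite nrmM (nrmM _ cf) nrm_real (gtr0_norm ep).
  apply: (@le_trans _ _ (eps J * nrm cf * (4 / t / s))).
    by rewrite ler_wpM2l// mulr_ge0 ?nrm_ge0// ltW.
  rewrite /t le_eqVlt; apply/orP; left; apply/eqP; field.
  by rewrite !gt_eqF.
have h2 := ler_nrmD (inner x kf) (inner (u0 - x) kf).
rewrite innerBl addrC subrK uf nrm1 in h2.
have h3 := inner_CS (u0 - x) kf; rewrite innerBl uf in h3.
have h4 := ler_nrmD (r (w J) * inner G0 kf) ((eps J)%:C * cf * (M.[w J] / q.[w J])).
rewrite -xf (nrmM (r _)) in h4.
have h5 : nrm (r (w J)) * nrm (inner G0 kf) <=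
    nrm (u0 - x) * (nrm (kc J) * nrm (inner G0 kf) / nrm cf).
  rewrite !mulrA ler_pdivlMr// mulrAC ler_wpM2r ?nrm_ge0//.
move: hx'; rewrite /q0 => hx'; have u0' := nrm_ge0 (u0 - x).
have : 0 <= nrm (u0 - x) * C0 by rewrite mulr_ge0// ltW.
move: hx' h5; move: (nrm (kc J) * _ / _) => X hx' h5 h6.
have := h3; have := h2; have := h1; have := h4.
by move: hx'; rewrite mulrA mulrDr mulrDr; lra.
Qed.

(* The hypothesis on rational functions is applied after clearing the first [J0]
   poles. *)
Lemma uniform_hat (i0 J0 m : nat) (s th : nat -> R) (et kp B : R) (z : nat -> C) :
  let c := b i0 in
  let Q : {poly C} := \prod_(j < J0) ('X - (w j)%:P) in
  (forall f, ratK K f -> nrm (f c) <= et * (qn (gform Gam) (slice i0 (bpull f)) / Num.sqrt (kap i0)) +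
     kp * \sum_(l < m) nrm (f (z (J0 + l)%N))) ->
  0 <= et -> 0 <= kp -> 0 <= B -> (forall j, 0 < s j) ->
  (forall j, eps j <= 2^-1 ^+ j.+1 * Num.sqrt (kap j) * (s j * th j)) ->
  (forall j, (J0 <= j)%N -> th j <= B) ->
  (forall j, s j <= nrm (c - w j)) -> (forall J j, s j <= nrm (z J - w j)) ->
  (forall J, K (z J)) ->
  forall BQ, 0 <= BQ -> (forall y, K y -> nrm Q.[y] <= BQ) ->
  forall x, D x -> nrm Q.[c] * nrm (phi c (hatc w eps c) x) <=
    (nrm Q.[c] * B + et * (3 * BQ / Num.sqrt (kap i0)) + kp * BQ * m%:R * B) * nrm (tau x) +
    kp * BQ * \sum_(l < m) nrm (phi (z (J0 + l)%N) (hatc w eps (z (J0 + l)%N)) x).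
Proof.
move=> c Q hbl et0 kp0 B0 s0 he hth cw zw Kz BQ BQ0 hBQ x Dx.
pose d' : {poly C} := take_poly J0 x.2.
pose Qj j : {poly C} := \prod_(i < J0 | (i : nat) != j) ('X - (w i)%:P).
(* The rational part with its first [J0] poles, multiplied by [Q], which cancels them. *)
pose f y : C := Q.[y] * x.1 y + fsum d' (fun j => (eps j)%:C * (Qj j).[y]).
have rf : ratK K f.
  apply: ratKD; first by apply: ratKM => //; exact: ratK_poly.
  apply: (@ratK_sum _ _ _ _ (fun (j : 'I_(size d')) y => d'`_j * ((eps j)%:C * (Qj j).[y]))) => j.
  by apply: ratKZ; apply: ratKZ; exact: ratK_poly.
have fE y : (forall j, y - w j != 0) -> f y = Q.[y] * phi y (hatc w eps y) (x.1, d').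
  move=> yw; rewrite /f /phi/= mulrDr; congr (_ + _); rewrite -fsumZ; apply: eq_fsum => j.
  rewrite coef_take_poly; case: ifP => [jJ _|]; last by rewrite eqxx.
  have -> : Q = Qj j * ('X - (w j)%:P).
    by rewrite /Q (bigD1 (Ordinal jJ))//= mulrC; congr (_ * _); apply: eq_bigl => i.
  rewrite hornerM hornerXsubC /hatc; have := yw j.
  by move: ((eps j)%:C : C) (w j) ((Qj j).[y]) => e v u yv; field.
(* The poles of index at least [J0], uniformly small at points [y] that keep the distance [s j] from
   each [w j]. *)
pose tl y := fsum x.2 (fun j => if (J0 <= j)%N then hatc w eps y j else 0).
have phiE y : phi y (hatc w eps y) x = phi y (hatc w eps y) (x.1, d') + tl y.
  rewrite /phi/= -addrA; congr (_ + _).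
  have h1 : (size x.2 <= maxn (size x.2) J0)%N by rewrite leq_maxl.
  have h2 : (size d' <= maxn (size x.2) J0)%N.
    by rewrite (leq_trans (size_take_poly _ _))// leq_maxr.
  rewrite /tl (fsum_wide _ h1) (fsum_wide _ h2) (fsum_wide _ h1) -big_split/=.
  apply: eq_bigr => j _; rewrite coef_take_poly ltnNge.
  by case: leqP => _; rewrite ?mul0r ?mulr0 ?addr0 ?add0r.
have tlb y : (forall j, s j <= nrm (y - w j)) -> nrm (tl y) <= B * nrm (tau x).
  move=> hy; apply: (fsum_le cd g Dx B0) => j.
  have p0 : 0 < 2^-1 ^+ j.+1 * Num.sqrt (kap j).
    by rewrite mulr_gt0 ?exprn_gt0// sqrtr_gt0; exact: core_kap0 cd j.
  rewrite -mulrA; case: leqP => [Jj|_]; last by rewrite nrm0 mulr_ge0// ltW.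
  rewrite /hatc nrmM nrmV nrm_real (gtr0_norm (seq_eps0 sd j)).
  have y0 : 0 < nrm (y - w j) by apply: lt_le_trans (hy j).
  rewrite ler_pdivrMr//; apply: le_trans (he j) _; rewrite (mulrC B) -(mulrA _ B).
  rewrite ler_wpM2l ?(ltW p0)// [s j * _]mulrC; apply: ler_pM => //.
  - have : 0 < 2^-1 ^+ j.+1 * Num.sqrt (kap j) * (s j * th j).
      by apply: lt_le_trans (he j); exact: seq_eps0 sd j.
    by rewrite pmulr_rgt0// pmulr_rgt0// => /ltW.
  - exact: ltW.
  - exact: hth.
have nz y j : s j <= nrm (y - w j) -> y - w j != 0.
  by move=> h; rewrite -nrm_gt0; apply: lt_le_trans h.
have k0 : 0 < Num.sqrt (kap i0) by rewrite sqrtr_gt0; exact: core_kap0 cd i0.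
have n0 : 0 <= nrm (tau x) by exact: nrm_ge0.
pose pB := gform_psd (core_GamL cd) (core_Gam_ge0 cd).
have Nf : qn (gform Gam) (slice i0 (bpull f)) <= BQ * (3 * nrm (tau x)).
  apply: le_trans (qn_slice_le cd i0 (cbf_bpull cd rf)) _.
  have D' : D (x.1, d') by exact: Dx.
  have bF := cbf_bd cd (seqF_ratK cd sd D').
  have h1 : qn (gform Gam) (bpull (seqF w eps (x.1, d'))) <= 3 * nrm (tau x).
    have b1 := cbf_bpull cd Dx; have b2 := cbf_bd cd (poles_ratK sd d').
    have -> : (bpull (seqF w eps (x.1, d')) : _ -> C^o) = bpull x.1 + bpull (poles w eps d') by [].
    apply: le_trans (qnD pB b1 b2) _.
    have := rat_le cd sd g Dx => h2.
    suff : qn (gform Gam) (bpull (poles w eps d')) <= nrm (tau x) by move: h2; lra.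
    apply: le_trans (poles_le cd sd _) _.
    apply: (@le_trans _ _ (\sum_(j < size d') 2^-1 ^+ j.+1 * nrm (tau x))).
      apply: ler_sum => j _; have dj := seq_delta0 sd j; have ej := seq_eps sd j.
      apply: (@le_trans _ _ (nrm x.2`_j * (2^-1 ^+ j.+1 * Num.sqrt (kap j)))).
        rewrite ler_pM ?nrm_ge0//.
        - by rewrite divr_ge0// ltW// (seq_eps0 sd).
        - by rewrite coef_take_poly; case: ifP => // _; rewrite nrm0 nrm_ge0.
        - rewrite ler_pdivrMr//; apply: le_trans ej _; by rewrite mulrAC.
      by rewrite mulrCA ler_wpM2l ?(coef_le cd g)// exprn_ge0.
    by rewrite -mulr_suml ler_piMl ?geo_half.
  apply: (@le_trans _ _ (BQ * qn (gform Gam) (bpull (seqF w eps (x.1, d'))))); last by rewrite ler_wpM2l.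
  have -> : BQ = nrm (BQ%:C : C) by rewrite nrm_real ger0_norm.
  rewrite -(qnZ pB)//; apply: (qn_gform_le (core_GamL cd) (core_Gam_ge0 cd)).
  - exact: (cbf_bpull cd rf).
  - by apply: cbfM => //; exact: cbf_cst.
  - move=> [[y By] j]; rewrite /bpull/= fE; last by move=> i; exact: (bd_neq_w sd).
    rewrite nrmM [leRHS]nrmM nrm_real (ger0_norm BQ0) ler_wpM2r ?nrm_ge0//.
    by apply: hBQ; exact: (boundary_sub clK).
have fz l : nrm (f (z (J0 + l)%N)) <= BQ * (nrm (phi (z (J0 + l)%N) (hatc w eps (z (J0 + l)%N)) x) + B * nrm (tau x)).
  rewrite fE; last by move=> j; exact: nz.
  rewrite nrmM ler_pM ?nrm_ge0 ?hBQ//.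
  have := ler_nrmB (phi (z (J0 + l)%N) (hatc w eps (z (J0 + l)%N)) x) (tl (z (J0 + l)%N)).
  have := tlb _ (zw (J0 + l)%N).
  have -> : phi (z (J0 + l)%N) (hatc w eps (z (J0 + l)%N)) (x.1, d') =
      phi (z (J0 + l)%N) (hatc w eps (z (J0 + l)%N)) x - tl (z (J0 + l)%N).
    by rewrite phiE addrK.
  lra.
have fc : nrm Q.[c] * nrm (phi c (hatc w eps c) x) <= nrm Q.[c] * (B * nrm (tau x)) + nrm (f c).
  rewrite fE; last by move=> j; exact: nz.
  rewrite nrmM -mulrDr ler_wpM2l ?nrm_ge0// phiE (le_trans (ler_nrmD _ _))// addrC.
  by rewrite lerD2r tlb.
apply: le_trans fc _.
have h1 : et * (qn (gform Gam) (slice i0 (bpull f)) / Num.sqrt (kap i0)) <=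
    et * (3 * BQ / Num.sqrt (kap i0)) * nrm (tau x).
  rewrite -mulrA ler_wpM2l// mulrAC ler_wpM2r ?invr_ge0 ?(ltW k0)//.
  by apply: le_trans Nf _; rewrite mulrA [BQ * 3]mulrC.
have h2 : kp * \sum_(l < m) nrm (f (z (J0 + l)%N)) <= kp * BQ * m%:R * B * nrm (tau x) +
    kp * BQ * \sum_(l < m) nrm (phi (z (J0 + l)%N) (hatc w eps (z (J0 + l)%N)) x).
  apply: (@le_trans _ _ (kp * \sum_(l < m) BQ *
      (nrm (phi (z (J0 + l)%N) (hatc w eps (z (J0 + l)%N)) x) + B * nrm (tau x)))).
    by rewrite ler_wpM2l//; apply: ler_sum => l _; exact: fz.
  rewrite -mulr_sumr big_split/= sumr_const card_ord -[_ * _ *+ m]mulr_natl.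
  move: (m%:R : R) (\sum_(l < m) _) => M X.
  by rewrite le_eqVlt; apply/orP; left; apply/eqP; ring.
have := hbl _ rf; move: h1 h2; rewrite !mulrDl -!addrA.
by move: (nrm (tau x)) => n h1 h2 h3; lra.
Qed.

End SeqNotCyclic.

(** * Choice of the sequence *)

Section Conclusion.
Variable R : realType.
Local Notation C := (cplx R).

(** The conclusion of [theorem1], reached separately in each of its three cases. *)
Definition model_operator (K Ke : set C) := exists (H : hilbertSpace R) (S : H -> H),
    [/\ bounded_operator S, subnormal_operator S & irreducible_operator S] /\
    [/\ spectrum S = K, essential_spectrum S = Ke
      & forall l, (K `\` Ke) l -> fredholm_index (sub_scalar S l) (-1)] /\
    rationally_cyclic S 2 /\
    (connected (~` K) -> cyclic_operator S 2).

Lemma model_operatorI (K Ke : set C) (H : hilbertSpace R) (S : H -> H) :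
  compact K -> K !=set0 ->
  [/\ bounded_operator S, subnormal_operator S & irreducible_operator S] ->
  [/\ spectrum S = K, essential_spectrum S = Ke
    & forall l, (K `\` Ke) l -> fredholm_index (sub_scalar S l) (-1)] ->
  (forall l (d : R), 0 < d -> (forall z, K z -> d <= nrm (z - l)) ->
    (exists T', bounded_inverse (sub_scalar S l) T') /\
    forall h, d * nrm h <= nrm (sub_scalar S l h)) ->
  (exists F : 'I_2 -> H, R2 S F = setT) -> (forall G : 'I_1 -> H, R2 S G <> setT) ->
  model_operator K Ke.
Proof.
move=> cK K0 [bS sS iS] [sp es ind] res [F RF] nc; exists H, S; split => //; split => //.
split; first by split => //; exists F.
move=> con; split.
  exists F; rewrite -subTset -RF; apply: R2_P2 => //; rewrite sp//.
  move=> l d d0 hd; have [[T' [_ _ T2]] below] := res l d d0 hd; split => // x.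
  by exists (T' x); exact: T2.
by move=> G PG; apply: (nc G); rewrite -subTset -PG; exact: P2_R2.
Qed.

Lemma fin_min (n : nat) (f : nat -> R) : (forall i, (i < n)%N -> 0 < f i) ->
  exists2 m : R, 0 < m & forall i, (i < n)%N -> m <= f i.
Proof.
elim: n => [|n IH] h; first by exists 1.
have [m m0 hm] := IH (fun i iN => h i (ltnW iN)).
exists (Num.min m (f n)); first by rewrite lt_min m0 h.
move=> i; rewrite ltnS leq_eqVlt => /orP[/eqP ->|/hm hi]; first by rewrite ge_min lexx orbT.
by rewrite (le_trans _ hi)// ge_min lexx.
Qed.

Variables (K : set C) (a : C) (b : nat -> C) (kap : nat -> R).
Variable Gam : (bd_type K * nat -> R) -> R.
Hypothesis cd : core_data a b kap Gam.
Let cK := core_compact cd.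
Let clK := compact_closed_nrm cK.

Lemma eps_exists (w : nat -> C) (ext : nat -> R) : (forall j, interior K (w j)) ->
  injective w -> (forall j, 0 < ext j) ->
  exists eps delta, seq_data K kap w eps delta /\ forall j, eps j <= ext j.
Proof.
move=> iw injw ext0.
have /choice[delta Hd] : forall j, exists d : R, [/\ 0 < d, d <= 1 &
    forall x, boundary K x -> d <= nrm (x - w j)].
  move=> j; have [d d0 hd] := interior_dist clK (iw j).
  exists (Num.min d 1); split; rewrite ?lt_min ?d0 ?ltr01// ?ge_min ?lexx ?orbT//.
  by move=> x /hd; apply: le_trans; rewrite ge_min lexx.
have /choice[eps He] : forall j, exists e : R, [/\ 0 < e, e <= ext j,
    e <= 2^-1 ^+ j.+1 * delta j * Num.sqrt (kap j)
  & forall i, (i < j)%N -> e <= 2^-1 ^+ j.+1 * nrm (w j - w i) * Num.sqrt (kap j)].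
  move=> j; have s0 : 0 < Num.sqrt (kap j) by rewrite sqrtr_gt0; exact: core_kap0 cd j.
  have p0 : 0 < (2^-1 : R) ^+ j.+1 by rewrite exprn_gt0.
  have [|m m0 hm] := @fin_min j (fun i => 2^-1 ^+ j.+1 * nrm (w j - w i) * Num.sqrt (kap j)).
    move=> i ij; rewrite !mulr_gt0// nrm_gt0 subr_eq0; apply: contraTneq ij => /injw ->.
    by rewrite ltnn.
  have [d0 d1 _] := Hd j.
  exists (Num.min m (Num.min (ext j) (2^-1 ^+ j.+1 * delta j * Num.sqrt (kap j)))); split.
  - by rewrite !lt_min m0 ext0 !mulr_gt0.
  - by rewrite !ge_min lexx !orbT.
  - by rewrite !ge_min lexx !orbT.
  - by move=> i /hm; apply: le_trans; rewrite ge_min lexx.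
exists eps, delta; split; last by move=> j; case: (He j).
split => // [j|j|j|j x|j|i j ij]; try by case: (He j).
- by case: (Hd j).
- by case: (Hd j).
- by case: (Hd j) => _ _; apply.
- by case: (He j) => _ _ _; apply.
Qed.

Lemma seq_conclusion (Ke : set C) (w : nat -> C) (eps delta : nat -> R) :
  seq_data K kap w eps delta -> boundary K `<=` Ke -> Ke `<=` K ->
  (forall l, interior K l -> Ke l <-> accum w l) ->
  (forall (H : hilbertSpace R) tau (S : H -> H)
     (g : gns_data (seq_Gam Gam) (@seq_zeta R K w) (@seqD R K) (@seqt R K w eps) (seqZ w eps) tau S)
     (kc : nat -> H), (forall j x, seqD K x -> x.2`_j = inner (tau x) (kc j)) ->
     forall G0, orbit_dense K S G0 -> False) ->
  model_operator K Ke.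
Proof.
move=> sd BKe KeK acc nc.
have [H [tau [S g]]] := seq_model_exists cd sd.
have [kc hkc] := coef_vectors cd g.
have [es ind] := seq_essential cd sd g hkc BKe KeK acc.
apply: (@model_operatorI K Ke H S cK (K_nonempty cd)).
- by split; [exact: gns_bounded g|exact: gns_subnormal g|exact: (seq_irreducible cd sd g hkc)].
- by split => //; exact: (seq_spectrum cd sd g).
- by move=> l d d0 hd; exact: (seq_resolvent cd sd g d0 hd).
- exact: (seq_two_cyclic cd sd g).
- by move=> G RG; apply: (nc H tau S g kc hkc (G ord0)); exact: (cyclic_orbit (gns_bounded g) (seq_spectrum cd sd g) RG).
Qed.

(** The [w j] have to be distinct and off the circle on which the evaluations are bounded, so each
    target point is moved slightly: off the circle a small real shift avoids any finite set. *)
Lemma avoid (v l0 : C) (r Rad : R) (bad : seq C) : 0 < r -> 0 < Rad ->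
  exists z, [/\ nrm (z - v) < r, z \notin bad & nrm (z - l0) != Rad].
Proof.
move=> r0 Rad0.
have main v' (r' : R) : 0 < r' -> nrm (v' - l0) != Rad ->
    exists z, [/\ nrm (z - v') < r', z \notin bad & nrm (z - l0) != Rad].
  move=> r'0 vR.
  pose d := Num.min r' `|nrm (v' - l0) - Rad|.
  have d0 : 0 < d by rewrite lt_min r'0 normr_gt0 subr_eq0.
  pose f k : C := v' + (d / k.+2%:R)%:C.
  have fv k : nrm (f k - v') < d.
    rewrite /f addrAC subrr add0r nrm_real ger0_norm ?divr_ge0 ?(ltW d0)//.
    by rewrite ltr_pdivrMr// ltr_pMr// ltr1n.
  have finj : injective f.
    move=> i j /addrI /(congr1 (@complex.Re R)) /= /(mulfI (lt0r_neq0 d0)) /invr_inj /eqP.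
    by rewrite eqr_nat => /eqP [].
  have [k _ kb] : exists2 k, (k < (size bad).+1)%N & f k \notin bad.
    apply: contrapT => h.
    have sub : {subset map f (iota 0 (size bad).+1) <= bad}.
      move=> y /mapP[k]; rewrite mem_iota => /andP[_ kb] ->; apply: contrapT => /negP nb.
      by apply: h; exists k.
    have := uniq_leq_size _ sub; rewrite map_inj_uniq// iota_uniq size_map size_iota ltnn.
    by move=> /(_ isT).
  exists (f k); split => //.
    by apply: lt_le_trans (fv k) _; rewrite ge_min lexx.
  apply/negP => /eqP e; have := ler_nrm_dist (f k - l0) (v' - l0).
  rewrite e (_ : f k - l0 - (v' - l0) = f k - v'); last by ring.
  move=> h; have := lt_le_trans (fv k) (_ : d <= `|nrm (v' - l0) - Rad|).
  by rewrite ge_min lexx orbT => /(_ isT); rewrite distrC; lra.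
have [vR|vR] := eqVneq (nrm (v - l0)) Rad; last exact: main.
have r2 : 0 < r / 2 by rewrite divr_gt0.
(* A point on the circle is first pushed outward by [r / 2]. *)
pose t : C := (r / (2 * Rad))%:C; pose v' := v + t * (v - l0).
have t0 : 0 <= r / (2 * Rad) by rewrite divr_ge0 ?mulr_ge0 ?ltW.
have h1 : nrm (v' - v) = r / 2.
  rewrite /v' addrAC subrr add0r nrmM nrm_real ger0_norm// vR.
  by field; rewrite gt_eqF.
have h2 : nrm (v' - l0) = Rad + r / 2.
  have -> : v' - l0 = (1 + r / (2 * Rad))%:C * (v - l0).
    by rewrite /v' /t rmorphD rmorph1; ring.
  rewrite nrmM nrm_real ger0_norm ?addr_ge0// vR; field; by rewrite gt_eqF.
have [z [zv zb zl]] : exists z, [/\ nrm (z - v') < r / 2, z \notin bad & nrm (z - l0) != Rad].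
  by apply: main => //; rewrite h2 gt_eqF// ltrDl.
exists z; split => //; have := ler_dist_nrm v' z v; rewrite h1; lra.
Qed.

(** Every neighborhood has to be visited infinitely often, isolated points of [A] included;
    otherwise these would not become limits of the perturbed points. *)
Lemma recurrent_sequence (A : set C) (l0 : C) : A l0 -> exists v : nat -> C,
  (forall n, A (v n)) /\
  forall l (e : R) N, A l -> 0 < e -> exists2 n, (N <= n)%N & nrm (v n - l) < e.
Proof.
move=> Al0.
have /choice[pk Hpk] : forall p : (rat * rat) * nat, exists z, A z /\
    ((exists2 z', A z' & nrm (z' - cratr R p.1) < p.2.+1%:R^-1) ->
     nrm (z - cratr R p.1) < p.2.+1%:R^-1).
  move=> p; case: (pselect (exists2 z', A z' & nrm (z' - cratr R p.1) < p.2.+1%:R^-1)).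
    by move=> [z Oz hz]; exists z.
  by move=> h; exists l0.
(* The last component of the code is ignored: it only repeats each choice infinitely often. *)
exists (fun n => if unpickle n is Some p then pk (p : (rat * rat) * nat * nat).1 else l0); split.
  by move=> n; case: unpickle => [p|//]; case: (Hpk p.1).
move=> l e N Al e0; have [k hk] := inv_small (divr_gt0 e0 (ltr0Sn _ 1)).
have k0 : 0 < k.+1%:R^-1 :> R by rewrite invr_gt0.
have [q hq] := crat_approx l k0.
have near : nrm (pk (q, k) - l) < e.
  have [_ Hh] := Hpk (q, k).
  have {Hh}/= h := Hh (ex_intro2 (fun z0 => A z0) (fun z0 => nrm (z0 - cratr R q) < k.+1%:R^-1) l Al hq).
  have := ler_dist_nrm (cratr R q) (pk (q, k)) l; rewrite (nrmBC (cratr R q)).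
  have := hk k (leqnn _); move: hq h; move: (k.+1%:R^-1 : R) => p; lra.
pose f i : nat := pickle (((q, k), i) : (rat * rat) * nat * nat).
have finj : injective f by move=> i j /(pcan_inj pickleK) [].
have [i Ni] : exists i, (N <= f i)%N.
  apply: contrapT => h.
  have sub : {subset map f (iota 0 N.+1) <= iota 0 N}.
    move=> y /mapP[i _ ->]; rewrite mem_iota /= add0n ltnNge; apply/negP => Ni; apply: h.
    by exists i.
  have := uniq_leq_size _ sub; rewrite map_inj_uniq// iota_uniq size_map !size_iota ltnn.
  by move=> /(_ isT).
by exists (f i) => //; rewrite /f pickleK.
Qed.

Lemma accum_model (Ke : set C) l0 : closed Ke -> boundary K `<=` Ke -> Ke `<=` K ->
  Ke l0 -> interior K l0 -> model_operator K Ke.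
Proof.
move=> clKe BKe KeK Kel0 Il0.
have [v [Av vrec]] := @recurrent_sequence [set l | Ke l /\ interior K l] l0 (conj Kel0 Il0).
have [A [Rad [A0 Rad0 hA]]] := evb_int cd Il0.
have n0 n : 0 < n.+1%:R^-1 :> R by rewrite invr_gt0.
(* The next point is chosen from the list of the previous ones, within [1 / (n + 1)] of [v n]. The
   limits in the interior are then the same as those of [v]: the interior points of the closed set
   [Ke]. *)
have /choice[pk Hpk] : forall p : nat * seq C, exists z,
    [/\ nrm (z - v p.1) < p.1.+1%:R^-1, interior K z, z \notin l0 :: p.2 & nrm (z - l0) != Rad].
  move=> [n s]; have [e e0 he] := interior_ball (Av n).2.
  have m0 : 0 < Num.min e n.+1%:R^-1 by rewrite lt_min e0 n0.
  have [z [zv zb zl]] := avoid (v n) l0 (l0 :: s) m0 Rad0.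
  exists z; split; [|apply: he|exact: zb|exact: zl].
    by apply: lt_le_trans zv _; rewrite ge_min lexx orbT.
  by apply: lt_le_trans zv _; rewrite ge_min lexx.
pose L := fix L n := if n is m.+1 then rcons (L m) (pk (m, L m)) else [::].
pose w n := pk (n, L n).
have LE n : L n = mkseq w n by elim: n => [//|n IH]; rewrite mkseqS -IH.
have Hw n := Hpk (n, L n).
have iw j : interior K (w j) by have [] := Hw j.
have injw : injective w.
  have lt i j : (i < j)%N -> w i != w j.
    move=> ij; have [_ _ h _] := Hw j; move: h; rewrite inE negb_or => /andP[_ h].
    apply: contraNneq h => e; rewrite /= -/(w j) -e LE; apply/mapP; exists i => //.
    by rewrite mem_iota.
  move=> i j e; have [ij|ji|//] := ltngtP i j; first by have := lt _ _ ij; rewrite e eqxx.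
  by have := lt _ _ ji; rewrite e eqxx.
have wl0 j : l0 - w j != 0.
  have [_ _ h _] := Hw j; move: h; rewrite inE negb_or => /andP[h _].
  by rewrite subr_eq0 eq_sym.
have wR j : nrm (w j - l0) != Rad by have [] := Hw j.
have wv j : nrm (w j - v j) < j.+1%:R^-1 by have [] := Hw j.
have close l (e : R) N : (Ke l /\ interior K l) -> 0 < e -> exists2 j, (N <= j)%N & nrm (w j - l) < e.
  move=> Al e0; have e2 := divr_gt0 e0 (ltr0Sn _ 1); have [M hM] := inv_small e2.
  have [n Mn vn] := vrec l _ (maxn M N) Al e2.
  exists n; first by rewrite (leq_trans _ Mn)// leq_maxr.
  have := hM n (leq_trans (leq_maxl M N) Mn); have := wv n.
  have := ler_dist_nrm (v n) (w n) l; move: vn; move: (n.+1%:R^-1 : R) => p; lra.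
have acc l : interior K l -> Ke l <-> accum w l.
  move=> Il; split=> [Kel m m0|ac].
    have [n1 _ h1] := close l m 0%N (conj Kel Il) m0.
    have [n2 h12 h2] := close l m n1.+1 (conj Kel Il) m0.
    have [e|ne] := eqVneq (w n1) l; last by exists n1.
    exists n2; split => //; apply: contraTneq h12 => e2.
    by rewrite (injw n2 n1) ?e2 ?e// ltnn.
  apply/((closed_nrmP _).1 clKe) => e e0; have e2 := divr_gt0 e0 (ltr0Sn _ 1).
  have [M hM] := inv_small e2.
  have [j Mj [_ jl]] := accum_tail ac M e2.
  exists (v j); first by case: (Av j).
  have := hM _ Mj; have := wv j; have := ler_dist_nrm (w j) l (v j).
  rewrite (nrmBC l (w j)); move: jl; move: (j.+1%:R^-1 : R) => p; lra.
(* A lower bound for the distance of [w j] to [l0] and to the circle; [eps j] is chosen small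
   against it, as [not_cyclic_accum] requires. *)
pose mn j := Num.min (nrm (l0 - w j)) `|nrm (w j - l0) - Rad|.
have mn0 j : 0 < mn j by rewrite lt_min nrm_gt0 wl0 normr_gt0 subr_eq0 wR.
have [|eps [delta [sd he]]] := @eps_exists w (fun j => 2^-1 ^+ j.+1 * mn j * Num.sqrt (kap j)) iw injw.
  by move=> j; rewrite !mulr_gt0 ?exprn_gt0// sqrtr_gt0; exact: core_kap0 cd j.
apply: (seq_conclusion sd BKe KeK acc) => H tau S g kc hkc G0 oG.
apply: (not_cyclic_accum cd sd g hkc oG Rad0 A0 hA (l0 := l0)); last exact/(acc _ Il0).
move=> l hl j.
have low : mn j <= nrm (l - w j).
  case: hl => [->|hl]; first by rewrite ge_min lexx.
  have h1 : mn j <= `|nrm (w j - l0) - Rad| by rewrite ge_min lexx orbT.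
  apply: le_trans h1 _; rewrite -hl (le_trans (ler_nrm_dist _ _))//.
  by rewrite (_ : w j - l0 - (l - l0) = w j - l) 1?nrmBC//; ring.
split; first by rewrite -nrm_gt0; exact: lt_le_trans low.
apply: le_trans (he j) _; rewrite ler_wpM2r ?sqrtr_ge0// ler_wpM2l// exprn_ge0//.
Qed.

End Conclusion.

(** * Sequences tending to the boundary *)

Section BoundaryModel.
Variable R : realType.
Local Notation C := (cplx R).

(** If [z] in the disc were off [K], the point of [K] on the segment from [c] to [z] closest to [z]
    could be moved on if it were interior; as a boundary point it would be too close to [c]. The
    segment is encoded by equality in the triangle inequality. *)
Lemma disc_sub (K : set C) (c : C) (rho : R) : compact K -> K c ->
  (forall x, boundary K x -> rho <= nrm (x - c)) -> 0 < rho -> cdisc c rho `<=` K.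
Proof.
move=> cK Kc hb rho0 z; rewrite /cdisc /= => zr; apply: contrapT => nKz.
have clK := compact_closed_nrm cK.
pose L := K `&` [set y | nrm (y - c) + nrm (y - z) <= nrm (z - c)].
have clL : closed L.
  apply/closed_nrmP => x hx; split.
    by apply: ((closed_nrmP K).1 clK) => e e0; have [y [Ky _] xy] := hx e e0; exists y.
  rewrite /= leNgt; apply/negP => lt.
  have [y [_ /= Ly] xy] := hx _ (divr_gt0 (eqbRL (subr_gt0 _ _) lt) (ltr0Sn _ 1)).
  have := ler_dist_nrm y x c; have := ler_dist_nrm y x z; move: Ly xy lt; lra.
have [y [Ky /= Ly] ymin] : exists2 x, L x & forall y, L y -> nrm (x - z) <= nrm (y - z).
  apply: compact_min; first by apply: closed_sub_compact cK clL _ => x [].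
    by exists c; split; rewrite //= subrr nrm0 add0r nrmBC.
  move=> x e _ e0; exists e => // y _ xy; apply: le_lt_trans (ler_nrm_dist _ _) _.
  by rewrite subrACA subrr subr0.
have yz : 0 < nrm (y - z) by rewrite nrm_gt0 subr_eq0; apply: contra_notN nKz => /eqP <-.
have [By|Iy] := boundary_or_interior clK Ky; first by have := hb y By; move: Ly zr yz; lra.
have [e e0 he] := interior_ball Iy.
pose t := Num.min (e / (2 * nrm (y - z))) 1.
have t0 : 0 < t by rewrite lt_min ltr01 divr_gt0// mulr_gt0.
have t1 : t <= 1 by rewrite ge_min lexx orbT.
have te : t * nrm (y - z) <= e / 2.
  by rewrite -ler_pdivlMr// /t -mulrA -invfM ge_min lexx.
pose y' := y - t%:C * (y - z).
have e1 : nrm (y' - z) = (1 - t) * nrm (y - z).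
  have -> : y' - z = (1 - t)%:C * (y - z) by rewrite /y' rmorphB rmorph1; ring.
  by rewrite nrmM nrm_real ger0_norm// subr_ge0.
have e2 : nrm (y' - y) = t * nrm (y - z).
  by rewrite /y' addrAC subrr add0r nrmN nrmM nrm_real ger0_norm// ltW.
have /ymin : L y'.
  split; first by apply: interior_subset; apply: he; rewrite e2; move: te e0; lra.
  by rewrite /= e1; have := ler_dist_nrm y y' c; rewrite e2; move: Ly; lra.
by rewrite e1 leNgt gtr_pMl// gtrBl t0.
Qed.

Section Lipschitz.
Variable H : hilbertSpace R.
Definition lipf (f : H -> R) := exists2 M : R, 0 <= M & forall x y, `|f x - f y| <= M * nrm (x - y).

Lemma lipf_nrm : lipf (fun x => nrm x).
Proof. by exists 1 => // x y; rewrite mul1r ler_nrm_dist. Qed.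

Lemma lipf_inner k : lipf (fun x => nrm (inner x k)).
Proof.
exists (nrm k); first exact: nrm_ge0.
by move=> x y; rewrite (le_trans (ler_nrm_dist _ _))// -innerBl mulrC inner_CS.
Qed.

Lemma lipfD f g : lipf f -> lipf g -> lipf (fun x => f x + g x).
Proof.
move=> [M M0 hf] [N N0 hg]; exists (M + N) => [|x y]; first exact: addr_ge0.
rewrite opprD addrACA mulrDl (le_trans (ler_normD _ _))//.
by apply: lerD.
Qed.

Lemma lipfZ r f : lipf f -> lipf (fun x => r * f x).
Proof.
move=> [M M0 hf]; exists (`|r| * M) => [|x y]; first exact: mulr_ge0.
by rewrite -mulrBr normrM -mulrA ler_wpM2l.
Qed.

Lemma lipf_sum m (f : nat -> H -> R) : (forall l, lipf (f l)) -> lipf (fun x => \sum_(l < m) f l x).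
Proof.
move=> hf; elim: m => [|m IH].
  by exists 0 => // x y; rewrite !big_ord0 subrr normr0 mul0r.
have [M M0 hM] := lipfD IH (hf m); exists M => // x y.
by rewrite !big_ord_recr /=; exact: hM.
Qed.

End Lipschitz.

Lemma dense_le (E : lmodType C) (D : set E) (H : hilbertSpace R) (tau : E -> H)
    (f g : H -> R) : model D tau -> lipf f -> lipf g ->
  (forall x, D x -> f (tau x) <= g (tau x)) -> forall h, f h <= g h.
Proof.
move=> [_ _ _ den] Lf Lg le h; rewrite leNgt; apply/negP => lt.
have [c c0 Lip] : lipf (fun x => f x + -1 * g x) by apply: lipfD => //; exact: lipfZ.
have c1 : 0 < c + 1 by rewrite ltr_wpDl.
have d0 : 0 < f h - g h by rewrite subr_gt0.
have [x Dx hx] := den h _ (divr_gt0 d0 c1).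
move: hx; rewrite ltr_pdivlMr// mulrDr mulr1 (mulrC _ c).
have := Lip h (tau x); have := le x Dx; have := nrm_ge0 (h - tau x).
by rewrite ler_norml => h1 h2 /andP[_ h3]; lra.
Qed.

Variables (K : set C) (a : C) (b : nat -> C) (kap : nat -> R).
Variable Gam : (bd_type K * nat -> R) -> R.
Hypothesis cd : core_data a b kap Gam.
Let cK := core_compact cd.
Let clK := compact_closed_nrm cK.
Let GL := core_GamL cd.
Let Gp := core_Gam_ge0 cd.
Let pB := gform_psd GL Gp.

Definition slice_norm (i : nat) (f : C -> C) : R :=
  qn (gform Gam) (slice i (bpull f)) / Num.sqrt (kap i).

(** The slice has mass [kap i], so after normalization the constant [e] has norm [e]. *)
Lemma slice_norm_le i f g (e : R) : ratK K f -> ratK K g -> 0 <= e ->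
  (forall x, boundary K x -> nrm (g x) <= nrm (f x) + e) ->
  slice_norm i g <= slice_norm i f + e.
Proof.
move=> rf rg e0 h; have sk : 0 < Num.sqrt (kap i) by rewrite sqrtr_gt0 (core_kap0 cd).
rewrite /slice_norm ler_pdivrMr// mulrDl divfK ?gt_eqF//.
pose F : bd_type K * nat -> C^o := fun t => (nrm (f (bd_val t.1)))%:C.
have nF t : nrm (F t) = nrm (f (bd_val t.1)) by rewrite nrm_real ger0_norm ?nrm_ge0.
have cF : cbf F.
  by have [M hM] := cbf_bpull cd rf; exists M => t; rewrite nF; exact: hM.
have c1 : cbf ((fun=> 1) : bd_type K * nat -> C^o) by exists 1 => t; rewrite nrm1.
pose e1 : bd_type K * nat -> C^o := (e%:C : C) *: slice i (fun=> 1).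
have cs : cbf (slice i (fun=> 1 : C^o)) := cbf_slice i c1.
have ce : cbf e1.
  by apply: (psd_DZ pB).
have cS : cbf (slice i F) := cbf_slice i cF.
apply: le_trans (qn_gform_le GL Gp (cbf_slice i (cbf_bpull cd rg)) (psd_DD pB cS ce) _) _.
  move=> t; rewrite /e1 /slice /= /GRing.add /= /GRing.scale /=.
  case: eqP => _; last by rewrite nrm0 nrm_ge0.
  rewrite (_ : F t + _ = ((nrm (f (bd_val t.1)) + e)%:C : C)).
    by rewrite nrm_real ger0_norm ?addr_ge0 ?nrm_ge0//; exact: h (svalP t.1).
  have hs (p : C) : F t + p * 1 = F t + p by rewrite mulr1.
  by rewrite rmorphD; exact: hs.
apply: le_trans (qnD pB cS ce) _; apply: lerD.
  apply: (qn_gform_le GL Gp cS (cbf_slice i (cbf_bpull cd rf))) => t.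
  by rewrite /slice; case: eqP => // _; rewrite nF.
by rewrite (qnZ pB)// nrm_real ger0_norm// (qn_slice1 cd).
Qed.

Section Radius.
(* Points of the radius from [c] to a nearest boundary point [p], with distances
   to [c] chosen for the Blaschke products on the discs around them to vanish. *)
Variables (i0 : nat) (p : C) (rho : R).
Local Notation c := (b i0).
Hypotheses (Ip : boundary K p) (Ep : nrm (p - c) = rho) (rho0 : 0 < rho).
Hypothesis hrho : forall x, boundary K x -> rho <= nrm (x - c).
Let q (j : nat) : R := j.+1%:R^-1.
Definition rad_w (j : nat) : C := c + (1 - (q j + q j.+1) / 2)%:C * (p - c).
(** Radius of a circle around [w j]. The [w j] are midpoints of consecutive gaps, so two of them
    differ by at least half the sum of their gaps; a sixteenth keeps the circles far apart. *)
Definition rad_s (j : nat) : R := rho * (q j - q j.+1) / 16.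
Local Notation w := rad_w.
Local Notation s := rad_s.

Lemma rad_q0 j : 0 < q j. Proof. by rewrite invr_gt0. Qed.

Lemma rad_q_mono i j : (i <= j)%N -> q j <= q i.
Proof. by move=> ij; rewrite lef_pV2 ?posrE// ler_nat. Qed.

Lemma rad_q_lt j : q j.+1 < q j.
Proof. by rewrite ltf_pV2 ?posrE// ltr_nat. Qed.

Lemma rad_q1 j : q j <= 1.
Proof. by rewrite (le_trans (rad_q_mono (leq0n j)))// /q invr1. Qed.

Lemma rad_s0 j : 0 < s j.
Proof. by rewrite divr_gt0// mulr_gt0// subr_gt0 rad_q_lt. Qed.

Lemma rad_dist i j : nrm (w i - w j) = rho * `|(q j + q j.+1) / 2 - (q i + q i.+1) / 2|.
Proof.
have -> : w i - w j = ((q j + q j.+1) / 2 - (q i + q i.+1) / 2)%:C * (p - c).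
  by rewrite /rad_w !rmorphB !rmorph1; ring.
by rewrite nrmM nrm_real Ep mulrC.
Qed.

Lemma rad_sep_lt i j : (i < j)%N -> 8 * (s i + s j) <= nrm (w i - w j).
Proof.
move=> ij; rewrite rad_dist distrC /rad_s.
have := rad_q_mono ij; have := rad_q_lt i; have := rad_q_lt j.
move: (q i) (q i.+1) (q j) (q j.+1) => x y x' y' h1 h2 h3.
rewrite ger0_norm; last lra.
rewrite -mulrDl -mulrDr mulrC -mulrA -mulrA ler_pM2l//; lra.
Qed.

Lemma rad_sep i j : i != j -> 8 * (s i + s j) <= nrm (w i - w j).
Proof.
case: (ltngtP i j) => // ij _; first exact: rad_sep_lt.
by rewrite nrmBC addrC; exact: rad_sep_lt.
Qed.

Lemma rad_inj : injective w.
Proof.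
move=> i j e; apply/eqP; apply: contrapT => /negP /rad_sep.
by rewrite e subrr nrm0; have := rad_s0 i; have := rad_s0 j; lra.
Qed.

Lemma rad_center j : nrm (w j - c) = rho * (1 - (q j + q j.+1) / 2).
Proof.
rewrite /rad_w addrAC subrr add0r nrmM nrm_real Ep ger0_norm 1?mulrC//.
by have := rad_q1 j; have := rad_q1 j.+1; lra.
Qed.

Lemma rad_s_center j : s j <= nrm (c - w j).
Proof.
rewrite nrmBC rad_center /rad_s -mulrA ler_pM2l//.
by have := rad_q1 j; have := rad_q_lt j; lra.
Qed.

Lemma rad_disc : cdisc c rho `<=` K.
Proof. exact: disc_sub cK (core_Kb cd i0) hrho rho0. Qed.

Lemma rad_interior j : interior K (w j).
Proof.
apply/interior_nrmP; exists (rho - nrm (w j - c)).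
  rewrite rad_center subr_gt0 gtr_pMr//.
  by have := rad_q0 j; have := rad_q0 j.+1; lra.
move=> y hy; apply: rad_disc; rewrite /cdisc /=.
by have := ler_dist_nrm (w j) y c; rewrite (nrmBC y (w j)); move: hy; lra.
Qed.

Lemma rad_not_accum l : interior K l -> ~ accum w l.
Proof.
move=> Il ac; have [d d0 hd] := interior_dist clK Il.
have [N hN] := inv_small (divr_gt0 (divr_gt0 d0 (ltr0Sn _ 1)) rho0).
have [j Nj [_ jl]] := accum_tail ac N (divr_gt0 d0 (ltr0Sn _ 1)).
have wp : nrm (p - w j) <= rho * q j.
  have -> : p - w j = ((q j + q j.+1) / 2)%:C * (p - c) by rewrite /rad_w rmorphB rmorph1; ring.
  rewrite nrmM nrm_real Ep mulrC ler_pM2l// ger0_norm.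
    by have := rad_q_lt j; lra.
  by have := rad_q0 j; have := rad_q0 j.+1; lra.
have := hN j Nj; rewrite ltr_pdivlMr// mulrC -/(q j) => h.
by have := hd p Ip; have := ler_dist_nrm (w j) p l; move: jl; lra.
Qed.

Lemma rad_circle_sep J z j : nrm (z - w J) = s J -> s j <= nrm (z - w j).
Proof.
move=> hz; have [->|ne] := eqVneq j J; first by rewrite hz.
have := rad_sep ne; have := ler_dist_nrm z (w j) (w J); rewrite hz (nrmBC (w j) z).
by have := rad_s0 j; have := rad_s0 J; lra.
Qed.

Lemma rad_circle_center J z : nrm (z - w J) <= s J -> nrm (z - c) <= (1 - q J.+1) * rho.
Proof.
move=> hz; have := ler_dist_nrm (w J) z c; rewrite rad_center; move: hz; rewrite /rad_s.
have := mulr_ge0 (ltW rho0) (ltW (eqbRL (subr_gt0 _ _) (rad_q_lt J))).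
by move: (q J) (q J.+1) => x y; rewrite !mulrBr !mulrBl !mulrDl !mulrDr; lra.
Qed.

Lemma rad_disc_sub J : cdisc (w J) (s J) `<=` K.
Proof.
move=> z; rewrite /cdisc /= => /rad_circle_center h; apply: rad_disc.
by rewrite /cdisc /= (le_trans h)// ger_pMl// gerBl ltW// rad_q0.
Qed.

Lemma rad_evb J z : nrm (z - w J) <= s J ->
  evb Gam z (2 / (q J.+1 * Num.sqrt (kap i0))).
Proof.
move=> hz f rf; have h := rad_circle_center hz.
have := @ev_bound _ _ _ _ _ _ cd i0 rho (1 - q J.+1) f z rf rho0.
rewrite (_ : 1 - (1 - q J.+1) = q J.+1); last by ring.
apply => //; first by rewrite subr_ge0 rad_q1.
  by rewrite gtrBl rad_q0.
exact: (rad_disc_sub hz).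
Qed.

(* The products of the [1 - q (J0 + l + 1)] telescope and tend to zero. *)
Lemma rad_blaschke J0 (et : R) : 0 < et -> exists m (kp : R), 0 <= kp /\
  forall z f, (forall J, nrm (z J - w J) = s J) -> ratK K f ->
    nrm (f c) <= et * slice_norm i0 f + kp * \sum_(l < m) nrm (f (z (J0 + l)%N)).
Proof.
move=> et0; have [m hm] := inv_small (divr_gt0 et0 (ltr0Sn R J0)).
have [sig sig0 hsig] : exists2 sig : R, 0 < sig & forall j, (j < J0 + m)%N -> sig <= s j.
  by apply: fin_min => j _; exact: rad_s0.
have [kp kp0 bl] := blaschke_bound cK rho0 rad_disc (fun f => @slice_value _ _ _ _ _ _ cd i0 f)
  (fun f g e => @slice_norm_le i0 f g e) m sig0.
exists m, kp; split => // z f hz rf.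
pose pts := [seq z (J0 + l)%N | l <- iota 0 m].
have := bl pts f; rewrite /pts size_map size_iota => /(_ erefl rf) {}bl.
have zc J : nrm (z J - c) / rho <= 1 - q J.+1.
  by rewrite ler_pdivrMr// (@rad_circle_center J)// hz.
apply: le_trans (bl _ _) _.
- rewrite pairwise_map; have := iota_uniq 0 m; rewrite uniq_pairwise.
  apply: (@sub_in_pairwise _ (fun l => (l < m)%N)); last first.
    by apply/allP => l; rewrite mem_iota.
  move=> i j /= im jm ne; set zj := z _; set zi := z _.
  have ne' : (J0 + i)%N != (J0 + j)%N by rewrite eqn_add2l.
  have si := hsig (J0 + i)%N; rewrite ltn_add2l in si; have {}si := si im.
  have := rad_sep ne'; have := ler_dist_nrm zi (w (J0 + i)%N) (w (J0 + j)%N).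
  rewrite (nrmBC _ zi) hz; have := ler_dist_nrm zj zi (w (J0 + j)%N); rewrite hz (nrmBC zi zj).
  by have := rad_s0 (J0 + j); move: si; lra.
- move=> x /mapP[l _ ->]; rewrite (le_trans (@rad_circle_center (J0 + l) _ _)) ?hz//.
  by rewrite ger_pMl// gerBl ltW// rad_q0.
rewrite !big_map -{1 2}(subn0 m) -/(index_iota 0 m) !big_mkord; apply: lerD => //.
rewrite ler_wpM2r//; first by rewrite divr_ge0 ?sqrtr_ge0// qn_ge0.
apply: le_trans (_ : \prod_(l < m) (1 - q (J0 + l).+1) <= _).
  by apply: ler_prod => l _; rewrite zc andbT divr_ge0 ?nrm_ge0// ltW.
have -> : \prod_(l < m) (1 - q (J0 + l).+1) = J0.+1%:R / (J0 + m).+1%:R.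
  elim: m {hm hsig bl pts} => [|m IH]; first by rewrite big_ord0 addn0 divff.
  rewrite big_ord_recr /= IH addnS /q; have := ltr0Sn R (J0 + m); have := ltr0Sn R (J0 + m).+1.
  by rewrite -(natr1 (J0 + m).+1) => h1 h2; field; rewrite !gt_eqF.
have := hm _ (leq_addl J0 m); rewrite ltr_pdivlMr// mulrC => /ltW.
by [].
Qed.

(** All Blaschke constants depend only on the circles around the [w j], so [eps] is chosen after
    them. A single generator [G0] is, by [small_hat], almost orthogonal to an evaluation on each
    circle; [uniform_hat] transports this to the center [c], where [G0] becomes orthogonal to the
    evaluation. Its orbit then cannot approach [u0], which has value 1 at [c]. *)
Lemma rad_model : model_operator K (boundary K).
Proof.
pose Q J0 : {poly C} := \prod_(j < J0) ('X - (w j)%:P).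
have cw j : c - w j != 0 by rewrite -nrm_gt0 (lt_le_trans (rad_s0 j)) ?rad_s_center.
have Qc0 J0 : 0 < nrm (Q J0).[c].
  by rewrite nrm_gt0 horner_prod; apply/prodf_neq0 => j _; rewrite hornerXsubC cw.
have sk : 0 < Num.sqrt (kap i0) by rewrite sqrtr_gt0 (core_kap0 cd).
have [MK hMK] := compact_bounded cK.
have /choice[BQ HBQ] : forall J0, exists BQ : R, 0 <= BQ /\ forall y, K y -> nrm (Q J0).[y] <= BQ.
  move=> J0; have [BQ B0 hB] := poly_bounded (Q J0) MK.
  by exists BQ; split => // y /hMK; exact: hB.
have B1 J0 : 0 < 3 * BQ J0 + 1 by rewrite ltr_wpDl// mulr_ge0//; case: (HBQ J0).
have half0 J0 : 0 < (2^-1 : R) ^+ J0 by rewrite exprn_gt0.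
(* Makes the term with [et] in [uniform_hat] at most [2^-J0] times the modulus of [Q] at [c]. *)
pose et J0 := 2^-1 ^+ J0 * nrm (Q J0).[c] * Num.sqrt (kap i0) / (3 * BQ J0 + 1).
have et0 J0 : 0 < et J0 by rewrite divr_gt0// !mulr_gt0.
have /choice[mk Hmk] : forall J0, exists mk : nat * R, 0 <= mk.2 /\
    forall z f, (forall J, nrm (z J - w J) = s J) -> ratK K f ->
    nrm (f c) <= et J0 * slice_norm i0 f + mk.2 * \sum_(l < mk.1) nrm (f (z (J0 + l)%N)).
  by move=> J0; have [m [kp h]] := rad_blaschke J0 (et0 J0); exists (m, kp).
(* The 5 is 1 for the tails of the poles in [uniform_hat] plus 4 for the pairings of [G0] on the
   circles, bounded in [G0z]. *)
pose B J0 := 2^-1 ^+ J0 / (1 + 5 * (mk J0).2 * BQ J0 * (mk J0).1%:R / nrm (Q J0).[c]).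
have pos J0 : 0 <= 5 * (mk J0).2 * BQ J0 * (mk J0).1%:R.
  have [k0 _] := Hmk J0; have [q0 _] := HBQ J0.
  by apply: mulr_ge0 => //; apply: mulr_ge0 => //; exact: mulr_ge0.
have den J0 : 0 < 1 + 5 * (mk J0).2 * BQ J0 * (mk J0).1%:R / nrm (Q J0).[c].
  by rewrite ltr_pwDl// divr_ge0// nrm_ge0.
have B0 J0 : 0 < B J0 by rewrite divr_gt0.
(* Only finitely many [J0] constrain each index [j], so one sequence [eps] serves all [J0]. *)
have /choice[th Hth] : forall j, exists th : R, 0 < th /\ forall J0, (J0 <= j)%N -> th <= B J0.
  by move=> j; have [th t0 ht] := fin_min (fun i (_ : (i < j.+1)%N) => B0 i); exists th.
have th0 j : 0 < th j by case: (Hth j).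
have th1 j : th j <= 1.
  apply: le_trans ((Hth j).2 0%N isT) _; rewrite /B expr0 ler_pdivrMr// mul1r lerDl.
  by rewrite divr_ge0// nrm_ge0.
have [|eps [delta [sd he]]] := eps_exists cd (ext := fun j => 2^-1 ^+ j.+1 * Num.sqrt (kap j) * (s j * th j))
    rad_interior rad_inj.
  move=> j; have skj : 0 < Num.sqrt (kap j) by rewrite sqrtr_gt0 (core_kap0 cd).
  by apply: mulr_gt0; apply: mulr_gt0 => //; exact: rad_s0.
have he1 j (m : R) : s j <= m -> eps j <= 2^-1 ^+ j.+1 * m * Num.sqrt (kap j).
  move=> sm; apply: le_trans (he j) _; rewrite mulrAC ler_wpM2r ?sqrtr_ge0//.
  by rewrite ler_wpM2l ?(ltW (half0 _))// (le_trans _ sm)// ler_piMr// ltW// rad_s0.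
apply: (seq_conclusion cd sd); [by []|exact: boundary_sub|move=> l Il; split|].
- by rewrite (boundaryE clK) => -[].
- by move=> ac; case: (rad_not_accum Il ac).
move=> H tau S g kc hkc G0 oG.
have circ J z : nrm (z - w J) = s J -> forall j, z - w j != 0 /\
    eps j <= 2^-1 ^+ j.+1 * nrm (z - w j) * Num.sqrt (kap j).
  move=> hz j; have h := @rad_circle_sep J z j hz; split; last exact: he1.
  by rewrite -nrm_gt0 (lt_le_trans (rad_s0 j)).
have /choice[zk Hzk] : forall J, exists zk : C * H, [/\ nrm (zk.1 - w J) = s J,
    forall x, seqD K x -> phi zk.1 (hatc w eps zk.1) x = inner (tau x) zk.2 &
    nrm (inner G0 zk.2) <= 8 * eps J * nrm (inner G0 (kc J)) / s J].
  move=> J; have A0 : 0 <= 2 / (q J.+1 * Num.sqrt (kap i0)).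
    by rewrite divr_ge0// mulr_ge0// ltW// rad_q0.
  have ev z : nrm (z - w J) = s J -> evb Gam z (2 / (q J.+1 * Num.sqrt (kap i0))).
    by move=> hz; apply: rad_evb; rewrite hz.
  have [z [k hk]] := small_hat cd sd g hkc oG (rad_s0 J) A0 (@rad_disc_sub J) ev (@circ J).
  by exists (z, k).
pose z J := (zk J).1.
have hz J : nrm (z J - w J) = s J by case: (Hzk J).
have Kz J : K (z J) by apply: (@rad_disc_sub J); rewrite /cdisc /= hz.
have G0z J0 J : (J0 <= J)%N -> nrm (inner G0 (zk J).2) <= 4 * B J0 * nrm G0.
  move=> JJ; have [_ _] := Hzk J; move/le_trans; apply.
  have skJ : 0 < Num.sqrt (kap J) by rewrite sqrtr_gt0 (core_kap0 cd).
  have cG : nrm (inner G0 (kc J)) <= nrm G0 / Num.sqrt (kap J).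
    by rewrite (le_trans (inner_CS _ _))// ler_wpM2l ?nrm_ge0// (nrm_kc cd g hkc).
  have eJ : eps J <= 2^-1 * Num.sqrt (kap J) * (s J * B J0).
    have p1 : 0 <= 2^-1 ^+ J.+1 * Num.sqrt (kap J).
      by apply: mulr_ge0; [exact: ltW (half0 _)|exact: sqrtr_ge0].
    have p2 : 0 <= s J * th J by apply: mulr_ge0; apply: ltW; [exact: rad_s0|exact: th0].
    apply: le_trans (he J) _; apply: ler_pM => //.
      by rewrite ler_wpM2r ?sqrtr_ge0// exprS ler_piMr// exprn_ile1// invf_le1// ler1n.
    by rewrite ler_wpM2l ?(ltW (rad_s0 _))//; case: (Hth J) => _; apply.
  have e0 : 0 <= eps J := ltW (seq_eps0 sd J).
  rewrite ler_pdivrMr ?rad_s0//.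
  apply: (@le_trans _ _ (8 * (2^-1 * Num.sqrt (kap J) * (s J * B J0)) * (nrm G0 / Num.sqrt (kap J)))).
    by apply: ler_pM => //; rewrite ?mulr_ge0 ?nrm_ge0// ler_wpM2l.
  rewrite le_eqVlt; apply/orP; left; apply/eqP; field; by rewrite gt_eqF.
have [A0 evc] : 0 <= (Num.sqrt (kap i0))^-1 /\ evb Gam c (Num.sqrt (kap i0))^-1.
  by split; [rewrite invr_ge0 sqrtr_ge0|exact: evb_b cd i0].
have [k [_ hk k1]] := hat_vector1 cd sd g A0 evc cw (fun j => he1 j _ (rad_s_center j)).
(* The terms with [et] and those with [B] each contribute at most [2^-J0] times the norm of [G0]. *)
have bound J0 : nrm (inner G0 k) <= 2 * 2^-1 ^+ J0 * nrm G0.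
  have [q0 hQ] := HBQ J0; have [k0 bl] := Hmk J0.
  pose P := nrm (Q J0).[c] * B J0 + et J0 * (3 * BQ J0 / Num.sqrt (kap i0)) +
    (mk J0).2 * BQ J0 * (mk J0).1%:R * B J0.
  have uni x : seqD K x -> nrm (Q J0).[c] * nrm (inner (tau x) k) <= P * nrm (tau x) +
      (mk J0).2 * BQ J0 * \sum_(l < (mk J0).1) nrm (inner (tau x) (zk (J0 + l)%N).2).
    move=> Dx; rewrite -hk//.
    have -> : \sum_(l < (mk J0).1) nrm (inner (tau x) (zk (J0 + l)%N).2) =
      \sum_(l < (mk J0).1) nrm (phi (z (J0 + l)%N) (hatc w eps (z (J0 + l)%N)) x).
      by apply: eq_bigr => l _; case: (Hzk (J0 + l)%N) => _ h _; rewrite -h.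
    apply: (uniform_hat cd sd g (fun f => bl z f hz) (ltW (et0 J0)) k0 (ltW (B0 J0)) rad_s0 he) => //.
    - by move=> j; case: (Hth j) => _; apply.
    - exact: rad_s_center.
    - by move=> J j; apply: rad_circle_sep.
  have := @dense_le _ _ H tau (fun h => nrm (Q J0).[c] * nrm (inner h k))
    (fun h => P * nrm h + (mk J0).2 * BQ J0 *
       \sum_(l < (mk J0).1) nrm (inner h (zk (J0 + l)%N).2)) (gns_mod g).
  move=> /(_ _ _ uni G0).
  have l1 : lipf (fun h : H => nrm (Q J0).[c] * nrm (inner h k)) by apply/lipfZ/lipf_inner.
  have l2 : lipf (fun h : H => P * nrm h + (mk J0).2 * BQ J0 *
      \sum_(l < (mk J0).1) nrm (inner h (zk (J0 + l)%N).2)).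
    apply: lipfD; first exact/lipfZ/lipf_nrm.
    by apply/lipfZ/(lipf_sum _ (f := fun l h => nrm (inner h (zk (J0 + l)%N).2))) => l; exact: lipf_inner.
  move=> /(_ l1 l2) main.
  have sum : \sum_(l < (mk J0).1) nrm (inner G0 (zk (J0 + l)%N).2) <= (mk J0).1%:R * (4 * B J0 * nrm G0).
    rewrite mulr_natl -[X in _ *+ X](card_ord (mk J0).1) -sumr_const.
    by apply: ler_sum => l _; apply: G0z; exact: leq_addr.
  have e1 : et J0 * (3 * BQ J0 / Num.sqrt (kap i0)) <= 2^-1 ^+ J0 * nrm (Q J0).[c].
    have -> : et J0 * (3 * BQ J0 / Num.sqrt (kap i0)) =
        2^-1 ^+ J0 * nrm (Q J0).[c] * (3 * BQ J0 / (3 * BQ J0 + 1)).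
      by rewrite /et; field; rewrite !gt_eqF.
    by rewrite ler_piMr ?mulr_ge0 ?nrm_ge0 ?(ltW (half0 _))// ler_pdivrMr// mul1r lerDl.
  have e2 : B J0 * (nrm (Q J0).[c] + 5 * (mk J0).2 * BQ J0 * (mk J0).1%:R) = 2^-1 ^+ J0 * nrm (Q J0).[c].
    have := den J0; have := Qc0 J0; rewrite /B; move: (nrm (Q J0).[c]) (5 * _ * _ * _) => x y x0 d0.
    field; rewrite gt_eqF//= gt_eqF//.
    by have := mulr_gt0 d0 x0; rewrite mulrDl divfK ?gt_eqF// mul1r.
  rewrite -(ler_pM2l (Qc0 J0)); apply: le_trans main _.
  apply: (@le_trans _ _ (P * nrm G0 + (mk J0).2 * BQ J0 * ((mk J0).1%:R * (4 * B J0 * nrm G0)))).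
    by rewrite lerD2l ler_wpM2l// mulr_ge0.
  have alg (x0 x1 x2 x3 x4 x5 x6 x7 : R) : x0 <= x7 * x1 -> 0 <= x2 ->
      x3 * (x1 + 5 * x4 * x5 * x6) = x7 * x1 ->
      (x1 * x3 + x0 + x4 * x5 * x6 * x3) * x2 + x4 * x5 * (x6 * (4 * x3 * x2)) <= x1 * (2 * x7 * x2).
    by move=> h1 h2 h3; have := ler_wpM2r h2 h1; have := congr1 ( *%R^~ x2) h3; rewrite /=; lra.
  exact: alg e1 (nrm_ge0 G0) e2.
have Gk : inner G0 k = 0.
  apply/eqP; rewrite -nrm_eq0 eq_le nrm_ge0 andbT leNgt; apply/negP => X0.
  have d0 : 0 < 2 * nrm G0 + 1 by rewrite ltr_wpDl// mulr_ge0 ?nrm_ge0.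
  have [N hN] := inv_small (divr_gt0 X0 d0).
  have := hN N (leqnn _); rewrite ltr_pdivlMr//.
  have : (2^-1 : R) ^+ N.+1 <= N.+1%:R^-1.
    by rewrite exprVn lef_pV2 ?posrE ?exprn_gt0// -natrX ler_nat ltnW// ltn_expl.
  have alg (x y t X : R) : 0 < x -> 0 <= y -> x <= t -> X <= 2 * x * y -> t * (2 * y + 1) < X -> False.
    move=> x0 y0 h1 h2 h3; have := ler_wpM2r y0 h1; move: h3; rewrite mulrDr mulr1.
    by move: h2; rewrite -mulrA; lra.
  by move=> h1 h2; exact: alg (half0 N.+1) (nrm_ge0 G0) h1 (bound N.+1) h2.
have k1' : 0 < nrm k + 1 by rewrite ltr_wpDl// nrm_ge0.
have [p' [q' [x [zf xe ux]]]] := oG (tau (sq_u0 R)) _ (divr_gt0 ltr01 k1').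
have := orbit_eigen (gns_bounded g) (core_Kb cd i0) zf (hat_eigen g cw hk) xe.
rewrite Gk mulr0 => xk0.
have := inner_CS (tau (sq_u0 R) - x) k; rewrite innerBl k1 xk0 subr0 nrm1.
move: ux; rewrite ltr_pdivlMr// mulrDr mulr1; have := nrm_ge0 (tau (sq_u0 R) - x); lra.
Qed.

End Radius.

Lemma boundary_model : interior K !=set0 -> model_operator K (boundary K).
Proof.
move=> [l Il]; have [e e0 he] := interior_ball Il.
have [i li] := core_dense cd (interior_subset Il) e0.
have Ii : interior K (b i) by apply: he; rewrite nrmBC.
have [d d0 hd] := interior_dist clK Ii.
have [p Bp hp] : exists2 p, boundary K p & forall y, boundary K y -> nrm (p - b i) <= nrm (y - b i).
  apply: compact_min; first exact: compact_boundary.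
    exact: boundary_nonempty cK (K_nonempty cd).
  move=> x r _ r0; exists r => // y _ xy; apply: le_lt_trans (ler_nrm_dist _ _) _.
  by rewrite subrACA subrr subr0.
exact: rad_model Bp erefl (lt_le_trans d0 (hd p Bp)) hp.
Qed.

End BoundaryModel.

(** * The model for compact sets without interior *)

Section PairModel.
Variable R : realType.
Local Notation C := (cplx R).
Variables (K : set C) (a : C) (b : nat -> C) (kap : nat -> R).
Variable Gam : (bd_type K * nat -> R) -> R.
Hypothesis cd : core_data a b kap Gam.
Hypothesis intK : interior K = set0.
Let cK := core_compact cd.
Let clK := compact_closed_nrm cK.
Let W : Type := (bd_type K * nat)%type.

Variables L0 L1 L2 : (W -> R) -> R.
Definition positive_linear (L : (W -> R) -> R) :=
  (forall (c : R) u v, bfun u -> bfun v -> L (fun t => c * u t + v t) = c * L u + L v) /\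
  forall u, bfun u -> (forall t, 0 <= u t) -> 0 <= L u.
Definition represents (L : (W -> R) -> R) (z : C) := forall f, ratK K f ->
  L (fun t => complex.Re (f (bd_val t.1))) = complex.Re (f z).
Hypotheses (P0 : positive_linear L0) (P1 : positive_linear L1) (P2 : positive_linear L2).
Hypotheses (r0 : represents L0 a) (r1 : represents L1 a) (r2 : represents L2 a).
(** One of the three functionals bounding the evaluations is enough: the first component of a pair
    is measured by it. *)
Hypothesis ev0 : forall j, exists2 M : R, 0 <= M & forall f, ratK K f ->
  nrm (f (b j)) <= M * qn (gform L0) (bpull f).

Let E : lmodType C := ((C -> C^o) * (C -> C^o))%type.
Definition pairD : set ((C -> C^o) * (C -> C^o)) := [set x | ratK K x.1 /\ ratK K x.2].
Definition pairt (x : (C -> C^o) * (C -> C^o)) (s : W * option bool) : C^o :=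
  let z := bd_val s.1.1 in
  match s.2 with Some true => x.1 z | Some false => x.2 z | None => x.1 z + x.2 z end.
Definition pairZ (x : (C -> C^o) * (C -> C^o)) : (C -> C^o) * (C -> C^o) :=
  (fun z => z * x.1 z, fun z => z * x.2 z).
Definition pair_zeta (s : W * option bool) : C := bd_val s.1.1.
Definition pair_kappa (s : W * option bool) : nat :=
  if s.2 is Some i then nat_of_bool i else 2%N.
Definition pair_Gam (u : W * option bool -> R) : R :=
  L0 (fun v => u (v, Some true)) + (L1 (fun v => u (v, Some false)) + L2 (fun v => u (v, None))).

Lemma pair_slices (u : W * option bool -> R) i : bfun u -> bfun (fun v => u (v, i)).
Proof. by move=> [M HM]; exists M => v; exact: HM. Qed.

Lemma pair_GamL (c : R) u v : bfun u -> bfun v ->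
  pair_Gam (fun s => c * u s + v s) = c * pair_Gam u + pair_Gam v.
Proof.
move=> bu bv; rewrite /pair_Gam P0.1 ?P1.1 ?P2.1; try exact: pair_slices.
by rewrite !mulrDr; ring.
Qed.

Lemma pair_Gam_ge0 u : bfun u -> (forall s, 0 <= u s) -> 0 <= pair_Gam u.
Proof.
move=> bu u0; apply: addr_ge0; [|apply: addr_ge0]; [apply: P0.2|apply: P1.2|apply: P2.2] => //;
  exact: pair_slices.
Qed.

Lemma pairD0 : pairD 0. Proof. by split; exact: ratK_cst. Qed.

Lemma pairDL (c : C) x y : pairD x -> pairD y -> pairD (c *: x + y).
Proof. by move=> [x1 x2] [y1 y2]; split; apply: ratKD => //; exact: ratKZ. Qed.

Lemma pairtL (c : C) x y : pairt (c *: x + y) = c *: pairt x + pairt y.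
Proof.
apply/funext => -[v [[]|]] //; rewrite /pairt /=.
have hs (p q r s : C) : c * p + q + (c * r + s) = c * (p + r) + (q + s) by ring.
exact: hs.
Qed.

Lemma pairt_lip x : pairD x -> lip_class pair_zeta pair_kappa (pairt x).
Proof.
move=> [r s]; have [M M0 hM] := ratK_bounded cK r; have [N N0 hN] := ratK_bounded cK s.
have [M' M'0 hM'] := ratK_lipschitz cK r; have [N' N'0 hN'] := ratK_lipschitz cK s.
have Kb (v : W) : K (bd_val v.1) := boundary_sub clK (svalP v.1).
split.
- exists (M + N) => -[v [[]|]]; rewrite /pairt /=.
  + by rewrite (le_trans (hM _ (Kb v)))// lerDl.
  + by rewrite (le_trans (hN _ (Kb v)))// lerDr.
  + by rewrite (le_trans (ler_nrmD _ _))// lerD// ?hM ?hN.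
- by exists 3%N => -[v [[]|]].
exists (M' + N'); first exact: addr_ge0.
have lr (p q r' : R) : 0 <= p -> 0 <= q -> 0 <= r' -> p * r' <= (p + q) * r' /\ q * r' <= (p + q) * r'.
  by move=> p0 q0 r0'; split; rewrite ler_wpM2r// ?lerDl ?lerDr.
move=> [v i] [v' i'] /=; have [l1 l2] := lr _ _ (nrm (bd_val v.1 - bd_val v'.1)) M'0 N'0 (nrm_ge0 _).
case: i => [[]|]; case: i' => [[]|] //= _; rewrite /pairt /pair_zeta /=.
- exact: le_trans (hM' _ _ (Kb v) (Kb v')) l1.
- exact: le_trans (hN' _ _ (Kb v) (Kb v')) l2.
- rewrite opprD addrACA mulrDl (le_trans (ler_nrmD _ _))// lerD//.
    exact: hM' (Kb v) (Kb v').
  exact: hN' (Kb v) (Kb v').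
Qed.

Lemma pairZD x : pairD x -> pairD (pairZ x).
Proof. by move=> [x1 x2]; split; apply: ratKM => //; exact: ratK_id. Qed.

Lemma pairtZ x s : pairt (pairZ x) s = pair_zeta s * pairt x s.
Proof.
case: s => v [[]|] //; rewrite /pairt /pair_zeta /=.
have hs (p q r : C) : p * q + p * r = p * (q + r) by ring.
exact: hs.
Qed.

Lemma pair_model_exists : exists (H : hilbertSpace R) tau (S : H -> H),
  gns_data pair_Gam pair_zeta pairD pairt pairZ tau S.
Proof.
have [M HM] := compact_bounded cK.
apply: (gns_exists (kappa := pair_kappa) (M := M)).
- exact: pair_GamL.
- exact: pair_Gam_ge0.
- by move=> [[[x Bx] j] i]; apply: HM; exact: (boundary_sub clK).
- exact: pairD0.
- exact: pairDL.
- by move=> c x y _ _; exact: pairtL.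
- exact: pairt_lip.
- exact: pairZD.
- move=> c x y _ _; congr pair; apply/funext => z /=.
    have hs (p q r : C) : p * (c * q + r) = c * (p * q) + p * r by ring.
    exact: hs.
  have hs (p q r : C) : p * (c * q + r) = c * (p * q) + p * r by ring.
  exact: hs.
- by move=> x s _; exact: pairtZ.
Qed.

Variables (H : hilbertSpace R) (tau : (C -> C^o) * (C -> C^o) -> H) (S : H -> H).
Hypothesis g : gns_data pair_Gam pair_zeta pairD pairt pairZ tau S.
Let bS := gns_bounded g.
Let lS := bounded_lin bS.
Let mD := gns_mod g.
Local Notation A f := (tau (f : C -> C^o, 0 : C -> C^o)).
Local Notation B f := (tau (0 : C -> C^o, f : C -> C^o)).
Local Notation c1 := ((fun=> 1) : C -> C^o).

Lemma pair_inner x y : pairD x -> pairD y -> inner (tau x) (tau y) =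
  gform L0 (bpull x.1) (bpull y.1) + (gform L1 (bpull x.2) (bpull y.2) +
    gform L2 (bpull (x.1 + x.2)) (bpull (y.1 + y.2))).
Proof. by move=> Dx Dy; rewrite (gns_inner g Dx Dy); apply: ReImE; rewrite !(ReD, ImD). Qed.

Lemma gform_0l (L : (W -> R) -> R) G : positive_linear L -> cbf G ->
  gform L (bpull (0 : C -> C^o)) G = 0.
Proof. by move=> [LL Lp] cG; exact: (psd_0l (gform_psd LL Lp) cG). Qed.

Lemma gform_0r (L : (W -> R) -> R) G : positive_linear L -> cbf G ->
  gform L G (bpull (0 : C -> C^o)) = 0.
Proof. by move=> [LL Lp] cG; exact: (psd_0r (gform_psd LL Lp) cG). Qed.

Lemma gform_1r (L : (W -> R) -> R) f : represents L a -> ratK K f ->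
  gform L (bpull f) (bpull c1) = f a.
Proof.
move=> rL rf; have e t : bpull f t * (bpull c1 t)^* = bpull f t :> C.
  by apply: ReImE; rewrite ?ReM ?ImM ReJ ImJ/=; ring.
rewrite /gform (_ : (fun t => _) = bpull f); last exact/funext.
apply: ReImE => /=; first exact: rL.
have := rL _ (ratKZ (0 -i* 1) rf); rewrite ReM/= mul0r sub0r mulN1r opprK => <-.
by congr L; apply/funext => t; rewrite ReM/= mul0r sub0r mulN1r opprK.
Qed.

Lemma DA f : ratK K f -> pairD (f, 0). Proof. by move=> rf; split => //; exact: ratK_cst. Qed.
Lemma DB f : ratK K f -> pairD (0, f). Proof. by move=> rf; split => //; exact: ratK_cst. Qed.

Lemma pair_split x : pairD x -> tau x = A x.1 + B x.2.
Proof.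
move=> [x1 x2]; rewrite -(gns_tauD g (DA x1) (DB x2)); congr tau.
by case: x {x1 x2} => f h; congr pair; rewrite /= ?addr0 ?add0r.
Qed.

Lemma inner_AA f h : ratK K f -> ratK K h -> inner (A f) (A h) =
  gform L0 (bpull f) (bpull h) + gform L2 (bpull f) (bpull h).
Proof.
move=> rf rh; rewrite (pair_inner (DA rf) (DA rh)) /= !addr0.
by rewrite (gform_0l P1) ?add0r//; exact: (cbf_bpull cd (ratK_cst K 0)).
Qed.

Lemma inner_AB f h : ratK K f -> ratK K h -> inner (A f) (B h) = gform L2 (bpull f) (bpull h).
Proof.
move=> rf rh; rewrite (pair_inner (DA rf) (DB rh)) /= addr0 add0r.
rewrite (gform_0l P1) ?(gform_0r P0) ?add0r//; exact: (cbf_bpull cd).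
Qed.

Lemma inner_BA f h : ratK K f -> ratK K h -> inner (B f) (A h) = gform L2 (bpull f) (bpull h).
Proof.
move=> rf rh; rewrite (pair_inner (DB rf) (DA rh)) /= addr0 add0r.
rewrite (gform_0l P0) ?(gform_0r P1) ?add0r//; exact: (cbf_bpull cd).
Qed.

Lemma inner_BB f h : ratK K f -> ratK K h -> inner (B f) (B h) =
  gform L1 (bpull f) (bpull h) + gform L2 (bpull f) (bpull h).
Proof.
move=> rf rh; rewrite (pair_inner (DB rf) (DB rh)) /= !add0r.
by rewrite (gform_0l P0) ?add0r//; exact: (cbf_bpull cd (ratK_cst K 0)).
Qed.

Let r1' : ratK K c1 := ratK_cst K 1.
Local Notation A1 := (A c1).
Local Notation B1 := (B c1).

Lemma pair_gram : [/\ inner A1 A1 = 2, inner A1 B1 = 1, inner B1 A1 = 1 & inner B1 B1 = 2].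
Proof.
by split; rewrite ?inner_AA ?inner_AB ?inner_BA ?inner_BB// !gform_1r// -mulr2n.
Qed.

Lemma pair_free (s t : C) : s *: A1 + t *: B1 = 0 -> s = 0 /\ t = 0.
Proof.
move=> e; have [g1 g2 g3 g4] := pair_gram.
have e1 : s * 2 + t = 0.
  by have := congr1 (fun x => inner x A1) e; rewrite innerDl !innerZl g1 g3 mulr1 inner0l.
have e2 : s + t * 2 = 0.
  by have := congr1 (fun x => inner x B1) e; rewrite innerDl !innerZl g2 g4 mulr1 inner0l.
have : t = - (s * 2) by apply/eqP; rewrite -addr_eq0 addrC e1.
move=> te; move: e2; rewrite te => e2; have : - 3 * s = 0 by rewrite -[RHS]e2; ring.
move/eqP; rewrite mulf_eq0 oppr_eq0 pnatr_eq0 /= => /eqP s0.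
by rewrite s0 mul0r oppr0.
Qed.

Lemma pair_poly p x : pairD x ->
  poly_op S p (tau x) = tau (fun z => p.[z] * x.1 z, fun z => p.[z] * x.2 z).
Proof.
move=> Dx; apply: (gns_poly_op g (m := fun p x => (fun z => p.[z] * x.1 z, fun z => p.[z] * x.2 z))) => //.
  by move=> p'; case: Dx => x1 x2; split; apply: ratKM => //; exact: ratK_poly.
by move=> p' [v [[]|]]; rewrite /pairt /pair_zeta /= ?mulrDr.
Qed.

Lemma pairt_eq x y : pairD x -> pairD y -> (forall z, K z -> x.1 z = y.1 z /\ x.2 z = y.2 z) ->
  tau x = tau y.
Proof.
move=> Dx Dy e; apply: (gns_tau_eq g Dx Dy) => -[[z j] i].
have [e1 e2] := e _ (boundary_sub clK (svalP z)).
by rewrite /pairt /= /bd_val e1 e2.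
Qed.

Lemma pair_frac f : ratK K f -> exists p q, [/\ zero_free K q,
  poly_op S q (A f) = poly_op S p A1 & poly_op S q (B f) = poly_op S p B1].
Proof.
move=> rf; have [p [q [zf e]]] := ratK_frac rf; exists p, q; split => //.
  rewrite (pair_poly _ (DA rf)) (pair_poly _ (DA r1')); apply: pairt_eq => [||z Kz] /=.
  + by split; apply: ratKM => //; [exact: ratK_poly|exact: ratK_poly|exact: ratK_cst].
  + by split; apply: ratKM => //; [exact: ratK_poly|exact: ratK_poly|exact: ratK_cst].
  + by rewrite e// mulr1 !mulr0.
rewrite (pair_poly _ (DB rf)) (pair_poly _ (DB r1')); apply: pairt_eq => [||z Kz] /=.
+ by split; apply: ratKM => //; [exact: ratK_poly|exact: ratK_cst|exact: ratK_poly].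
+ by split; apply: ratKM => //; [exact: ratK_poly|exact: ratK_cst|exact: ratK_poly].
+ by rewrite e// mulr1 !mulr0.
Qed.

Lemma pair_resolvent (l : C) (d : R) : 0 < d -> (forall z, K z -> d <= nrm (z - l)) ->
  (exists T', bounded_inverse (sub_scalar S l) T') /\
  forall h, d * nrm h <= nrm (sub_scalar S l h).
Proof.
move=> d0 Kd; have zl z : K z -> z - l != 0 by move=> /Kd h; rewrite -nrm_gt0 (lt_le_trans d0).
have rl : ratK K (fun z => (z - l)^-1).
  by apply: ratKV => //; apply: ratKB; [exact: ratK_id|exact: ratK_cst].
apply: (dense_resolvent mD (bounded_sub_scalar bS l) d0) => x [x1 x2].
  apply: (gns_below g) => //; first exact: ltW.
  move=> [[z j] i]; rewrite ler_wpM2r ?nrm_ge0//; apply: Kd; exact: (boundary_sub clK (svalP z)).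
have Dy : pairD (fun z => (z - l)^-1 * x.1 z, fun z => (z - l)^-1 * x.2 z).
  by split; apply: ratKM.
exists (fun z => (z - l)^-1 * x.1 z, fun z => (z - l)^-1 * x.2 z) => //.
have DZ := gns_DB g (pairZD Dy) (gns_DZ g l Dy).
rewrite (gns_sub_scalar g l Dy); apply: (gns_tau_eq g) => // -[[z j] i].
rewrite (gns_t_sub g)//; have z0 := zl _ (boundary_sub clK (svalP z)).
have hs (p : C) : (bd_val z - l) * ((bd_val z - l)^-1 * p) = p by rewrite mulVKf.
case: i => [[]|]; rewrite /pairt /=; [exact: hs|exact: hs|].
by rewrite -mulrDr; exact: hs.
Qed.

(** Without interior every point of [K] is a limit of points off [K], so [not_bounded_below] applies
    with the whole space and evaluation of the first component at some [b j]. *)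
Lemma pair_not_below l : K l ->
  forall c : R, 0 < c -> ~ (forall x, c * nrm x <= nrm (sub_scalar S l x)).
Proof.
move=> Kl; apply: (not_bounded_below bS (V := setT)) => [||d d0]; [by split|exact: closedT|].
have d2 : 0 < d / 2 by rewrite divr_gt0.
have [mu nK lmu] : exists2 mu, ~ K mu & nrm (l - mu) < d / 2.
  apply: contrapT => h; suff : interior K l by rewrite intK.
  apply/interior_nrmP; exists (d / 2) => // y ly; apply: contrapT => nKy.
  by apply: h; exists y.
have [j hj] := core_dense cd Kl d2; have [M M0 hM] := ev0 j.
have [k hk] : exists k, forall x, pairD x -> x.1 (b j) = inner (tau x) k.
  apply: (gns_riesz g M0) => // x [x1 x2]; apply: le_trans (hM _ x1) _.
  rewrite ler_wpM2l// -(@ler_pXn2r _ 2)// ?nnegrE ?nrm_ge0 ?qn_ge0//.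
  have [b1 b2 b3] : [/\ cbf (bpull x.1 : W -> C^o), cbf (bpull x.2 : W -> C^o) &
    cbf (bpull (x.1 + x.2) : W -> C^o)] by split; apply: (cbf_bpull cd) => //; exact: ratKD.
  have [[L0L L0p] [L1L L1p] [L2L L2p]] := And3 P0 P1 P2.
  rewrite (qn_gform L0L L0p)// -[nrm _ ^+ 2]/(complex.Re (nrm (tau x) ^+ 2)%:C) -inner_nrm pair_inner//.
  rewrite !ReD !gform_sqr// !lerDl; apply: addr_ge0.
    by apply: L1p => [|t]; [exact: bfun_nrm|rewrite exprn_ge0// nrm_ge0].
  by apply: L2p => [|t]; [exact: bfun_nrm|rewrite exprn_ge0// nrm_ge0].
exists mu, (b j), k; split.
- by have := ler_dist_nrm l mu (b j); rewrite (nrmBC mu l); lra.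
- by move: lmu; lra.
- have [dm dm0 hdm] := off_dist cd nK.
  have [[T' [bT' T1 T2]] _] := pair_resolvent dm0 hdm.
  by move=> v _; exists (T' v) => //; exact: T2.
- by exists A1 => //; rewrite -hk /=; [apply/eqP; exact: oner_neq0|exact: DA].
- move=> v _; have := gns_eigen g (k := k) (l := b j) => /(_ _ v) e.
  rewrite innerBl innerZl e ?subrr// => x Dx; rewrite -!hk//; exact: pairZD.
Qed.

Lemma pair_eigen v h : v = A1 \/ v = B1 -> inner (S h) v = a * inner h v.
Proof.
move=> vAB; apply: (gns_eigen g) => x Dx; rewrite (pair_split Dx) (pair_split (pairZD Dx)).
have [x1 x2] := Dx; have [z1 z2] := pairZD Dx.
case: vAB => ->; rewrite !innerDl.
  by rewrite !inner_AA// !inner_BA// !gform_1r//=; ring.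
by rewrite !inner_AB// !inner_BB// !gform_1r//=; ring.
Qed.

(* [A f - f a *: A 1] is in the range of [S - a], to which [P A1] and [P B1] are
   orthogonal. *)
Lemma pair_ortho (v : H) : (forall h, inner (S h) v = a * inner h v) ->
  exists s t : C, v = s *: A1 + t *: B1.
Proof.
move=> ev; have [g1 g2 g3 g4] := pair_gram.
have shift x x0 y : pairD x -> pairD x0 -> pairD y ->
    (forall z, K z -> x.1 z = x0.1 z + (z - a) * y.1 z /\ x.2 z = x0.2 z + (z - a) * y.2 z) ->
    inner (tau x) v = inner (tau x0) v.
  move=> Dx Dx0 Dy e; have Dz := gns_DB g (pairZD Dy) (gns_DZ g a Dy).
  have -> : tau x = tau x0 + sub_scalar S a (tau y).
    rewrite (gns_sub_scalar g a Dy) -(gns_tauD g Dx0 Dz); apply: pairt_eq => //.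
      exact: (gns_DD g Dx0 Dz).
    move=> z /e[-> ->]; have hs (p q r : C) : p + (z - a) * q = p + (z * q - a * q) by ring.
    by split; exact: hs.
  by rewrite innerDl innerBl innerZl ev subrr addr0.
have cst f : ratK K f -> inner (A f) v = f a * inner A1 v /\ inner (B f) v = f a * inner B1 v.
  move=> rf; have [h rh e] := ratK_quotient rf (core_Ka cd).
  have hs (p q : C) : p + q = p * 1 + q by ring.
  have hs' (z : C) : 0 = f a * 0 + (z - a) * 0 :> C by ring.
  rewrite -!innerZl -(gns_tauZ g _ (DA r1')) -(gns_tauZ g _ (DB r1')); split.
    apply: (shift _ _ _ (DA rf) (gns_DZ g (f a) (DA r1')) (DA rh)) => z Kz /=.
    by rewrite (e z Kz); split; [exact: (hs (f a))|exact: (hs' z)].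
  apply: (shift _ _ _ (DB rf) (gns_DZ g (f a) (DB r1')) (DB rh)) => z Kz /=.
  by rewrite (e z Kz); split; [exact: (hs' z)|exact: (hs (f a))].
pose p := inner A1 v; pose q := inner B1 v.
(* The inverse of the Gram matrix of [A1] and [B1], which has 2 on the diagonal and 1 off it. *)
pose s := ((2 * p - q) / 3)^*; pose t := ((2 * q - p) / 3)^*.
exists s, t; apply/eqP; rewrite -subr_eq0; apply/eqP/(dense_ortho mD) => x Dx.
have [x1 x2] := Dx; have [[e1 _] [_ e2]] := (cst _ x1, cst _ x2).
rewrite (pair_split Dx) innerBr !innerDl !innerDr !innerZr e1 e2 -/p -/q.
rewrite inner_AA// inner_AB// inner_BA// inner_BB// !gform_1r//.
have cc (y : C) : y^*^* = y by apply: ReImE; rewrite !(ReJ, ImJ) ?opprK.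
have hs (y1 y2 p' q' : C) : y1 * p' + y2 * q' - ((2 * p' - q') / 3 * (y1 + y1) +
    (2 * q' - p') / 3 * y1 + ((2 * p' - q') / 3 * y2 + (2 * q' - p') / 3 * (y2 + y2))) = 0.
  by field.
by rewrite /s /t !cc; exact: hs.
Qed.

Hypothesis indep : forall al be ga : C, (forall f h, ratK K f -> ratK K h ->
  al * gform L0 (bpull f) (bpull h) + be * gform L1 (bpull f) (bpull h) +
    ga * gform L2 (bpull f) (bpull h) = 0) -> [/\ al = 0, be = 0 & ga = 0].

Lemma pair_poly_inverse q : zero_free K q -> exists Q, bounded_inverse (poly_op S q) Q.
Proof.
move=> zf; apply: (poly_inverse_off bS (K_nonempty cd) zf) => l /(off_dist cd)[d d0 hd].
by have [] := pair_resolvent d0 hd.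
Qed.

Lemma pair_irreducible : irreducible_operator S.
Proof.
move=> V redV; have [P [PL Pn Psa PP [PS VP]]] := reducing_projection bS redV.
have Ppoly p x : P (poly_op S p x) = poly_op S p (P x).
  elim/poly_ind: p => [|p c IH]; first by rewrite !poly_op0// (lin_0 PL).
  by rewrite !poly_opD// !poly_opMX// !poly_opC// (lin_add PL) PS IH (lin_scale PL).
have Pe v : (forall h, inner (S h) v = a * inner h v) -> forall h, inner (S h) (P v) = a * inner h (P v).
  by move=> ev h; rewrite -!Psa PS ev.
have [x [z PA]] := pair_ortho (Pe _ (fun h => pair_eigen h (or_introl erefl))).
have [y [t PB]] := pair_ortho (Pe _ (fun h => pair_eigen h (or_intror erefl))).
have inj q u v : zero_free K q -> poly_op S q u = poly_op S q v -> u = v.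
  by move=> /pair_poly_inverse[Q [_ Q1 _]] e; rewrite -(Q1 u) e Q1.
have PAf f : ratK K f -> P (A f) = x *: A f + z *: B f /\ P (B f) = y *: A f + t *: B f.
  move=> rf; have [p [q [zf e1 e2]]] := pair_frac rf.
  have lp r (c d : C) u v : poly_op S r (c *: u + d *: v) = c *: poly_op S r u + d *: poly_op S r v.
    by rewrite (poly_op_lin bS) (lin_scale (poly_op_lin bS r)).
  by split; apply: (inj q) => //; rewrite -Ppoly lp ?e1 ?e2 Ppoly ?PA ?PB lp.
have cc (p : C) : p^*^* = p by apply: ReImE; rewrite !(ReJ, ImJ) ?opprK.
(* Self-adjointness of [P], tested first on two vectors [A f], [A h] and then on [A f], [B h], is a
   linear relation between the three forms; independence makes each coefficient vanish. *)
have [xr _ _] : [/\ x - x^* = 0, 0 = 0 :> C & x + z - x^* - z^* = 0].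
  apply: indep => f h rf rh; have := Psa (A f) (A h); rewrite (PAf f rf).1 (PAf h rh).1.
  rewrite innerDl innerDr !innerZl !innerZr inner_AA// inner_AB// inner_BA//.
  by move/eqP; rewrite -subr_eq0 => /eqP e; apply: etrans e; ring.
have [y0 z0 xt] : [/\ - y^* = 0, z = 0 & x + z - y^* - t^* = 0].
  apply: indep => f h rf rh; have := Psa (A f) (B h); rewrite (PAf f rf).1 (PAf h rh).2.
  rewrite innerDl innerDr !innerZl !innerZr inner_AA// inner_AB// inner_BB//.
  by move/eqP; rewrite -subr_eq0 => /eqP e; apply: etrans e; ring.
have {}y0 : y = 0 by rewrite -[y]cc -[y^*]opprK y0 oppr0; apply: ReImE; rewrite ?(ReJ, ImJ) ?oppr0.
have tx : t = x.
  have ys : y^* = 0 by rewrite y0; apply: ReImE; rewrite ?(ReJ, ImJ) ?oppr0.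
  move: xt; rewrite z0 ys addr0 subr0 => /eqP; rewrite subr_eq0 => /eqP xt.
  by rewrite -[t]cc -xt; move/eqP: xr; rewrite subr_eq0 => /eqP.
have Px h : P h = x *: h.
  apply/eqP; rewrite -subr_eq0; apply/eqP.
  apply: (dense_eq0 mD (f := fun h => P h - x *: h) (c := 1 + nrm x)) => [u v|w [w1 w2]].
    have -> : P u - x *: u - (P v - x *: v) = P (u - v) - x *: (u - v).
      by rewrite (lin_sub PL) scalerBr subrACA.
    by rewrite (le_trans (ler_nrmB _ _))// mulrDl mul1r nrmZ lerD2r Pn.
  rewrite pair_split// (lin_add PL) (PAf _ w1).1 (PAf _ w2).2 z0 y0 tx !scale0r addr0 add0r.
  by rewrite scalerDr subrr.
have A0 : A1 != 0.
  have [g1 _ _ _] := pair_gram; apply/eqP => h; move/eqP: g1; rewrite h inner0l eq_sym.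
  by rewrite pnatr_eq0.
have : x * (x - 1) = 0.
  have := PP A1; rewrite !Px scalerA => /eqP; rewrite -subr_eq0 -scalerBl scaler_eq0 (negPf A0) orbF.
  by rewrite mulrBr mulr1 => /eqP.
move/eqP; rewrite mulf_eq0 subr_eq0 => /orP[/eqP xe|/eqP xe]; [left|right].
  apply/seteqP; split=> [u /VP|u ->]; first by rewrite Px xe scale0r => <-.
  by apply/VP; exact: lin_0 PL.
by apply/seteqP; split=> // u _; apply/VP; rewrite Px xe scale1r.
Qed.

Lemma pair_no_eigen l v : S v = l *: v -> v = 0.
Proof.
move=> Sv; apply: contrapT => v0.
have one := irreducible_eigen (gns_subnormal g) pair_irreducible bS Sv v0.
have [t1 h1] := one A1; have [t2 h2] := one B1.
have [|t20 t10] := @pair_free t2 (- t1).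
  by rewrite h1 h2 scaleNr !scalerA mulrC subrr.
have [|] := @pair_free 1 0; last by move=> /eqP; rewrite oner_eq0.
by move/eqP: t10; rewrite oppr_eq0 => /eqP t10; rewrite h1 t10 !scale0r scaler0 addr0.
Qed.

Lemma pair_spectrum : spectrum S = K /\ essential_spectrum S = K.
Proof.
split; apply/seteqP; split=> l.
- apply: contra_notP => nK; have [d d0 hd] := off_dist cd nK.
  by have [] := pair_resolvent d0 hd.
- move=> Kl [T' inv]; have [c c0 below] := inverse_below inv.
  exact: pair_not_below Kl _ c0 below.
- apply: contra_notP => nK; have [d d0 hd] := off_dist cd nK.
  have [[T' inv] _] := pair_resolvent d0 hd.
  by exists 0%N, 0%N; exact: inverse_fredholm (bounded_sub_scalar bS l) inv.
- move=> Kl [m [n]]; apply: (not_fredholm (bounded_sub_scalar bS l)); last exact: pair_not_below.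
  by move=> x /eqP; rewrite /sub_scalar subr_eq0 => /eqP /pair_no_eigen.
Qed.

Lemma pair_two_cyclic : exists F : 'I_2 -> H, R2 S F = setT.
Proof.
exists (fun i => if i == ord0 then A1 else B1); apply/seteqP; split => // y _.
apply/closure_nrmP => e e0; have [_ _ _ den] := mD; have [x [x1 x2] hx] := den y e e0.
exists (tau x) => //; have [p1 [q1 [z1 eA _]]] := pair_frac x1.
have [p2 [q2 [z2 _ eB]]] := pair_frac x2.
have [Q1 i1] := pair_poly_inverse z1; have [Q2 i2] := pair_poly_inverse z2.
exists (fun i => if i == ord0 then poly_op S p1 \o Q1 else poly_op S p2 \o Q2); split.
  by move=> i; case: ifP => _; [exists p1, q1, Q1|exists p2, q2, Q2]; rewrite pair_spectrum.1.
rewrite big_ord_recl big_ord1 /=; rewrite pair_split//.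
have [_ c1' _] := i1; have [_ c2' _] := i2.
congr (_ + _).
  by rewrite -[LHS]c1' eA -(rat_op_eq bS A1 i1 (erefl (poly_op S p1 \o Q1))) c1'.
by rewrite -[LHS]c2' eB -(rat_op_eq bS B1 i2 (erefl (poly_op S p2 \o Q2))) c2'.
Qed.

(** The eigenfunctionals at [a] form a plane, so a nonzero one annihilates the generator, hence its
    whole orbit. *)
Lemma pair_not_cyclic (G : 'I_1 -> H) : R2 S G <> setT.
Proof.
move=> /(cyclic_orbit bS pair_spectrum.1) oG; pose y := G ord0.
have [s [t [st e]]] : exists s t : C, (s != 0) || (t != 0) /\ inner y (s *: A1 + t *: B1) = 0.
  have [h|h] := eqVneq (inner y A1) 0.
    by exists 1, 0; rewrite oner_neq0 scale1r scale0r addr0.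
  exists (inner y B1)^*, (- inner y A1)^*; split.
    apply/orP; right; rewrite -nrm_eq0 nrm_conj nrmN nrm_eq0//.
  rewrite innerDr !innerZr; have cc (p : C) : p^*^* = p by apply: ReImE; rewrite !(ReJ, ImJ) ?opprK.
  by rewrite !cc; ring.
set v := s *: A1 + t *: B1 in e; have v0 : v != 0.
  by apply: contraTneq st => /pair_free[-> ->]; rewrite eqxx.
have ev h : inner (S h) v = a * inner h v.
  by rewrite !innerDr !innerZr !pair_eigen; [ring|right|left].
have d0 : 0 < nrm v by rewrite nrm_gt0.
have [p [q [x [zf xe vx]]]] := oG v _ d0.
have := orbit_eigen bS (core_Ka cd) zf ev xe; rewrite e mulr0 => xv.
have := inner_CS (v - x) v; rewrite innerBl xv subr0 inner_nrm nrm_real ger0_norm ?exprn_ge0 ?nrm_ge0//.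
by rewrite expr2 ler_pM2r// leNgt vx.
Qed.

Lemma pair_model : model_operator K K.
Proof.
apply: (@model_operatorI R K K H S cK (K_nonempty cd)).
- by split; [exact: bS|exact: gns_subnormal g|exact: pair_irreducible].
- by split; [exact: pair_spectrum.1|exact: pair_spectrum.2|move=> l []].
- by move=> l d d0 hd; exact: pair_resolvent.
- exact: pair_two_cyclic.
- exact: pair_not_cyclic.
Qed.

End PairModel.

(** * Three independent representing functionals *)

Section NoInterior.
Variable R : realType.
Local Notation C := (cplx R).
Variables (K : set C) (a : C) (b : nat -> C) (kap : nat -> R).
Variable Gam : (bd_type K * nat -> R) -> R.
Hypothesis cd : core_data a b kap Gam.
Hypothesis intK : interior K = set0.
Let cK := core_compact cd.
Let clK := compact_closed_nrm cK.
Let W : Type := (bd_type K * nat)%type.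
Implicit Types (L : (W -> R) -> R) (u v : W -> R).

Lemma positive_linearD L L' : positive_linear L -> positive_linear L' ->
  positive_linear (fun u => L u + L' u).
Proof.
move=> [l p] [l' p']; split => [c u v bu bv|u bu u0].
  by rewrite l// l'// mulrDr addrACA.
by rewrite addr_ge0 ?p ?p'.
Qed.

Lemma positive_linearZ (c : R) L : 0 <= c -> positive_linear L -> positive_linear (fun u => c * L u).
Proof.
move=> c0 [l p]; split => [d u v bu bv|u bu u0]; last by rewrite mulr_ge0 ?p.
by rewrite l// mulrDr mulrCA.
Qed.

Lemma positive_linear_ev (w : W) : positive_linear (fun u => u w).
Proof. by split. Qed.

Definition off_slice (i : nat) (u : W -> R) : R := Gam (fun t => (t.2 != i)%:R * u t).

Lemma bfun_ind (P : W -> bool) u : bfun u -> bfun (fun t => (P t)%:R * u t).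
Proof.
move=> [M HM]; exists M => t; case: (P t); rewrite ?mul1r// mul0r normr0.
exact: le_trans (normr_ge0 _) (HM t).
Qed.

Lemma positive_linear_off i : positive_linear (off_slice i).
Proof.
split => [c u v bu bv|u bu u0]; last first.
  by apply: (core_Gam_ge0 cd) => [|t]; [exact: bfun_ind|rewrite mulr_ge0].
rewrite /off_slice -(core_GamL cd); [|exact: bfun_ind|exact: bfun_ind].
by congr Gam; apply/funext => t; rewrite mulrDr mulrCA.
Qed.

Lemma off_slice_value i f : ratK K f -> off_slice i (fun t => complex.Re (f (bd_val t.1))) =
  complex.Re (f a) - kap i * complex.Re (f (b i)).
Proof.
move=> rf; rewrite -(core_Gam_a cd rf) -(core_Gam_b cd i rf) -mulN1r.
have bf : bfun (fun t : W => complex.Re (f (bd_val t.1))) := cbf_Re (cbf_bpull cd rf).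
rewrite addrC -(core_GamL cd)//; last exact: bfun_ind.
congr Gam; apply/funext => t; case: eqP => _ /=; ring.
Qed.

Let KB z : K z -> boundary K z.
Proof. by move=> Kz; rewrite (boundaryE clK) intK setD0. Qed.
Definition bd_point z (Kz : K z) : W := (exist _ z (KB Kz), 0%N).

Variable i : nat.
Hypothesis bia : b i != a.
Local Notation pa := (bd_point (core_Ka cd)).
Local Notation pb := (bd_point (core_Kb cd i)).

(** By Harnack's inequality, evaluation at [b i] minus [c] times evaluation at [a] is still
    positive. As [K] is its own boundary, it extends to [P], and [P] plus [c] times the point mass
    at [a] represents [b i]. *)
Lemma strict_harnack : exists c (P : (W -> R) -> R), [/\ 0 < c, positive_linear P &
  forall f, ratK K f -> P (fun t => complex.Re (f (bd_val t.1))) =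
    complex.Re (f (b i)) - c * complex.Re (f a)].
Proof.
have [c c0 hc] := core_harnack cd i.
pose G : set ((W -> R) * R) := [set p | exists2 f, ratK K f &
  p = (fun t => complex.Re (f (bd_val t.1)), complex.Re (f (b i)) - c * complex.Re (f a))].
have posG : pos_graph G; last first.
  have [|P [PL Pp Pe]] := positive_extension posG.
    exists (1 - c * 1); exists (fun=> 1); [exact: ratK_cst|by []].
  by exists c, P; split => // f rf; apply: Pe; exists f.
split.
- move=> r u v s t [f rf [-> ->]] [h rh [-> ->]]; exists (fun z => r%:C * f z + h z).
    by apply: ratKD => //; exact: ratKZ.
  by congr pair; rewrite ?ReD ?ReRM; [apply/funext => x; rewrite ReD ReRM|ring].
- move=> u r [f rf [-> ->]] u0; rewrite subr_ge0; apply: hc => // z Kz.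
  exact: (u0 (bd_point Kz)).
- by move=> u r [f rf [-> _]]; exact: cbf_Re (cbf_bpull cd rf).
Qed.

Definition sqv (f : C -> C) : W -> R := fun t => nrm (f (bd_val t.1)) ^+ 2.

Lemma bfun_sqv f : ratK K f -> bfun (sqv f).
Proof. by move=> rf; exact: bfun_nrm (cbf_bpull cd rf). Qed.

(* Cauchy-Schwarz: if [T] lived on the points [a] and [b i], then [a = b i]. *)
Lemma functional_spread (T : (W -> R) -> R) (c : R) : positive_linear T -> 0 < c ->
  represents T (b i) -> (forall u, bfun u -> (forall t, 0 <= u t) -> c * u pa <= T u) ->
  0 < T (sqv (fun z => (z - a) * (z - b i))).
Proof.
move=> [TL Tp] c0 rT Tc; have rz z : ratK K (fun y => y - z).
  by apply: ratKB; [exact: ratK_id|exact: ratK_cst].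
have rab := ratKM (rz a) (rz (b i)).
rewrite lt_neqAle Tp ?andbT; [|exact: bfun_sqv|by move=> t; rewrite exprn_ge0 ?nrm_ge0].
apply/eqP => T0; have pB := gform_psd TL Tp.
pose F : W -> C^o := fun t => bpull (fun z => z - b i) t * (bpull (fun z => z - a) t)^*.
have c1 : cbf ((fun=> 1) : W -> C^o) by exists 1 => t; rewrite nrm1.
have cF : cbf F by apply: cbfM; [|apply: cbf_conj]; exact: (cbf_bpull cd).
have qF : qn (gform T) F = 0.
  apply/eqP; rewrite -sqrf_eq0 (qn_gform TL Tp)// T0; apply/eqP; congr T; apply/funext => t.
  by rewrite /F /sqv /bpull !nrmM nrm_conj mulrC.
have := psd_CS pB cF c1; rewrite qF mul0r => h.
have {h} : T (fun t => complex.Re (F t)) = 0.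
  apply/eqP; rewrite -normr_le0 (le_trans _ h)// (le_trans _ (ler_Re_nrm _))//.
  rewrite /gform /= (_ : (fun t => complex.Re (F t * _)) = fun t => complex.Re (F t))//.
  by apply/funext => t; rewrite ReM ReJ ImJ/= mulr1 oppr0 mulr0 subr0.
have rf : ratK K (fun z => (b i - a)^* * (z - b i)) by exact: ratKZ.
have -> : (fun t => complex.Re (F t)) = fun t => 1 * sqv (fun z => z - b i) t +
    complex.Re ((b i - a)^* * (bd_val t.1 - b i)).
  apply/funext => t; rewrite /F /sqv /bpull nrm_sqr.
  have -> : bd_val t.1 - a = (bd_val t.1 - b i) + (b i - a) by ring.
  by rewrite !ReM !ReJ !ImJ !ReD !ImD; ring.
rewrite TL; [|exact: bfun_sqv|exact: cbf_Re (cbf_bpull cd rf)].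
rewrite (rT _ rf) subrr mulr0 addr0 mul1r => T1.
have := Tc _ (bfun_sqv (rz (b i))) (fun t => exprn_ge0 2 (nrm_ge0 _)).
rewrite T1 leNgt mulr_gt0// exprn_gt0// nrm_gt0 /bd_val /= subr_eq0 eq_sym//.
Qed.

Lemma small_power (x e : R) : 0 <= x -> x < 1 -> 0 < e -> exists k, x ^+ k < e.
Proof.
move=> x0 x1 e0; have /cvgrPdist_lt/(_ e e0)[n _ hn] : (GRing.exp x : nat -> R) @ \oo --> (0 : R).
  by apply: cvg_expr; rewrite ger0_norm.
by exists n; have := hn n (leqnn n); rewrite /= sub0r normrN ger0_norm// exprn_ge0.
Qed.

(** The first relation forces [ga <= 0], hence [al >= 0]; in the second, [pk < ub] then leaves no
    room for a positive [al]. *)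
Lemma signs_absurd (al ga n2 p2 nk ub pk k : R) : 0 <= n2 -> 0 < p2 -> 0 <= nk -> 0 < k ->
  0 <= pk -> pk < ub -> (al + ga) * n2 + ga * k * p2 = 0 ->
  (al + ga) * nk + k * (al * ub + ga * pk) = 0 -> 0 <= al + ga -> al = 0 /\ ga = 0.
Proof.
move=> n20 p20 nk0 k0 pk0 pu e1 e2 s0.
have ga0 : ga <= 0.
  rewrite leNgt; apply/negP => g0; have := mulr_ge0 s0 n20.
  by have := mulr_gt0 (mulr_gt0 g0 k0) p20; lra.
have al0 : 0 <= al by lra.
have h1 : al * ub + ga * pk <= 0.
  by rewrite -(pmulr_rle0 _ k0); have := mulr_ge0 s0 nk0; lra.
have h2 : 0 <= (al + ga) * pk by exact: mulr_ge0.
have h3 : al * (ub - pk) <= 0 by lra.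
have : al <= 0 by rewrite -(pmulr_lle0 _ (_ : 0 < ub - pk))// subr_gt0.
move=> al1; have ae : al = 0 by lra.
by rewrite ae; split => //; lra.
Qed.

Variables (c : R) (P : (W -> R) -> R).
Hypotheses (c0 : 0 < c) (plP : positive_linear P).
Hypothesis hP : forall f, ratK K f -> P (fun t => complex.Re (f (bd_val t.1))) =
  complex.Re (f (b i)) - c * complex.Re (f a).
Let k0 : 0 < kap i := core_kap0 cd i.

(** The slice [i] of [Gam] is replaced by another representing functional for [b i] of the same
    mass: the point mass at [b i] here, and in [spread_b] one that charges [a]. The third functional
    is the point mass at [a]. *)
Definition atom_b u := off_slice i u + kap i * u pb.
Definition atom_a u : R := u pa.
Definition spread_b u := off_slice i u + kap i * (P u + c * u pa).

Lemma positive_linear_atom_b : positive_linear atom_b.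
Proof.
apply: positive_linearD (positive_linear_off i) (positive_linearZ (ltW k0) (positive_linear_ev _)).
Qed.

Lemma positive_linear_rep : positive_linear (fun u => P u + c * u pa).
Proof. exact: positive_linearD plP (positive_linearZ (ltW c0) (positive_linear_ev _)). Qed.

Lemma positive_linear_spread_b : positive_linear spread_b.
Proof.
exact: positive_linearD (positive_linear_off i) (positive_linearZ (ltW k0) positive_linear_rep).
Qed.

Lemma represents_atom_b : represents atom_b a.
Proof. by move=> f rf; rewrite /atom_b off_slice_value// subrK. Qed.

Lemma represents_spread_b : represents spread_b a.
Proof. by move=> f rf; rewrite /spread_b off_slice_value// hP// /bd_val/= !subrK. Qed.

Lemma evaluation_atom_b j : exists2 M : R, 0 <= M & forall f, ratK K f ->
  nrm (f (b j)) <= M * qn (gform atom_b) (bpull f).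
Proof.
have [LL Lp] := positive_linear_atom_b; have kj := core_kap0 cd j.
exists (Num.sqrt (kap j))^-1; first by rewrite invr_ge0 sqrtr_ge0.
move=> f rf; have cf := cbf_bpull cd rf; have bf := bfun_nrm cf.
rewrite mulrC ler_pdivlMr ?sqrtr_gt0// -(@ler_pXn2r _ 2)// ?nnegrE ?mulr_ge0 ?sqrtr_ge0 ?nrm_ge0 ?qn_ge0//.
rewrite exprMn sqr_sqrtr ?(ltW kj)// (qn_gform LL Lp)// /atom_b.
have sq0 u : (forall t, 0 <= u t) -> bfun u -> 0 <= off_slice i u.
  by move=> u0 bu; exact: (positive_linear_off i).2.
have [->|ji] := eqVneq j i.
  by rewrite mulrC lerDr sq0// => t; rewrite exprn_ge0// nrm_ge0.
have h := slice_value cd j rf.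
have cs : cbf (slice j (bpull f)) := cbf_slice j cf.
rewrite ler_pdivlMr ?sqrtr_gt0// in h.
have {h} : (nrm (f (b j)) * Num.sqrt (kap j)) ^+ 2 <= qn (gform Gam) (slice j (bpull f)) ^+ 2.
  by rewrite ler_pXn2r ?nnegrE ?mulr_ge0 ?sqrtr_ge0 ?nrm_ge0 ?qn_ge0.
rewrite exprMn sqr_sqrtr ?(ltW kj)// (qn_gform (core_GamL cd) (core_Gam_ge0 cd))// => h.
apply: le_trans h _; rewrite -[leLHS]addr0; apply: lerD; last first.
  by rewrite mulr_ge0 ?(ltW k0)// exprn_ge0// nrm_ge0.
apply: (Gam_mono (core_GamL cd) (core_Gam_ge0 cd)); [exact: bfun_nrm|exact: bfun_ind|].
move=> t; rewrite /slice; case: eqP => [->|_]; first by rewrite ji mul1r.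
by rewrite nrm0 expr0n mulr_ge0// exprn_ge0// nrm_ge0.
Qed.

(** Two test functions decide: [|z - a|^2 |z - b i|^2], which vanishes at both points but is charged
    by [P], and [1 - U k], which vanishes at [a] and is larger at [b i] than its value under [P]. *)
Lemma real_independence (al be ga : R) : (forall f, ratK K f ->
  al * atom_b (sqv f) + be * atom_a (sqv f) + ga * spread_b (sqv f) = 0) ->
  [/\ al = 0, be = 0 & ga = 0].
Proof.
move=> rel; have [M hM] := compact_bounded cK; pose D := `|M| + `|M| + 1.
have D0 : 0 < D by rewrite ltr_wpDl.
have hD z : K z -> nrm (z - a) <= D.
  move=> Kz; have := hM z Kz; have := hM a (core_Ka cd); have := ler_nrmB z a; have := ler_norm M.
  by rewrite /D; lra.
(* At most 1 in modulus on [K] and zero only at [a], so the powers [U k] decrease to the indicator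
   of [a]. *)
pose psi z := (D^-1)%:C * (z - a).
have rz z : ratK K (fun y => y - z) by apply: ratKB; [exact: ratK_id|exact: ratK_cst].
have rpsi : ratK K psi by exact: ratKZ.
have psi1 t : sqv psi t <= 1.
  rewrite /sqv /psi nrmM nrm_real ger0_norm ?invr_ge0 ?(ltW D0)// mulrC exprn_ile1 ?mulr_ge0 ?nrm_ge0 ?invr_ge0 ?(ltW D0)//.
  by rewrite ler_pdivrMr// mul1r; apply: hD; exact: (boundary_sub clK (svalP t.1)).
have psi0 t : 0 <= sqv psi t by rewrite exprn_ge0// nrm_ge0.
pose U k : W -> R := fun t => (1 - sqv psi t) ^+ k.
have U0 k t : 0 <= U k t by rewrite exprn_ge0// subr_ge0.
have U1 k t : U k t <= 1 by rewrite exprn_ile1// ?subr_ge0// gerBl.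
have bU k : bfun (U k) by exists 1 => t; rewrite ger0_norm.
have [[bL bp] [aL ap] [sL sp]] := And3 positive_linear_atom_b (positive_linear_ev pa) positive_linear_spread_b.
(* The relation is assumed only for squared moduli of rational functions. Multiplication by
   [|psi|^2] preserves these, and [U k] is a polynomial in [|psi|^2]. *)
have relU k f : ratK K f -> al * atom_b (fun t => sqv f t * U k t) +
    be * atom_a (fun t => sqv f t * U k t) + ga * spread_b (fun t => sqv f t * U k t) = 0.
  elim: k f => [|k IH] f rf.
    rewrite (_ : (fun t => _) = sqv f); first exact: rel.
    by apply/funext => t; rewrite /U expr0 mulr1.
  have rfp := ratKM rf rpsi; have e1 := IH _ rf; have e2 := IH _ rfp.
  have b1 : bfun (fun t => sqv f t * U k t) := bfunM (bfun_sqv rf) (bU k).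
  have b2 : bfun (fun t => sqv (fun z => f z * psi z) t * U k t) := bfunM (bfun_sqv rfp) (bU k).
  have -> : (fun t => sqv f t * U k.+1 t) = fun t => -1 * (sqv (fun z => f z * psi z) t * U k t) + sqv f t * U k t.
    apply/funext => t; rewrite /U exprS (_ : sqv (fun z => f z * psi z) t = sqv f t * sqv psi t).
      by ring.
    by rewrite /sqv (nrmM (f _)) exprMn.
  rewrite bL// sL// /atom_a; move: e1 e2; rewrite /atom_a; lra.
have one t : sqv (fun=> 1) t = 1 by rewrite /sqv nrm1 expr1n.
have relu k : al * atom_b (fun t => 1 - U k t) + be * atom_a (fun t => 1 - U k t) +
    ga * spread_b (fun t => 1 - U k t) = 0.
  have e1 := rel _ (ratK_cst K 1); have e2 := relU k _ (ratK_cst K 1).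
  have E : (fun t => sqv (fun=> 1) t * U k t) = U k by apply/funext => t; rewrite one mul1r.
  have F : (fun t => 1 - U k t) = fun t => -1 * U k t + sqv (fun=> 1) t.
    by apply/funext => t; rewrite one; ring.
  have b1 : bfun (sqv (fun=> 1)) by exact: bfun_sqv (ratK_cst K 1).
  by rewrite F bL// sL//; move: e1 e2; rewrite E /atom_a; lra.
have ub : 0 < sqv psi pb.
  rewrite exprn_gt0// nrm_gt0 mulf_neq0 ?subr_eq0//.
  by rewrite -nrm_gt0 nrm_real ger0_norm ?invr_gt0// invr_ge0 ltW.
have eP : P (fun=> 1) = 1 - c by move: (hP (ratK_cst K 1)); rewrite /= mulr1.
have bf1 : bfun ((fun=> 1) : W -> R) by exists 1 => t; rewrite normr1.
have c1 : c <= 1.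
  by rewrite -subr_ge0 -eP; exact: plP.2.
(* Then [1 - U k] exceeds [1 - c] at [b i], whereas [P], of mass [1 - c], gives it at most
   [1 - c]. *)
have [k hk] : exists k, (1 - sqv psi pb) ^+ k < c.
  by apply: small_power => //; rewrite ?subr_ge0// gtrBl.
have rab := ratKM (rz a) (rz (b i)); set u2 := sqv (fun z => (z - a) * (z - b i)).
have u20 t : 0 <= u2 t by rewrite exprn_ge0// nrm_ge0.
have u2a : u2 pa = 0 by rewrite /u2 /sqv /bd_val/= subrr mul0r nrm0 expr0n.
have u2b : u2 pb = 0 by rewrite /u2 /sqv /bd_val/= subrr mulr0 nrm0 expr0n.
have p2 : 0 < P u2.
  have := @functional_spread _ c positive_linear_rep c0.
  rewrite -/u2 u2a mulr0 addr0; apply => [f rf|u bu u0].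
    by rewrite hP// /bd_val/= subrK.
  by rewrite lerDr plP.2.
have uk0 t : 0 <= 1 - U k t by rewrite subr_ge0.
have bk : bfun (fun t => 1 - U k t).
  by exists 1 => t; rewrite ger0_norm// gerBl.
have pk : P (fun t => 1 - U k t) <= 1 - c.
  have := plP.2 (U k) (bU k) (U0 k).
  have -> : (fun t => 1 - U k t) = fun t => -1 * U k t + 1 by apply/funext => t; ring.
  by rewrite plP.1// eP; lra.
have uka : U k pa = 1 by rewrite /U /sqv /psi /bd_val/= subrr mulr0 nrm0 expr0n subr0 expr1n.
have offp u : bfun u -> (forall t, 0 <= u t) -> 0 <= off_slice i u := (positive_linear_off i).2 u.
have e2 := rel _ rab; have ek := relu k; rewrite /atom_a -/u2 in e2 ek.
rewrite /atom_b /spread_b u2a u2b in e2; rewrite /atom_b /spread_b /atom_a uka in ek.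
have sum : al + be + ga = 0.
  have := rel _ (ratK_cst K 1); rewrite /atom_a.
  have -> : sqv (fun=> 1) = fun t : W => complex.Re ((fun=> 1 : C) (bd_val t.1)) by apply/funext => t; rewrite one.
  by rewrite (represents_atom_b (ratK_cst K 1)) (represents_spread_b (ratK_cst K 1)) /= !mulr1.
have alg (x y : R) : (x + y) * off_slice i u2 + y * kap i * P u2 = 0 ->
    (x + y) * off_slice i (fun t => 1 - U k t) + kap i * (x * (1 - U k pb) +
      y * P (fun t => 1 - U k t)) = 0 -> 0 <= x + y -> x = 0 /\ y = 0.
  apply: signs_absurd => //.
  - by apply: offp => //; exact: bfun_sqv.
  - exact: offp.
  - exact: plP.2.
  - by apply: le_lt_trans pk _; rewrite ltrD2l ltrN2.
suff [a0 g0] : al = 0 /\ ga = 0 by split => //; move: sum; rewrite a0 g0; lra.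
have [h|h] := leP 0 (al + ga); first by apply: alg => //; move: e2 ek; lra.
(* The relations are homogeneous, so the sign of [al + ga] may be reversed. *)
have [|||a0 g0] := alg (- al) (- ga); by move: e2 ek h; lra.
Qed.

Lemma complex_independence (al be ga : C) : (forall f h, ratK K f -> ratK K h ->
  al * gform atom_b (bpull f) (bpull h) + be * gform atom_a (bpull f) (bpull h) +
    ga * gform spread_b (bpull f) (bpull h) = 0) -> [/\ al = 0, be = 0 & ga = 0].
Proof.
move=> rel.
have E f : ratK K f -> al * (atom_b (sqv f))%:C + be * (atom_a (sqv f))%:C + ga * (spread_b (sqv f))%:C = 0.
  move=> rf; have cf := cbf_bpull cd rf; have := rel f f rf rf.
  have [[bL bp] [aL ap] [sL sp]] := And3 positive_linear_atom_b (positive_linear_ev pa) positive_linear_spread_b.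
  by rewrite (gform_sqr bL)// (gform_sqr aL)// (gform_sqr sL).
have cM (x : C) (r : R) : complex.Re (x * r%:C) = complex.Re x * r /\ complex.Im (x * r%:C) = complex.Im x * r.
  by rewrite ReM ImM /= !mulr0 subr0 add0r.
have [re1 re2 re3] : [/\ complex.Re al = 0, complex.Re be = 0 & complex.Re ga = 0].
  apply: real_independence => f rf; have := congr1 (@complex.Re R) (E f rf).
  by rewrite !ReD !(cM _ _).1.
have [im1 im2 im3] : [/\ complex.Im al = 0, complex.Im be = 0 & complex.Im ga = 0].
  apply: real_independence => f rf; have := congr1 (@complex.Im R) (E f rf).
  by rewrite !ImD !(cM _ _).2.
by split; exact: ReImE.
Qed.

End NoInterior.

Lemma no_interior_model (R : realType) (K : set (cplx R)) a b kap Gam :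
  core_data (K := K) a b kap Gam -> interior K = set0 -> model_operator K K.
Proof.
move=> cd intK; have [i bia] := core_two cd.
have [c [P [c0 plP hP]]] := strict_harnack cd intK i.
have PB := positive_linear_atom_b cd intK i.
have PA := positive_linear_ev (bd_point cd intK (core_Ka cd)).
have PS := positive_linear_spread_b cd intK i c0 plP.
have [H [tau [S g]]] := pair_model_exists cd PB PA PS.
apply: (pair_model cd intK PB PA PS _ _ _ _ g).
- exact: represents_atom_b.
- by [].
- exact: represents_spread_b.
- exact: evaluation_atom_b.
- exact: complex_independence.
Qed.

Theorem theorem1 (R : realType) (K Ke Om : set (cplx R))
  (compact_K : compact K) (compact_Ke : compact Ke)
  (Om_part : only_nontrivial_gleason_part K Om)
  (K_closure : K = closure Om)
  (boundary_Ke : boundary K `<=` Ke) (Ke_K : Ke `<=` K) :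
  exists (H : hilbertSpace R) (S : H -> H),
    [/\ bounded_operator S, subnormal_operator S & irreducible_operator S] /\
    [/\ spectrum S = K, essential_spectrum S = Ke
      & forall l, (K `\` Ke) l -> fredholm_index (sub_scalar S l) (-1)] /\
    rationally_cyclic S 2 /\
    (connected (~` K) -> cyclic_operator S 2).
Proof.
have [a [b [kap [Gam cd]]]] := core_exists compact_K Om_part K_closure.
have clK := compact_closed_nrm compact_K.
have [int|/set0P/negP/negPn/eqP int0] := pselect (interior K !=set0); last first.
  (* Without interior [K] equals its boundary, which pins down [Ke]. *)
  suff -> : Ke = K by exact: no_interior_model cd int0.
  by apply/seteqP; split => // z Kz; apply: boundary_Ke; rewrite (boundaryE clK) int0 setD0.
have [[l [Kel Il]]|h] := pselect (exists l, Ke l /\ interior K l).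
  exact: (accum_model cd (compact_closed_nrm compact_Ke) boundary_Ke Ke_K Kel Il).
suff -> : Ke = boundary K by exact: boundary_model cd int.
apply/seteqP; split => // z Kez; rewrite (boundaryE clK); split; first exact: Ke_K.
by move=> Iz; apply: h; exists z.
Qed.
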